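(* Let $\{\phi_k\mid k\in\mathbb N_0\}\subseteq L^\infty(\mathbb I)$ be a complete orthonormal basis of $L^2(\mathbb I)$ with $\phi_0=1$ and $\sup_{k\in\mathbb N_0}\|\phi_k\|_{L^\infty(\mathbb I)}=C_\phi<\infty$. Suppose there exist $\lambda:\mathbb N\to\mathbb C\setminus\{0\}$, $\mathcal N:\mathbb N\to\mathbb N$, $\mathcal M:\mathbb N\to\mathbb N_0$ and functions $\phi^*_\ell\in L^\infty(\mathbb I)$ with $\|\phi^*_\ell\|_{L^\infty(\mathbb I)}=1$ ($\ell\in\mathbb N$) such that for all $k\in\mathbb N$, $\mathcal I(\phi_k)=\lambda(k)\,\phi^*_{\mathcal N(k)}\,\phi_{\mathcal M(k)}$. Let $p\geq 1$, $\theta_1,\dots,\theta_s\in(0,1/2]$, $w_j=w_{\theta_j}$, and suppose $f^w\in W^{1,2}_{\mathrm{mix}}(\mathbb I^s)$. Then for $\alpha\in(0,1)$ and $\boldsymbol\ell\in\mathbb N_0^s$, $$\sum_{\boldsymbol k\in\mathcal E(\boldsymbol\ell)}|\hat f^w(\boldsymbol k)|^2\prod_{j\in\boldsymbol s(\boldsymbol\ell)}|\lambda(k_j)|^{-2\alpha}\le2^{|\boldsymbol s(\boldsymbol\ell)|}\sum_{v\subseteq\boldsymbol s(\boldsymbol\ell)}\|\partial^vf^w_v\|^{2\alpha}_{L^2(\mathbb I^{|v|})}\|f^w_v\|^{2-2\alpha}_{L^2(\mathbb I^{|v|})}\prod_{j\in\boldsymbol s(\boldsymbol\ell)\setminus v}\mathcal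 S(\theta_j,\ell_j,\alpha),$$ where $$\mathcal E(\boldsymbol\ell)=\{\boldsymbol k\in\mathbb N_0^s\mid\boldsymbol s(\boldsymbol k)=\boldsymbol s(\boldsymbol\ell),\ \mathcal N(k_j)=\ell_j\ \forall j\in\boldsymbol s(\boldsymbol\ell)\},$$ $$\mathcal S(\theta,\ell,\alpha)=16C_\phi^2\sum_{k\in\mathcal N^{-1}(\ell)}\min\big(\theta^2,|\lambda(k)|^2\big)|\lambda(k)|^{-2\alpha}.$$
   Context: $\mathbb I=(0,1)$; $\mathcal I(\phi)(u)=\int_0^u\phi(t)\,dt$; $\boldsymbol s(\boldsymbol k)=\{j\mid k_j\ne0\}$ is the support of $\boldsymbol k\in\mathbb N_0^s$. Density: $\varphi:\mathbb R\to\mathbb R$ is a probability density with $\varphi(x)>0$, $\varphi(x)=\varphi(-x)$, $\varphi_\infty:=\sup_x\varphi(x)<\infty$, and such that for every $\varepsilon>0$ there is $c_\varepsilon>0$ with $\varphi(x)\ge c_\varepsilon\Phi(x)^{1+\varepsilon}$ for all $x\le0$, where $\Phi(x)=\int_{-\infty}^x\varphi(y)\,dy$. Weights and transport. For $p\ge1$ let $\eta(u)=\eta_p(u)=2^{-p-2}u^{-p-1}\exp(2^p-u^{-p})$ for $u\in(0,1/2]$ and $\eta(0)=0$. For $\theta\in(0,1/2]$ define $w_\theta:\mathbb I\to\mathbb R$ by: $w_\theta(u)=(1-\theta)^{-1}\eta(u/\theta)$ if $u\in(0,\theta/2]$; $w_\theta(u)=(1-\theta)^{-1}(1-\eta(1-u/\theta))$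 if $u\in(\theta/2,\theta)$; $w_\theta(u)=(1-\theta)^{-1}$ if $u\in[\theta,1/2]$; $w_\theta(u)=w_\theta(1-u)$ if $u\in(1/2,1)$. Set $w_j=w_{\theta_j}$, $T_j(u)=\Phi^{-1}\big(\int_0^uw_j(t)\,dt\big)$, $T(\boldsymbol u)=(T_1(u_1),\dots,T_s(u_s))$, and for $f:\mathbb R^s\to\mathbb R$, $f^w(\boldsymbol u)=\big(\prod_{j=1}^sw_j(u_j)\big)f(T(\boldsymbol u))$, $\boldsymbol u\in\mathbb I^s$. ANOVA components: $P_j(f)(\boldsymbol x)=\int_{\mathbb R}f(\boldsymbol x)\varphi(x_j)\,dx_j$, $P_v=\prod_{j\in v}P_j$, $P_\emptyset=I$, $f_v=\big(\prod_{j\in v}(I-P_j)\big)P_{\{1,\dots,s\}\setminus v}f$, which depends only on $\boldsymbol x_v$; $f_v^w(\boldsymbol u_v)=f_v(T(\boldsymbol u))\prod_{j\in v}w_j(u_j)$, a function on $\mathbb I^{|v|}$ (a constant when $v=\emptyset$). Generalized Fourier coefficients: for $g\in L^1(\mathbb I^s)$ and $\boldsymbol k\in\mathbb N_0^s$, $\hat g(\boldsymbol k)=\int_{\mathbb I^s}g(\boldsymbol u)\prod_{j=1}^s\overline{\phi_{k_j}(u_j)}\,d\boldsymbol u$; $\hat f^w$ denotes the coefficients of $f^w$. $\partial^v$ is the mixed weak derivative of order one in each variable indexed by $v$ ($\partial^\emptyset g=g$); $W^{1,2}_{\mathrm{mix}}(\mathbb I^s)$ is the space of $g$ with $\partial^vg\in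 L^2(\mathbb I^s)$ for all $v\subseteq\{1,\dots,s\}$. Sums of nonnegative terms take values in $[0,\infty]$, with $0\cdot\infty=0$. *)

(* Defs.v *)
From HB Require Import structures.
From mathcomp Require Import all_boot all_order all_algebra.
From mathcomp Require Import complex.
From mathcomp Require Import all_classical all_reals all_analysis.

Set Implicit Arguments.
Unset Strict Implicit.
Unset Printing Implicit Defensive.

Import Order.TTheory GRing.Theory Num.Theory.
Import numFieldNormedType.Exports.

Local Open Scope classical_set_scope.
Local Open Scope ring_scope.

(* Points of R^n are row vectors 'rV[R]_n. They carry the product sigma-algebra
   (generated by the coordinates), as n.-tuple does in the library. *)

Definition row_display : measure_display -> measure_display.
Proof. exact. Qed.

Section measurable_row.
Context {d : measure_display} {T : measurableType d}.
Variable n : nat.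

Let coord : 'I_n -> 'rV[T]_n -> T := fun i x => x ord0 i.

Let row_set0 : g_sigma_preimage coord set0.
Proof. exact: sigma_algebra0. Qed.

Let row_setC A : g_sigma_preimage coord A -> g_sigma_preimage coord (~` A).
Proof. exact: sigma_algebraC. Qed.

Let row_bigcup (F : (set 'rV[T]_n)^nat) :
  (forall i, g_sigma_preimage coord (F i)) ->
  g_sigma_preimage coord (\bigcup_i (F i)).
Proof. exact: sigma_algebra_bigcup. Qed.

HB.instance Definition _ := @isMeasurable.Build (row_display d)
  'rV[T]_n (g_sigma_preimage coord) row_set0 row_setC row_bigcup.

Lemma measurable_row_coord (i : 'I_n) :
  measurable_fun setT (fun x : 'rV[T]_n => x ord0 i).
Proof.
move=> _ A mA; rewrite setTI; apply: sub_sigma_algebra => /=.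
rewrite -bigcup_seq/=; exists i; first by rewrite /= mem_index_enum.
by exists A => //; rewrite setTI.
Qed.

Lemma measurable_fun_row d' (X : measurableType d') (f : X -> 'rV[T]_n) :
  (forall i, measurable_fun setT (fun x => f x ord0 i)) ->
  measurable_fun setT f.
Proof.
move=> mf; apply: (@measurability _ _ _ _ _ _
  (\big[setU/set0]_(i < n) preimage_set_system setT (coord i) measurable)) => //.
move=> B [C + <-] => {B}; rewrite -bigcup_seq => -[i _ [A mA <-]] {C}.
by rewrite (setTI (_ @^-1` A)); exact: mf.
Qed.

End measurable_row.

Section lebesgue_row.
Context {R : realType}.
Local Notation mR := (measurableTypeR R).

Definition row_cons n (p : mR * 'rV[mR]_n) : 'rV[mR]_n.+1 :=
  \row_i oapp (p.2 ord0) p.1 (unlift ord0 i).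

Lemma measurable_row_cons n : measurable_fun setT (@row_cons n).
Proof.
apply: measurable_fun_row => i.
rewrite (_ : (fun p => _) =
    fun p : mR * 'rV[mR]_n => oapp (p.2 ord0) p.1 (unlift ord0 i)); last first.
  by apply/funext => p; rewrite mxE.
case: (unlift ord0 i) => [j|] /=; last exact: measurable_fst.
exact: (measurableT_comp (measurable_row_coord j) measurable_snd).
Qed.

Section step.
Variables (n : nat) (m : {sigma_finite_measure set 'rV[mR]_n -> \bar R}).

Definition lebesgue_row_step : set 'rV[mR]_n.+1 -> \bar R :=
  pushforward (@lebesgue_measure R \x m)%E (@row_cons n).

Let mstep : {measure set 'rV[mR]_n.+1 -> \bar R} :=
  measure_function_pushforward__canonical__measure_function_Measure
    (@lebesgue_measure R \x m)%E (@measurable_row_cons n).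

HB.instance Definition _ := isMeasure.Build _ _ _ lebesgue_row_step
  (measure0 mstep) (measure_ge0 mstep) (@measure_semi_sigma_additive _ _ _ mstep).

Let step_sigma_finite : sigma_finite setT lebesgue_row_step.
Proof.
have /sigma_finiteP[F [TF ndF Foo]] := sigma_finiteT (@lebesgue_measure R).
have /sigma_finiteP[G [TG ndG Goo]] := sigma_finiteT m.
pose hd (y : 'rV[mR]_n.+1) : mR := y ord0 ord0.
pose tl (y : 'rV[mR]_n.+1) : 'rV[mR]_n := \row_i y ord0 (lift ord0 i).
have mtl : measurable_fun setT tl.
  apply: measurable_fun_row => i.
  rewrite (_ : (fun y => _) = fun y : 'rV[mR]_n.+1 => y ord0 (lift ord0 i)).
    exact: measurable_row_coord.
  by apply/funext => y; rewrite mxE.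
exists (fun k => hd @^-1` F k `&` tl @^-1` G k).
  apply/seteqP; split => // y _.
  have [i _ Fi] : (\bigcup_k F k) (hd y) by rewrite -TF.
  have [j _ Gj] : (\bigcup_k G k) (tl y) by rewrite -TG.
  exists (maxn i j) => //; split.
    by have /subsetPset := ndF _ _ (leq_maxl i j); apply.
  by have /subsetPset := ndG _ _ (leq_maxr i j); apply.
move=> k; have [mF lF] := Foo k; have [mG lG] := Goo k; split.
  apply: measurableI; rewrite -[X in measurable X]setTI.
    exact: measurable_row_coord.
  exact: mtl.
rewrite /lebesgue_row_step /pushforward.
rewrite (_ : _ @^-1` _ = F k `*` G k).
  by rewrite product_measure1E// lte_mul_pinfty// ge0_fin_numE.
have tlE p : tl (row_cons p) = p.2 by apply/rowP => i; rewrite !mxE liftK.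
have hdE p : hd (row_cons p) = p.1 by rewrite /hd mxE unlift_none.
by apply/seteqP; split => p /=; rewrite tlE hdE.
Qed.

HB.instance Definition _ := Measure_isSigmaFinite.Build _ _ _ lebesgue_row_step
  step_sigma_finite.

End step.

(* Lebesgue measure on R^n, see lebesgue_row_box. *)
Fixpoint lebesgue_row (n : nat) :
    {sigma_finite_measure set 'rV[mR]_n -> \bar R} :=
  match n with
  | 0 => @dirac _ 'rV[mR]_0 (0 : 'rV[R]_0) R
  | n'.+1 => lebesgue_row_step (lebesgue_row n')
  end.

Lemma lebesgue_row_box n (A : 'I_n -> set mR) : (forall i, measurable (A i)) ->
  lebesgue_row n [set x | forall i, A i (x ord0 i)] =
  (\prod_(i < n) lebesgue_measure (A i))%E.
Proof.
elim: n A => [|n IHn] A mA /=.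
  by rewrite big_ord0 diracE mem_set//= => -[].
pose B : set 'rV[mR]_n := [set x | forall i, A (lift ord0 i) (x ord0 i)].
rewrite /lebesgue_row_step /pushforward (_ : _ @^-1` _ = A ord0 `*` B).
  rewrite product_measure1E//; first by rewrite big_ord_recl -IHn.
  have -> : B = \big[setI/setT]_(i < n)
      ((fun x : 'rV[mR]_n => x ord0 i) @^-1` A (lift ord0 i)).
    rewrite -bigcap_seq; apply/seteqP; split => [x Bx i _|x Ax i]; first exact: Bx.
    by apply: (Ax i); rewrite /= mem_index_enum.
  apply: bigsetI_measurable => i _; rewrite -[X in measurable X]setTI.
  exact: measurable_row_coord.
apply/seteqP; split => p /=.
  move=> Ap; split=> [|i]; first by have := Ap ord0; rewrite mxE unlift_none.
  by have := Ap (lift ord0 i); rewrite mxE liftK.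
by move=> -[A0 Al] i; rewrite mxE; case: unliftP => [j ->|->] //=.
Qed.

End lebesgue_row.

Section spaces.
Context {R : realType}.

(* Elements of the L^p spaces are represented by Borel functions; only their
   values on the cube (0,1)^n, resp. the interval (0,1), matter. *)

Definition unit_interval : set R := `]0, 1[%classic.

Definition cube n : set 'rV[R]_n :=
  [set u | forall i, unit_interval (u ord0 i)].

Definition L2norm n (g : 'rV[R]_n -> R) : \bar R :=
  'N[lebesgue_row n]_2%:E [EFin \o (g \_ (@cube n))].

Definition inL2 n (g : 'rV[R]_n -> R) :=
  measurable_fun (@cube n) g /\ (L2norm g < +oo)%E.

Definition loc_integrable n (g : 'rV[R]_n -> R) :=
  forall K : set 'rV[R]_n, compact K -> K `<=` @cube n ->
    (lebesgue_row n).-integrable K (EFin \o g).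

Definition partial n (i : 'I_n) (g : 'rV[R]_n -> R) : 'rV[R]_n -> R :=
  fun x => 'D_(delta_mx ord0 i) g x.

Definition partials n (r : seq 'I_n) (g : 'rV[R]_n -> R) : 'rV[R]_n -> R :=
  foldr (@partial n) g r.

Definition smooth n (g : 'rV[R]_n -> R) :=
  forall r : seq 'I_n, continuous (partials r g) /\
    forall i x, derivable (partials r g) x (delta_mx ord0 i).

Definition test_function n (psi : 'rV[R]_n -> R) :=
  smooth psi /\ exists K : set 'rV[R]_n,
    [/\ compact K, K `<=` @cube n & forall x, ~ K x -> psi x = 0].

Definition is_weak_partial n (v : {set 'I_n}) (g h : 'rV[R]_n -> R) :=
  [/\ loc_integrable g, loc_integrable h &
    forall psi, test_function psi ->
      \int[lebesgue_row n]_(u in @cube n) (g u * partials (enum v) psi u) =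
      (-1) ^+ #|v| * \int[lebesgue_row n]_(u in @cube n) (h u * psi u)].

(* Weak derivatives are unique up to a null set of the cube, so that L2norm does
   not depend on the choice made here. *)
Definition weak_partial n (v : {set 'I_n}) (g : 'rV[R]_n -> R) : 'rV[R]_n -> R :=
  get [set h | is_weak_partial v g h].

Definition W12mix n (g : 'rV[R]_n -> R) :=
  inL2 g /\ forall v : {set 'I_n}, exists2 h, is_weak_partial v g h & inL2 h.

Definition cintegral d (T : measurableType d) (mu : {measure set T -> \bar R})
    (D : set T) (g : T -> R[i]) : R[i] :=
  Complex (\int[mu]_(x in D) complex.Re (g x)) (\int[mu]_(x in D) complex.Im (g x)).

Definition cLnorm (q : \bar R) (g : R -> R[i]) : \bar R :=
  'N[@lebesgue_measure R]_q [EFin \o ((@Normc.normc R \o g) \_ unit_interval)].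

Definition inLp (q : \bar R) (g : R -> R[i]) :=
  [/\ measurable_fun unit_interval (@complex.Re R \o g),
      measurable_fun unit_interval (@complex.Im R \o g) &
      (cLnorm q g < +oo)%E].

Definition orthonormal_basis (phi : nat -> R -> R[i]) :=
  [/\ forall k, inLp 2%:E (phi k),
      forall k l, cintegral (@lebesgue_measure R) unit_interval
        (fun u => phi k u * conjc (phi l u)) = (k == l)%:R &
      forall g, inLp 2%:E g -> forall e : R, 0 < e ->
        exists (n : nat) (c : 'I_n -> R[i]),
          (cLnorm 2%:E (fun u => g u - \sum_(k < n) c k * phi k u)%R < e%:E)%E].

Definition primitive (g : R -> R[i]) (u : R) : R[i] :=
  cintegral (@lebesgue_measure R) `]0, u]%classic g.

Definition fourier (phi : nat -> R -> R[i]) n (g : 'rV[R]_n -> R[i])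
    (k : {ffun 'I_n -> nat}) : R[i] :=
  cintegral (lebesgue_row n) (@cube n)
    (fun u => g u * \prod_(j < n) conjc (phi (k j) (u ord0 j))).

End spaces.

Section transport.
Context {R : realType}.
Variable rho : R -> R.

Definition cdf (x : R) : R :=
  \int[@lebesgue_measure R]_(y in `]-oo, x]%classic) rho y.

Definition admissible_density :=
  [/\ measurable_fun setT rho /\ (\int[@lebesgue_measure R]_x (rho x)%:E = 1)%E,
      forall x, 0 < rho x,
      forall x, rho (- x) = rho x,
      has_ubound (range rho) &
      forall e : R, 0 < e -> exists2 c : R, 0 < c &
        forall x, x <= 0 -> c * cdf x `^ (1 + e) <= rho x].

Variable p : R.

Definition eta (u : R) : R :=
  if u == 0 then 0 else
  2 `^ (- p - 2) * u `^ (- p - 1) * expR (2 `^ p - u `^ (- p)).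

Definition weight (theta u : R) : R :=
  let v := if u <= 1 / 2 then u else 1 - u in
  (1 - theta)^-1 *
  (if v <= theta / 2 then eta (v / theta)
   else if v < theta then 1 - eta (1 - v / theta)
   else 1).

Definition transport1 (theta u : R) : R :=
  'pinv_(fun=> 0) setT cdf
    (\int[@lebesgue_measure R]_(t in `]0, u]%classic) weight theta t).

Variables (s : nat) (theta : 'I_s -> R).

Definition transport (u : 'rV[R]_s) : 'rV[R]_s :=
  \row_j transport1 (theta j) (u ord0 j).

Variable f : 'rV[R]_s -> R.

Definition weighted (u : 'rV[R]_s) : R :=
  (\prod_(j < s) weight (theta j) (u ord0 j)) * f (transport u).

Definition set_coord (x : 'rV[R]_s) (j : 'I_s) (t : R) : 'rV[R]_s :=
  \row_i if i == j then t else x ord0 i.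

Definition proj1 (j : 'I_s) (g : 'rV[R]_s -> R) : 'rV[R]_s -> R :=
  fun x => \int[@lebesgue_measure R]_t (g (set_coord x j t) * rho t).

(* By Fubini's theorem the order of the coordinates matters, here and in anova,
   only on a null set. *)
Definition proj (v : {set 'I_s}) (g : 'rV[R]_s -> R) : 'rV[R]_s -> R :=
  foldr proj1 g (enum v).

Definition anova (v : {set 'I_s}) : 'rV[R]_s -> R :=
  foldr (fun j g x => g x - proj1 j g x) (proj (~: v) f) (enum v).

(* The value 1 / 2 given to the coordinates outside v is arbitrary in the cube:
   anova v does not depend on them. *)
Definition extend (v : {set 'I_s}) (y : 'rV[R]_#|v|) : 'rV[R]_s :=
  \row_j oapp (y ord0) (1 / 2) [pick i | enum_val i == j].

Definition anova_weighted (v : {set 'I_s}) (y : 'rV[R]_#|v|) : R :=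
  anova v (transport (extend y)) *
  \prod_(i < #|v|) weight (theta (enum_val i)) (y ord0 i).

End transport.

Arguments extend {R s} v y.
Arguments anova_weighted {R} rho p {s} theta f v y.

(* Functions of a positive integer (lambda, calN, ...) are total functions on nat;
   their value at 0 is never used. *)
Section indices.
Context {R : realType}.
Variables (lambda : nat -> R[i]) (calN : nat -> nat).

Definition supp (s : nat) (k : {ffun 'I_s -> nat}) : {set 'I_s} :=
  [set j | k j != 0%N]%SET.

Definition calE (s : nat) (l : {ffun 'I_s -> nat}) : set {ffun 'I_s -> nat} :=
  [set k | supp k = supp l /\
           forall j, j \in supp l -> calN (k j) = l j].

Definition calS (Cphi theta : R) (l : nat) (alpha : R) : \bar R :=
  ((16 * Cphi ^+ 2)%:E *
   \esum_(k in [set k | (0 < k)%N /\ calN k = l])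
     (Num.min (theta ^+ 2) (Normc.normc (lambda k) ^+ 2) *
      Normc.normc (lambda k) `^ (- (2 * alpha)))%:E)%E.

End indices.

(* Main.v *)
(* On the cube, the projection P_j becomes the operator
   Q_j g(u) = w_j(u_j) * \int g(u) du_j, which acts on the coefficients g^ of g by
   (Q_j g)^(k) = w_j^(k_j) * g^(k with k_j replaced by 0). Expanding the product
   over the support s(k) of (I - Q_j) + Q_j writes the k-th coefficient of f^w as
   the sum over v included in s(k) of (f_v^w)^(k_v) times the product of the
   w_j^(k_j), j in s(k) \ v, and Cauchy-Schwarz over the 2^|s(k)| sets v reduces
   the claim to each summand. For the second factor,
   |w_j^(k)|^2 <= 16 C^2 min(theta_j^2, |lambda(k)|^2), since the L^1 norms of
   w_j - 1 and of w_j' are at most 4 theta_j and 4. For the first, integration by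
   parts turns (f_v^w)^(k_v), up to phases, into the product of the |lambda(k_j)| times the
   coefficient of index M(k_v) of the mixed derivative of f_v^w multiplied by a
   function bounded by 1. As M is injective on the fibres of N, Bessel's
   inequality applies to f_v^w and to its derivative, and Hoelder's inequality
   interpolates between the two. *)

From HB Require Import structures.
Require Import Defs.
From mathcomp Require Import all_boot all_order all_algebra.
From mathcomp Require Import complex perm.
From mathcomp Require Import all_classical all_reals all_analysis.
From mathcomp Require Import measurable_realfun.
From mathcomp Require Import ring lra.

Set Implicit Arguments.
Unset Strict Implicit.
Unset Printing Implicit Defensive.

Import Order.TTheory GRing.Theory Num.Theory.
Import numFieldNormedType.Exports.

Local Open Scope classical_set_scope.
Local Open Scope ring_scope.

(** * Complex-valued integrals *)

(** Weak derivatives are tested only against smooth functions of compact support, whereas basis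
    functions are merely bounded. Integration by parts is still free of boundary terms: for k > 0,
    orthogonality to [phi 0] = 1 gives [phi k] mean zero, so its primitive vanishes at both ends of
    the interval, and the fundamental lemma, applied in one coordinate at a time, passes from test
    functions to bounded ones. The hypothesis concerns f^w alone, so the existence of a weak
    derivative of each f_v^w has to be proved; otherwise the choice in [weak_partial] would be
    meaningless. This happens in L^1 ([mixed]), a class stable under the Q_j because the weights are
    C^1. Square integrability of the derivatives is not claimed: the final inequalities are proved
    in the extended reals and allow the norm +oo. All integrals are moved to probability measures on
    the whole line or space, so that Fubini turns into statements on measure-preserving maps, and
    the basis is replaced by representatives bounded at every point. *)

Section complex_numbers.
Context {R : realType}.
Implicit Types z : R[i].

Lemma ReD z z' : complex.Re (z + z') = complex.Re z + complex.Re z'.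
Proof. by case: z z' => a b [c d]. Qed.

Lemma ImD z z' : complex.Im (z + z') = complex.Im z + complex.Im z'.
Proof. by case: z z' => a b [c d]. Qed.

Lemma ReM z z' : complex.Re (z * z') =
  complex.Re z * complex.Re z' - complex.Im z * complex.Im z'.
Proof. by case: z z' => a b [c d]. Qed.

Lemma ImM z z' : complex.Im (z * z') =
  complex.Re z * complex.Im z' + complex.Im z * complex.Re z'.
Proof. by case: z z' => a b [c d]. Qed.

Lemma normc_sqr z : Normc.normc z ^+ 2 = complex.Re z ^+ 2 + complex.Im z ^+ 2.
Proof. by case: z => a b /=; rewrite sqr_sqrtr// addr_ge0// sqr_ge0. Qed.

Lemma normc_ge0 z : 0 <= Normc.normc z.
Proof. by case: z => a b /=; rewrite sqrtr_ge0. Qed.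

Lemma Re_le_normc z : `|complex.Re z| <= Normc.normc z.
Proof.
rewrite -(@ler_pXn2r _ 2)// ?nnegrE ?normc_ge0// normc_sqr -normrX ger0_norm ?sqr_ge0//.
by rewrite lerDl sqr_ge0.
Qed.

Lemma Im_le_normc z : `|complex.Im z| <= Normc.normc z.
Proof.
rewrite -(@ler_pXn2r _ 2)// ?nnegrE ?normc_ge0// normc_sqr -normrX ger0_norm ?sqr_ge0//.
by rewrite lerDr sqr_ge0.
Qed.

Lemma normc_le_ReIm z : Normc.normc z <= `|complex.Re z| + `|complex.Im z|.
Proof.
rewrite -(@ler_pXn2r _ 2)// ?nnegrE ?normc_ge0 ?addr_ge0// normc_sqr.
rewrite sqrrD !real_normK ?num_real// -addrA lerD2l lerDr.
by rewrite mulrn_wge0// mulr_ge0.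
Qed.

Lemma normc_conj z : Normc.normc (conjc z) = Normc.normc z.
Proof. by case: z => a b /=; rewrite sqrrN. Qed.

Lemma normc_real (x : R) : Normc.normc (x%:C)%C = `|x|.
Proof. by rewrite /= expr0n/= addr0 sqrtr_sqr. Qed.

Lemma normcN z : Normc.normc (- z) = Normc.normc z.
Proof. by case: z => a b /=; rewrite !sqrrN. Qed.

Lemma normcD z z' : Normc.normc (z + z') <= Normc.normc z + Normc.normc z'.
Proof. by have := ler_normD z z'; rewrite lecE/= => /andP[]. Qed.

Lemma normc_prod (I : Type) (r : seq I) (F : I -> R[i]) :
  Normc.normc (\prod_(i <- r) F i) = \prod_(i <- r) Normc.normc (F i).
Proof.
elim/big_rec2: _ => [|i y z _ <-]; first exact: Normc.normc1.
exact: Normc.normcM.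
Qed.

Lemma mulc_conj z : z * conjc z = (Normc.normc z ^+ 2)%:C%C.
Proof.
by case: z => a b /=; apply/eqP; rewrite eq_complex/= sqr_sqrtr ?addr_ge0 ?sqr_ge0//; apply/andP; split; apply/eqP; ring.
Qed.

Lemma conjcM z z' : conjc (z * z') = conjc z * conjc z'.
Proof. exact: rmorphM. Qed.

End complex_numbers.

Section complex_integral.
Context {d} {T : measurableType d} {R : realType}.
Implicit Types (m : {measure set T -> \bar R}) (f g : T -> R[i]).

Definition cmeas f :=
  measurable_fun setT (@complex.Re R \o f) /\ measurable_fun setT (@complex.Im R \o f).

Definition cintble m f :=
  m.-integrable setT (EFin \o (@complex.Re R \o f)) /\
  m.-integrable setT (EFin \o (@complex.Im R \o f)).

(** The bound holds at every point, not almost everywhere, so that products of bounded and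
    integrable functions need no null sets. *)
Definition cbounded f := exists M : R, forall x, Normc.normc (f x) <= M.

Lemma cintble_meas m f : cintble m f -> cmeas f.
Proof. by move=> [/measurable_int/measurable_EFinP ? /measurable_int/measurable_EFinP]. Qed.

Lemma cmeas_cst (c : R[i]) : cmeas (cst c).
Proof. by split; exact: measurable_cst. Qed.

Lemma cmeasD f g : cmeas f -> cmeas g -> cmeas (fun x => f x + g x).
Proof.
move=> [f1 f2] [g1 g2]; split.
- rewrite (_ : _ \o _ = (@complex.Re R \o f) \+ (@complex.Re R \o g)); first exact: measurable_funD.
  by apply/funext => x /=; rewrite ReD.
- rewrite (_ : _ \o _ = (@complex.Im R \o f) \+ (@complex.Im R \o g)); first exact: measurable_funD.
  by apply/funext => x /=; rewrite ImD.
Qed.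

Lemma cmeasM f g : cmeas f -> cmeas g -> cmeas (fun x => f x * g x).
Proof.
move=> [f1 f2] [g1 g2]; split.
- rewrite (_ : _ \o _ = ((@complex.Re R \o f) \* (@complex.Re R \o g)) \- ((@complex.Im R \o f) \* (@complex.Im R \o g))).
    by apply: measurable_funB; exact: measurable_funM.
  by apply/funext => x /=; rewrite ReM.
- rewrite (_ : _ \o _ = ((@complex.Re R \o f) \* (@complex.Im R \o g)) \+ ((@complex.Im R \o f) \* (@complex.Re R \o g))).
    by apply: measurable_funD; exact: measurable_funM.
  by apply/funext => x /=; rewrite ImM.
Qed.

Lemma cmeas_conj f : cmeas f -> cmeas (fun x => conjc (f x)).
Proof.
move=> [f1 f2]; split.
- by rewrite (_ : _ \o _ = (@complex.Re R \o f))//; apply/funext => x /=; case: (f x).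
- rewrite (_ : _ \o _ = -%R \o (@complex.Im R \o f)); first exact: measurableT_comp.
  by apply/funext => x /=; case: (f x).
Qed.

Lemma cmeas_real (f : T -> R) : measurable_fun setT f -> cmeas (fun x => (f x)%:C%C).
Proof. by split => //; exact: measurable_cst. Qed.

Lemma cmeas_prod (I : Type) (r : seq I) (F : I -> T -> R[i]) :
  (forall i, cmeas (F i)) -> cmeas (fun x => \prod_(i <- r) F i x).
Proof.
move=> mF; elim: r => [|i r IH].
  by under eq_fun do rewrite big_nil; exact: cmeas_cst.
by under eq_fun do rewrite big_cons; exact: cmeasM.
Qed.

Lemma cmeas_sum (I : Type) (r : seq I) (F : I -> T -> R[i]) :
  (forall i, cmeas (F i)) -> cmeas (fun x => \sum_(i <- r) F i x).
Proof.
move=> mF; elim: r => [|i r IH].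
  by under eq_fun do rewrite big_nil; exact: cmeas_cst.
by under eq_fun do rewrite big_cons; exact: cmeasD.
Qed.

Lemma measurable_normc f : cmeas f -> measurable_fun setT (fun x => Normc.normc (f x)).
Proof.
move=> [f1 f2].
rewrite (_ : (fun _ => _) = Num.sqrt \o (fun x => complex.Re (f x) ^+ 2 + complex.Im (f x) ^+ 2)).
  apply: measurableT_comp.
    by apply: nondecreasing_measurable => // x y; exact: ler_wsqrtr.
  by apply: measurable_funD; apply: measurable_funX.
by apply/funext => x /=; rewrite -normc_sqr sqrtr_sqr ger0_norm// normc_ge0.
Qed.

Lemma cbounded_cst (c : R[i]) : cbounded (cst c).
Proof. by exists (Normc.normc c). Qed.

Lemma cboundedM f g : cbounded f -> cbounded g -> cbounded (fun x => f x * g x).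
Proof.
move=> [M1 h1] [M2 h2]; exists (M1 * M2) => x; rewrite Normc.normcM.
by apply: ler_pM => //; exact: normc_ge0.
Qed.

Lemma cboundedD f g : cbounded f -> cbounded g -> cbounded (fun x => f x + g x).
Proof.
move=> [M1 h1] [M2 h2]; exists (M1 + M2) => x; apply: le_trans (normcD _ _) _.
exact: lerD.
Qed.

Lemma cbounded_conj f : cbounded f -> cbounded (fun x => conjc (f x)).
Proof. by move=> [M h]; exists M => x; rewrite normc_conj. Qed.

Lemma cbounded_prod (I : Type) (r : seq I) (F : I -> T -> R[i]) :
  (forall i, cbounded (F i)) -> cbounded (fun x => \prod_(i <- r) F i x).
Proof.
move=> mF; elim: r => [|i r IH].
  by under eq_fun do rewrite big_nil; exact: cbounded_cst.
by under eq_fun do rewrite big_cons; exact: cboundedM.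
Qed.

Lemma cbounded_sum (I : Type) (r : seq I) (F : I -> T -> R[i]) :
  (forall i, cbounded (F i)) -> cbounded (fun x => \sum_(i <- r) F i x).
Proof.
move=> mF; elim: r => [|i r IH].
  by under eq_fun do rewrite big_nil; exact: cbounded_cst.
by under eq_fun do rewrite big_cons; exact: cboundedD.
Qed.

Lemma integrable_boundedM m (f g : T -> R) (M : R) :
  m.-integrable setT (EFin \o f) -> measurable_fun setT g ->
  (forall x, `|g x| <= M) -> m.-integrable setT (EFin \o (fun x => f x * g x)).
Proof.
move=> intf mg gM.
have mf : measurable_fun setT f by exact/measurable_EFinP/(measurable_int m).
apply: (@le_integrable _ _ _ m setT measurableT _ (fun x => M%:E * (`|f x|)%:E)%E).
- by apply/measurable_EFinP; exact: measurable_funM.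
- move=> x _ /=; rewrite lee_fin normrM [leRHS]ger0_norm.
    by rewrite mulrC ler_wpM2r.
  by rewrite mulr_ge0//; exact: le_trans (gM x).
- exact/integrableZl/integrable_norm.
Qed.

Lemma integrable_bounded m (g : T -> R) (M : R) : (m setT < +oo)%E ->
  measurable_fun setT g -> (forall x, `|g x| <= M) -> m.-integrable setT (EFin \o g).
Proof.
move=> foo mg gM; apply: measurable_bounded_integrable => //.
by exists M; split; [exact: num_real|move=> N MN x _ /=; apply: le_trans (gM x) (ltW MN)].
Qed.

Lemma cintbleD m f g : cintble m f -> cintble m g -> cintble m (fun x => f x + g x).
Proof.
move=> [f1 f2] [g1 g2]; split.
- rewrite (_ : _ \o _ = (EFin \o (@complex.Re R \o f)) \+ (EFin \o (@complex.Re R \o g)))%E; first exact: integrableD.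
  by apply/funext => x /=; rewrite ReD EFinD.
- rewrite (_ : _ \o _ = (EFin \o (@complex.Im R \o f)) \+ (EFin \o (@complex.Im R \o g)))%E; first exact: integrableD.
  by apply/funext => x /=; rewrite ImD EFinD.
Qed.

Lemma cintbleMb m f g : cintble m f -> cmeas g -> cbounded g -> cintble m (fun x => f x * g x).
Proof.
move=> [f1 f2] [g1 g2] [M gM].
have gR x : `|complex.Re (g x)| <= M by exact: le_trans (Re_le_normc _) (gM x).
have gI x : `|complex.Im (g x)| <= M by exact: le_trans (Im_le_normc _) (gM x).
split.
- rewrite (_ : _ \o _ = (EFin \o (fun x => complex.Re (f x) * complex.Re (g x))%R) \- (EFin \o (fun x => complex.Im (f x) * complex.Im (g x))%R))%E.
    by apply: integrableB => //; apply: integrable_boundedM; eauto.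
  by apply/funext => x /=; rewrite ReM EFinD.
- rewrite (_ : _ \o _ = (EFin \o (fun x => complex.Re (f x) * complex.Im (g x))%R) \+ (EFin \o (fun x => complex.Im (f x) * complex.Re (g x))%R))%E.
    by apply: integrableD => //; apply: integrable_boundedM; eauto.
  by apply/funext => x /=; rewrite ImM EFinD.
Qed.

Lemma cintbleZ m f (c : R[i]) : cintble m f -> cintble m (fun x => c * f x).
Proof.
move=> mf; under eq_fun do rewrite mulrC.
by apply: cintbleMb => //; [exact: cmeas_cst|exact: cbounded_cst].
Qed.

Lemma cintbleN m f : cintble m f -> cintble m (fun x => - f x).
Proof.
by move=> mf; under eq_fun do rewrite -mulN1r; exact: cintbleZ.
Qed.

Lemma cintble_bounded m f : (m setT < +oo)%E -> cmeas f -> cbounded f -> cintble m f.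
Proof.
move=> foo [f1 f2] [M fM]; split; apply: integrable_bounded => // x.
  exact: le_trans (Re_le_normc _) (fM x).
exact: le_trans (Im_le_normc _) (fM x).
Qed.

Lemma cintble_real m (f : T -> R) : m.-integrable setT (EFin \o f) -> cintble m (fun x => (f x)%:C%C).
Proof.
by move=> intf; split => //; apply: (eq_integrable _ (cst 0%E)) => //; exact: integrable0.
Qed.

Lemma cintble_sum m (I : Type) (r : seq I) (F : I -> T -> R[i]) :
  (forall i, cintble m (F i)) -> cintble m (fun x => \sum_(i <- r) F i x).
Proof.
move=> mF; elim: r => [|i r IH].
  under eq_fun do rewrite big_nil.
  by apply: (@cintble_real _ (cst 0)); exact: integrable0.
by under eq_fun do rewrite big_cons; exact: cintbleD.
Qed.

Definition cI m f : R[i] := cintegral m setT f.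

Lemma eq_cI m f g : f =1 g -> cI m f = cI m g.
Proof. by move=> fg; congr cI; exact/funext. Qed.

Lemma cI_real m (f : T -> R) : cI m (fun x => (f x)%:C%C) = (\int[m]_x f x)%:C%C.
Proof. by rewrite /cI /cintegral /= Rintegral_cst// mul0r. Qed.

Lemma cID m f g : cintble m f -> cintble m g ->
  cI m (fun x => f x + g x) = cI m f + cI m g.
Proof.
move=> [f1 f2] [g1 g2]; rewrite /cI /cintegral.
under [X in Complex X _]eq_Rintegral do rewrite ReD.
under [X in Complex _ X]eq_Rintegral do rewrite ImD.
by rewrite !RintegralD.
Qed.

Lemma cIZ m f (c : R[i]) : cintble m f -> cI m (fun x => c * f x) = c * cI m f.
Proof.
move=> [f1 f2]; rewrite /cI /cintegral.
under [X in Complex X _]eq_Rintegral do rewrite ReM.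
under [X in Complex _ X]eq_Rintegral do rewrite ImM.
have h (k : R) (g : T -> R) : m.-integrable setT (EFin \o g) ->
    m.-integrable setT (EFin \o (fun x => k * g x)).
  move=> ig; rewrite (_ : _ \o _ = (fun x => k%:E * (EFin \o g) x)%E); first exact: integrableZl.
  by apply/funext => x /=; rewrite EFinM.
rewrite RintegralB//; [|exact: h|exact: h].
rewrite RintegralD//; [|exact: h|exact: h].
by rewrite !RintegralZl//; case: c.
Qed.

Lemma cIN m f : cintble m f -> cI m (fun x => - f x) = - cI m f.
Proof. by move=> mf; under eq_cI do rewrite -mulN1r; rewrite cIZ// mulN1r. Qed.

Lemma cIB m f g : cintble m f -> cintble m g ->
  cI m (fun x => f x - g x) = cI m f - cI m g.
Proof. by move=> mf mg; rewrite cID ?cIN//; exact: cintbleN. Qed.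

Lemma cI_sum m (I : Type) (r : seq I) (F : I -> T -> R[i]) :
  (forall i, cintble m (F i)) -> cI m (fun x => \sum_(i <- r) F i x) = \sum_(i <- r) cI m (F i).
Proof.
move=> mF; elim: r => [|i r IH].
  under eq_cI do rewrite big_nil.
  by rewrite big_nil (cI_real m (cst 0)) Rintegral_cst// mul0r.
by under eq_cI do rewrite big_cons; rewrite big_cons cID// ?IH//; exact: cintble_sum.
Qed.

Lemma cI_conj m f : cintble m f -> cI m (fun x => conjc (f x)) = conjc (cI m f).
Proof.
move=> [f1 f2]; rewrite /cI /cintegral/=; congr Complex.
  by apply: eq_Rintegral => x _; case: (f x).
rewrite -mulN1r -RintegralZl//.
by apply: eq_Rintegral => x _; rewrite mulN1r; case: (f x).
Qed.

Lemma cI_cst m (c : R[i]) : (m setT = 1)%E -> cI m (cst c) = c.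
Proof.
move=> m1; rewrite /cI /cintegral/= !Rintegral_cst// m1/= !mulr1; by case: c.
Qed.

Lemma ae_eq_cI m f g : cmeas f -> cmeas g -> {ae m, forall x, f x = g x} -> cI m f = cI m g.
Proof.
move=> [f1 f2] [g1 g2] fg; rewrite /cI /cintegral /Rintegral; congr (Complex (fine _) (fine _));
  apply: ae_eq_integral => //; do 1?exact/measurable_EFinP;
  by apply: filterS fg => x /= ->.
Qed.

Lemma Re_cI m f : complex.Re (cI m f) = \int[m]_x complex.Re (f x).
Proof. by []. Qed.

(** Multiplication by the unimodular constant [c] turns the integral into its modulus, and then only
    real parts have to be compared. *)
Lemma normc_cI_le m f : cintble m f -> Normc.normc (cI m f) <= \int[m]_x Normc.normc (f x).
Proof.
move=> mf; have [/eqP I0|I0] := eqVneq (Normc.normc (cI m f)) 0.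
  by rewrite (eqP I0); apply: Rintegral_ge0 => x _; exact: normc_ge0.
have Igt0 : 0 < Normc.normc (cI m f) by rewrite lt_neqAle eq_sym I0 normc_ge0.
pose c : R[i] := conjc (cI m f) / (Normc.normc (cI m f))%:C%C.
have c1 : Normc.normc c = 1.
  by rewrite /c Normc.normcM Normc.normcV normc_conj normc_real gtr0_norm// divff.
have cE : c * cI m f = (Normc.normc (cI m f))%:C%C.
  rewrite /c mulrAC [conjc _ * _]mulrC mulc_conj -rmorphV ?unitfE//= -rmorphM.
  by congr (_ %:C)%C; rewrite expr2 mulfK.
have -> : Normc.normc (cI m f) = complex.Re (cI m (fun x => c * f x)) by rewrite cIZ// cE.
have [r1 r2] := cintbleZ c mf.
have [mf1 mf2] := mf.
rewrite Re_cI; apply: le_Rintegral => //.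
  apply: (@le_integrable _ _ _ m setT measurableT _ (fun x => (`|complex.Re (f x)|)%:E + (`|complex.Im (f x)|)%:E)%E).
  - by apply/measurable_EFinP/measurable_normc/(cintble_meas mf).
  - move=> x _ /=; rewrite lee_fin [leLHS]ger0_norm ?normc_ge0//.
    by rewrite [leRHS]ger0_norm ?addr_ge0//; exact: normc_le_ReIm.
  - by apply: integrableD => //; exact: integrable_norm.
move=> x _; apply: le_trans (ler_norm _) _; apply: le_trans (Re_le_normc _) _.
by rewrite Normc.normcM c1 mul1r.
Qed.

End complex_integral.
Arguments cI {d T R} m f.

(** * The uniform probability on the cube *)

Section measure_preserving.
Context {d1 d2} {T1 : measurableType d1} {T2 : measurableType d2} {R : realType}.
Variables (m1 : {measure set T1 -> \bar R}) (m2 : {measure set T2 -> \bar R}).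
Variable phi : T1 -> T2.

(** Coordinate projections, permutations, replacement of a coordinate and splitting into two groups
    of coordinates are all of this kind; integrals, integrability and null sets are transported
    along them uniformly. *)
Definition mpres := measurable_fun setT phi /\
  forall A, measurable A -> m1 (phi @^-1` A) = m2 A.

Hypothesis hphi : mpres.

Lemma mpres_ge0_integral (f : T2 -> \bar R) : measurable_fun setT f ->
  (forall y, 0 <= f y)%E -> (\int[m1]_x f (phi x) = \int[m2]_y f y)%E.
Proof.
case: hphi => mphi phiE mf f0.
transitivity (\int[pushforward m1 phi]_y f y)%E.
  by rewrite ge0_integral_pushforward//; move=> y _; exact: f0.
by apply: eq_measure_integral => A mA _; exact: phiE.
Qed.

Lemma mpres_integrable (f : T2 -> \bar R) : measurable_fun setT f ->
  m1.-integrable setT (f \o phi) <-> m2.-integrable setT f.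
Proof.
move=> mf; have [mphi _] := hphi.
have mabs : measurable_fun setT (fun y => `|f y|)%E by exact: measurableT_comp.
have e : (\int[m1]_x `|f (phi x)| = \int[m2]_y `|f y|)%E.
  by rewrite (@mpres_ge0_integral (fun y => `|f y|)%E).
by split => /integrableP[_ h]; apply/integrableP; split;
  [|rewrite -e|exact: measurableT_comp|rewrite /= e].
Qed.

Lemma mpres_Rintegral (f : T2 -> R) : measurable_fun setT f ->
  \int[m1]_x f (phi x) = \int[m2]_y f y.
Proof.
move=> mf; rewrite /Rintegral; congr fine.
rewrite [LHS]integralE [RHS]integralE; congr (_ - _)%E.
- transitivity (\int[m1]_x ((EFin \o f)^\+ (phi x)))%E.
    by apply: eq_integral => x _; rewrite !funeposE.
  apply: mpres_ge0_integral => [|y]; last exact: funepos_ge0.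
  by apply: measurable_funepos; exact/measurable_EFinP.
- transitivity (\int[m1]_x ((EFin \o f)^\- (phi x)))%E.
    by apply: eq_integral => x _; rewrite !funenegE.
  apply: mpres_ge0_integral => [|y]; last exact: funeneg_ge0.
  by apply: measurable_funeneg; exact/measurable_EFinP.
Qed.

Lemma mpres_cmeas (f : T2 -> R[i]) : cmeas f -> cmeas (f \o phi).
Proof.
by case: hphi => mphi _ [f1 f2]; split; rewrite compA; exact: measurableT_comp.
Qed.

Lemma mpres_cI (f : T2 -> R[i]) : cmeas f -> cI m1 (fun x => f (phi x)) = cI m2 f.
Proof.
by move=> [f1 f2]; rewrite /cI /cintegral; congr Complex; exact: (mpres_Rintegral (f := _ \o f)).
Qed.

Lemma mpres_cintble (f : T2 -> R[i]) : cmeas f ->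
  cintble m1 (fun x => f (phi x)) <-> cintble m2 f.
Proof.
move=> [/measurable_EFinP/mpres_integrable f1 /measurable_EFinP/mpres_integrable f2].
by split => -[h1 h2]; split; [exact: (f1.1 h1)|exact: (f2.1 h2)|exact: (f1.2 h1)|exact: (f2.2 h2)].
Qed.

Lemma mpres_ae (Q : T2 -> Prop) :
  {ae m2, forall y, Q y} -> {ae m1, forall x, Q (phi x)}.
Proof.
case: hphi => mphi phiE [N [mN N0 QN]]; exists (phi @^-1` N); split.
- by rewrite -[X in measurable X]setTI; exact: mphi.
- by rewrite phiE.
- by move=> x h; apply: QN.
Qed.

End measure_preserving.

(** * Fubini's theorem for real and complex integrals *)

Section fubini_Rintegral.
Context {d1 d2} {T1 : measurableType d1} {T2 : measurableType d2} {R : realType}.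
Variables (m1 : {sigma_finite_measure set T1 -> \bar R}).
Variables (m2 : {sigma_finite_measure set T2 -> \bar R}).

Lemma measurable_Rintegral_section (F : T1 * T2 -> R) : measurable_fun setT F ->
  measurable_fun setT (fun x => \int[m2]_y F (x, y)).
Proof.
move=> mF; have mEF : measurable_fun setT (EFin \o F) by exact/measurable_EFinP.
apply: (measurableT_comp (fine_measurable measurableT)).
rewrite (_ : (fun _ => _) = (fun x => \int[m2]_y ((EFin \o F)^\+ (x, y))%E) \-
    (fun x => \int[m2]_y ((EFin \o F)^\- (x, y))%E))%E.
  apply: emeasurable_funB; apply: measurable_fun_fubini_tonelli_F => //.
    exact: measurable_funepos.
  exact: measurable_funeneg.
apply/funext => x; rewrite integralE; congr (_ - _)%E; apply: eq_integral => y _; by rewrite ?funeposE ?funenegE.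
Qed.

(** The inner integral may be infinite on a null set. There [Rintegral] takes the value 0, so it is
    still dominated by [fubini_F] and equal to it almost everywhere. *)
Lemma Rintegral_fubini1 (F : T1 * T2 -> R) :
  (m1 \x m2)%E.-integrable setT (EFin \o F) ->
  m1.-integrable setT (EFin \o (fun x => \int[m2]_y F (x, y))) /\
  \int[m1]_x (\int[m2]_y F (x, y)) = \int[(m1 \x m2)%E]_z F z.
Proof.
move=> iF; have iF1 := integrable_fubini_F iF.
have mF : measurable_fun setT F by apply/measurable_EFinP; exact: measurable_int iF.
have mF1 := measurable_Rintegral_section mF.
split.
  apply: le_integrable iF1 => //; first exact/measurable_EFinP.
  move=> x _ /=; rewrite /fubini_F/= /Rintegral.
  by case: (integral _ _ _) => [r| |] //=; rewrite ?leey ?normr0//.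
rewrite [RHS]/Rintegral -(integral12_prod_meas1 iF) [LHS]/Rintegral; congr fine.
apply: ae_eq_integral => //; first exact/measurable_EFinP.
  exact: measurable_int iF1.
have := integrable_ae measurableT iF1; apply: filterS => x /= h _.
by rewrite /Rintegral fineK//; exact: h.
Qed.

Lemma cI_fubini1 (F : T1 * T2 -> R[i]) : cintble (m1 \x m2)%E F ->
  cintble m1 (fun x => cI m2 (fun y => F (x, y))) /\
  cI m1 (fun x => cI m2 (fun y => F (x, y))) = cI (m1 \x m2)%E F.
Proof.
move=> [iF1 iF2].
have [h1 e1] := Rintegral_fubini1 iF1; have [h2 e2] := Rintegral_fubini1 iF2.
by split => //; rewrite /cI /cintegral; congr Complex.
Qed.

(** A measure on a product is determined by its values on rectangles, where both sides are the same
    product of two numbers. *)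
Lemma mpres_swap : mpres (m1 \x m2)%E (m2 \x m1)%E (fun z => (z.2, z.1)).
Proof.
have ms : measurable_fun setT (fun z : T1 * T2 => (z.2, z.1)) by exact: measurable_swap.
split => // A mA.
apply/esym; apply: (product_measure_unique (m' := measure_function_pushforward__canonical__measure_function_Measure (m1 \x m2)%E ms)) => // {mA}.
move=> B C mB mC; rewrite /= /pushforward.
have -> : (fun z : T1 * T2 => (z.2, z.1)) @^-1` (B `*` C) = C `*` B.
  by apply/seteqP; split => z /= [].
by rewrite product_measure1E// muleC.
Qed.

End fubini_Rintegral.

Section fubini_swap.
Context {d1 d2} {T1 : measurableType d1} {T2 : measurableType d2} {R : realType}.
Variables (m1 : {sigma_finite_measure set T1 -> \bar R}).
Variables (m2 : {sigma_finite_measure set T2 -> \bar R}).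

Lemma cI_fubini2 (F : T1 * T2 -> R[i]) : cintble (m1 \x m2)%E F ->
  cintble m2 (fun y => cI m1 (fun x => F (x, y))) /\
  cI m2 (fun y => cI m1 (fun x => F (x, y))) = cI (m1 \x m2)%E F.
Proof.
move=> iF; have mF := cintble_meas iF; have sw := mpres_swap m2 m1.
have iF' := (mpres_cintble sw mF).2 iF.
by have [h e] := cI_fubini1 iF'; split => //; rewrite -(mpres_cI sw mF).
Qed.

End fubini_swap.


(** * Uniform probabilities on the interval and on the cube *)

Section cube_measure.
Context {R : realType}.
Local Notation mR := (measurableTypeR R).

Lemma measurable_unit_interval : measurable (unit_interval : set mR).
Proof. exact: measurable_itv. Qed.

Definition box n (A : 'I_n -> set mR) : set 'rV[mR]_n :=
  [set x | forall i, A i (x ord0 i)].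

Lemma measurable_box n (A : 'I_n -> set mR) : (forall i, measurable (A i)) ->
  measurable (box A).
Proof.
move=> mA.
have -> : box A = \big[setI/setT]_(i < n)
    ((fun x : 'rV[mR]_n => x ord0 i) @^-1` A i).
  rewrite -bigcap_seq; apply/seteqP; split => [x Bx i _|x Ax i]; first exact: Bx.
  by apply: (Ax i); rewrite /= mem_index_enum.
apply: bigsetI_measurable => i _; rewrite -[X in measurable X]setTI.
exact: measurable_row_coord.
Qed.

(** Boxes are stable under intersection and generate the coordinate sigma-algebra, so Dynkin's
    argument applies to finite measures. *)
Lemma row_measure_unique n (m1 m2 : {measure set 'rV[mR]_n -> \bar R}) :
  (m1 setT < +oo)%E ->
  (forall A, (forall i, measurable (A i)) -> m1 (box A) = m2 (box A)) ->
  forall X, measurable X -> m1 X = m2 X.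
Proof.
move=> m1oo m12 X mX.
pose G : set (set 'rV[mR]_n) := [set B | exists2 A, (forall i, measurable (A i)) & B = box A].
have GT : G setT by exists (fun=> setT) => //; apply/seteqP; split=> // x _ i.
apply: (measure_unique G (fun=> setT)) => //.
- apply/seteqP; split; last first.
    apply: smallest_sub; first exact: sigma_algebra_measurable.
    by move=> _ [A mA ->]; exact: measurable_box.
  apply: smallest_sub; first exact: smallest_sigma_algebra.
  move=> B; rewrite -bigcup_seq => -[i _ [A mA <-]]; apply: sub_sigma_algebra.
  exists (fun j => if j == i then A else setT) => [j|]; first by case: ifP.
  apply/seteqP; split => [x [_ Ax] j /=|x /= Ax]; first by case: eqP => [->|].
  by split => //; have := Ax i; rewrite eqxx.
- move=> _ _ [A mA ->] [B mB ->]; exists (fun i => A i `&` B i) => [i|].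
    exact: measurableI.
  by apply/seteqP; split => [x [Ax Bx] i|x AB]; [split|split => i; have [] := AB i].
- by rewrite bigcup_const.
- by move=> _ [A mA ->]; exact: m12.
Qed.

(** Kept as a measure on the whole line that is concentrated on (0,1), so that integrals run over
    [setT] and functions are total. [cubeP] follows the same pattern. *)
Definition uniform : set mR -> \bar R :=
  mrestr (@lebesgue_measure R) measurable_unit_interval.

HB.instance Definition _ := Measure.on uniform.

Let uniform_setT : uniform setT = 1%E.
Proof.
by rewrite /uniform /mrestr setTI /unit_interval lebesgue_measure_itv/= lte01 sube0.
Qed.

HB.instance Definition _ := Measure_isProbability.Build _ _ _ uniform uniform_setT.

Lemma measurable_cube n : measurable (@cube R n : set 'rV[mR]_n).
Proof.
exact: (@measurable_box n (fun=> unit_interval) (fun=> measurable_unit_interval)).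
Qed.

Definition cubeP n : set 'rV[mR]_n -> \bar R := mrestr (lebesgue_row n) (@measurable_cube n).

HB.instance Definition _ n := Measure.on (@cubeP n).

Lemma cubeP_box n (A : 'I_n -> set mR) : (forall i, measurable (A i)) ->
  cubeP (box A) = (\prod_(i < n) uniform (A i))%E.
Proof.
move=> mA; rewrite /cubeP /mrestr/=.
have -> : box A `&` @cube R n = box (fun i => A i `&` unit_interval).
  by apply/seteqP; split => [x [Ax Bx] i|x AB]; [split|split => i; have [] := AB i].
rewrite lebesgue_row_box// => i; apply: measurableI => //.
exact: measurable_unit_interval.
Qed.

Let cubeP_setT n : cubeP [set: 'rV[mR]_n] = 1%E.
Proof.
have -> : [set: 'rV[mR]_n] = box (fun=> setT) by apply/seteqP; split=> // x _ i.
by rewrite cubeP_box// big1// => i _; rewrite probability_setT.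
Qed.

HB.instance Definition _ n := Measure_isProbability.Build _ _ _ (@cubeP n) (@cubeP_setT n).

Definition Pn n : probability 'rV[mR]_n R := @cubeP n.

Definition Un : probability mR R := uniform.

Lemma Pn_box n (A : 'I_n -> set mR) : (forall i, measurable (A i)) ->
  Pn n (box A) = (\prod_(i < n) Un (A i))%E.
Proof. exact: cubeP_box. Qed.

Lemma integral_Pn n (f : 'rV[mR]_n -> \bar R) :
  (\int[Pn n]_x (f \_ (@cube R n)) x = \int[lebesgue_row n]_(x in @cube R n) f x)%E.
Proof.
rewrite -integral_mkcond; apply: eq_measure_integral => A mA AD.
by rewrite /Pn/= /cubeP /mrestr setIidl.
Qed.

Lemma integral_Un (f : mR -> \bar R) :
  (\int[Un]_x (f \_ unit_interval) x = \int[@lebesgue_measure R]_(x in unit_interval) f x)%E.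
Proof.
rewrite -integral_mkcond; apply: eq_measure_integral => A mA AD.
by rewrite /Un/= /uniform /mrestr setIidl.
Qed.

Lemma ae_Pn_cube n : {ae Pn n, forall x, @cube R n x}.
Proof.
exists (~` @cube R n); split.
- by apply: measurableC; exact: (@measurable_cube n).
- by rewrite /Pn/= /cubeP /mrestr setICl measure0.
- by [].
Qed.

Lemma ae_Un_unit : {ae Un, forall x, unit_interval x}.
Proof.
exists (~` unit_interval); split.
- by apply: measurableC; exact: measurable_unit_interval.
- by rewrite /Un/= /uniform /mrestr setICl measure0.
- by [].
Qed.

Lemma mpres_coord n (i : 'I_n) : mpres (Pn n) Un (fun x => x ord0 i).
Proof.
split; first exact: measurable_row_coord.
move=> A mA.
rewrite (_ : _ @^-1` _ = box (fun j => if j == i then A else setT)).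
  transitivity (\prod_(j < n) Un (if j == i then A else setT))%E.
    by apply: Pn_box => j; case: ifP.
  rewrite (bigD1 i)//= eqxx big1 ?mule1// => j /negbTE ->.
  exact: probability_setT.
apply/seteqP; split => [x Ax j /=|x /= Ax]; first by case: eqP => [->|].
by have := Ax i; rewrite eqxx.
Qed.

Lemma measurable_colsub m n (c : 'I_n -> 'I_m) :
  measurable_fun setT (fun x : 'rV[mR]_m => \row_i x ord0 (c i) : 'rV[mR]_n).
Proof.
apply: measurable_fun_row => i; under eq_fun do rewrite mxE.
exact: measurable_row_coord.
Qed.

(** Covers both permutations of the coordinates (m = n) and restrictions to a subset of them: a box
    pulls back to the box that leaves the coordinates outside the range of [c] free, each
    contributing a factor 1. *)
Lemma mpres_colsub m n (c : 'I_n -> 'I_m) : injective c ->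
  mpres (Pn m) (Pn n) (fun x => \row_i x ord0 (c i)).
Proof.
move=> cinj; split; first exact: measurable_colsub.
move=> A mA.
set f := fun x => _.
have mf : measurable_fun setT f by exact: measurable_colsub.
pose mf_mixin := isMeasurableFun.Build _ _ _ _ _ mf.
apply: (@row_measure_unique _ (measure_function_pushforward__canonical__measure_function_Measure (Pn m) mf)) => //.
  by rewrite /= /pushforward preimage_setT; apply: le_lt_trans (ltry 1); rewrite probability_le1.
move=> {mA}A mA; rewrite /= /pushforward.
pose B (k : 'I_m) : set mR := if [pick i | c i == k] is Some i then A i else setT.
have -> : f @^-1` box A = box B.
  apply/seteqP; split => x /=; rewrite /B => Ax.
    by move=> k; case: pickP => // i /eqP <-; have := Ax i; rewrite /f mxE.
  move=> i; rewrite /f mxE; have := Ax (c i).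
  by case: pickP => [j /eqP/cinj <-//|/(_ i)]; rewrite eqxx.
transitivity (\prod_(k < m) Un (B k))%E.
  by apply: Pn_box => k; rewrite /B; case: pickP.
transitivity (\prod_(i < n) Un (A i))%E; last exact/esym/Pn_box.
rewrite (bigID (fun k => k \in codom c))/= [X in (_ * X)%E]big1 ?mule1; last first.
  move=> k kc; rewrite /B; case: pickP => [i /eqP ck|_]; last exact: probability_setT.
  by rewrite -ck codom_f in kc.
rewrite (eq_bigl [in [set c i | i in 'I_n]%SET]); last first.
  by move=> k; apply/codomP/imsetP => [[i ->]|[i _ ->]]; exists i.
rewrite big_imset/=; last by move=> ? ? _ _; exact: cinj.
apply: eq_big => // i _; rewrite /B; case: pickP => [j /eqP/cinj ->//|/(_ i)].
by rewrite eqxx.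
Qed.

End cube_measure.

(** * Independence, exchange and splitting of coordinates *)

Section coordinates.
Context {R : realType}.
Local Notation mR := (measurableTypeR R).

Lemma mpres_comp {d1 d2 d3} {T1 : measurableType d1} {T2 : measurableType d2}
    {T3 : measurableType d3} (m1 : {measure set T1 -> \bar R})
    (m2 : {measure set T2 -> \bar R}) (m3 : {measure set T3 -> \bar R})
    (f : T1 -> T2) (g : T2 -> T3) :
  mpres m1 m2 f -> mpres m2 m3 g -> mpres m1 m3 (g \o f).
Proof.
move=> [mf f12] [mg g23]; split; first exact: measurableT_comp.
move=> A mA; rewrite comp_preimage f12 ?g23//.
by rewrite -[X in measurable X]setTI; exact: mg.
Qed.

Lemma mpres_fst {d1 d2} {T1 : measurableType d1} {T2 : measurableType d2}
    (m1 : {sigma_finite_measure set T1 -> \bar R}) (m2 : probability T2 R) :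
  mpres (m1 \x m2)%E m1 fst.
Proof.
split => // A mA; have -> : fst @^-1` A = A `*` [set: T2].
  by apply/seteqP; split => z //= [].
transitivity (m1 A * m2 setT)%E; first exact: product_measure1E.
by rewrite probability_setT mule1.
Qed.

Lemma mpres_snd {d1 d2} {T1 : measurableType d1} {T2 : measurableType d2}
    (m1 : probability T1 R) (m2 : {sigma_finite_measure set T2 -> \bar R}) :
  mpres (m1 \x m2)%E m2 snd.
Proof.
split => // A mA; have -> : snd @^-1` A = [set: T1] `*` A.
  by apply/seteqP; split => z //= [].
transitivity (m1 setT * m2 A)%E; first exact: product_measure1E.
by rewrite probability_setT mul1e.
Qed.

Definition row_uncons n (x : 'rV[mR]_n.+1) : mR * 'rV[mR]_n :=
  (x ord0 ord0, \row_i x ord0 (lift ord0 i)).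

Lemma row_consK n : cancel (@row_cons R n) (@row_uncons n).
Proof.
move=> [t u]; rewrite /row_uncons; congr pair; first by rewrite mxE unlift_none.
by apply/rowP => i; rewrite !mxE liftK.
Qed.

Lemma mpres_row_cons n : mpres (Un \x Pn n)%E (Pn n.+1) (@row_cons R n).
Proof.
have mc := @measurable_row_cons R n.
split => // A mA.
apply: (@row_measure_unique R _ (measure_function_pushforward__canonical__measure_function_Measure (Un \x Pn n)%E mc)) => //.
  rewrite /= /pushforward preimage_setT.
  by apply: le_lt_trans (ltry 1); exact: probability_le1.
move=> {mA}A mA; rewrite /= /pushforward.
have -> : @row_cons R n @^-1` box A = A ord0 `*` box (fun i => A (lift ord0 i)).
  apply/seteqP; split => p /=.
    move=> Ap; split=> [|i]; first by have := Ap ord0; rewrite mxE unlift_none.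
    by have := Ap (lift ord0 i); rewrite mxE liftK.
  by move=> -[A0 Al] i; rewrite mxE; case: unliftP => [j ->|->] //=.
rewrite product_measure1E//; last exact: measurable_box.
transitivity (\prod_(i < n.+1) Un (A i))%E; last exact/esym/Pn_box.
by rewrite big_ord_recl; congr (_ * _)%E; exact: Pn_box.
Qed.

Lemma mpres_row_uncons n : mpres (Pn n.+1) (Un \x Pn n)%E (@row_uncons n).
Proof.
have mu : measurable_fun setT (@row_uncons n).
  apply/measurable_fun_pairP; split; first exact: measurable_row_coord.
  exact: measurable_colsub.
split => // A mA.
have mA' : measurable (@row_uncons n @^-1` A) by rewrite -[X in measurable X]setTI; exact: mu.
rewrite -(mpres_row_cons n).2// -comp_preimage.
by congr ((Un \x Pn n)%E _); apply/seteqP; split => z /=; rewrite row_consK.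
Qed.

(** Regarded as a point of the (n+1)-cube, the pair (u, t) has its coordinates t and u_j exchanged.
    The map is thus a transposition conjugated by [row_cons]. *)
Lemma mpres_swap_coord n (j : 'I_n) : mpres (Pn n \x Un)%E (Pn n \x Un)%E
  (fun z => (set_coord z.1 j z.2 : 'rV[mR]_n, z.1 ord0 j)).
Proof.
pose c : 'I_n.+1 -> 'I_n.+1 := tperm ord0 (lift ord0 j).
have cinj : injective c by exact: perm_inj.
have h := mpres_comp (mpres_comp (mpres_comp (mpres_comp (mpres_swap (Pn n) Un) (mpres_row_cons n))
  (mpres_colsub cinj)) (mpres_row_uncons n)) (mpres_swap Un (Pn n)).
rewrite (_ : (fun z => _) = (fun z : mR * 'rV[mR]_n => (z.2, z.1)) \o (@row_uncons n) \o
   (fun x : 'rV[mR]_n.+1 => \row_i x ord0 (c i)) \o @row_cons R n \o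
   (fun z : 'rV[mR]_n * mR => (z.2, z.1))); first exact: h.
apply/funext => -[u t] /=; congr pair.
  apply/rowP => i; rewrite !mxE /c; case: tpermP => [//|/lift_inj ->|].
    by rewrite unlift_none eqxx.
  by move=> _ /eqP; rewrite (inj_eq (@lift_inj _ _)) => /negbTE ->; rewrite liftK.
by rewrite !mxE /c tpermL liftK.
Qed.

Lemma mpres_set_coord n (j : 'I_n) : mpres (Pn n \x Un)%E (Pn n)
  (fun z => set_coord z.1 j z.2 : 'rV[mR]_n).
Proof. exact: mpres_comp (mpres_swap_coord j) (mpres_fst _ _). Qed.

Lemma set_coordE n (u : 'rV[R]_n) j t i :
  set_coord u j t ord0 i = if i == j then t else u ord0 i.
Proof. by rewrite mxE. Qed.

Definition indep_coord n (X : Type) (j : 'I_n) (H : 'rV[R]_n -> X) :=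
  forall u t, H (set_coord u j t) = H u.

Lemma cmeas_coord n (j : 'I_n) (b : R -> R[i]) : @cmeas _ mR _ b ->
  cmeas (fun u : 'rV[mR]_n => b (u ord0 j)).
Proof. by move=> mb; exact: (mpres_cmeas (mpres_coord j) (f := b)). Qed.

Lemma cbounded_coord n (j : 'I_n) (b : R -> R[i]) : cbounded b ->
  cbounded (fun u : 'rV[mR]_n => b (u ord0 j)).
Proof. by case=> M bM; exists M => u; exact: bM. Qed.

Lemma Pn_lty n : (Pn n setT < +oo :> \bar R)%E.
Proof. by apply: le_lt_trans (ltry 1); exact: probability_le1. Qed.

Lemma Un_lty : (Un setT < +oo :> \bar R)%E.
Proof. by apply: le_lt_trans (ltry 1); exact: probability_le1. Qed.

(** Replacing u_j by an independent variable t does not change the integral; as [H] ignores that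
    coordinate, it leaves the inner integral over t. *)
Lemma cI_indep n (j : 'I_n) (H : 'rV[R]_n -> R[i]) (b : R -> R[i]) :
  cintble (Pn n) H -> indep_coord j H -> @cmeas _ mR _ b -> cbounded b ->
  cI (Pn n) (fun u => H u * b (u ord0 j)) = cI (Pn n) H * cI Un b.
Proof.
move=> iH Hj mb bb.
have mbj : cmeas (fun u : 'rV[mR]_n => b (u ord0 j)) by exact: cmeas_coord.
have mH := cintble_meas iH.
have iHb : cintble (Pn n) (fun u => H u * b (u ord0 j)).
  by apply: cintbleMb => //; exact: cbounded_coord.
have mHb := cintble_meas iHb.
rewrite -(mpres_cI (mpres_set_coord j) mHb).
have := iHb; rewrite -(mpres_cintble (mpres_set_coord j) mHb) => iz.
rewrite -(cI_fubini1 iz).2/=.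
under eq_cI => u.
  under eq_cI => t do rewrite Hj mxE eqxx.
  rewrite cIZ; last by apply: cintble_bounded => //; exact: Un_lty.
  over.
under eq_cI => u do rewrite mulrC.
by rewrite cIZ// mulrC.
Qed.

Lemma cI_indep_prod n (r : seq 'I_n) (H : 'rV[R]_n -> R[i]) (b : 'I_n -> R -> R[i]) :
  uniq r -> cintble (Pn n) H -> (forall j, j \in r -> indep_coord j H) ->
  (forall j, @cmeas _ mR _ (b j)) -> (forall j, cbounded (b j)) ->
  cI (Pn n) (fun u => H u * \prod_(j <- r) b j (u ord0 j)) =
  cI (Pn n) H * \prod_(j <- r) cI Un (b j).
Proof.
move=> + + + mb bb; elim: r H => [|j r IH] H /=.
  by move=> _ iH _; under eq_cI do rewrite big_nil mulr1; rewrite big_nil mulr1.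
move=> /andP[jr ur] iH Hr.
have mbj : cmeas (fun u : 'rV[mR]_n => b j (u ord0 j)) by exact: cmeas_coord.
have bbj : cbounded (fun u : 'rV[mR]_n => b j (u ord0 j)) by exact: cbounded_coord.
under eq_cI do rewrite big_cons mulrA.
rewrite IH//; first last.
- move=> i ir u t; rewrite Hr ?inE ?ir ?orbT// set_coordE; case: eqP => // ji.
  by rewrite ji ir in jr.
- exact: cintbleMb.
by rewrite big_cons mulrA cI_indep//; apply: Hr; rewrite inE eqxx.
Qed.

Lemma cI_tensor n (b : 'I_n -> R -> R[i]) :
  (forall j, @cmeas _ mR _ (b j)) -> (forall j, cbounded (b j)) ->
  cI (Pn n) (fun u => \prod_j b j (u ord0 j)) = \prod_j cI Un (b j).
Proof.
move=> mb bb; under eq_cI do rewrite -[\prod_j _]mul1r.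
rewrite (@cI_indep_prod _ _ (fun=> 1))//.
- by rewrite (cI_cst (m := Pn n)) ?mul1r//; exact: probability_setT.
- exact: index_enum_uniq.
- apply: cintble_bounded; [|exact: cmeas_cst|exact: cbounded_cst].
  exact: Pn_lty.
Qed.

(** The argument [z] keeps all [s] coordinates, those in [v] being overwritten by [y]. The
    complement of [v] then needs no enumeration of its own. *)
Definition merge s (v : {set 'I_s}) (y : 'rV[R]_#|v|) (z : 'rV[R]_s) : 'rV[R]_s :=
  \row_j oapp (y ord0) (z ord0 j) [pick i | enum_val i == j].

Definition res s (v : {set 'I_s}) (u : 'rV[R]_s) : 'rV[R]_#|v| :=
  \row_i u ord0 (enum_val i).

Lemma merge_in s (v : {set 'I_s}) y z (i : 'I_#|v|) :
  merge y z ord0 (enum_val i) = y ord0 i.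
Proof.
rewrite mxE; case: pickP => [k /eqP/enum_val_inj -> //|/(_ i)]; by rewrite eqxx.
Qed.

Lemma merge_out s (v : {set 'I_s}) (y : 'rV_#|v|) z j : j \notin v ->
  merge y z ord0 j = z ord0 j.
Proof.
move=> jv; rewrite mxE; case: pickP => // k /eqP kj.
by move: jv; rewrite -kj enum_valP.
Qed.

Lemma in_setP_enum s (v : {set 'I_s}) j : j \in v -> exists i : 'I_#|v|, j = enum_val i.
Proof. by move=> jv; exists (enum_rank_in jv j); rewrite enum_rankK_in. Qed.

Lemma res_merge s (v : {set 'I_s}) y z : res v (merge y z) = y.
Proof. by apply/rowP => i; rewrite !mxE -[RHS](merge_in y z) mxE. Qed.

Lemma mpres_res s (v : {set 'I_s}) : mpres (Pn s) (Pn #|v|) (res v).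
Proof. exact: mpres_colsub (@enum_val_inj _ _). Qed.

(** The overwritten coordinates of the second argument are integrated out with total mass 1, which
    is the factor 1 obtained for j in [v]. *)
Lemma mpres_merge s (v : {set 'I_s}) :
  mpres (Pn #|v| \x Pn s)%E (Pn s) (fun z => merge z.1 z.2 : 'rV[mR]_s).
Proof.
set f := fun z : 'rV[mR]_#|v| * 'rV[mR]_s => (merge z.1 z.2 : 'rV[mR]_s).
have mf : measurable_fun setT f.
  apply: measurable_fun_row => j.
  have [jv|jv] := boolP (j \in v).
    have [i ->] := in_setP_enum jv; rewrite (_ : (fun z => _) = (fun z : 'rV[mR]_#|v| * 'rV[mR]_s => z.1 ord0 i)).
      exact: measurableT_comp (measurable_row_coord i) measurable_fst.
    by apply/funext => z; exact: merge_in.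
  rewrite (_ : (fun z => _) = (fun z : 'rV[mR]_#|v| * 'rV[mR]_s => z.2 ord0 j)).
    exact: measurableT_comp (measurable_row_coord j) measurable_snd.
  by apply/funext => z; exact: merge_out.
split => // A mA.
apply: (@row_measure_unique R _ (measure_function_pushforward__canonical__measure_function_Measure (Pn #|v| \x Pn s)%E mf)) => //.
  rewrite /= /pushforward preimage_setT.
  by apply: le_lt_trans (ltry 1); exact: probability_le1.
move=> {mA}A mA; rewrite /= /pushforward.
have -> : f @^-1` box A = box (fun i => A (enum_val i)) `*` box (fun j => if j \in v then setT else A j).
  apply/seteqP; split => p /=.
    move=> Ap; split=> i.
      by have := Ap (enum_val i); rewrite /f merge_in.
    by case: ifPn => // iv; have := Ap i; rewrite /f merge_out.
  move=> -[A1 A2] j; have [jv|jv] := boolP (j \in v).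
    by have [i ->] := in_setP_enum jv; rewrite /f merge_in; exact: A1.
  by rewrite /f merge_out//; have := A2 j; rewrite (negbTE jv).
rewrite product_measure1E; first last.
- by apply: measurable_box => j; case: ifP.
- exact: measurable_box.
transitivity ((\prod_(i < #|v|) Un (A (enum_val i))) * (\prod_(j < s) Un (if j \in v then setT else A j)))%E.
  by congr (_ * _)%E; apply: Pn_box => // j; case: ifP.
transitivity (\prod_(j < s) Un (A j))%E; last exact/esym/Pn_box.
rewrite [RHS](bigID (fun j => j \in v))/=; congr (_ * _)%E.
  by rewrite [RHS]big_enum_val.
rewrite (bigID (fun j => j \in v))/= big1 ?mul1e.
  by apply: eq_bigr => j /negbTE ->.
by move=> j jv; rewrite jv; exact: probability_setT.
Qed.

End coordinates.

(** * Test functions and the fundamental lemma *)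

Section smooth_real.
Context {R : realType}.
Implicit Types f g : R -> R.

(** The derivative is carried as a witness rather than as an iterated [derive1], so that sums,
    products and affine substitutions are handled by plain induction on [n]. *)
Fixpoint diffn (n : nat) f : Prop :=
  if n is n'.+1 then exists2 g, (forall x, is_derive x (1 : R) f (g x)) & diffn n' g else True.

Definition smooth1 f := forall n, diffn n f.

Lemma is_derive_ext f g (x d d' : R) : is_derive x (1 : R) f d -> f =1 g -> d = d' ->
  is_derive x (1 : R) g d'.
Proof. by move=> + /funext <- <-. Qed.

Lemma diffnS n f : diffn n.+1 f -> diffn n f.
Proof.
by elim: n f => [//|n IH] f [g dg hg]; exists g => //; exact: IH.
Qed.

Lemma diffn_ext n f g : f =1 g -> diffn n f -> diffn n g.
Proof. by move=> /funext ->. Qed.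

Lemma diffn_cst n (c : R) : diffn n (fun=> c).
Proof.
elim: n c => [//|n IH] c; exists (fun=> 0) => // x; exact: is_derive_cst.
Qed.

Lemma diffnD n f g : diffn n f -> diffn n g -> diffn n (fun x => f x + g x).
Proof.
elim: n f g => [//|n IH] f g [f' df hf] [g' dg hg].
exists (fun x => f' x + g' x) => [x|]; last exact: IH.
exact: is_deriveD.
Qed.

Lemma diffnM n f g : diffn n f -> diffn n g -> diffn n (fun x => f x * g x).
Proof.
elim: n f g => [//|n IH] f g hf hg.
have hf' := diffnS hf; have hg' := diffnS hg.
case: hf hg => [f' df hf] [g' dg hg].
exists (fun x => f x * g' x + g x * f' x) => [x|]; first exact: is_deriveM.
by apply: diffnD; apply: IH.
Qed.

Lemma diffnX n f m : diffn n f -> diffn n (fun x => f x ^+ m).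
Proof.
move=> hf; elim: m => [|m IH]; first by apply: diffn_ext (diffn_cst n 1) => x; rewrite expr0.
by apply: diffn_ext (diffnM hf IH) => x; rewrite exprS.
Qed.

Lemma is_derive_affine f (c a x d : R) : is_derive (c * x + a) (1 : R) f d ->
  is_derive x (1 : R) (fun t => f (c * t + a)) (c * d).
Proof.
move=> fd; have h : is_derive x (1 : R) (fun t => c * t + a) c.
  apply: (is_derive_ext (f := (c *: (id : R -> R)) + cst a) (is_deriveD (is_deriveZ c (is_derive_id x 1)) (is_derive_cst a x 1))) => //.
  by rewrite addr0 /GRing.scale/= mulr1.
apply: (is_derive_ext (@is_derive1_comp R f (fun t => c * t + a) x d c fd h)) => //.
by rewrite mulrC.
Qed.

Lemma diffn_affine n f (c a : R) : diffn n f -> diffn n (fun t => f (c * t + a)).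
Proof.
elim: n f => [//|n IH] f [g dg hg].
exists (fun t => c * g (c * t + a)) => [x|]; first exact: is_derive_affine.
by apply: diffnM; [exact: diffn_cst|exact: IH].
Qed.

Lemma smooth1_derive f : smooth1 f ->
  smooth1 (derive1 f) /\ forall x, is_derive x (1 : R) f (derive1 f x).
Proof.
move=> sf; have h x : is_derive x (1 : R) f (derive1 f x).
  have [g dg _] := sf 1%N; rewrite derive1E.
  by have [d1 d2] := dg x; exact: derivableP.
split => // n; have [g dg hg] := sf n.+1.
rewrite (_ : derive1 f = g)//; apply/funext => x; rewrite derive1E.
by have [_ ->] := dg x.
Qed.

Lemma smooth1_continuous f : smooth1 f -> continuous f.
Proof.
move=> /smooth1_derive[_ h] x; have [d1 _] := h x.
by apply: differentiable_continuous; exact/derivable1_diffP.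
Qed.

(** [flat 0] is the classical smooth function exp(-1/t) extended by 0. The factor t^-k makes the
    family stable: each derivative is a combination of two members. *)
Definition flat k (t : R) : R := if 0 < t then t ^- k * expR (- t^-1) else 0.

Lemma flat_ge0 k t : 0 <= flat k t.
Proof.
rewrite /flat; case: ifPn => // t0.
by rewrite mulr_ge0 ?expR_ge0// invr_ge0 exprn_ge0// ltW.
Qed.

(** A single term of the exponential series, (1/t)^(k+2) / (k+2)!, already bounds exp(1/t) from
    below. The quadratic decay is what gives derivative 0 at the origin. *)
Lemma flat_le k t : flat k t <= (k.+2)`!%:R * t ^+ 2.
Proof.
rewrite /flat; case: ifPn => [t0|_]; last by rewrite mulr_ge0// sqr_ge0.
have t'0 : 0 < t^-1 by rewrite invr_gt0.
have h := expR_ge1Dxn k.+1 (ltW t'0).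
have {h}h : t^-1 ^+ k.+2 / (k.+2)`!%:R <= expR t^-1 by apply: le_trans h; rewrite lerDr.
have f0 : (0 : R) < (k.+2)`!%:R by rewrite ltr0n fact_gt0.
rewrite expRN ler_pdivrMr ?expR_gt0//.
rewrite -ler_pdivrMl ?mulr_gt0 ?exprn_gt0//.
apply: le_trans h; rewrite le_eqVlt; apply/orP; left; apply/eqP.
rewrite exprVn !exprS expr0; move: (k.+2)`!%:R f0 => c f0; field.
by rewrite expf_neq0 ?gt_eqF.
Qed.

Lemma is_derive_flat k t :
  is_derive t (1 : R) (flat k) (flat k.+2 t - k%:R * flat k.+1 t).
Proof.
have [t0|t0|t0] := ltgtP t 0.
- rewrite {2 3}/flat !ltNge (ltW t0)/= mulr0 subrr.
  apply: (near_eq_is_derive (f := fun=> 0 : R)).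
  near=> x; rewrite /flat ltNge; have -> // : x <= 0.
  by apply: ltW; near: x; exact: lt_nbhsl.
- have d1 : is_derive t (1 : R) (fun x : R => x ^+ k) (k%:R * t ^+ k.-1).
    apply: (is_derive_ext (is_deriveX k (is_derive_id t (1 : R)))) => [x|].
      by rewrite !fctE.
    by rewrite /GRing.scale/= mulr1.
  have tk : t ^+ k != 0 by rewrite expf_neq0// gt_eqF.
  have d2 := is_deriveV (f := fun x : R => x ^+ k) tk d1.
  have d3 : is_derive t (1 : R) (fun x : R => x^-1) (- t ^- 2).
    apply: (is_derive_ext (is_deriveV (f := id) (lt0r_neq0 t0) (is_derive_id t (1 : R)))) => //.
    by rewrite /GRing.scale/= mulr1.
  have d4 := is_deriveN d3.
  have d5 := @is_derive1_comp R expR (fun x : R => - x^-1) t _ _ (is_derive_expR _) d4.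
  have d6 := is_deriveM d2 d5.
  have d7 : is_derive t (1 : R) (fun x : R => x ^- k * expR (- x^-1)) (flat k.+2 t - k%:R * flat k.+1 t).
    apply: (is_derive_ext d6) => //.
    rewrite /flat t0 /GRing.scale/= /GRing.scale/=; case: (k) => [|m] /=.
      by rewrite !mul0r mulr0 mulr0 addr0 subr0 expr0 invr1 mul1r opprK mulrC.
    rewrite !exprS; field.
    by rewrite expf_neq0 gt_eqF.
  apply: near_eq_is_derive d7.
  near=> x; rewrite /flat; have -> // : 0 < x.
  by near: x; exact: lt_nbhsr.
(* At the origin the difference quotient is at most (k+2)! |h|, by the quadratic bound. *)
- rewrite {}t0 {2 3}/flat ltxx mulr0 subrr.
  have c : (fun h : R => h^-1 *: (flat k (h *: 1 + 0) - flat k 0)) @ 0^' --> (0 : R).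
    apply/cvgr0Pnorm_le => e e0.
    near=> h; rewrite {2}/flat ltxx subr0 addr0 /GRing.scale/= mulr1.
    rewrite normrM (ger0_norm (flat_ge0 _ _)) normfV.
    have h0 : h != 0 by near: h; exact: nbhs_dnbhs_neq.
    rewrite ler_pdivrMl ?normr_gt0//.
    apply: le_trans (flat_le _ _) _; rewrite -[h ^+ 2]real_normK ?num_real// expr2.
    rewrite mulrA mulrC ler_wpM2l//.
    rewrite -ler_pdivlMl ?ltr0n ?fact_gt0//.
    near: h; apply: nbhs_dnbhs; rewrite /=.
    exists ((k.+2)`!%:R^-1 * e) => /= [|x]; first by rewrite mulr_gt0// invr_gt0 ltr0n fact_gt0.
    by rewrite /ball_/= sub0r normrN => /ltW.
  by apply: DeriveDef; [exact: cvgP c|exact: cvg_lim c].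
Unshelve. all: by end_near. Qed.

Lemma smooth1_flat k : smooth1 (flat k).
Proof.
move=> n; elim: n k => [//|n IH] k.
exists (fun t => flat k.+2 t + (- k%:R) * flat k.+1 t) => [x|].
  by rewrite mulNr; exact: is_derive_flat.
by apply: diffnD => //; apply: diffnM => //; exact: diffn_cst.
Qed.

Lemma flat0_lt1 t : flat 0 t < 1.
Proof.
rewrite /flat; case: ifPn => // t0.
by rewrite expr0 invr1 mul1r expR_lt1 oppr_lt0 invr_gt0.
Qed.

Lemma flat0_gt0 t : 0 < t -> 0 < flat 0 t.
Proof. by move=> t0; rewrite /flat t0 expr0 invr1 mul1r expR_gt0. Qed.

Lemma flat_le0 k t : t <= 0 -> flat k t = 0.
Proof. by move=> t0; rewrite /flat ltNge t0. Qed.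

(* Smooth approximations of the indicator of the interval (x,y): with b > 0 a
   bump supported in [x,y], 1 - (1 - b)^m increases to 1 where b > 0. *)
Definition plateau (x y : R) (m : nat) (t : R) : R :=
  1 - (1 - flat 0 (t - x) * flat 0 (y - t)) ^+ m.

Lemma smooth1_plateau x y m : smooth1 (plateau x y m).
Proof.
move=> n; apply: diffnD; first exact: diffn_cst.
have h : diffn n (fun t : R => (1 - flat 0 (t - x) * flat 0 (y - t)) ^+ m).
  apply: diffnX; apply: diffnD; first exact: diffn_cst.
  have h1 : diffn n (fun t => flat 0 (t - x)).
    by apply: diffn_ext (diffn_affine 1 (- x) (smooth1_flat 0 n)) => t; rewrite mul1r.
  have h2 : diffn n (fun t => flat 0 (y - t)).
    by apply: diffn_ext (diffn_affine (-1) y (smooth1_flat 0 n)) => t; rewrite mulN1r addrC.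
  by apply: diffn_ext (diffnM (diffn_cst n (-1)) (diffnM h1 h2)) => t; rewrite mulN1r.
by apply: diffn_ext (diffnM (diffn_cst n (-1)) h) => t; rewrite mulN1r.
Qed.

Lemma plateau_itv x y t : 0 <= 1 - flat 0 (t - x) * flat 0 (y - t) <= 1.
Proof.
rewrite gerBl mulr_ge0 ?flat_ge0// andbT subr_ge0.
by rewrite mulr_ile1 ?flat_ge0// ltW ?flat0_lt1.
Qed.

Lemma plateau_ge0 x y m t : 0 <= plateau x y m t.
Proof. by have /andP[h1 h2] := plateau_itv x y t; rewrite subr_ge0 exprn_ile1. Qed.

Lemma plateau_le1 x y m t : plateau x y m t <= 1.
Proof. by have /andP[h1 h2] := plateau_itv x y t; rewrite gerBl exprn_ge0. Qed.

Lemma plateau_out x y m t : ~~ (x < t < y) -> plateau x y m t = 0.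
Proof.
rewrite negb_and -!leNgt => h; rewrite /plateau.
suff -> : flat 0 (t - x) * flat 0 (y - t) = 0 by rewrite subr0 expr1n subrr.
case/orP: h => h; first by rewrite flat_le0 ?mul0r// subr_le0.
by rewrite mulrC flat_le0 ?mul0r// subr_le0.
Qed.

Lemma plateau_cvg x y t : x < t < y -> plateau x y m t @[m --> \oo] --> (1 : R).
Proof.
move=> /andP[xt ty]; rewrite -[X in _ --> X]subr0; apply: cvgB; first exact: cvg_cst.
apply: cvg_expr; have /andP[h1 h2] := plateau_itv x y t.
by rewrite ger0_norm// gtrBl mulr_gt0// flat0_gt0// subr_gt0.
Qed.

(** One-dimensional test functions, with an explicit interval [e, 1 - e] in place of an arbitrary
    compact subset of (0,1). *)
Definition test1 f := smooth1 f /\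
  exists2 e : R, 0 < e & forall t, ~~ (e <= t <= 1 - e) -> f t = 0.

Lemma test1_plateau x y m : 0 < x -> y < 1 -> test1 (plateau x y m).
Proof.
move=> x0 y1; split; first exact: smooth1_plateau.
exists (Num.min x (1 - y)); first by rewrite lt_min x0 subr_gt0.
move=> t ht; apply: plateau_out; apply: contra ht => /andP[xt ty].
have m1 : Num.min x (1 - y) <= x by rewrite ge_min lexx.
have m2 : Num.min x (1 - y) <= 1 - y by rewrite ge_min lexx orbT.
by apply/andP; split; lra.
Qed.

Lemma test1_derive f : test1 f -> test1 (derive1 f).
Proof.
move=> [sf [e e0 fe]]; split; first exact: (smooth1_derive sf).1.
(* A point outside [e/2, 1 - e/2] has a whole neighbourhood outside [e, 1 - e], where [f] vanishes
   identically. *)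
exists (e / 2); first by rewrite divr_gt0.
move=> t ht; have [_ df] := smooth1_derive sf.
rewrite derive1E (near_eq_derive (g := fun=> 0 : R)) ?derive_cst//.
move: ht; rewrite negb_and -!ltNge => /orP[h|h]; near=> x; apply: fe; rewrite negb_and -!ltNge; apply/orP; [left|right].
  by near: x; apply: lt_nbhsl; lra.
by near: x; apply: lt_nbhsr; lra.
Unshelve. all: by end_near. Qed.

Lemma test1_bounded f : test1 f -> exists M, forall t, `|f t| <= M.
Proof.
move=> [sf [e e0 fe]].
have [|e1] := leP e (1 - e); last first.
  by exists 0 => t; rewrite fe ?normr0//; apply/negP => /andP[/le_trans h /h]; rewrite leNgt e1.
move=> e1; have cf := smooth1_continuous sf.
have cg : {within `[e, 1 - e], continuous (fun t => `|f t|)}.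
  by apply: continuous_subspaceT => x; apply: continuous_comp; [exact: cf|exact: norm_continuous].
have [c _ hc] := EVT_max e1 cg.
exists `|f c| => t; have [ht|/fe ->] := boolP (e <= t <= 1 - e); first by apply: hc; rewrite in_itv.
by rewrite normr0.
Qed.

End smooth_real.

(** * Measures with a density *)

Section density_measure.
Context {d} {T : measurableType d} {R : realType}.
Local Notation mR := (measurableTypeR R).
Variables (m : {sigma_finite_measure set T -> \bar R}) (g : T -> R).
Hypotheses (mg : measurable_fun setT g) (g0 : forall x, 0 <= g x).

Definition subgraph : set (T * mR) := [set z | 0 <= z.2 < g z.1].

Lemma measurable_subgraph : measurable subgraph.
Proof.
have -> : subgraph = ((fun z : T * mR => 0 <= z.2 :> R) @^-1` [set true]) `&`
    ((fun z : T * mR => (z.2 : R) < g z.1) @^-1` [set true]).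
  by apply/seteqP; split => z /=; rewrite /subgraph/=; [move/andP|move=> h; exact/andP].
apply: measurableI; rewrite -[X in measurable X]setTI.
  have h : measurable_fun setT (fun z : T * mR => 0 <= z.2 :> R).
    by apply: measurable_fun_ler => //; exact: measurable_snd.
  exact: h.
have h : measurable_fun setT (fun z : T * mR => (z.2 : R) < g z.1).
  apply: measurable_fun_ltr; first exact: measurable_snd.
  exact: measurableT_comp mg measurable_fst.
exact: h.
Qed.

(* The measure with density g is the projection of the area under its graph. *)
Definition density : {measure set T -> \bar R} :=
  measure_function_pushforward__canonical__measure_function_Measure
    (mrestr (m \x @lebesgue_measure R)%E measurable_subgraph)
    (@measurable_fst _ _ T mR).

(** By Tonelli, the vertical section of the area over x is the interval [0, g x[, of length
    [g x]. *)
Lemma integral_density (f : T -> \bar R) : measurable_fun setT f ->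
  (forall x, 0 <= f x)%E -> (\int[density]_x f x = \int[m]_x (f x * (g x)%:E))%E.
Proof.
move=> mf f0; rewrite ge0_integral_pushforward//.
have mff : measurable_fun setT (f \o @fst T mR) by exact: measurableT_comp.
have mD := measurable_subgraph.
rewrite preimage_setT (ge0_negligible_integral (N := ~` subgraph))//; first last.
- suff : mrestr (m \x @lebesgue_measure R)%E mD (~` subgraph) = 0%E by [].
  by rewrite /mrestr setICl measure0.
- by move=> x _ /=; exact: f0.
- exact: measurableC.
rewrite setTD setCK.
transitivity (\int[(m \x @lebesgue_measure R)%E]_(z in subgraph) (f \o fst) z)%E.
  by apply: eq_measure_integral => A mA AD; rewrite /= /mrestr setIidl.
rewrite integral_mkcond fubini_tonelli1//; first last.
- by move=> z; rewrite patchE; case: ifP => // _; exact: f0.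
- by apply/(measurable_restrictT _ mD); exact: measurable_funTS.
apply: eq_integral => x _; rewrite /fubini_F/=.
transitivity (\int[@lebesgue_measure R]_(y in `[0%R, g x[) f x)%E.
  rewrite [RHS]integral_mkcond; apply: eq_integral => y _; rewrite !patchE.
  by rewrite /subgraph !mem_setE/= in_itv/=.
rewrite integral_cst//= lebesgue_measure_itv/= lte_fin.
by case: ltP => gx; rewrite ?oppr0 ?sube0 ?adde0//; rewrite (_ : g x = 0) ?mule0//; apply/eqP; rewrite eq_le gx g0.
Qed.

Lemma densityE (A : set T) : measurable A ->
  density A = (\int[m]_x ((\1_A x * g x)%:E))%E.
Proof.
move=> mA; have : (\int[density]_x (\1_A x)%:E = density A)%E.
  by rewrite integral_indic// setIT.
move=> <-; rewrite integral_density//; last by apply/measurable_EFinP; exact: measurable_indic.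
Qed.

End density_measure.

Section ray_uniqueness.
Context {R : realType}.
Local Notation mR := (measurableTypeR R).

(** Rays to the right are stable under intersection, generate the Borel sets, and exhaust the line
    through the rays starting at -n. *)
Lemma ray_measure_unique (m1 m2 : {measure set mR -> \bar R}) :
  (m1 setT < +oo)%E ->
  (forall x : R, m1 `]x, +oo[%classic = m2 `]x, +oo[%classic) ->
  forall A, measurable A -> m1 A = m2 A.
Proof.
move=> m1oo m12 A mA.
apply: (@measure_unique _ R mR (@RGenOInfty.G R) (fun n => `](- n%:R : R), +oo[%classic)) => //.
- exact: RGenOInfty.measurableE.
- move=> _ _ [x ->] [y ->]; exists (Num.max x y); apply/seteqP; split => z /=.
    by rewrite !in_itv/= !andbT gt_max => -[-> ->].
  by rewrite !in_itv/= !andbT gt_max => /andP.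
- by move=> n; exists (- n%:R).
- apply/seteqP; split => // x _.
  exists (Num.trunc `|x|).+1 => //=; rewrite in_itv/= andbT ltrNl.
  apply: le_lt_trans (ler_norm _) _; rewrite normrN.
  by rewrite truncnS_gt.
- by move=> _ [x ->].
- move=> n; apply: le_lt_trans m1oo; apply: le_measure => //; rewrite inE//.
Qed.

End ray_uniqueness.

(** * The fundamental lemma of the calculus of variations along one coordinate *)

Section fundamental_lemma.
Context {d} {T : measurableType d} {R : realType}.
Local Notation mR := (measurableTypeR R).

Lemma cvg_Rintegral_mul (m : {measure set T -> \bar R}) (H : T -> R)
    (g_ : nat -> T -> R) (g : T -> R) :
  m.-integrable setT (EFin \o H) -> (forall n, measurable_fun setT (g_ n)) ->
  measurable_fun setT g -> (forall n x, `|g_ n x| <= 1) ->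
  {ae m, forall x, g_ n x @[n --> \oo] --> g x} ->
  \int[m]_x (H x * g_ n x) @[n --> \oo] --> \int[m]_x (H x * g x).
Proof.
move=> iH mg_ mg bg cg.
have mH : measurable_fun setT H by exact/measurable_EFinP/(measurable_int m).
have [||||i1 _ c] := @dominated_convergence _ T R m setT measurableT
  (fun n x => (H x * g_ n x)%:E) (fun x => (H x * g x)%:E) (fun x => (`|H x|)%:E) _ _ _ (integrable_norm iH).
- by move=> n; apply/measurable_EFinP; exact: measurable_funM.
- by apply/measurable_EFinP; exact: measurable_funM.
- apply: filterS cg => x h _; apply: cvg_EFin; first exact: nearW.
  by apply: cvgM => //; exact: cvg_cst.
- by apply: aeW => x n _; rewrite /= lee_fin normrM; exact: ler_piMr.
apply: fine_cvg.
rewrite -[X in _ --> X]/(EFin _) /Rintegral fineK; last exact: integrable_fin_num.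
exact: c.
Qed.

Variables (m : {sigma_finite_measure set T -> \bar R}) (H : T -> R) (tau : T -> R).
Hypotheses (iH : m.-integrable setT (EFin \o H)) (mtau : measurable_fun setT tau)
  (tau01 : {ae m, forall x, unit_interval (tau x)})
  (H0 : forall chi, test1 chi -> \int[m]_x (H x * chi (tau x)) = 0).

Let mH : measurable_fun setT H.
Proof. exact/measurable_EFinP/(measurable_int m). Qed.

(** The plateaus are test functions, bounded by 1 and converging pointwise to the indicator;
    dominated convergence with majorant |H| applies. *)
Let H_itv (x y : R) : 0 < x -> y < 1 -> \int[m]_t (H t * \1_(`]x, y[%classic) (tau t)) = 0.
Proof.
move=> x0 y1.
have := @cvg_Rintegral_mul m H (fun n t => plateau x y n (tau t)) (fun t => \1_(`]x, y[%classic) (tau t)) iH.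
under eq_cvg => n do rewrite (H0 (test1_plateau n x0 y1)).
move=> h; apply/esym/(cvg_unique _ (cvg_cst (0 : R) : _ @ \oo --> _)) => //; apply: h.
- move=> n; apply: (@measurableT_comp _ _ _ _ _ _ (plateau x y n)) => //.
  by apply: continuous_measurable_fun; apply: smooth1_continuous; exact: smooth1_plateau.
- by apply: (@measurableT_comp _ _ _ _ _ _ (\1_(`]x, y[%classic) : R -> R)) => //; exact: measurable_indic.
- by move=> n t; rewrite ger0_norm ?plateau_ge0// plateau_le1.
- apply: aeW => t; rewrite indicE mem_setE in_itv/=.
  have [h1|h1] := boolP (x < tau t < y); first exact: plateau_cvg.
  by under eq_cvg do rewrite plateau_out//; exact: cvg_cst.
Qed.

Let H_ray (x : R) : \int[m]_t (H t * \1_(`]x, +oo[%classic) (tau t)) = 0.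
Proof.
(* Intervals strictly inside (0,1) whose indicators converge to that of the ray at every point of
   (0,1), that is, almost everywhere along [tau]. *)
pose a n : R := Num.max x n.+1%:R^-1; pose b n : R := 1 - n.+1%:R^-1.
have := @cvg_Rintegral_mul m H (fun n t => \1_(`]a n, b n[%classic) (tau t)) (fun t => \1_(`]x, +oo[%classic) (tau t)) iH.
have a0 n : 0 < a n by rewrite lt_max invr_gt0 ltr0n orbT.
have b1 n : b n < 1 by rewrite ltrBlDr ltrDl invr_gt0 ltr0n.
under eq_cvg => n do rewrite (H_itv (a0 n) (b1 n)).
move=> h; apply/esym/(cvg_unique _ (cvg_cst (0 : R) : _ @ \oo --> _)) => //; apply: h.
- move=> n; apply: (@measurableT_comp _ _ _ _ _ _ (\1_(`]a n, b n[%classic) : R -> R)) => //; exact: measurable_indic.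
- by apply: (@measurableT_comp _ _ _ _ _ _ (\1_(`]x, +oo[%classic) : R -> R)) => //; exact: measurable_indic.
- by move=> n t; rewrite indicE; case: (_ \in _); rewrite ?normr1 ?normr0.
- apply: filterS tau01 => t; rewrite /unit_interval/= in_itv/= => /andP[t0 t1].
  have inv0 : (n.+1%:R^-1 : R) @[n --> \oo] --> (0 : R).
    exact: cvg_harmonic.
  rewrite indicE mem_setE in_itv/= andbT.
  apply: cvg_near_cst; near=> n; rewrite indicE mem_setE in_itv/=.
  congr ((_ : bool)%:R); rewrite /a /b gt_max -andbA; apply: andb_idr => xt.
  apply/andP; split.
    near: n; exact: (cvgr_lt _ inv0).
  rewrite ltrBrDr -ltrBrDl; near: n; apply: (cvgr_lt _ inv0).
  by rewrite subr_gt0.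
Unshelve. all: by end_near. Qed.

Let Hp x := Num.max (H x) 0.
Let Hn x := Num.max (- H x) 0.
Let mHp : measurable_fun setT Hp. Proof. exact: measurable_maxr. Qed.
Let mHn : measurable_fun setT Hn.
Proof. by apply: measurable_maxr => //; exact: measurable_funN. Qed.
Let Hp0 x : 0 <= Hp x. Proof. by rewrite le_max lexx orbT. Qed.
Let Hn0 x : 0 <= Hn x. Proof. by rewrite le_max lexx orbT. Qed.
Let HE x : H x = Hp x - Hn x.
Proof.
rewrite /Hp /Hn; have [h|h] := leP (H x) 0.
  by rewrite max_l ?oppr_ge0// sub0r opprK.
by rewrite max_r ?subr0// oppr_le0 ltW.
Qed.
Let Hp_le x : Hp x <= `|H x|.
Proof. by rewrite /Hp ge_max ler_norm normr_ge0. Qed.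
Let Hn_le x : Hn x <= `|H x|.
Proof. by rewrite /Hn ge_max -[`|_|]normrN ler_norm normr_ge0. Qed.
Let iHp : m.-integrable setT (EFin \o Hp).
Proof.
apply: le_integrable (integrable_norm iH) => //; first exact/measurable_EFinP.
by move=> x _ /=; rewrite lee_fin normr_id ger0_norm.
Qed.
Let iHn : m.-integrable setT (EFin \o Hn).
Proof.
apply: le_integrable (integrable_norm iH) => //; first exact/measurable_EFinP.
by move=> x _ /=; rewrite lee_fin normr_id ger0_norm.
Qed.

Let mtau' : @measurable_fun _ _ T mR setT tau := mtau.

Let nu (G : T -> R) (mG : measurable_fun setT G) : {measure set mR -> \bar R} :=
  measure_function_pushforward__canonical__measure_function_Measure (density m mG) mtau'.

Let nuE (G : T -> R) (mG : measurable_fun setT G) (G0 : forall x, 0 <= G x) (f : R -> R) :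
  @measurable_fun _ _ mR _ setT f -> (forall x, 0 <= f x) ->
  (\int[nu mG]_x (f x)%:E = \int[m]_x (G x * f (tau x))%:E)%E.
Proof.
move=> mf f0; rewrite ge0_integral_pushforward//; first last.
- by move=> x _; rewrite lee_fin.
- exact/measurable_EFinP.
rewrite preimage_setT integral_density//.
- by apply: eq_integral => x _ /=; rewrite -EFinM mulrC.
- by apply/measurable_EFinP; exact: measurableT_comp.
- by move=> x; rewrite lee_fin.
Qed.

Let split_integral (f : R -> R) M : @measurable_fun _ _ mR _ setT f -> (forall x, `|f x| <= M) ->
  \int[m]_x (H x * f (tau x)) = \int[m]_x (Hp x * f (tau x)) - \int[m]_x (Hn x * f (tau x)).
Proof.
move=> mf fM; have mft : measurable_fun setT (f \o tau) by exact: measurableT_comp.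
rewrite -RintegralB//.
- by apply: eq_Rintegral => x _; rewrite HE mulrBl.
- exact: (integrable_boundedM iHp mft (fun x => fM (tau x))).
- exact: (integrable_boundedM iHn mft (fun x => fM (tau x))).
Qed.

Let nu_eq (A : set mR) : measurable A -> nu mHp A = nu mHn A.
Proof.
have fin (G : T -> R) (mG : measurable_fun setT G) (G0 : forall x, 0 <= G x) (B : set mR) : measurable B ->
    nu mG B = (\int[m]_x (G x * \1_B (tau x))%:E)%E.
  move=> mB; rewrite -(nuE mG G0 (f := \1_B : R -> R))//.
  by rewrite (@integral_indic _ mR R (nu mG) setT measurableT B mB) setIT.
apply: ray_measure_unique.
  rewrite fin//; under eq_integral do rewrite indicT mulr1.
  exact: integrable_lty iHp.
move=> x; rewrite !fin//; try exact: measurable_itv.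
have mi : @measurable_fun _ _ mR _ setT (\1_(`]x, +oo[%classic) : R -> R) by exact: measurable_indic.
have bi t : `|\1_(`]x, +oo[%classic) t| <= 1 :> R.
  by rewrite indicE; case: (_ \in _); rewrite ?normr1 ?normr0.
have mit : measurable_fun setT ((\1_(`]x, +oo[%classic) : R -> R) \o tau) by exact: measurableT_comp.
have := H_ray x; rewrite (split_integral mi bi) => /eqP; rewrite subr_eq0 => /eqP.
have i1 := integrable_boundedM iHp mit (fun x => bi (tau x)).
have i2 := integrable_boundedM iHn mit (fun x => bi (tau x)).
move=> h; have := congr1 EFin h; rewrite /Rintegral fineK; last exact: integrable_fin_num i1.
by rewrite fineK//; exact: integrable_fin_num i2.
Qed.

(** In probabilistic terms, the conditional expectation of [H] given [tau] vanishes. The images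
    under [tau] of the measures with densities [Hp] and [Hn] agree on rays, hence on all Borel sets,
    hence integrate every nonnegative bounded function alike. *)
Lemma fundamental_lemma (f : R -> R) M : @measurable_fun _ _ mR _ setT f -> (forall x, `|f x| <= M) ->
  \int[m]_x (H x * f (tau x)) = 0.
Proof.
have pos (g : R -> R) K : @measurable_fun _ _ mR _ setT g -> (forall x, 0 <= g x <= K) ->
    \int[m]_x (H x * g (tau x)) = 0.
  move=> mg gK; have g0 x : 0 <= g x by have /andP[] := gK x.
  have bg x : `|g x| <= K by rewrite ger0_norm//; have /andP[] := gK x.
  rewrite (split_integral mg bg); apply/eqP; rewrite subr_eq0; apply/eqP.
  have e1 := nuE mHp Hp0 mg g0; have e2 := nuE mHn Hn0 mg g0.
  rewrite /Rintegral; congr fine; rewrite -e1 -e2.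
  by apply: eq_measure_integral => A mA _; exact: nu_eq.
move=> mf fM.
have M0 : 0 <= M by exact: le_trans (fM 0).
have mft : measurable_fun setT (f \o tau) by exact: measurableT_comp.
(* Adding the bound [M] makes the function nonnegative, and the added constant is itself a
   nonnegative bounded function. *)
have e : (fun x => H x * f (tau x)) = (fun x => H x * (f (tau x) + M) - H x * M).
  by apply/funext => x; rewrite mulrDr addrK.
have b1 x : `|f (tau x) + M| <= M + M by apply: le_trans (ler_normD _ _) _; rewrite lerD// ger0_norm.
have mft1 : measurable_fun setT (fun x => f (tau x) + M) by exact: measurable_funD.
rewrite e RintegralB//.
- rewrite (@pos (fun x => f x + M) (M + M)).
  + by rewrite (@pos (cst M) M) ?subr0// => x; rewrite M0 lexx.
  + exact: measurable_funD.
  + move=> x; have := fM x; rewrite ler_norml => /andP[h1 h2].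
    by rewrite -lerBlDr sub0r h1 lerD2r h2.
- exact: integrable_boundedM iH mft1 b1.
- by apply: (integrable_boundedM (M := M) iH) => // x; rewrite ger0_norm.
Qed.

End fundamental_lemma.

(** * Borel measurability of open sets, compact sets and continuous functions of rows *)

Section row_topology.
Context {R : realType}.
Local Notation mR := (measurableTypeR R).

Lemma measurable_countable_bigcup d (T : measurableType d) (I : countType) (F : I -> set T) :
  (forall i, measurable (F i)) -> measurable (\bigcup_i F i).
Proof.
move=> mF.
have -> : \bigcup_i F i = \bigcup_(k : nat) (if unpickle k is Some i then F i else set0).
  apply/seteqP; split => x [i _ Fix].
    by exists (pickle i) => //; rewrite pickleK.
  by move: Fix; case: unpickle => // j Fjx; exists j.
by apply: bigcupT_measurable => k; case: unpickle.
Qed.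

(** An open set is the union of the boxes with rational corners that it contains, a countable
    family. *)
Lemma open_row_measurable n (U : set 'rV[R]_n) : open U ->
  measurable (U : set 'rV[mR]_n).
Proof.
move=> oU.
pose B (q : {ffun 'I_n -> rat * rat}) : set 'rV[mR]_n :=
  box (fun i => `](ratr (q i).1 : R), ratr (q i).2[%classic).
have -> : U = \bigcup_q (if `[< B q `<=` U >] then B q else set0).
  apply/seteqP; split => [x Ux|x [q _]]; last by case: asboolP => // BU /BU.
  have /nbhs_ballP[e /= e0 eU] : nbhs x U by exact: open_nbhs_nbhs.
  have h i : exists q : rat * rat, x ord0 i - e < ratr q.1 < x ord0 i /\ x ord0 i < ratr q.2 < x ord0 i + e.
    have [q1] := rat_in_itvoo (ltac:(by rewrite ltrBlDr ltrDl) : x ord0 i - e < x ord0 i).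
    have [q2] := rat_in_itvoo (ltac:(by rewrite ltrDl) : x ord0 i < x ord0 i + e).
    by rewrite !in_itv/= => h2 h1; exists (q1, q2).
  have [q hq] := choice h.
  exists (finfun q) => //; rewrite asboolT.
    by move=> i; rewrite /= ffunE in_itv/=; have [/andP[_ ->] /andP[->]] := hq i.
  move=> y By; apply: eU; split=> // i j; rewrite /ball/= ord1.
  have := By j; rewrite /= ffunE in_itv/= => /andP[y1 y2].
  have [/andP[h1 h2] /andP[h3 h4]] := hq j.
  by rewrite ltr_norml; apply/andP; split; lra.
apply: measurable_countable_bigcup => q; case: ifP => // _.
by apply: measurable_box => i; exact: measurable_itv.
Qed.

Lemma continuous_row_measurable n (g : 'rV[R]_n -> R) : continuous g ->
  measurable_fun setT (g : 'rV[mR]_n -> R).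
Proof.
move=> cg; apply: (measurability (@RGenOpens.G R)) => [|_ [_ [a [b ->] <-]]].
  exact: RGenOpens.measurableE.
rewrite setTI; apply: open_row_measurable; apply: open_comp => // x _; exact: cg.
Qed.

Lemma compact_row_measurable n (K : set 'rV[R]_n) : compact K ->
  measurable (K : set 'rV[mR]_n).
Proof.
move=> cK; have : closed K by apply: compact_closed => //; exact: norm_hausdorff.
move=> /closed_openC /open_row_measurable; rewrite -[X in _ -> measurable X]setCK.
exact: measurableC.
Qed.

End row_topology.

(** * Smooth functions of several variables and the symmetry of mixed derivatives *)

Section smooth_rows.
Context {R : realType}.

Lemma is_derive_line n (g : 'rV[R]_n -> R) x v d :
  is_derive x v g d <-> is_derive 0 (1 : R) (fun h : R => g (h *: v + x)) d.
Proof.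
have e : (fun h : R => h^-1 *: (g (h *: v + x) - g x)) =
    (fun h : R => h^-1 *: (g ((h *: 1 + 0) *: v + x) - g (0 *: v + x))).
  by apply/funext => h; rewrite addr0 scale0r add0r [_%:A]mulr1.
split => -[d1 d2]; apply: DeriveDef; move: d1 d2; rewrite /derivable /derive/=.
- by rewrite e.
- by rewrite e.
- by rewrite -e.
- by rewrite -e.
Qed.

(** A coinduction principle: to prove smoothness, exhibit a class of continuous, partially
    differentiable functions that is stable under partial derivatives. *)
Lemma smooth_ind n (Q : ('rV[R]_n -> R) -> Prop) :
  (forall g, Q g -> continuous g /\
    forall i, (forall x, derivable g x (delta_mx ord0 i)) /\ Q (partial i g)) ->
  forall g, Q g -> smooth g.
Proof.
move=> QP g Qg r; have : Q (partials r g).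
  by elim: r => [//|i r /QP[_ /(_ i)[_]]].
by move=> /QP[c h]; split => // i x; have [] := h i.
Qed.

Lemma smooth_partial n (g : 'rV[R]_n -> R) i : smooth g -> smooth (partial i g).
Proof. by move=> sg r; have := sg (rcons r i); rewrite /partials foldr_rcons. Qed.

Lemma smooth_partials n (g : 'rV[R]_n -> R) r : smooth g -> smooth (partials r g).
Proof. by move=> sg; elim: r => [//|i r IH]; exact: smooth_partial. Qed.

Lemma smooth_continuous n (g : 'rV[R]_n -> R) : smooth g -> continuous g.
Proof. by move=> sg; have [] := sg [::]. Qed.

Lemma smooth_is_derive n (g : 'rV[R]_n -> R) : smooth g -> forall i x,
  is_derive x (delta_mx ord0 i) g (partial i g x).
Proof. by move=> sg i x; apply: derivableP; have [_] := sg [::]; apply. Qed.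

(** Derivatives of a product are no longer products but sums of products; this class is stable under
    partial derivatives, as [smooth_ind] requires. *)
Inductive sum_products n : ('rV[R]_n -> R) -> Prop :=
| SumProductsM a b : smooth a -> smooth b -> sum_products (fun x => a x * b x)
| SumProductsD f g : sum_products f -> sum_products g -> sum_products (fun x => f x + g x).

Lemma partialM n (a b : 'rV[R]_n -> R) i : smooth a -> smooth b ->
  (forall x, derivable (fun x => a x * b x) x (delta_mx ord0 i)) /\
  partial i (fun x => a x * b x) = fun x => a x * partial i b x + b x * partial i a x.
Proof.
move=> sa sb; have h x := is_deriveM (smooth_is_derive sa i x) (smooth_is_derive sb i x).
split => [x|]; first by have [] := h x.
by apply/funext => x; have [_ e] := h x.
Qed.

Lemma partialD n (a b : 'rV[R]_n -> R) i :
  (forall x, derivable a x (delta_mx ord0 i)) -> (forall x, derivable b x (delta_mx ord0 i)) ->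
  (forall x, derivable (fun x => a x + b x) x (delta_mx ord0 i)) /\
  partial i (fun x => a x + b x) = fun x => partial i a x + partial i b x.
Proof.
move=> sa sb; have h x := is_deriveD (derivableP (sa x)) (derivableP (sb x)).
split => [x|]; first by have [] := h x.
by apply/funext => x; have [_ e] := h x.
Qed.

Lemma continuous_rowM n (a b : 'rV[R]_n -> R) : continuous a -> continuous b ->
  continuous (fun x => a x * b x).
Proof. by move=> ca cb x; exact: (continuousM (ca x) (cb x)). Qed.

Lemma continuous_rowD n (a b : 'rV[R]_n -> R) : continuous a -> continuous b ->
  continuous (fun x => a x + b x).
Proof. by move=> ca cb x; exact: (continuousD (ca x) (cb x)). Qed.

Lemma smoothM n (a b : 'rV[R]_n -> R) : smooth a -> smooth b -> smooth (fun x => a x * b x).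
Proof.
move=> sa sb; apply: (@smooth_ind n (@sum_products n)); last exact: SumProductsM.
move=> {a b sa sb} g; elim=> [a b sa sb|f {}g _ [cf hf] _ [cg hg]].
  split; first by apply: continuous_rowM; exact: smooth_continuous.
  move=> i; have [h ->] := partialM i sa sb; split => //.
  exact: (SumProductsD (SumProductsM sa (smooth_partial i sb)) (SumProductsM sb (smooth_partial i sa))).
split; first exact: continuous_rowD.
move=> i; have [h ->] := partialD (hf i).1 (hg i).1; split => //.
by apply: SumProductsD; [exact: (hf i).2|exact: (hg i).2].
Qed.

Lemma row_line n (x : 'rV[R]_n) (h : R) i j :
  (h *: delta_mx ord0 i + x) ord0 j = if i == j then h + x ord0 j else x ord0 j.
Proof.
by rewrite !mxE eqxx/= [j == i]eq_sym; case: eqP => _; rewrite ?mulr1// mulr0 add0r.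
Qed.

Lemma is_derive_coord1 n (j : 'I_n) (chi : R -> R) i x : smooth1 chi ->
  is_derive x (delta_mx ord0 i) (fun u : 'rV[R]_n => chi (u ord0 j))
    (if i == j then derive1 chi (x ord0 j) else 0).
Proof.
move=> /smooth1_derive[_ dchi]; apply/is_derive_line.
have -> : (fun h : R => chi ((h *: delta_mx ord0 i + x) ord0 j)) =
    fun h => if i == j then chi (h + x ord0 j) else chi (x ord0 j).
  by apply/funext => h; rewrite row_line; case: eqP.
case: eqP => _; last exact: is_derive_cst.
have h := @is_derive_affine R chi 1 (x ord0 j) 0 (derive1 chi (x ord0 j)).
rewrite mulr0 add0r in h; have {}h := h (dchi _).
by apply: (is_derive_ext h) => [y|]; rewrite mul1r.
Qed.

Lemma smooth1_cst (c : R) : smooth1 (fun=> c).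
Proof. by move=> n; exact: diffn_cst. Qed.

Lemma partial_coord1 n (j : 'I_n) (chi : R -> R) i : smooth1 chi ->
  partial i (fun u : 'rV[R]_n => chi (u ord0 j)) =
  if i == j then (fun u => derive1 chi (u ord0 j)) else (fun=> 0).
Proof.
move=> s; apply/funext => x; have [_ e] := is_derive_coord1 j i x s.
by rewrite /partial e; case: eqP.
Qed.

Lemma smooth_coord1 n (j : 'I_n) (chi : R -> R) : smooth1 chi ->
  smooth (fun u : 'rV[R]_n => chi (u ord0 j)).
Proof.
move=> schi; apply: (@smooth_ind n (fun g => exists2 c, smooth1 c & g = fun u => c (u ord0 j))); last by exists chi.
move=> _ [c sc ->]; split.
  by move=> x; apply: continuous_comp; [exact: coord_continuous|exact: smooth1_continuous].
move=> i; split; first by move=> x; have [] := is_derive_coord1 j i x sc.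
exists (if i == j then derive1 c else fun=> 0).
  by case: eqP => _; [exact: (smooth1_derive sc).1|exact: smooth1_cst].
by rewrite partial_coord1//; case: eqP.
Qed.

Lemma smooth_cst n (c : R) : smooth (fun _ : 'rV[R]_n => c).
Proof.
apply: (@smooth_ind n (fun g => exists c, g = fun=> c)); last by exists c.
move=> _ [d ->]; split; first exact: cst_continuous.
move=> i; split; first by move=> x; exact: derivable_cst.
by exists 0; apply/funext => x; rewrite /partial derive_cst.
Qed.

Section substitution.
Variables (m n : nat) (c : 'I_n -> option 'I_m) (a : 'I_n -> R).
Hypothesis cinj : forall i i' j, c i = Some j -> c i' = Some j -> i = i'.

(** Each coordinate of the result is either a variable or a constant, and by [cinj] no variable
    occurs twice, so the chain rule produces at most one term, [psubst]. Freezing a coordinate and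
    restricting to a subset of the coordinates are the two instances used. *)
Definition rsubst (u : 'rV[R]_m) : 'rV[R]_n :=
  \row_i (if c i is Some j then u ord0 j else a i).

Lemma rsubst_continuous : continuous rsubst.
Proof.
move=> u A /nbhs_ballP[e e0 eA]; apply/nbhs_ballP; exists e => // v [_ hv].
apply: eA; split => // i k.
rewrite !mxE ord1; case: (c k) => [j|]; last exact: ballxx.
exact: (hv ord0 j).
Qed.

Definition psubst j (g : 'rV[R]_n -> R) : 'rV[R]_m -> R :=
  if [pick i | c i == Some j] is Some i then (fun u => partial i g (rsubst u)) else fun=> 0.

Lemma is_derive_rsubst g j x : smooth g ->
  is_derive x (delta_mx ord0 j) (fun u => g (rsubst u)) (psubst j g x).
Proof.
move=> sg; apply/is_derive_line; rewrite /psubst; case: pickP => [i /eqP ci|nc].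
  have /is_derive_line := smooth_is_derive sg i (rsubst x).
  congr is_derive; apply/funext => h; congr g; apply/rowP => k.
  rewrite row_line !mxE; case: eqP => [<-|ik]; first by rewrite ci row_line eqxx.
  case ck : (c k) => [j'|] //; rewrite row_line.
  case: eqP => [jj|//].
  by case: ik; apply: (cinj ci); rewrite ck jj.
have -> : (fun h : R => g (rsubst (h *: delta_mx ord0 j + x))) = fun=> g (rsubst x).
  apply/funext => h; congr g; apply/rowP => k; rewrite !mxE.
  case ck : (c k) => [j'|] //; rewrite row_line.
  case: eqP => [jj|//].
  by have := nc k; rewrite ck jj eqxx.
exact: is_derive_cst.
Qed.

Lemma partial_rsubst g j : smooth g -> partial j (fun u => g (rsubst u)) = psubst j g.
Proof. by move=> sg; apply/funext => x; have [_ e] := is_derive_rsubst j x sg; rewrite /partial e. Qed.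

Lemma smooth_rsubst g : smooth g -> smooth (fun u => g (rsubst u)).
Proof.
move=> sg; apply: (@smooth_ind m (fun h => exists2 g, smooth g & h = fun u => g (rsubst u))); last by exists g.
move=> {g sg} _ [g sg ->]; split.
  by move=> x; apply: continuous_comp; [exact: rsubst_continuous|exact: smooth_continuous].
move=> j; split; first by move=> x; have [] := is_derive_rsubst j x sg.
rewrite partial_rsubst// /psubst; case: pickP => [i _|_].
  by exists (partial i g) => //; exact: smooth_partial.
by exists (fun=> 0) => //; exact: smooth_cst.
Qed.

End substitution.

Section schwarz.
Variables (n : nat) (g : 'rV[R]_n -> R).
Hypothesis sg : smooth g.

Let pt (x : 'rV[R]_n) i j (s t : R) := s *: delta_mx ord0 i + (t *: delta_mx ord0 j + x).

Let ptC x i j s t : pt x i j s t = pt x j i t s.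
Proof. by rewrite /pt addrCA. Qed.

Let is_derive_pt (f : 'rV[R]_n -> R) (sf : smooth f) x i j s t :
  is_derive s (1 : R) (fun s => f (pt x i j s t)) (partial i f (pt x i j s t)).
Proof.
have /is_derive_line h := smooth_is_derive sf i (pt x i j s t).
have h' := @is_derive_affine R (fun h => f (h *: delta_mx ord0 i + pt x i j s t)) 1 (- s) s (partial i f (pt x i j s t)).
rewrite mul1r subrr in h'; have {h'} := h' h.
move=> h'; apply: (is_derive_ext h') => [y|]; last by rewrite mul1r.
by rewrite mul1r /pt addrA -scalerDl subrK.
Qed.

Let second_difference x i j (e : R) : 0 < e -> exists s t, [/\ 0 < s < e, 0 < t < e &
  g (pt x i j e e) - g (pt x i j e 0) - (g (pt x i j 0 e) - g (pt x i j 0 0)) =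
  partial j (partial i g) (pt x i j s t) * e ^+ 2].
Proof.
move=> e0.
have d1 s : is_derive s (1 : R) (fun s => g (pt x i j s e) - g (pt x i j s 0))
    (partial i g (pt x i j s e) - partial i g (pt x i j s 0)).
  exact: is_deriveB (is_derive_pt sg x i j s e) (is_derive_pt sg x i j s 0).
have [|s] := @MVT R (fun s => g (pt x i j s e) - g (pt x i j s 0)) _ 0 e e0 (fun s _ => d1 s).
  apply: continuous_subspaceT => s; have [d2 _] := d1 s.
  by apply: differentiable_continuous; exact/derivable1_diffP.
rewrite in_itv/= => s0e ->.
have d3 t : is_derive t (1 : R) (fun t => partial i g (pt x i j s t)) (partial j (partial i g) (pt x i j s t)).
  have h := is_derive_pt (smooth_partial i sg) x j i t s.
  have ee : (fun t => partial i g (pt x i j s t)) = (fun t => partial i g (pt x j i t s)).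
    by apply/funext => y; rewrite ptC.
  by rewrite ee ptC.
have [|t] := @MVT R (fun t => partial i g (pt x i j s t)) _ 0 e e0 (fun t _ => d3 t).
  apply: continuous_subspaceT => t; have [d2 _] := d3 t.
  by apply: differentiable_continuous; exact/derivable1_diffP.
rewrite in_itv/= => t0e ->; exists s, t; split => //.
by rewrite subr0 expr2 mulrA.
Qed.

(** The second difference of [g] over a square of side [d] is symmetric in [i] and [j]. By two
    applications of the mean value theorem it is d^2 times either mixed derivative at a point of
    that square, and both derivatives are continuous at [x]. *)
Lemma schwarz i j : partial i (partial j g) = partial j (partial i g).
Proof.
apply/funext => x; apply/eqP; rewrite -subr_eq0 -normr_le0; apply/ler_addgt0Pr => eps eps0.
rewrite add0r.
have c1 : continuous (partial i (partial j g)) by apply: smooth_continuous; do 2 apply: smooth_partial.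
have c2 : continuous (partial j (partial i g)) by apply: smooth_continuous; do 2 apply: smooth_partial.
have e2 : 0 < eps / 2 by rewrite divr_gt0.
have /nbhs_ballP[d1 /= d10 h1] : nbhs x (fun y => `|partial i (partial j g) x - partial i (partial j g) y| < eps / 2).
  exact: (c1 x (ball (partial i (partial j g) x) (eps / 2)) (nbhsx_ballx _ _ e2)).
have /nbhs_ballP[d2 /= d20 h2] : nbhs x (fun y => `|partial j (partial i g) x - partial j (partial i g) y| < eps / 2).
  exact: (c2 x (ball (partial j (partial i g) x) (eps / 2)) (nbhsx_ballx _ _ e2)).
pose d := Num.min d1 d2 / 2.
have d0 : 0 < d by rewrite divr_gt0// lt_min d10.
have dd1 : d + d <= d1 by rewrite /d -splitr ge_min lexx.
have dd2 : d + d <= d2 by rewrite /d -splitr ge_min lexx orbT.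
have [s [t [hs ht e1]]] := second_difference x i j d0.
have [s' [t' [hs' ht' e1']]] := second_difference x j i d0.
have near_pt i' j' u v : 0 < u < d -> 0 < v < d -> forall k, `|x ord0 k - pt x i' j' u v ord0 k| < d + d.
  move=> /andP[u0 ud] /andP[v0 vd] k; rewrite /pt !mxE.
  rewrite !eqxx/= addrA opprD addrCA subrr addr0 normrN.
  apply: le_lt_trans (ler_normD _ _) _; rewrite !normrM.
  have nb (b : bool) : `|b%:R| <= 1 :> R by case: b; rewrite ?normr1 ?normr0.
  rewrite (gtr0_norm u0) (gtr0_norm v0); apply: ltrD.
    by apply: le_lt_trans ud; rewrite ler_piMr ?(ltW u0)// nb.
  by apply: le_lt_trans vd; rewrite ler_piMr ?(ltW v0)// nb.
have b1 : `|partial j (partial i g) x - partial j (partial i g) (pt x i j s t)| < eps / 2.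
  apply: h2; split => // a b; rewrite ord1; apply: (lt_le_trans _ dd2).
  exact: near_pt.
have b2 : `|partial i (partial j g) x - partial i (partial j g) (pt x j i s' t')| < eps / 2.
  apply: h1; split => // a b; rewrite ord1; apply: (lt_le_trans _ dd1).
  exact: near_pt.
have : partial j (partial i g) (pt x i j s t) = partial i (partial j g) (pt x j i s' t').
  have d2n : d ^+ 2 != 0 by rewrite expf_neq0// gt_eqF.
  apply: (mulIf d2n).
  apply: (etrans (esym e1)); apply: (etrans _ e1').
  rewrite (ptC x j i d d) (ptC x j i d 0) (ptC x j i 0 d) (ptC x j i 0 0).
  move: (g _) (g _) (g _) (g _) => a1 a2 a3 a4; ring.
move=> e; rewrite e in b1.
rewrite [eps]splitr; apply: le_trans (ler_distD (partial i (partial j g) (pt x j i s' t')) _ _) _.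
apply: lerD; first exact: (ltW b2).
by rewrite distrC; exact: (ltW b1).
Qed.

End schwarz.

(** Mixed derivatives are taken in the order of [enum v]; this allows a chosen direction to be
    pulled to the front and enumerations of different index types to be compared. *)
Lemma partials_perm n (g : 'rV[R]_n -> R) r r' : smooth g -> perm_eq r r' ->
  partials r g = partials r' g.
Proof.
move=> sg; have cons r1 i r2 : partials (r1 ++ i :: r2) g = partials (i :: r1 ++ r2) g.
  elim: r1 => [//|k r1 IH] /=; rewrite IH/= schwarz//.
  exact: smooth_partials.
elim: r r' => [|i r IH] r' rr'; first by move: rr'; rewrite perm_sym => /perm_nilP ->.
have : i \in r' by rewrite -(perm_mem rr') inE eqxx.
move=> /path.splitPr h; case: h rr' => r1 r2 rr'.
rewrite cons /= (IH (r1 ++ r2))//; move: rr'.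
by rewrite perm_sym perm_catC/= perm_cons perm_catC perm_sym.
Qed.

End smooth_rows.

(** * Test functions on the cube *)

Section test_functions.
Context {R : realType}.
Local Notation mR := (measurableTypeR R).

Definition margin n (e : R) (x : 'rV[R]_n) := forall i, e <= x ord0 i <= 1 - e.

(** Each coordinate attains its extrema on the compact support, so the support keeps a positive
    distance from every face of the open cube. *)
Lemma test_margin n (psi : 'rV[R]_n -> R) : test_function psi ->
  smooth psi /\ exists2 e : R, 0 < e & forall x, ~ margin e x -> psi x = 0.
Proof.
move=> [spsi [K [cK Kc K0]]]; split => //.
have [K00|/set0P[x0 Kx0]] := eqVneq K set0.
  by exists 1 => // x _; apply: K0; rewrite K00.
have h (i : 'I_n) : exists2 e : R, 0 < e & forall x, K x -> e <= x ord0 i <= 1 - e.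
  have cc : {within K, continuous (fun x : 'rV[R]_n => x ord0 i)}.
    by apply: continuous_subspaceT; exact: coord_continuous.
  have [a aK ha] := compact_EVT_min (ex_intro _ x0 Kx0) cK cc.
  have [b bK hb] := compact_EVT_max (ex_intro _ x0 Kx0) cK cc.
  rewrite !inE in aK bK.
  have := Kc _ aK i; have := Kc _ bK i; rewrite /unit_interval/= !in_itv/= => /andP[b0 b1] /andP[a0 a1].
  exists (Num.min (a ord0 i) (1 - b ord0 i)); first by rewrite lt_min a0 subr_gt0.
  move=> x Kx; have := ha x (mem_set Kx); have := hb x (mem_set Kx) => h1 h2.
  have m1 : Num.min (a ord0 i) (1 - b ord0 i) <= a ord0 i by rewrite ge_min lexx.
  have m2 : Num.min (a ord0 i) (1 - b ord0 i) <= 1 - b ord0 i by rewrite ge_min lexx orbT.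
  by apply/andP; split; lra.
have [e he] := choice (fun i => (fun '(ex_intro2 e e0 h) => ex_intro (fun e : R => 0 < e /\ forall x, K x -> e <= x ord0 i <= 1 - e) e (conj e0 h)) (h i)).
(* The initial value 1 keeps [m] positive when there are no coordinates. *)
pose m := \big[Num.min/1]_(i < n) e i.
have m0 : 0 < m by rewrite /m; elim/big_ind: _ => // [x y x0' y0'|i _]; [rewrite lt_min x0'|have [] := he i].
have me i : m <= e i by exact: bigmin_le_cond.
exists m => // x hx; apply: K0 => Kx; apply: hx => i.
have [_ /(_ x Kx) /andP[h1 h2]] := he i; have := me i => h3.
by apply/andP; split; lra.
Qed.

Lemma margin_test n (psi : 'rV[R]_n -> R) (e : R) : smooth psi -> 0 < e ->
  (forall x, ~ margin e x -> psi x = 0) -> test_function psi.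
Proof.
move=> spsi e0 h; split => //; exists (margin e); split => //.
  exact: (@rV_compact _ n (fun=> `[e, 1 - e]%classic) (fun=> @segment_compact _ _ _)).
move=> x hx i; have := hx i; rewrite /unit_interval/= in_itv/= => /andP[h1 h2].
by apply/andP; split; lra.
Qed.

Lemma test_smooth n (psi : 'rV[R]_n -> R) : test_function psi -> smooth psi.
Proof. by case. Qed.

Lemma test_partials n (psi : 'rV[R]_n -> R) r : test_function psi ->
  test_function (partials r psi).
Proof.
move=> tpsi; elim: r => [//|i r /test_margin[sp [e e0 he]]] /=.
(* A point outside the box of margin e/2 can be moved by less than e/2 in any direction without
   entering the box of margin e, so [partials r psi] vanishes along a short segment. *)
apply: (@margin_test _ _ (e / 2)); [exact: smooth_partial|by rewrite divr_gt0|].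
move=> x hx; have := smooth_is_derive sp i x => /is_derive_line [_ <-].
rewrite (near_eq_derive (g := fun=> 0 : R)) ?derive_cst//.
have [j hj] : exists j, ~ (e / 2 <= x ord0 j <= 1 - e / 2) by apply/existsNP.
near=> h; apply: he => /(_ j) /andP[h1 h2]; apply: hj.
have hh : `|h| < e / 2 by near: h; exists (e / 2) => /=; [rewrite divr_gt0|move=> y; rewrite /ball_/= sub0r normrN].
move: h1 h2; rewrite row_line; move: hh; rewrite ltr_norml => /andP[h3 h4].
by case: eqP => _ h1 h2; apply/andP; split; lra.
Unshelve. all: by end_near. Qed.

Lemma test_bounded n (psi : 'rV[R]_n -> R) : test_function psi -> exists M, forall x, `|psi x| <= M.
Proof.
move=> [spsi [K [cK Kc K0]]]; have [K00|/set0P[x0 Kx0]] := eqVneq K set0.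
  by exists 0 => x; rewrite K0 ?normr0// K00.
have cc : {within K, continuous (fun x : 'rV[R]_n => `|psi x|)}.
  by apply: continuous_subspaceT => x; apply: continuous_comp; [exact: smooth_continuous|exact: norm_continuous].
have [b bK hb] := compact_EVT_max (ex_intro _ x0 Kx0) cK cc.
exists `|psi b| => x; have [Kx|nKx] := pselect (K x); first by apply: hb; rewrite inE.
by rewrite K0// normr0.
Qed.

Lemma test_measurable n (psi : 'rV[R]_n -> R) : test_function psi ->
  measurable_fun setT (psi : 'rV[mR]_n -> R).
Proof. by move=> /test_smooth/smooth_continuous; exact: continuous_row_measurable. Qed.

Lemma test1_measurable (chi : R -> R) : test1 chi -> @measurable_fun _ _ mR _ setT chi.
Proof. by move=> [s _]; apply: continuous_measurable_fun; exact: smooth1_continuous. Qed.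

Lemma test_functionM n (a b : 'rV[R]_n -> R) e : 0 < e -> smooth a -> smooth b ->
  (forall x, ~ margin e x -> a x * b x = 0) -> test_function (fun x => a x * b x).
Proof. by move=> e0 sa sb h; apply: margin_test e0 h; exact: smoothM. Qed.

Lemma smooth_prod n (I : Type) (r : seq I) (F : I -> 'rV[R]_n -> R) :
  (forall i, smooth (F i)) -> smooth (fun x => \prod_(i <- r) F i x).
Proof.
move=> sF; elim: r => [|i r IH].
  by under eq_fun do rewrite big_nil; exact: smooth_cst.
by under eq_fun do rewrite big_cons; exact: smoothM.
Qed.

Lemma partialsM_indep n (g : 'rV[R]_n -> R) (b : 'rV[R]_n -> R) r :
  smooth g -> smooth b -> (forall i, i \in r -> partial i b = fun=> 0) ->
  partials r (fun x => g x * b x) = fun x => partials r g x * b x.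
Proof.
move=> sg sb; elim: r => [//|i r IH] hr /=.
rewrite IH => [|k kr]; last by apply: hr; rewrite inE kr orbT.
have [_ ->] := partialM i (smooth_partials r sg) sb.
rewrite hr ?inE ?eqxx//; apply/funext => x.
by rewrite mulr0 add0r mulrC.
Qed.

Definition tensor n (chi : 'I_n -> R -> R) (r : seq 'I_n) (u : 'rV[R]_n) :=
  \prod_(i <- r) chi i (u ord0 i).

Lemma smooth_tensor n (chi : 'I_n -> R -> R) r : (forall i, smooth1 (chi i)) ->
  smooth (tensor chi r).
Proof. by move=> sc; apply: smooth_prod => i; exact: smooth_coord1. Qed.

Lemma partial_tensor_notin n (chi : 'I_n -> R -> R) r j : (forall i, smooth1 (chi i)) ->
  j \notin r -> partial j (tensor chi r) = fun=> 0.
Proof.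
move=> sc; elim: r => [_|i r IH].
  apply/funext => x; rewrite /partial /tensor; under eq_fun do rewrite big_nil.
  by rewrite derive_cst.
rewrite inE negb_or => /andP[ji jr]; rewrite /tensor; under eq_fun do rewrite big_cons.
have [_ ->] := partialM j (smooth_coord1 i (sc i)) (smooth_tensor r sc).
rewrite IH// partial_coord1// (negbTE ji); apply/funext => x.
by rewrite mulr0 mulr0 addr0.
Qed.

Lemma partials_tensor n (chi : 'I_n -> R -> R) r : (forall i, smooth1 (chi i)) -> uniq r ->
  partials r (tensor chi r) = tensor (fun i => derive1 (chi i)) r.
Proof.
move=> sc; elim: r => [_|i r IH]; first by apply/funext => u; rewrite /partials/= /tensor !big_nil.
move=> /= /andP[ir ur].
have -> : tensor chi (i :: r) = fun u => tensor chi r u * chi i (u ord0 i).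
  by apply/funext => u; rewrite /tensor big_cons mulrC.
rewrite (@partialsM_indep _ _ (fun u => chi i (u ord0 i))); first last.
- move=> k kr; rewrite partial_coord1//; case: eqP => // ki.
  by rewrite -ki kr in ir.
- exact: smooth_coord1.
- exact: smooth_tensor.
rewrite IH// => {IH}.
have sd k : smooth1 (derive1 (chi k)) by exact: (smooth1_derive (sc k)).1.
have [_ ->] := partialM i (smooth_tensor r sd) (smooth_coord1 i (sc i)).
rewrite partial_tensor_notin// partial_coord1// eqxx; apply/funext => x.
by rewrite mulr0 addr0 mulrC /tensor big_cons.
Qed.

Lemma test_tensor n (chi : 'I_n -> R -> R) : (forall i, test1 (chi i)) ->
  test_function (tensor chi (enum [set: 'I_n]%SET)).
Proof.
move=> tc; have [e he] := choice (fun i => (fun '(ex_intro2 e e0 h) => ex_intro (fun e : R => 0 < e /\ forall t, ~~ (e <= t <= 1 - e) -> chi i t = 0) e (conj e0 h)) (tc i).2).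
pose m := \big[Num.min/1]_(i < n) e i.
have m0 : 0 < m by rewrite /m; elim/big_ind: _ => // [x y x0' y0'|i _]; [rewrite lt_min x0'|have [] := he i].
have me i : m <= e i by exact: bigmin_le_cond.
apply: margin_test m0 _; first by apply: smooth_tensor => i; exact: (tc i).1.
move=> x /existsNP[j hj]; apply/eqP; rewrite prodf_seq_eq0; apply/hasP.
exists j; first by rewrite mem_enum inE.
rewrite /= (he j).2//; apply/negP => /andP[h1 h2]; apply: hj.
by have := me j => h3; apply/andP; split; lra.
Qed.

End test_functions.

(** * Primitives of test functions of mean zero *)

Section primitives.
Context {R : realType}.
Local Notation mR := (measurableTypeR R).

Lemma fundamental_lemma_c d (T : measurableType d) (m : {sigma_finite_measure set T -> \bar R})
    (H : T -> R[i]) (tau : T -> R) (f : R -> R[i]) :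
  cintble m H -> measurable_fun setT tau -> {ae m, forall x, unit_interval (tau x)} ->
  (forall chi, test1 chi -> cI m (fun x => H x * (chi (tau x))%:C%C) = 0) ->
  @cmeas _ mR _ f -> cbounded f -> cI m (fun x => H x * f (tau x)) = 0.
Proof.
move=> [i1 i2] mtau tau01 H0 [f1 f2] [M fM].
have H1 chi : test1 chi -> \int[m]_x (complex.Re (H x) * chi (tau x)) = 0.
  move=> /H0 /(congr1 (@complex.Re R)); rewrite Re_cI/= => <-.
  by apply: eq_Rintegral => x _; rewrite ReM/= mulr0 subr0.
have H2 chi : test1 chi -> \int[m]_x (complex.Im (H x) * chi (tau x)) = 0.
  move=> /H0 /(congr1 (@complex.Im R)) /= <-.
  by apply: eq_Rintegral => x _; rewrite ImM/= mulr0 add0r.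
have b1 x : `|complex.Re (f x)| <= M by exact: le_trans (Re_le_normc _) (fM x).
have b2 x : `|complex.Im (f x)| <= M by exact: le_trans (Im_le_normc _) (fM x).
have mt (g : R -> R) : @measurable_fun _ _ mR _ setT g -> measurable_fun setT (g \o tau).
  by move=> mg; exact: measurableT_comp.
have ib (h g : T -> R) : m.-integrable setT (EFin \o h) -> measurable_fun setT g -> (forall x, `|g x| <= M) ->
    m.-integrable setT (EFin \o (fun x => h x * g x)).
  by move=> ih mg gM; exact: integrable_boundedM gM.
rewrite /cI /cintegral.
under [X in Complex X _]eq_Rintegral do rewrite ReM.
under [X in Complex _ X]eq_Rintegral do rewrite ImM.
rewrite RintegralB//; [|by apply: (ib _ (fun x => complex.Re (f (tau x)))) => //; exact: (mt _ f1)
                       |by apply: (ib _ (fun x => complex.Im (f (tau x)))) => //; exact: (mt _ f2)].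
rewrite RintegralD//; [|by apply: (ib _ (fun x => complex.Im (f (tau x)))) => //; exact: (mt _ f2)
                       |by apply: (ib _ (fun x => complex.Re (f (tau x)))) => //; exact: (mt _ f1)].
rewrite (fundamental_lemma i1 mtau tau01 H1 f1 b1) (fundamental_lemma i2 mtau tau01 H2 f2 b2).
rewrite (fundamental_lemma i1 mtau tau01 H1 f2 b2) (fundamental_lemma i2 mtau tau01 H2 f1 b1).
by rewrite subr0 addr0.
Qed.

Lemma Rintegral_cst1 d (T : measurableType d) (m : {measure set T -> \bar R}) (c : R) :
  m setT = 1%E -> \int[m]_x (fun=> c) x = c.
Proof. by move=> m1; rewrite /= Rintegral_cst// m1 mulr1. Qed.

(** The primitive as an integral against the kernel 1_{t <= u}: total in [u] and directly accessible
    to Fubini. On (0,1) it agrees with [primitive], see [primitive_prim]. *)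
Definition prim (f : R -> R[i]) (u : R) : R[i] :=
  cI Un (fun t : mR => ((t : R) <= u)%R%:R * f t).

Lemma Rintegral_Un (f : R -> R) :
  \int[Un]_t (f \_ unit_interval) t = \int[@lebesgue_measure R]_(t in unit_interval) f t.
Proof.
rewrite /Rintegral -integral_Un; congr fine; apply: eq_integral => t _.
by rewrite !patchE; case: ifP.
Qed.

(** Mean zero is exactly what makes the primitive vanish again near 1, so that it is a test function
    and not merely smooth. *)
Lemma test1_primitive (chi : R -> R) : test1 chi -> \int[Un]_t chi t = 0 ->
  exists2 psi, test1 psi & derive1 psi = chi /\
    forall u, (psi u)%:C%C = prim (fun t => (chi t)%:C%C) u.
Proof.
move=> [schi [e e0 he]] chi0.
have cchi := smooth1_continuous schi.
have out t : ~ unit_interval t -> chi t = 0.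
  move=> ht; apply: he; apply/negP => /andP[h1 h2]; apply: ht.
  by rewrite /unit_interval/= in_itv/=; apply/andP; split; lra.
pose psi x : R := \int[@lebesgue_measure R]_(t in `]-oo, x]%classic) chi t.
have psiE u : psi u = \int[Un]_t ((t <= u)%R%:R * chi t).
  rewrite /psi Rintegral_mkcond.
  transitivity (\int[@lebesgue_measure R]_(t in unit_interval) ((t <= u)%R%:R * chi t)).
    rewrite [RHS]Rintegral_mkcond; apply: eq_Rintegral => t _; rewrite !patchE !mem_setE in_itv/=.
    case: ifPn => tu; case: ifPn => t01; rewrite ?mul1r ?mul0r//.
    by apply: out; exact/negP.
  rewrite -Rintegral_Un; apply: eq_Rintegral => t _; rewrite patchE; case: ifPn => // t01.
  by rewrite out ?mulr0//; move/negP : t01; rewrite inE.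
have [M chiM] := test1_bounded (conj schi (ex_intro2 _ _ e e0 he)).
have ichi : (@lebesgue_measure R).-integrable setT (EFin \o chi).
  have : (@lebesgue_measure R).-integrable `[0%R, 1%R] (EFin \o chi).
    by apply: continuous_compact_integrable; [exact: segment_compact|exact: continuous_subspaceT].
  rewrite integrable_mkcond//; apply: eq_integrable => // t _; rewrite patchE mem_setE in_itv/=.
  case: ifPn => // t01; rewrite /= out// /unit_interval/= in_itv/= => /andP[h1 h2].
  by rewrite (ltW h1) (ltW h2) in t01.
have dpsi x : is_derive x (1 : R) psi (chi x).
  have ix : (@lebesgue_measure R).-integrable `]-oo, (x + 1)%R] (EFin \o chi).
    by apply: integrableS ichi.
  have [d1 d2] := @continuous_FTC1 R chi -oo%O x (x + 1) (ltac:(by rewrite ltrDl)) ix (ltNyr _) (cchi x).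
  by apply: DeriveDef; [exact: d1|rewrite -derive1E; exact: d2].
exists psi; last first.
  split; first by apply/funext => x; rewrite derive1E; have [_ ->] := dpsi x.
  move=> u; rewrite psiE -cI_real; apply: eq_cI => t.
  by case: (_ <= _); rewrite ?mul1r ?mul0r.
split.
  by case => [//|n]; exists chi.
exists e => // t; rewrite negb_and -!ltNge => /orP[h|h]; rewrite psiE.
  transitivity (Rintegral Un setT (fun=> 0 : R)); last by rewrite Rintegral_cst// mul0r.
  apply: eq_Rintegral => x _.
  have [xt|] := leP x t; last by rewrite mul0r.
  by rewrite mul1r he// negb_and -!ltNge (le_lt_trans xt h).
rewrite -[RHS]chi0; apply: eq_Rintegral => x _.
have [xt|tx] := leP x t; first by rewrite mul1r.
by rewrite mul0r he// negb_and -!ltNge (lt_trans h tx) orbT.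
Qed.

(** If all test functions had mean zero, the fundamental lemma applied to the constant 1 would give
    1 = 0; no integral of a bump has to be evaluated. *)
Lemma exists_test1_unit : exists2 om : R -> R, test1 om & \int[Un]_t om t = 1.
Proof.
have [[c tc c0]|h] := pselect (exists2 c : R -> R, test1 c & \int[Un]_t c t != 0); last first.
  have i1 : Un.-integrable setT (EFin \o (fun _ : mR => 1 : R)).
    by apply: (@integrable_bounded _ mR R Un (fun=> 1) 1 Un_lty) => // x; rewrite normr1.
  have H0 (chi : R -> R) : test1 chi -> \int[Un]_x (1 * chi x) = 0.
    move=> tchi; under eq_Rintegral do rewrite mul1r.
    by apply/eqP/negPn/negP => hc; apply: h; exists chi.
  have mid : measurable_fun setT (fun t : mR => t : R) by exact: measurable_id.
  have := @fundamental_lemma _ _ R Un (fun=> 1) (fun t : mR => t : R) i1 mid ae_Un_unit H0 (fun=> 1) 1 (measurable_cst _).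
  rewrite (@Rintegral_cst1 _ mR Un _ (probability_setT Un)) !mulr1 normr1 => /(_ (fun=> lexx _))/eqP.
  by rewrite oner_eq0.
have [s [e e0 he]] := tc.
exists (fun t => (\int[Un]_t c t)^-1 * c t).
  split; first by move=> n; apply: diffnM; [exact: diffn_cst|exact: s].
  by exists e => // t ht; rewrite he// mulr0.
have [M cM] := test1_bounded tc.
rewrite RintegralZl//; first by rewrite mulVf.
exact: integrable_bounded Un_lty (test1_measurable tc) cM.
Qed.

End primitives.

(** * Mixed weak derivatives *)

Section integration_by_parts.
Context {R : realType}.
Local Notation mR := (measurableTypeR R).

Lemma cmeas_le (u : R) : @cmeas _ mR R (fun t : R => (t <= u)%R%:R).
Proof.
have h : @measurable_fun _ _ mR _ setT (fun t : R => (t <= u)%R%:R : R).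
  rewrite (_ : (fun _ => _) = \1_(`]-oo, u]%classic)).
    by apply: measurable_indic; exact: measurable_itv.
  by apply/funext => t; rewrite indicE mem_setE in_itv.
rewrite (_ : (fun _ => _) = (fun t : R => ((t <= u)%R%:R : R)%:C%C)); first exact: cmeas_real.
by apply/funext => t; case: (t <= u); rewrite ?rmorph1 ?rmorph0.
Qed.

Lemma cmeas_le2 : @cmeas _ (mR * mR)%type R (fun z : R * R => (z.2 <= z.1)%R%:R).
Proof.
have h : measurable_fun setT (fun z : mR * mR => (z.2 <= z.1 :> R)%R%:R : R).
  have mb : measurable_fun setT (fun z : mR * mR => (z.2 <= z.1 :> R)).
    by apply: measurable_fun_ler; [exact: measurable_snd|exact: measurable_fst].
  rewrite (_ : (fun _ => _) = \1_((fun z : mR * mR => (z.2 <= z.1 :> R)) @^-1` [set true])).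
    by apply: measurable_indic; rewrite -[X in measurable X]setTI; exact: mb.
  apply/funext => z; rewrite indicE; case: (boolP (z.2 <= z.1 :> R)) => h.
    by rewrite mem_set.
  by rewrite memNset//= => h'; rewrite h' in h.
rewrite (_ : (fun _ => _) = (fun z : R * R => ((z.2 <= z.1)%R%:R : R)%:C%C)); first exact: cmeas_real.
by apply/funext => z; case: (_ <= _); rewrite ?rmorph1 ?rmorph0.
Qed.

Lemma normc_nat (b : bool) : Normc.normc (b%:R : R[i]) <= 1.
Proof. by case: b; rewrite ?Normc.normc1 ?Normc.normc0. Qed.

Lemma prod_setT d1 d2 (T1 : measurableType d1) (T2 : measurableType d2)
    (P : probability T1 R) (Q : probability T2 R) : (P \x Q)%E setT = 1%E.
Proof.
rewrite -setXTT; transitivity (P setT * Q setT)%E; first exact: product_measure1E.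
by rewrite !probability_setT mule1.
Qed.

Lemma prod_lty d1 d2 (T1 : measurableType d1) (T2 : measurableType d2)
    (P : probability T1 R) (Q : probability T2 R) : ((P \x Q)%E setT < +oo)%E.
Proof. by rewrite prod_setT ltry. Qed.

Lemma cbounded_bool d (T : measurableType d) (b : T -> bool) : cbounded (fun t => (b t)%:R : R[i]).
Proof. by exists 1 => t; exact: normc_nat. Qed.

Lemma normc_cI_bound d (T : measurableType d) (m : {measure set T -> \bar R}) (f : T -> R[i]) (M : R) :
  m setT = 1%E -> cmeas f -> (forall x, Normc.normc (f x) <= M) -> Normc.normc (cI m f) <= M.
Proof.
move=> m1 mf fM.
have moo : (m setT < +oo)%E by rewrite m1 ltry.
have iF : cintble m f by apply: cintble_bounded => //; exists M.
apply: le_trans (normc_cI_le iF) _.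
rewrite -[leRHS](Rintegral_cst1 M m1); apply: le_Rintegral => //.
- apply: (integrable_bounded moo) (measurable_normc mf) _ => x.
  by rewrite ger0_norm ?normc_ge0//; exact: fM.
- by apply: (integrable_bounded (M := `|M|) moo) => // x.
Qed.

Section prim_theory.
Variables (f : R -> R[i]) (mf : @cmeas _ mR _ f).

Lemma prim_cintble u : cbounded f -> cintble Un (fun t : mR => ((t : R) <= u)%R%:R * f t).
Proof.
move=> bf; apply: cintble_bounded; first exact: Un_lty.
  by apply: cmeasM => //; exact: cmeas_le.
by apply: cboundedM => //; exact: cbounded_bool.
Qed.

Lemma normc_prim u M : (forall t, Normc.normc (f t) <= M) -> Normc.normc (prim f u) <= M.
Proof.
move=> fM; apply: normc_cI_bound; first exact: probability_setT.
  by apply: cmeasM => //; exact: cmeas_le.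
move=> t; rewrite Normc.normcM -[leRHS]mul1r.
by apply: ler_pM; rewrite ?normc_ge0//; exact: normc_nat.
Qed.

Lemma cbounded_prim : cbounded f -> cbounded (prim f).
Proof. by move=> [M fM]; exists M => u; exact: normc_prim. Qed.

Lemma cmeas_prim : cbounded f -> @cmeas _ mR _ (prim f).
Proof.
move=> bf.
have mF : @cmeas _ (mR * mR)%type R (fun z : R * R => (z.2 <= z.1)%R%:R * f z.2).
  apply: cmeasM; first exact: cmeas_le2.
  exact: (mpres_cmeas (mpres_snd Un Un) (f := f)).
have iF : cintble (Un \x Un)%E (fun z : mR * mR => ((z.2 : R) <= z.1)%R%:R * f z.2).
  apply: cintble_bounded => //.
  - exact: prod_lty.
  - apply: cboundedM; first exact: (cbounded_bool (fun z : mR * mR => (z.2 : R) <= z.1)).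
    by case: bf => M fM; exists M => z; exact: fM.
have [iF1 _] := cI_fubini1 iF.
exact: cintble_meas iF1.
Qed.

End prim_theory.

Lemma primD f g u : @cmeas _ mR _ f -> @cmeas _ mR _ g -> cbounded f -> cbounded g ->
  prim (fun t => f t + g t) u = prim f u + prim g u.
Proof.
move=> mf mg bf bg; rewrite /prim; under eq_cI do rewrite mulrDr.
by rewrite cID//; exact: prim_cintble.
Qed.

Lemma primZ c f u : @cmeas _ mR _ f -> cbounded f ->
  prim (fun t => c * f t) u = c * prim f u.
Proof.
move=> mf bf; rewrite /prim; under eq_cI do rewrite mulrCA.
by rewrite cIZ//; exact: prim_cintble.
Qed.

Definition wder n (v : {set 'I_n}) (g h : 'rV[R]_n -> R[i]) :=
  forall psi, test_function psi ->
  cI (Pn n) (fun u => g u * (partials (enum v) psi u)%:C%C) =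
  (-1) ^+ #|v| * cI (Pn n) (fun u => h u * (psi u)%:C%C).

Lemma test1_cmeas (chi : R -> R) : test1 chi -> @cmeas _ mR _ (fun t => (chi t)%:C%C).
Proof. by move=> h; apply: cmeas_real; exact: test1_measurable. Qed.

Lemma test1_cbounded (chi : R -> R) : test1 chi -> cbounded (fun t => (chi t)%:C%C).
Proof. by move=> /test1_bounded[M h]; exists M => t; rewrite normc_real. Qed.

Lemma test1D (a b : R -> R) : test1 a -> test1 b -> test1 (fun t => a t + b t).
Proof.
move=> [sa [e e0 he]] [sb [f f0 hf]]; split; first by move=> n; exact: diffnD.
exists (Num.min e f); first by rewrite lt_min e0.
have m1 : Num.min e f <= e by rewrite ge_min lexx.
have m2 : Num.min e f <= f by rewrite ge_min lexx orbT.
move=> t ht; rewrite he ?hf ?addr0//; apply: contra ht => /andP[h1 h2]; apply/andP; split; lra.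
Qed.

Lemma test1Z (c : R) (a : R -> R) : test1 a -> test1 (fun t => c * a t).
Proof.
move=> [sa [e e0 he]]; split; first by move=> n; apply: diffnM; [exact: diffn_cst|exact: sa].
by exists e => // t ht; rewrite he// mulr0.
Qed.

Section ibp.
Variables (n : nat) (g h : 'rV[R]_n -> R[i]).
Hypotheses (ig : cintble (Pn n) g) (ih : cintble (Pn n) h).
Hypothesis wgh : wder [set: 'I_n]%SET g h.

(* The formula holds for tensor products of derivatives of test functions; the
   fundamental lemma then frees the factors one coordinate at a time. The list r
   contains the coordinates whose factor is already an arbitrary bounded
   function of mean zero. *)
Let admissible (r : seq 'I_n) (f : 'I_n -> R -> R[i]) := forall j,
  [/\ @cmeas _ mR _ (f j), cbounded (f j), cI Un (f j) = 0 &
  j \notin r -> exists2 c, test1 c & f j = fun t => (c t)%:C%C].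

Let goal f := cI (Pn n) (fun u => g u * \prod_j f j (u ord0 j)) =
  (-1) ^+ n * cI (Pn n) (fun u => h u * \prod_j prim (f j) (u ord0 j)).

Let goal_nil f : admissible [::] f -> goal f.
Proof.
move=> af.
have /choice[c hc] : forall j : 'I_n, exists c : R -> R, test1 c /\ f j = fun t => (c t)%:C%C.
  by move=> j; have [_ _ _ /(_ isT)[c]] := af j; exists c.
have /choice[p hp] : forall j : 'I_n, exists p : R -> R, [/\ test1 p, derive1 p = c j &
    forall u, (p u)%:C%C = prim (f j) u].
  move=> j.
  have [tc fc] := hc j; have [_ _ + _] := af j; rewrite fc cI_real => /(congr1 (@complex.Re R))/= c0.
  by have [p tp [p1 p2]] := test1_primitive tc c0; exists p.
have tp : test_function (tensor p (enum [set: 'I_n]%SET)).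
  by apply: test_tensor => i; have [] := hp i.
(* The tensor product of the primitives is an admissible test function, and its full mixed
   derivative is the tensor product of the original factors. *)
have := wgh tp; rewrite cardsT card_ord partials_tensor; first last.
- exact: enum_uniq.
- by move=> i; have [[]] := hp i.
have e (q : 'I_n -> R -> R) u : (tensor q (enum [set: 'I_n]%SET) u)%:C%C = \prod_j (q j (u ord0 j))%:C%C.
  by rewrite /tensor rmorph_prod big_enum/=; apply: eq_bigl => i; rewrite inE.
move=> w; rewrite /goal.
under eq_cI => u.
  under eq_bigr => j _ do rewrite (hc j).2.
  over.
under [in RHS]eq_cI => u.
  under eq_bigr => j _.
    have [_ _ <-] := hp j.
    over.
  over.
under [in RHS]eq_cI do rewrite -e; rewrite -w; apply: eq_cI => u.
rewrite e; congr (_ * _); apply: eq_bigr => j _.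
by have [_ -> _] := hp j.
Qed.

(** With the other factors frozen in [A] and [B], the goal is linear in the j-th factor q. It is
    known when q is a test function of mean zero. Correcting by a multiple of the fixed [om], of
    integral 1, extends it to all test functions at the price of a term [K0] times the integral of
    q. The fundamental lemma then extends it to bounded q, and for mean zero the extra term
    disappears. *)
Let step j r f : j \notin r -> (forall f, admissible r f -> goal f) ->
  admissible (j :: r) f -> goal f.
Proof.
move=> jr IH af.
pose A (u : 'rV[R]_n) := \prod_(i | i != j) f i (u ord0 i).
pose B (u : 'rV[R]_n) := \prod_(i | i != j) prim (f i) (u ord0 i).
have mA : @cmeas _ 'rV[mR]_n _ A.
  rewrite /A; under eq_fun do rewrite big_mkcond/=; apply: cmeas_prod => i.
  have [mi bi _ _] := af i; case: (i != j); [exact: cmeas_coord|exact: cmeas_cst].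
have bA : cbounded A.
  rewrite /A; under eq_fun do rewrite big_mkcond/=; apply: cbounded_prod => i.
  have [mi bi _ _] := af i; case: (i != j); [exact: cbounded_coord|exact: cbounded_cst].
have mB : @cmeas _ 'rV[mR]_n _ B.
  rewrite /B; under eq_fun do rewrite big_mkcond/=; apply: cmeas_prod => i.
  have [mi bi _ _] := af i; case: (i != j); [by apply: cmeas_coord; exact: cmeas_prim|exact: cmeas_cst].
have bB : cbounded B.
  rewrite /B; under eq_fun do rewrite big_mkcond/=; apply: cbounded_prod => i.
  have [mi bi _ _] := af i; case: (i != j); [by apply: cbounded_coord; exact: cbounded_prim|exact: cbounded_cst].
have igA : cintble (Pn n) (fun u => g u * A u) by exact: cintbleMb.
have ihB : cintble (Pn n) (fun u => h u * B u) by exact: cintbleMb.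
have goalE q : (forall i, i != j -> q i = f i) -> goal q <->
    cI (Pn n) (fun u => g u * A u * q j (u ord0 j)) = (-1) ^+ n * cI (Pn n) (fun u => h u * B u * prim (q j) (u ord0 j)).
  move=> hq; rewrite /goal; have -> : (fun u => g u * \prod_j q j (u ord0 j)) = (fun u => g u * A u * q j (u ord0 j)).
    apply/funext => u; rewrite (bigD1 j)//= [q j _ * _]mulrC mulrA; congr (_ * _ * _).
    by apply: eq_bigr => i /hq ->.
  have -> // : (fun u => h u * \prod_j prim (q j) (u ord0 j)) = (fun u => h u * B u * prim (q j) (u ord0 j)).
  apply/funext => u; rewrite (bigD1 j)//= [prim (q j) _ * _]mulrC mulrA; congr (_ * _ * _).
  by apply: eq_bigr => i /hq ->.
have [om tom om1] := @exists_test1_unit R.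
pose omc t : R[i] := (om t)%:C%C.
(* [K0] is the defect of the formula at [om]. The kernel [K] lives on pairs (u, t), so that
   integrating it against q(t) reproduces both sides of the formula; the indicator encodes the
   primitive of q. *)
pose K0 := cI (Pn n) (fun u => g u * A u * omc (u ord0 j)) -
  (-1) ^+ n * cI (Pn n) (fun u => h u * B u * prim omc (u ord0 j)).
pose K (z : 'rV[mR]_n * mR) : R[i] := g (set_coord z.1 j z.2) * A (set_coord z.1 j z.2) - K0
  - (-1) ^+ n * (h z.1 * B z.1 * ((z.2 : R) <= z.1 ord0 j)%R%:R).
have PU : ((Pn n \x Un)%E setT < +oo :> \bar R)%E by exact: prod_lty.
have mle : cmeas (fun z : 'rV[mR]_n * mR => ((z.2 : R) <= z.1 ord0 j)%R%:R : R[i]).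
  have mz : measurable_fun setT (fun z : 'rV[mR]_n * mR => (z.1 ord0 j, z.2)).
    apply/measurable_fun_pairP; split; last exact: measurable_snd.
    exact: measurableT_comp (measurable_row_coord j) measurable_fst.
  have [m1 m2] := cmeas_le2.
  by split; [exact: (measurableT_comp m1 mz)|exact: (measurableT_comp m2 mz)].
have i1 : cintble (Pn n \x Un)%E (fun z => g (set_coord z.1 j z.2) * A (set_coord z.1 j z.2)).
  by apply/(mpres_cintble (mpres_set_coord j) (cintble_meas igA)).
have i2 : cintble (Pn n \x Un)%E (fun z => h z.1 * B z.1 * ((z.2 : R) <= z.1 ord0 j)%R%:R).
  apply: cintbleMb mle _.
    exact/(mpres_cintble (mpres_fst (Pn n) Un) (cintble_meas ihB)).
  exact: (cbounded_bool (fun z : 'rV[mR]_n * mR => (z.2 : R) <= z.1 ord0 j)).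
have i3 : cintble (Pn n \x Un)%E (fun=> K0).
  by apply: cintble_bounded PU (cmeas_cst _) (cbounded_cst _).
have iK : cintble (Pn n \x Un)%E K.
  rewrite /K; apply: cintbleD; last by apply: cintbleN; exact: cintbleZ.
  by apply: cintbleD => //; exact: cintbleN.
have unwind (q : R -> R[i]) : @cmeas _ mR _ q -> cbounded q ->
    cI (Pn n \x Un)%E (fun z => K z * q z.2) =
    cI (Pn n) (fun u => g u * A u * q (u ord0 j)) - K0 * cI Un q -
    (-1) ^+ n * cI (Pn n) (fun u => h u * B u * prim q (u ord0 j)).
  move=> mq bq.
  have mq2 : cmeas (fun z : 'rV[mR]_n * mR => q z.2) by exact: (mpres_cmeas (mpres_snd (Pn n) Un) (f := q)).
  have bq2 : cbounded (fun z : 'rV[mR]_n * mR => q z.2) by case: bq => M qM; exists M => z; exact: qM.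
  have -> : (fun z => K z * q z.2) = (fun z => g (set_coord z.1 j z.2) * A (set_coord z.1 j z.2) * q z.2
      - K0 * q z.2 - (-1) ^+ n * (h z.1 * B z.1 * ((z.2 : R) <= z.1 ord0 j)%R%:R * q z.2)).
    by apply/funext => z; rewrite /K; ring.
  have j1 := cintbleMb i1 mq2 bq2; have j2 := cintbleMb i2 mq2 bq2.
  have j3 : cintble (Pn n \x Un)%E (fun z => K0 * q z.2) by exact: cintbleMb i3 mq2 bq2.
  rewrite cIB//; [|by apply: cintbleD => //; exact: cintbleN|exact: cintbleZ].
  have j4 : cintble (Pn n \x Un)%E (fun z => q z.2) by apply: cintble_bounded PU mq2 bq2.
  rewrite cIB// (cIZ K0 j4) (cIZ _ j2); congr (_ - _ * _ - _ * _).
  - have mm : @cmeas _ 'rV[mR]_n _ (fun u => g u * A u * q (u ord0 j)).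
      by apply: cmeasM; [exact: cintble_meas igA|exact: cmeas_coord].
    rewrite -(mpres_cI (mpres_set_coord j) mm); apply: eq_cI => z.
    by rewrite set_coordE eqxx.
  - by rewrite (mpres_cI (mpres_snd (Pn n) Un) mq).
  - rewrite -(cI_fubini1 j2).2; apply: eq_cI => u.
    rewrite /prim -cIZ; last exact: prim_cintble.
    by apply: eq_cI => t; rewrite mulrA.
apply/goalE => //.
have [mfj bfj fj0 _] := af j.
have K0E : forall chi, test1 chi -> cI (Pn n \x Un)%E (fun z => K z * (chi z.2)%:C%C) = 0.
  move=> chi tchi; rewrite (unwind (fun t => (chi t)%:C%C)); [|exact: test1_cmeas|exact: test1_cbounded].
  (* Subtracting [c] times [om] brings the integral of [chi] to 0, so the induction hypothesis
     applies to [q]. *)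
  pose c := \int[Un]_t chi t; pose q t : R := chi t + (- c) * om t.
  have tq : test1 q by apply: test1D => //; exact: test1Z.
  pose qc t : R[i] := (q t)%:C%C.
  have mqc := test1_cmeas tq; have bqc := test1_cbounded tq.
  have mom := test1_cmeas tom; have bom := test1_cbounded tom.
  have mchi := test1_cmeas tchi; have bchi := test1_cbounded tchi.
  have qcE : qc = fun t => (chi t)%:C%C + (- c)%:C%C * omc t.
    by apply/funext => t; rewrite /qc /q rmorphD rmorphM.
  pose F i := if i == j then qc else f i.
  have : goal F.
    apply: IH => i; rewrite /F; case: eqP => [->|/eqP ij].
      split => //; last by exists q.
      rewrite qcE cID; first last.
      - by apply: cintbleZ; apply: cintble_bounded Un_lty mom bom.
      - by apply: cintble_bounded Un_lty mchi bchi.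
      rewrite cIZ; last by apply: cintble_bounded Un_lty mom bom.
      by rewrite /omc !cI_real om1 -rmorphM -rmorphD/= mulr1 subrr.
    have [h1 h2 h3 h4] := af i; split => // ir; apply: h4.
    by rewrite inE negb_or ij.
  have FE : goal F <-> _ := goalE F _; rewrite FE => [|i ij]; last by rewrite /F (negbTE ij).
  have -> : F j = qc by rewrite /F eqxx.
  move=> e.
  have p1 u : prim qc u = prim (fun t => (chi t)%:C%C) u + (- c)%:C%C * prim omc u.
    by rewrite qcE primD//; [rewrite primZ|apply: cmeasM mom; exact: cmeas_cst|apply: cboundedM bom; exact: cbounded_cst].
  have s1 : (fun u => g u * A u * qc (u ord0 j)) = fun u => g u * A u * (chi (u ord0 j))%:C%C + (- c)%:C%C * (g u * A u * omc (u ord0 j)).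
    by apply/funext => u; rewrite qcE; ring.
  have s2 : (fun u => h u * B u * prim qc (u ord0 j)) = fun u => h u * B u * prim (fun t => (chi t)%:C%C) (u ord0 j) + (- c)%:C%C * (h u * B u * prim omc (u ord0 j)).
    by apply/funext => u; rewrite p1; ring.
  have ic (k : R -> R[i]) (G : 'rV[mR]_n -> R[i]) : cintble (Pn n) G -> @cmeas _ mR _ k -> cbounded k ->
      cintble (Pn n) (fun u => G u * k (u ord0 j)).
    by move=> iG mk bk; apply: cintbleMb => //; [exact: cmeas_coord|exact: cbounded_coord].
  move: e; rewrite s1 s2.
  rewrite cID; [|exact: (ic (fun t => (chi t)%:C%C))|by apply: cintbleZ; exact: (ic omc)].
  rewrite cIZ; last exact: (ic omc).
  rewrite [in RHS]cID; [|by apply: (ic (prim (fun t => (chi t)%:C%C))) => //; [exact: cmeas_prim|exact: cbounded_prim]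
      |by apply: cintbleZ; apply: (ic (prim omc)) => //; [exact: cmeas_prim|exact: cbounded_prim]].
  rewrite cIZ; last by apply: (ic (prim omc)) => //; [exact: cmeas_prim|exact: cbounded_prim].
  rewrite cI_real -/c /K0 rmorphN.
  move: (cI _ _) (cI _ _) (cI _ _) (cI _ _) => a1 a2 a3 a4 /eqP; rewrite -subr_eq0 => /eqP e.
  by rewrite -[RHS]e; ring.
have ms : measurable_fun setT (fun z : 'rV[mR]_n * mR => z.2 : R) by exact: measurable_snd.
have ae2 : {ae (Pn n \x Un)%E, forall z, unit_interval (z.2 : R)}.
  exact: (mpres_ae (mpres_snd (Pn n) Un) ae_Un_unit).
have := @fundamental_lemma_c R _ ('rV[mR]_n * mR)%type (product_subprobability ((Pn n : subprobability _ _), (Un : subprobability _ _))) K (fun z => z.2) (f j) iK ms ae2 K0E mfj bfj.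
by rewrite (unwind _ mfj bfj) fj0 mulr0 subr0 => /eqP; rewrite subr_eq0 => /eqP.
Qed.

Lemma ibp (f : 'I_n -> R -> R[i]) : (forall j, @cmeas _ mR _ (f j)) -> (forall j, cbounded (f j)) ->
  (forall j, cI Un (f j) = 0) ->
  cI (Pn n) (fun u => g u * \prod_j f j (u ord0 j)) =
  (-1) ^+ n * cI (Pn n) (fun u => h u * \prod_j prim (f j) (u ord0 j)).
Proof.
move=> mf bf f0.
have : admissible (enum 'I_n) f by move=> j; split; [exact: mf|exact: bf|exact: f0|rewrite mem_enum].
have := enum_uniq 'I_n; elim: (enum 'I_n) f {mf bf f0} => [f _|j r IH f /= /andP[jr ur]]; first exact: goal_nil.
by apply: step => // f' af'; exact: IH.
Qed.

End ibp.

End integration_by_parts.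

(** * Homogeneity of the integral without integrability *)

Section scaling.
Context {R : realType}.

(** Infinite or indeterminate integrals are sent to 0 by [fine] on both sides. This generality
    matters for sections of integrable functions, which are integrable only almost everywhere. *)
Lemma Rintegral_scale d (T : measurableType d) (m : {measure set T -> \bar R}) (c : R) (f : T -> R) :
  measurable_fun setT f -> \int[m]_x (c * f x) = c * \int[m]_x f x.
Proof.
move=> mf; have mEf : measurable_fun setT (EFin \o f) by exact/measurable_EFinP.
have pos (k : R) (g : T -> R) : measurable_fun setT g -> 0 < k -> \int[m]_x (k * g x) = k * \int[m]_x g x.
  move=> mg k0; have mEg : measurable_fun setT (EFin \o g) by exact/measurable_EFinP.
  rewrite /Rintegral [X in fine X = _]integralE [X in _ = _ * fine X]integralE.
  under eq_integral => x _.
    rewrite (_ : (fun x => (k * g x)%:E)^\+%E x = k%:E * (EFin \o g)^\+%E x)%E; first by over.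
    by rewrite !funeposE /= -!EFin_max -EFinM maxr_pMr ?(ltW k0)// mulr0.
  under [X in fine (_ - X)%E]eq_integral => x _.
    rewrite (_ : (fun x => (k * g x)%:E)^\-%E x = k%:E * (EFin \o g)^\-%E x)%E; first by over.
    by rewrite !funenegE /= -!EFin_max -EFinM maxr_pMr ?(ltW k0)// mulr0 mulrN.
  rewrite !ge0_integralZl ?lee_fin ?(ltW k0)//; [|exact: measurable_funeneg|exact: measurable_funepos].
  have := @integral_ge0 _ _ _ m setT (EFin \o g)^\+%E (fun x _ => funepos_ge0 _ _).
  have := @integral_ge0 _ _ _ m setT (EFin \o g)^\-%E (fun x _ => funeneg_ge0 _ _).
  case: (integral _ _ _) => [a| |] // _; case: (integral _ _ _) => [b| |] // _ /=.
  - by rewrite mulrBr.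
  - by rewrite gt0_muley ?lte_fin//= mulr0.
  - by rewrite gt0_muley ?lte_fin//= mulr0.
  - by rewrite gt0_muley ?lte_fin//= mulr0.
have opp (g : T -> R) : \int[m]_x (- g x) = - \int[m]_x g x.
  rewrite /Rintegral [X in fine X = _]integralE [X in _ = - fine X]integralE.
  under eq_integral => x _.
    rewrite (_ : (fun x => (- g x)%:E)^\+%E x = (EFin \o g)^\-%E x)%E; first by over.
    by rewrite funeposE funenegE.
  under [X in fine (_ - X)%E]eq_integral => x _.
    rewrite (_ : (fun x => (- g x)%:E)^\-%E x = (EFin \o g)^\+%E x)%E; first by over.
    by rewrite funeposE funenegE /= opprK.
  have := @integral_ge0 _ _ _ m setT (EFin \o g)^\+%E (fun x _ => funepos_ge0 _ _).
  have := @integral_ge0 _ _ _ m setT (EFin \o g)^\-%E (fun x _ => funeneg_ge0 _ _).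
  by case: (integral _ _ _) => [a| |] // _; case: (integral _ _ _) => [b| |] // _ /=; rewrite ?oppr0// opprB.
have [c0|c0|->] := ltgtP c 0; last 2 first.
- exact: pos.
- by rewrite mul0r; under eq_Rintegral do rewrite mul0r; rewrite Rintegral_cst// mul0r.
- rewrite -[c]opprK mulNr -pos ?oppr_gt0// -opp; apply: eq_Rintegral => x _.
  by rewrite mulNr.
Qed.

Lemma cI_scale d (T : measurableType d) (m : {measure set T -> \bar R}) (c : R) (f : T -> R[i]) :
  cmeas f -> cI m (fun x => c%:C%C * f x) = c%:C%C * cI m f.
Proof.
move=> [f1 f2]; rewrite /cI /cintegral.
under [X in Complex X _]eq_Rintegral do rewrite ReM/= mul0r subr0.
under [X in Complex _ X]eq_Rintegral do rewrite ImM/= mul0r addr0.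
rewrite (Rintegral_scale _ c f1)/= (Rintegral_scale _ c f2)/=.
by apply/eqP; rewrite eq_complex/= !mul0r subr0 addr0 !eqxx.
Qed.

Lemma integrable_prod d1 d2 (T1 : measurableType d1) (T2 : measurableType d2)
    (m1 : {sigma_finite_measure set T1 -> \bar R}) (m2 : {sigma_finite_measure set T2 -> \bar R})
    (f : T1 -> R) (g : T2 -> R) :
  m1.-integrable setT (EFin \o f) -> m2.-integrable setT (EFin \o g) ->
  (m1 \x m2)%E.-integrable setT (EFin \o (fun z => f z.1 * g z.2)).
Proof.
move=> i1 i2.
have m1f : measurable_fun setT f by exact/measurable_EFinP/(measurable_int m1).
have m2g : measurable_fun setT g by exact/measurable_EFinP/(measurable_int m2).
have mfg : measurable_fun setT (fun z : T1 * T2 => f z.1 * g z.2).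
  by apply: measurable_funM; [exact: measurableT_comp m1f measurable_fst|exact: measurableT_comp m2g measurable_snd].
apply/integrable12ltyP; first exact/measurable_EFinP.
have /integrableP[_ h1] := i1; have /integrableP[_ h2] := i2.
under eq_integral => x _.
  under eq_integral => y _ do rewrite /= normrM EFinM.
  rewrite ge0_integralZl//; last by apply/measurable_EFinP; exact: measurableT_comp.
  over.
rewrite ge0_integralZr//.
- apply: lte_mul_pinfty => //; first exact: integral_ge0.
  by rewrite ge0_fin_numE//; exact: integral_ge0.
- by apply/measurable_EFinP; exact: measurableT_comp.
- exact: integral_ge0.
Qed.

Lemma cintble_prod d1 d2 (T1 : measurableType d1) (T2 : measurableType d2)
    (m1 : {sigma_finite_measure set T1 -> \bar R}) (m2 : {sigma_finite_measure set T2 -> \bar R})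
    (f : T1 -> R[i]) (g : T2 -> R[i]) :
  cintble m1 f -> cintble m2 g -> cintble (m1 \x m2)%E (fun z => f z.1 * g z.2).
Proof.
move=> [f1 f2] [g1 g2]; split.
- have := integrableB measurableT (integrable_prod f1 g1) (integrable_prod f2 g2).
  by apply: eq_integrable => // z _ /=; rewrite ReM EFinB.
- have := integrableD measurableT (integrable_prod f1 g2) (integrable_prod f2 g1).
  by apply: eq_integrable => // z _ /=; rewrite ImM EFinD.
Qed.

End scaling.

(** * Averaging in one coordinate and weak derivatives *)

Section averaging.
Context {R : realType}.
Local Notation mR := (measurableTypeR R).

(* The projection proj1 in the coordinates of the cube, see wextc_proj1. *)
Definition Ek n (k : R -> R) (j : 'I_n) (g : 'rV[R]_n -> R[i]) (u : 'rV[R]_n) : R[i] :=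
  (k (u ord0 j))%:C%C * cI Un (fun t : mR => g (set_coord u j t)).

Section Ek.
Variables (n : nat) (k : R -> R) (j : 'I_n) (g : 'rV[R]_n -> R[i]).
Hypotheses (ig : cintble (Pn n) g) (ik : cintble Un (fun t : mR => (k t)%:C%C)).

Lemma section_cmeas u : @cmeas _ mR _ (fun t => g (set_coord u j t)).
Proof.
have mg := cintble_meas ig.
have [m1 m2] := mg; have [ms _] := mpres_set_coord (R := R) j.
have pm : measurable_fun setT (fun t : mR => (u, t) : 'rV[mR]_n * mR) by exact: measurable_pair1.
by split; [exact: (measurableT_comp m1 (measurableT_comp ms pm))|exact: (measurableT_comp m2 (measurableT_comp ms pm))].
Qed.

(** Exchanging u_j with the integration variable preserves the measure; it moves [k] onto the new
    variable and the replacement of the coordinate from [g] onto [eta]. *)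
Lemma Ek_fubini (eta : 'rV[R]_n -> R) : @measurable_fun _ _ 'rV[mR]_n _ setT eta ->
  (exists M, forall u, `|eta u| <= M) ->
  [/\ cintble (Pn n) (fun u => Ek k j g u * (eta u)%:C%C),
      cintble (Pn n \x Un)%E (fun z => g z.1 * ((k z.2)%:C%C * (eta (set_coord z.1 j z.2))%:C%C)) &
   cI (Pn n) (fun u => Ek k j g u * (eta u)%:C%C) =
   cI (Pn n \x Un)%E (fun z => g z.1 * ((k z.2)%:C%C * (eta (set_coord z.1 j z.2))%:C%C))].
Proof.
move=> meta [M etaM].
pose F (z : 'rV[mR]_n * mR) : R[i] := g z.1 * ((k z.2)%:C%C * (eta (set_coord z.1 j z.2))%:C%C).
have meta2 : cmeas (fun z : 'rV[mR]_n * mR => (eta (set_coord z.1 j z.2))%:C%C).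
  exact: (mpres_cmeas (mpres_set_coord j) (cmeas_real meta)).
have iF : cintble (Pn n \x Un)%E F.
  rewrite /F; under eq_fun do rewrite mulrA.
  apply: cintbleMb (cintble_prod ig ik) meta2 _.
  by exists M => z; rewrite normc_real.
have mF := cintble_meas iF.
have iFs := (mpres_cintble (mpres_swap_coord j) mF).2 iF.
have [h1 h2] := cI_fubini1 iFs.
have e : (fun u => cI Un (fun t : mR => F (set_coord (u, t).1 j (u, t).2, (u, t).1 ord0 j))) =
    (fun u => Ek k j g u * (eta u)%:C%C).
  apply/funext => u; rewrite /F /Ek /= mulrAC -rmorphM -cI_scale; last exact: section_cmeas.
  apply: eq_cI => t; rewrite mulrC -rmorphM; congr ((_ * eta _)%:C%C * _).
  by apply/rowP => i; rewrite !set_coordE; case: eqP => [->|].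
rewrite e in h1 h2; split => //.
by rewrite h2 (mpres_cI (mpres_swap_coord j) mF).
Qed.

Lemma Ek_cintble : cintble (Pn n) (Ek k j g).
Proof.
have [|h _ _] := @Ek_fubini (fun=> 1) (measurable_cst _); first by exists 1 => u; rewrite normr1.
by move: h; under eq_fun do rewrite mulr1.
Qed.

(** Integrating the new variable last presents the pairing as an average of pairings of [g] itself
    with slices of [eta]. *)
Lemma Ek_fubini2 (eta : 'rV[R]_n -> R) : @measurable_fun _ _ 'rV[mR]_n _ setT eta ->
  (exists M, forall u, `|eta u| <= M) ->
  cI (Pn n) (fun u => Ek k j g u * (eta u)%:C%C) =
  cI Un (fun t : mR => (k t)%:C%C * cI (Pn n) (fun u => g u * (eta (set_coord u j t))%:C%C)).
Proof.
move=> meta beta; have [_ h ->] := Ek_fubini meta beta; rewrite -(cI_fubini2 h).2.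
apply: eq_cI => t /=; rewrite -cI_scale; first by apply: eq_cI => u; rewrite mulrCA.
apply: cmeasM; first exact: cintble_meas ig.
have [ms _] := mpres_set_coord (R := R) j.
have pm : measurable_fun setT (fun u : 'rV[mR]_n => (u, t) : 'rV[mR]_n * mR) by exact: measurable_pair2.
by apply: cmeas_real; exact: (measurableT_comp meta (measurableT_comp ms pm)).
Qed.

End Ek.

Section slices.
Variables (n : nat) (j : 'I_n) (t : R).

Let c (i : 'I_n) : option 'I_n := if i == j then None else Some i.
Let cinj i i' k : c i = Some k -> c i' = Some k -> i = i'.
Proof. by rewrite /c; case: eqP => // _; case: eqP => // _ [->] [->]. Qed.

Lemma set_coord_rsubst (u : 'rV[R]_n) : set_coord u j t = rsubst c (fun=> t) u.
Proof. by apply/rowP => i; rewrite set_coordE mxE /c; case: eqP. Qed.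

Lemma smooth_slice (psi : 'rV[R]_n -> R) : smooth psi -> smooth (fun u => psi (set_coord u j t)).
Proof.
move=> sp; under eq_fun do rewrite set_coord_rsubst.
exact: (smooth_rsubst (fun=> t) cinj sp).
Qed.

Lemma partials_slice (psi : 'rV[R]_n -> R) r : smooth psi -> j \notin r ->
  partials r (fun u => psi (set_coord u j t)) = (fun u => partials r psi (set_coord u j t)).
Proof.
move=> sp; elim: r => [//|i r IH]; rewrite inE negb_or => /andP[ji jr] /=.
rewrite IH//; under eq_fun do rewrite set_coord_rsubst.
rewrite (partial_rsubst (fun=> t) cinj i (smooth_partials r sp)) /psubst.
case: pickP => [k|/(_ i)]; last by rewrite /c [i == j]eq_sym (negbTE ji) eqxx.
rewrite /c; case: (k == j) => [/eqP//|/eqP[->]].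
by apply/funext => u; rewrite set_coord_rsubst.
Qed.

Lemma test_slice (psi : 'rV[R]_n -> R) (chi : R -> R) : test_function psi -> test1 chi ->
  test_function (fun u => psi (set_coord u j t) * chi (u ord0 j)).
Proof.
move=> tp tchi; have [sp [e e0 he]] := test_margin tp; have [sc [f f0 hf]] := tchi.
apply: (@test_functionM _ _ _ _ (Num.min e f)).
- by rewrite lt_min e0.
- exact: smooth_slice.
- exact: smooth_coord1.
have m1 : Num.min e f <= e by rewrite ge_min lexx.
have m2 : Num.min e f <= f by rewrite ge_min lexx orbT.
move=> x /existsNP[i hi]; have [ij|/eqP ij] := eqVneq i j.
  rewrite hf ?mulr0//; apply/negP => /andP[h1 h2]; apply: hi.
  by rewrite ij; apply/andP; split; lra.
rewrite he ?mul0r// => /(_ i); rewrite set_coordE; case: eqP => // _ /andP[h1 h2]; apply: hi.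
by apply/andP; split; lra.
Qed.

Lemma section_smooth1 (psi : 'rV[R]_n -> R) u : smooth psi ->
  (forall r, is_derive r (1 : R) (fun r => psi (set_coord u j r)) (partial j psi (set_coord u j r))) /\
  smooth1 (fun r => psi (set_coord u j r)).
Proof.
have d p : smooth p -> forall r, is_derive r (1 : R) (fun r => p (set_coord u j r)) (partial j p (set_coord u j r)).
  move=> sp r; have /is_derive_line h := smooth_is_derive sp j (set_coord u j r).
  have h' := @is_derive_affine R (fun h => p (h *: delta_mx ord0 j + set_coord u j r)) 1 (- r) r (partial j p (set_coord u j r)).
  rewrite mul1r subrr in h'; have {h'} := h' h => h'.
  apply: (is_derive_ext h') => [y|]; last by rewrite mul1r.
  congr p; apply/rowP => i; rewrite row_line !set_coordE eq_sym mul1r.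
  by case: eqP => // _; rewrite addrAC addrK -?addrA ?subrK.
move=> sp; split; first exact: d.
move=> m; elim: m psi sp => [//|m IH] psi sp.
exists (fun r => partial j psi (set_coord u j r)); first exact: d.
by apply: IH; exact: smooth_partial.
Qed.

Lemma section_test1 (psi : 'rV[R]_n -> R) u : test_function psi ->
  test1 (fun r => psi (set_coord u j r)) /\
  derive1 (fun r => psi (set_coord u j r)) = fun r => partial j psi (set_coord u j r).
Proof.
move=> tp; have [sp [e e0 he]] := test_margin tp; have [d s] := section_smooth1 u sp.
split; last by apply/funext => r; rewrite derive1E; have [_ ->] := d r.
split => //; exists e => // r hr; apply: he => /(_ j).
by rewrite set_coordE eqxx => h; rewrite h in hr.
Qed.

(** The slice of [psi] at u_j = t is constant in u_j, hence not compactly supported. Multiplied by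
    chi(u_j) it becomes a test function, and derivatives in the directions of [v] do not see this
    factor; the fundamental lemma along the j-th coordinate then replaces it by 1. *)
Lemma wder_slice (v : {set 'I_n}) (g h : 'rV[R]_n -> R[i]) psi : j \notin v ->
  cintble (Pn n) g -> cintble (Pn n) h -> wder v g h -> test_function psi ->
  cI (Pn n) (fun u => g u * (partials (enum v) psi (set_coord u j t))%:C%C) =
  (-1) ^+ #|v| * cI (Pn n) (fun u => h u * (psi (set_coord u j t))%:C%C).
Proof.
move=> jv ig ih wgh tp.
have msl p : test_function p -> [/\ @cmeas _ 'rV[mR]_n _ (fun u => (p (set_coord u j t))%:C%C) &
    cbounded (fun u : 'rV[mR]_n => (p (set_coord u j t))%:C%C)].
  move=> tp'; split; last by have [M pM] := test_bounded tp'; exists M => u; rewrite normc_real.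
  have mp := test_measurable tp'; have [ms _] := mpres_set_coord (R := R) j.
  have pm : measurable_fun setT (fun u : 'rV[mR]_n => (u, t) : 'rV[mR]_n * mR) by exact: measurable_pair2.
  by apply: cmeas_real; exact: (measurableT_comp mp (measurableT_comp ms pm)).
have [m1 b1] := msl _ tp; have [m2 b2] := msl _ (test_partials (enum v) tp).
pose H u := g u * (partials (enum v) psi (set_coord u j t))%:C%C - (-1) ^+ #|v| * (h u * (psi (set_coord u j t))%:C%C).
have i1 : cintble (Pn n) (fun u => g u * (partials (enum v) psi (set_coord u j t))%:C%C) by exact: cintbleMb.
have i2 : cintble (Pn n) (fun u => h u * (psi (set_coord u j t))%:C%C) by exact: cintbleMb.
have iH : cintble (Pn n) H by apply: cintbleD => //; apply: cintbleN; exact: cintbleZ.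
have mj : measurable_fun setT (fun u : 'rV[mR]_n => u ord0 j : R) by exact: measurable_row_coord.
have aej : {ae Pn n, forall u : 'rV[mR]_n, unit_interval (u ord0 j : R)}.
  exact: (mpres_ae (mpres_coord j) ae_Un_unit).
have H0 chi : test1 chi -> cI (Pn n) (fun u => H u * (chi (u ord0 j))%:C%C) = 0.
  move=> tchi; have [sc _] := tchi.
  have mc : @cmeas _ 'rV[mR]_n _ (fun u => (chi (u ord0 j))%:C%C).
    by apply: (cmeas_coord j (b := fun t => (chi t)%:C%C)); exact: test1_cmeas.
  have bc : cbounded (fun u : 'rV[mR]_n => (chi (u ord0 j))%:C%C).
    by apply: (cbounded_coord j (b := fun t => (chi t)%:C%C)); exact: test1_cbounded.
  have := wgh _ (test_slice tp tchi).
  rewrite (@partialsM_indep _ _ _ (fun u => chi (u ord0 j))); first last.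
  - move=> i iv; rewrite partial_coord1//; case: eqP => // ij.
    by move: iv; rewrite mem_enum ij (negbTE jv).
  - exact: smooth_coord1.
  - by apply: smooth_slice; exact: test_smooth.
  rewrite partials_slice ?mem_enum//; last exact: test_smooth.
  under eq_cI do rewrite rmorphM mulrA.
  under [in RHS]eq_cI do rewrite rmorphM mulrA.
  move/eqP; rewrite -subr_eq0 => /eqP <-; rewrite -cIZ; last exact: cintbleMb.
  rewrite -cIB; [|exact: cintbleMb|by apply: cintbleZ; exact: cintbleMb].
  by apply: eq_cI => u; rewrite /H; ring.
(* Here the bounded function is the constant 1, which is not itself a test function. *)
have := fundamental_lemma_c iH mj aej H0 (cmeas_cst 1) (cbounded_cst 1).
under eq_cI do rewrite mulr1.
rewrite cIB//; last exact: cintbleZ.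
by rewrite cIZ// => /eqP; rewrite subr_eq0 => /eqP.
Qed.

End slices.

Lemma wder_Ek_notin n (v : {set 'I_n}) j k g h : j \notin v ->
  cintble Un (fun t : mR => (k t)%:C%C) -> cintble (Pn n) g -> cintble (Pn n) h ->
  wder v g h -> wder v (Ek k j g) (Ek k j h).
Proof.
move=> jv ik ig ih wgh psi tp.
have tp' := test_partials (enum v) tp.
rewrite (Ek_fubini2 j ig ik (test_measurable tp') (test_bounded tp')).
rewrite (Ek_fubini2 j ih ik (test_measurable tp) (test_bounded tp)).
have [_ F _] := Ek_fubini j ih ik (test_measurable tp) (test_bounded tp).
have [F2 _] := cI_fubini2 F.
rewrite -cIZ.
  by apply: eq_cI => t; rewrite (wder_slice t jv ig ih wgh tp); rewrite mulrCA.
move: F2; congr cintble; apply/funext => t /=.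
rewrite -cI_scale; first by apply: eq_cI => u; rewrite mulrCA.
apply: cmeasM; first exact: cintble_meas ih.
have [ms _] := mpres_set_coord (R := R) j.
have pm : measurable_fun setT (fun u : 'rV[mR]_n => (u, t) : 'rV[mR]_n * mR) by exact: measurable_pair2.
by apply: cmeas_real; exact: (measurableT_comp (test_measurable tp) (measurableT_comp ms pm)).
Qed.

Definition wder1 (w d : R -> R) := forall c, test1 c ->
  cI Un (fun t : mR => (w t)%:C%C * (derive1 c t)%:C%C) = - cI Un (fun t : mR => (d t)%:C%C * (c t)%:C%C).

(** After averaging, the only dependence on u_j is through [w], so the j-th derivative falls on [w]
    and only the derivative of [g] in the remaining directions is required. This is why [mixed] asks
    for all subsets at once. *)
Lemma wder_Ek_in n (v : {set 'I_n}) j w d g h : j \in v ->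
  cintble Un (fun t : mR => (w t)%:C%C) -> cintble Un (fun t : mR => (d t)%:C%C) -> wder1 w d ->
  cintble (Pn n) g -> cintble (Pn n) h ->
  wder (v :\ j)%SET g h -> wder v (Ek w j g) (Ek d j h).
Proof.
move=> jv iw id wd ig ih wgh psi tp.
have jv' : j \notin (v :\ j)%SET by rewrite !inE eqxx.
pose p' := partials (enum (v :\ j)%SET) psi.
have tp' : test_function p' by exact: test_partials.
(* By symmetry of mixed derivatives the direction [j] may be taken last, which prepares the
   one-dimensional integration by parts. *)
have e : partials (enum v) psi = partial j p'.
  rewrite (@partials_perm _ _ _ _ (j :: enum (v :\ j)%SET) (test_smooth tp))//.
  apply: uniq_perm; first exact: enum_uniq.
    by rewrite /= mem_enum !inE eqxx/= enum_uniq.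
  by move=> i; rewrite inE !mem_enum !inE; case: eqP => [->|].
have tpj : test_function (partial j p') by exact: (test_partials [:: j] tp').
have [_ F1 E1] := Ek_fubini j ig iw (test_measurable tpj) (test_bounded tpj).
have [_ F2 E2] := Ek_fubini j ig id (test_measurable tp') (test_bounded tp').
have E3 := Ek_fubini2 j ig id (test_measurable tp') (test_bounded tp').
rewrite e E1.
have -> : cI (Pn n \x Un)%E (fun z => g z.1 * ((w z.2)%:C%C * (partial j p' (set_coord z.1 j z.2))%:C%C)) =
    - cI (Pn n) (fun u => Ek d j g u * (p' u)%:C%C).
  rewrite E2 -(cI_fubini1 F1).2 -(cI_fubini1 F2).2 -cIN; last exact: (cI_fubini1 F2).1.
  apply: eq_cI => u /=.
  have [t1 t2] := section_test1 j u tp'.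
  have t1' := test1_derive t1; rewrite t2 in t1'.
  rewrite cIZ; last by apply: cintbleMb iw _ _; [exact: test1_cmeas t1'|exact: test1_cbounded t1'].
  rewrite cIZ; last by apply: cintbleMb id _ _; [exact: test1_cmeas t1|exact: test1_cbounded t1].
  by rewrite -mulrN -(wd _ t1) t2.
rewrite E3 (Ek_fubini2 j ih id (test_measurable tp) (test_bounded tp)).
rewrite (cardsD1 j v) jv exprS mulN1r mulNr; congr (- _).
have [_ F _] := Ek_fubini j ih id (test_measurable tp) (test_bounded tp).
have [F3 _] := cI_fubini2 F.
rewrite -cIZ.
  by apply: eq_cI => t; rewrite (wder_slice t jv' ig ih wgh tp); rewrite mulrCA.
move: F3; congr cintble; apply/funext => t /=.
rewrite -cI_scale; first by apply: eq_cI => u; rewrite mulrCA.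
apply: cmeasM; first exact: cintble_meas ih.
have [ms _] := mpres_set_coord (R := R) j.
have pm : measurable_fun setT (fun u : 'rV[mR]_n => (u, t) : 'rV[mR]_n * mR) by exact: measurable_pair2.
by apply: cmeas_real; exact: (measurableT_comp (test_measurable tp) (measurableT_comp ms pm)).
Qed.

(** An L^1 counterpart of [W12mix]: integrability is enough to pair with test functions and is
    preserved by [Ek], as Fubini shows directly. *)
Definition mixed n (g : 'rV[R]_n -> R[i]) := cintble (Pn n) g /\
  forall v : {set 'I_n}, exists2 h, cintble (Pn n) h & wder v g h.

Lemma wderD n (v : {set 'I_n}) (g h g' h' : 'rV[R]_n -> R[i]) : cintble (Pn n) g -> cintble (Pn n) h ->
  cintble (Pn n) g' -> cintble (Pn n) h' -> wder v g h -> wder v g' h' ->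
  wder v (fun u => g u - g' u) (fun u => h u - h' u).
Proof.
move=> ig ih ig' ih' w w' psi tp.
have tp' := test_partials (enum v) tp.
have cb p : test_function p -> @cmeas _ 'rV[mR]_n _ (fun u => (p u)%:C%C) /\ cbounded (fun u : 'rV[mR]_n => (p u)%:C%C).
  move=> h0; split; first by apply: cmeas_real; exact: test_measurable.
  by have [M pM] := test_bounded h0; exists M => u; rewrite normc_real.
have [m1 b1] := cb _ tp; have [m2 b2] := cb _ tp'.
under eq_cI do rewrite mulrBl.
under [in RHS]eq_cI do rewrite mulrBl.
rewrite cIB; [|exact: cintbleMb|exact: cintbleMb].
rewrite [in RHS]cIB; [|exact: cintbleMb|exact: cintbleMb].
by rewrite w// w'// mulrBr.
Qed.

Lemma mixedB n (g g' : 'rV[R]_n -> R[i]) : mixed g -> mixed g' -> mixed (fun u => g u - g' u).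
Proof.
move=> [ig hg] [ig' hg']; split; first by apply: cintbleD => //; exact: cintbleN.
move=> v; have [h ih w] := hg v; have [h' ih' w'] := hg' v.
exists (fun u => h u - h' u); first by apply: cintbleD => //; exact: cintbleN.
exact: wderD.
Qed.

Lemma mixed_Ek n (j : 'I_n) w d (g : 'rV[R]_n -> R[i]) :
  cintble Un (fun t : mR => (w t)%:C%C) -> cintble Un (fun t : mR => (d t)%:C%C) -> wder1 w d ->
  mixed g -> mixed (Ek w j g).
Proof.
move=> iw id wd [ig hg]; split; first exact: Ek_cintble.
move=> v; have [jv|jv] := boolP (j \in v).
  have [h ih wh] := hg (v :\ j)%SET.
  by exists (Ek d j h); [exact: Ek_cintble|exact: wder_Ek_in].
have [h ih wh] := hg v.
by exists (Ek w j h); [exact: Ek_cintble|exact: wder_Ek_notin].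
Qed.

End averaging.

(** * Real weak derivatives and restriction to a subset of the coordinates *)

Section weak_partials.
Context {R : realType}.
Local Notation mR := (measurableTypeR R).

Lemma patch_cube n (g : 'rV[R]_n -> R) u : @cube R n u -> (g \_ (@cube R n)) u = g u.
Proof. by move=> cu; rewrite patchE mem_set. Qed.

Lemma Rintegral_Pn n (g q : 'rV[R]_n -> R) :
  \int[Pn n]_u ((g \_ (@cube R n)) u * q u) = \int[lebesgue_row n]_(u in @cube R n) (g u * q u).
Proof.
rewrite /Rintegral -integral_Pn; congr fine; apply: eq_integral => u _.
by rewrite !patchE; case: ifP => //; rewrite mul0r.
Qed.

Lemma measurable_patch_cube n (g : 'rV[R]_n -> R) :
  measurable_fun (@cube R n : set 'rV[mR]_n) g <->
  @measurable_fun _ _ 'rV[mR]_n _ setT (g \_ (@cube R n)).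
Proof. by rewrite -measurable_restrictT//; exact: measurable_cube. Qed.

Lemma wder_real n (v : {set 'I_n}) (g h : 'rV[R]_n -> R) :
  wder v (fun u => ((g \_ (@cube R n)) u)%:C%C) (fun u => ((h \_ (@cube R n)) u)%:C%C) <->
  forall psi, test_function psi ->
      \int[lebesgue_row n]_(u in @cube R n) (g u * partials (enum v) psi u) =
      (-1) ^+ #|v| * \int[lebesgue_row n]_(u in @cube R n) (h u * psi u).
Proof.
split=> H psi tp; have {H} := H psi tp.
  under eq_cI do rewrite -rmorphM.
  under [in RHS]eq_cI do rewrite -rmorphM.
  rewrite !cI_real !Rintegral_Pn -(rmorphN1 (real_complex R)) -rmorphXn -rmorphM.
  by move=> /(congr1 (@complex.Re R)).
have e (a : 'rV[R]_n -> R) b : cI (Pn n) (fun u => ((a \_ (@cube R n)) u)%:C%C * (b u)%:C%C) =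
    (\int[lebesgue_row n]_(u in @cube R n) (a u * b u))%:C%C.
  by rewrite -Rintegral_Pn -cI_real; apply: eq_cI => u; rewrite rmorphM.
by rewrite !e => ->; rewrite rmorphM rmorphXn rmorphN1.
Qed.

Lemma margin_cube n (e : R) (x : 'rV[R]_n) : 0 < e -> margin e x -> @cube R n x.
Proof.
move=> e0 mx i; have /andP[h1 h2] := mx i; rewrite /unit_interval/= in_itv/=.
by apply/andP; split; lra.
Qed.

Lemma margin_compact n (e : R) : compact (margin e : set 'rV[R]_n).
Proof.
exact: (@rV_compact _ n (fun=> `[e, 1 - e]%classic) (fun=> @segment_compact _ _ _)).
Qed.

(** The open cube is a countable union of the compact boxes on which local integrability provides
    measurability. *)
Lemma loc_integrable_measurable n (g : 'rV[R]_n -> R) : loc_integrable g ->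
  measurable_fun (@cube R n : set 'rV[mR]_n) g.
Proof.
move=> lg.
have -> : @cube R n = \bigcup_k (margin (k.+2%:R^-1 : R)).
  apply/seteqP; split => [x cx|x [k _]]; last by apply: margin_cube; rewrite invr_gt0.
  pose e := \big[Num.min/1]_i Num.min (x ord0 i) (1 - x ord0 i).
  have e0 : 0 < e.
    apply: (big_ind (fun x => 0 < x)) => [|a b a0 b0|i _]; [exact: ltr01|by rewrite lt_min a0|].
    by have := cx i; rewrite /unit_interval/= in_itv/= => /andP[h1 h2]; rewrite lt_min h1 subr_gt0.
  have [k hk] : exists k, k.+2%:R^-1 < e.
    have [k hk] := ltr_add_invr e0.
    exists k; apply: le_lt_trans hk; rewrite add0r lef_pV2 ?posrE ?ltr0n// ler_nat; exact: leqnSn.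
  exists k => // i.
  have : e <= Num.min (x ord0 i) (1 - x ord0 i) by exact: bigmin_le_cond.
  rewrite le_min => /andP[h1 h2]; have h3 := lt_le_trans hk h1; have h4 := lt_le_trans hk h2.
  by rewrite (ltW h3) lerBrDl -lerBrDr (ltW h4).
apply/measurable_fun_bigcup => [k|k]; first exact: compact_row_measurable (@margin_compact n _).
apply/measurable_EFinP; apply: (measurable_int (lebesgue_row n)).
apply: lg; first exact: margin_compact.
by move=> x; apply: margin_cube; rewrite invr_gt0.
Qed.

Lemma integrable_Pn n (g : 'rV[R]_n -> R) : (Pn n).-integrable setT (EFin \o (g \_ (@cube R n))) <->
  (lebesgue_row n).-integrable (@cube R n : set 'rV[mR]_n) (EFin \o g).
Proof.
have e : (\int[Pn n]_x `|(EFin \o (g \_ (@cube R n))) x| = \int[lebesgue_row n]_(x in @cube R n) `|(EFin \o g) x|)%E.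
  rewrite -integral_Pn; apply: eq_integral => u _ /=; rewrite !patchE.
  by case: ifP => // _; rewrite normr0.
split=> /integrableP[m1 h]; apply/integrableP; split; rewrite ?e//; rewrite -?e//.
  by apply/measurable_EFinP/measurable_patch_cube/measurable_EFinP.
by apply/measurable_EFinP/measurable_patch_cube/measurable_EFinP.
Qed.

Lemma integrable_loc n (g : 'rV[R]_n -> R) :
  (Pn n).-integrable setT (EFin \o (g \_ (@cube R n))) -> loc_integrable g.
Proof.
move=> /integrable_Pn ig K cK Kc; apply: integrableS ig => //; first exact: measurable_cube.
exact: compact_row_measurable.
Qed.

Definition sqnorm n (g : 'rV[R]_n -> R) : \bar R := (\int[Pn n]_u ((g \_ (@cube R n)) u ^+ 2)%:E)%E.

Lemma sqnorm_ge0 n (g : 'rV[R]_n -> R) : (0 <= sqnorm g)%E.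
Proof. by apply: integral_ge0 => u _; rewrite lee_fin sqr_ge0. Qed.

Lemma L2norm_pow n (g : 'rV[R]_n -> R) a : (L2norm g `^ (2 * a) = sqnorm g `^ a)%E.
Proof.
rewrite poweRrM /L2norm poweR_Lnorm ?pnatr_eq0//; congr (_ `^ _)%E.
transitivity (\int[Pn n]_u (((fun u => (g u ^+ 2)%:E) \_ (@cube R n)) u))%E.
  rewrite integral_Pn [RHS]integral_mkcond; apply: eq_integral => u _ /=; rewrite !patchE.
  rewrite powR_mulrn//; case: ifP => _; first by rewrite real_normK ?num_real.
  by rewrite normr0 expr0n.
by apply: eq_integral => u _; rewrite !patchE; case: ifP => //; rewrite expr0n.
Qed.

Lemma sqnorm_integrable n (g : 'rV[R]_n -> R) : measurable_fun (@cube R n : set 'rV[mR]_n) g ->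
  (sqnorm g < +oo)%E -> (Pn n).-integrable setT (EFin \o (g \_ (@cube R n))).
Proof.
move=> /measurable_patch_cube mg goo; apply/integrableP; split; first exact/measurable_EFinP.
(* The total mass is 1, so |x| <= 1 + x^2 gives L^2 in L^1. *)
apply: le_lt_trans (_ : (\int[Pn n]_u (1%:E + ((g \_ (@cube R n)) u ^+ 2)%:E) < +oo)%E); last first.
  rewrite ge0_integralD//; first last.
  - by apply/measurable_EFinP; exact: measurable_funX.
  - by move=> u _; rewrite lee_fin sqr_ge0.
  by rewrite integral_cst// mul1e lte_add_pinfty// Pn_lty.
apply: ge0_le_integral => //.
- by apply/measurable_EFinP; exact: measurableT_comp.
- by apply/measurable_EFinP; apply: measurable_funD => //; exact: measurable_funX.
move=> u _ /=; rewrite -EFinD lee_fin; set x := patch _ _ _ _.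
have := sqr_ge0 (`|x| - 1); rewrite sqrrB1 real_normK ?num_real// => h.
have := normr_ge0 x; lra.
Qed.

Lemma inL2_integrable n (g : 'rV[R]_n -> R) : inL2 g ->
  (Pn n).-integrable setT (EFin \o (g \_ (@cube R n))).
Proof.
move=> [mg goo]; apply: sqnorm_integrable => //; rewrite -[sqnorm g]poweRe1 ?sqnorm_ge0// -L2norm_pow.
exact: poweR_lty.
Qed.

Lemma W12mix_mixed n (g : 'rV[R]_n -> R) : W12mix g ->
  mixed (fun u => ((g \_ (@cube R n)) u)%:C%C).
Proof.
move=> [gL2 hg]; split; first by apply: cintble_real; exact: inL2_integrable.
move=> v; have [h [_ _ wh] hL2] := hg v.
exists (fun u => ((h \_ (@cube R n)) u)%:C%C); first by apply: cintble_real; exact: inL2_integrable.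
exact/wder_real.
Qed.

Section transfer.
Variables (s : nat) (v : {set 'I_s}) (om : 'I_s -> R -> R).
Hypothesis tom : forall j, test1 (om j).

Definition transfer (H : 'rV[R]_s -> R[i]) (y : 'rV[R]_#|v|) : R[i] :=
  cI (Pn s) (fun z => H (merge y z) * (tensor om (enum (~: v)%SET) z)%:C%C).

Let mom : @cmeas _ 'rV[mR]_s _ (fun z => (tensor om (enum (~: v)%SET) z)%:C%C).
Proof.
under eq_fun do rewrite rmorph_prod; apply: cmeas_prod => j.
by apply: (cmeas_coord j (b := fun t => (om j t)%:C%C)); exact: test1_cmeas.
Qed.

Let bom : cbounded (fun z : 'rV[mR]_s => (tensor om (enum (~: v)%SET) z)%:C%C).
Proof.
under eq_fun do rewrite rmorph_prod; apply: cbounded_prod => j.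
by apply: (cbounded_coord j (b := fun t => (om j t)%:C%C)); exact: test1_cbounded.
Qed.

Let tensor_merge (y : 'rV[R]_#|v|) z : tensor om (enum (~: v)%SET) (merge y z) = tensor om (enum (~: v)%SET) z.
Proof.
apply: eq_big_seq => j; rewrite mem_enum inE => jv; by rewrite merge_out.
Qed.

Lemma transfer_pairing H (q : 'rV[R]_#|v| -> R) : cintble (Pn s) H ->
  @measurable_fun _ _ 'rV[mR]_#|v| _ setT q -> (exists M, forall y, `|q y| <= M) ->
  cintble (Pn #|v|) (fun y => transfer H y * (q y)%:C%C) /\
  cI (Pn #|v|) (fun y => transfer H y * (q y)%:C%C) =
  cI (Pn s) (fun u => H u * (q (res v u) * tensor om (enum (~: v)%SET) u)%:C%C).
Proof.
move=> iH mq [M qM].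
pose F u := H u * (q (res v u) * tensor om (enum (~: v)%SET) u)%:C%C.
have mqr : @cmeas _ 'rV[mR]_s _ (fun u => (q (res v u))%:C%C).
  exact: (mpres_cmeas (mpres_res v) (cmeas_real mq)).
have bqr : cbounded (fun u : 'rV[mR]_s => (q (res v u))%:C%C).
  by exists M => u; rewrite normc_real.
have iF : cintble (Pn s) F.
  apply: cintbleMb iH _ _; under eq_fun do rewrite rmorphM.
    exact: cmeasM.
  exact: cboundedM.
have mF := cintble_meas iF.
have iF2 := (mpres_cintble (mpres_merge v) mF).2 iF.
have [h1 h2] := cI_fubini1 iF2.
have e : (fun y => cI (Pn s) (fun z => F (merge (y, z).1 (y, z).2))) = (fun y => transfer H y * (q y)%:C%C).
  apply/funext => y; rewrite /transfer [RHS]mulrC.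
  have mH : @cmeas _ 'rV[mR]_s _ (fun z => H (merge y z)).
    have [mm _] := mpres_merge (R := R) v.
    have pm : measurable_fun setT (fun z : 'rV[mR]_s => (y, z) : 'rV[mR]_#|v| * 'rV[mR]_s) by exact: measurable_pair1.
    have [a b] := cintble_meas iH.
    by split; [exact: (measurableT_comp a (measurableT_comp mm pm))|exact: (measurableT_comp b (measurableT_comp mm pm))].
  rewrite -cI_scale; last exact: cmeasM.
  apply: eq_cI => z; rewrite /F /= res_merge tensor_merge rmorphM; ring.
rewrite e in h1 h2; split => //.
by rewrite h2 (mpres_cI (mpres_merge v) mF).
Qed.

Lemma transfer_cintble H : cintble (Pn s) H -> cintble (Pn #|v|) (transfer H).
Proof.
move=> iH; have [|h _] := transfer_pairing iH (measurable_cst (1 : R)).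
  by exists 1 => y; rewrite normr1.
by move: h; under eq_fun do rewrite mulr1.
Qed.

Let c (i : 'I_#|v|) : option 'I_s := Some (enum_val i).
Let cinj i i' j : c i = Some j -> c i' = Some j -> i = i'.
Proof. by rewrite /c => -[<-] [/enum_val_inj ->]. Qed.
Let resE (u : 'rV[R]_s) : res v u = rsubst c (fun=> 0) u.
Proof. by apply/rowP => i; rewrite !mxE. Qed.

Lemma smooth_res (psi : 'rV[R]_#|v| -> R) : smooth psi -> smooth (fun u => psi (res v u)).
Proof. by move=> sp; under eq_fun do rewrite resE; exact: smooth_rsubst. Qed.

Lemma partials_res (psi : 'rV[R]_#|v| -> R) r : smooth psi ->
  partials (map enum_val r) (fun u => psi (res v u)) = fun u => partials r psi (res v u).
Proof.
move=> sp; elim: r => [//|i r IH] /=.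
rewrite IH; under eq_fun do rewrite resE.
rewrite (partial_rsubst (fun=> 0) cinj (enum_val i) (smooth_partials r sp)) /psubst.
case: pickP => [k|/(_ i)]; last by rewrite /c eqxx.
rewrite /c => /eqP[/enum_val_inj ->].
by apply/funext => u; rewrite resE.
Qed.

(** A test function in the coordinates of [v] becomes one on the large cube only after
    multiplication by compactly supported factors in the other coordinates; these factors are
    constant in the directions of [v] and survive differentiation. *)
Lemma test_lift (psi : 'rV[R]_#|v| -> R) : test_function psi ->
  test_function (fun u => psi (res v u) * tensor om (enum (~: v)%SET) u) /\
  partials (enum v) (fun u => psi (res v u) * tensor om (enum (~: v)%SET) u) =
  fun u => partials (enum [set: 'I_#|v|]%SET) psi (res v u) * tensor om (enum (~: v)%SET) u.
Proof.
move=> tp; have [sp [e e0 he]] := test_margin tp.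
have som j : smooth1 (om j) by have [] := tom j.
have st : smooth (tensor om (enum (~: v)%SET)) by exact: smooth_tensor.
split.
  have /choice[f hf] : forall j, exists f : R, 0 < f /\ forall t, ~~ (f <= t <= 1 - f) -> om j t = 0.
    by move=> j; have [_ [f f0 hf]] := tom j; exists f.
  pose m := \big[Num.min/e]_j f j.
  have m0 : 0 < m by apply: (big_ind (fun x => 0 < x)) => // [a b a0 b0|j _]; [rewrite lt_min a0|have [] := hf j].
  have me : m <= e by exact: bigmin_le_id.
  have mf j : m <= f j by exact: bigmin_le_cond.
  apply: (test_functionM m0) => //; first exact: smooth_res.
  move=> x /existsNP[j hj]; have [jv|jv] := boolP (j \in v).
    have [i ij] := in_setP_enum jv.
    rewrite he ?mul0r// => /(_ i); rewrite mxE -ij => /andP[h1 h2]; apply: hj.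
    by apply/andP; split; lra.
  rewrite /tensor (big_rem j)/=; last by rewrite mem_enum inE.
  rewrite (hf j).2 ?mul0r ?mulr0//; apply/negP => /andP[h1 h2]; apply: hj.
  by have := mf j; move=> h3; apply/andP; split; lra.
rewrite partialsM_indep//; last 2 first.
- exact: smooth_res.
- move=> i; rewrite mem_enum => iv; apply: partial_tensor_notin => //.
  by rewrite mem_enum inE iv.
rewrite (@partials_perm _ _ _ _ (map enum_val (enum [set: 'I_#|v|]%SET)) (smooth_res sp)).
  by rewrite partials_res.
apply: uniq_perm; [exact: enum_uniq|by rewrite map_inj_uniq ?enum_uniq//; exact: enum_val_inj|].
move=> j; rewrite mem_enum; apply/idP/mapP => [jv|[i _ ->]]; last exact: enum_valP.
by have [i ->] := in_setP_enum jv; exists i => //; rewrite mem_enum inE.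
Qed.

Lemma wder_transfer H H' : cintble (Pn s) H -> cintble (Pn s) H' -> wder v H H' ->
  wder [set: 'I_#|v|]%SET (transfer H) (transfer H').
Proof.
move=> iH iH' w psi tp; have [tl pl] := test_lift tp.
have tp' := test_partials (enum [set: 'I_#|v|]%SET) tp.
have [_ ->] := transfer_pairing iH (test_measurable tp') (test_bounded tp').
have [_ ->] := transfer_pairing iH' (test_measurable tp) (test_bounded tp).
have := w _ tl; rewrite pl cardsT card_ord => <-; exact: eq_cI.
Qed.

End transfer.

(** Otherwise [w] would annihilate every test function, hence by the fundamental lemma also the
    constant 1, against its integral being 1. *)
Lemma exists_test1_weight (w : R -> R) : Un.-integrable setT (EFin \o (w : mR -> R)) ->
  \int[Un]_t w t = 1 -> exists2 om : R -> R, test1 om & \int[Un]_t (w t * om t) = 1.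
Proof.
move=> iw w1.
have [[c tc c0]|h] := pselect (exists2 c : R -> R, test1 c & \int[Un]_t (w t * c t) != 0); last first.
  have id_meas : measurable_fun setT (fun t : mR => t : R) by exact: measurable_id.
  have := fundamental_lemma iw id_meas ae_Un_unit _ (measurable_cst (1 : R)) (fun _ => _ : `|1| <= 1).
  under eq_Rintegral do rewrite mulr1.
  rewrite w1 => E; have : (1 : R) = 0.
    apply: E; last by rewrite normr1.
    by move=> chi tchi; apply/eqP; apply/negPn/negP => c0; apply: h; exists chi.
  by move/eqP; rewrite oner_eq0.
exists (fun t => (\int[Un]_t (w t * c t))^-1 * c t); first exact: test1Z.
under eq_Rintegral do rewrite mulrCA.
rewrite Rintegral_scale ?mulVf//; apply: measurable_funM; last exact: test1_measurable.
by apply/measurable_EFinP; exact: (measurable_int _ iw).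
Qed.

Lemma eq_cI_cube n (f g : 'rV[R]_n -> R[i]) : @cmeas _ 'rV[mR]_n _ f -> @cmeas _ 'rV[mR]_n _ g ->
  (forall u, @cube R n u -> f u = g u) -> cI (Pn n) f = cI (Pn n) g.
Proof. move=> mf mg fg; apply: ae_eq_cI => //; have [N [mN N0 hN]] := ae_Pn_cube (R := R) n.
by exists N; split => // u nfg; apply: hN => /= cu; apply: nfg; exact: fg. Qed.

Lemma integrable_patch n (f : 'rV[R]_n -> R) : (Pn n).-integrable setT (EFin \o (f : 'rV[mR]_n -> R)) ->
  (Pn n).-integrable setT (EFin \o (f \_ (@cube R n))).
Proof.
move=> i_f; have i_f' := i_f; apply: le_integrable i_f' => //.
  apply/measurable_EFinP/measurable_patch_cube; apply: measurable_funTS.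
  by apply/measurable_EFinP; exact: (measurable_int _ i_f).
by move=> u _ /=; rewrite patchE; case: ifP => //; rewrite normr0 lee_fin.
Qed.

(* Testing G in the coordinates outside v against functions om j with
   \int w j * om j = 1 recovers g, and this commutes with weak derivatives in
   the directions of v. *)
Lemma restriction_weak_partial s (v : {set 'I_s}) (G : 'rV[R]_s -> R[i]) (g : 'rV[R]_#|v| -> R)
    (w : 'I_s -> R -> R) : mixed G ->
  (forall j, @measurable_fun _ _ mR _ setT (w j)) -> (forall j, exists M, forall t, `|w j t| <= M) ->
  (forall j, \int[Un]_t w j t = 1) ->
  (forall u, @cube R s u -> G u = (g (res v u) * \prod_(j in ~: v) w j (u ord0 j))%:C%C) ->
  (Pn #|v|).-integrable setT (EFin \o (g \_ (@cube R #|v|))) /\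
  is_weak_partial [set: 'I_#|v|]%SET g (weak_partial [set: 'I_#|v|]%SET g).
Proof.
move=> [iG hG] mw bw w1 GE.
have /choice[om hom] : forall j, exists om : R -> R, test1 om /\ \int[Un]_t (w j t * om t) = 1.
  move=> j; have iw : Un.-integrable setT (EFin \o (w j : mR -> R)).
    by have [M hM] := bw j; exact: integrable_bounded Un_lty (mw j) hM.
  by have [om] := exists_test1_weight iw (w1 j); exists om.
have tom j : test1 (om j) := (hom j).1.
have [H iH wH] := hG v.
have iTG : cintble (Pn #|v|) (transfer om G) by exact: transfer_cintble.
have iTH : cintble (Pn #|v|) (transfer om H) by exact: transfer_cintble.
have wT := wder_transfer tom iG iH wH.
(* Every coordinate outside [v] contributes the integral of [w j] times [om j], which was normalised
   to 1. *)
have gE y : @cube R #|v| y -> transfer om G y = (g y)%:C%C.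
  move=> cy.
  pose b j t : R[i] := (w j t * om j t)%:C%C.
  have mb j : @cmeas _ mR _ (b j) by apply: cmeas_real; apply: measurable_funM => //; exact: test1_measurable.
  have bb j : cbounded (b j).
    have [M hM] := bw j; have [N hN] := test1_bounded (tom j).
    by exists (M * N) => t; rewrite normc_real normrM; exact: ler_pM.
  have mt : @cmeas _ 'rV[mR]_s _ (fun z => (tensor om (enum (~: v)%SET) z)%:C%C).
    under eq_fun do rewrite rmorph_prod; apply: cmeas_prod => j.
    by apply: (cmeas_coord j (b := fun t => (om j t)%:C%C)); exact: test1_cmeas.
  have mG : @cmeas _ 'rV[mR]_s _ (fun z => G (merge y z)).
    have [mm _] := mpres_merge (R := R) v.
    have pm : measurable_fun setT (fun z : 'rV[mR]_s => (y, z) : 'rV[mR]_#|v| * 'rV[mR]_s) by exact: measurable_pair1.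
    have [m1 m2] := cintble_meas iG.
    by split; [exact: (measurableT_comp m1 (measurableT_comp mm pm))|exact: (measurableT_comp m2 (measurableT_comp mm pm))].
  have mB : @cmeas _ 'rV[mR]_s _ (fun z => \prod_(j <- enum (~: v)%SET) b j (z ord0 j)).
    by apply: cmeas_prod => j; exact: cmeas_coord.
  transitivity (cI (Pn s) (fun z => (g y)%:C%C * \prod_(j <- enum (~: v)%SET) b j (z ord0 j))).
    apply: eq_cI_cube; [exact: cmeasM|by apply: cmeasM => //; exact: cmeas_cst|].
    move=> z cz; rewrite GE; last first.
      move=> j; have [/in_setP_enum[i ->]|jv] := boolP (j \in v); first by rewrite merge_in.
      by rewrite merge_out.
    rewrite res_merge rmorphM -mulrA; congr (_ * _).
    rewrite -rmorphM /tensor -[in LHS]big_enum -big_split/= rmorph_prod.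
    apply: eq_big_seq => j; rewrite mem_enum inE => jv.
    by rewrite merge_out.
  rewrite cI_scale//.
  have := @cI_indep_prod R s (enum (~: v)%SET) (fun=> 1) b (enum_uniq _) _ _ mb bb.
  under eq_cI do rewrite mul1r.
  move=> ->; last 2 first.
  - by apply: cintble_bounded (Pn_lty s) (cmeas_cst 1) (cbounded_cst 1).
  - by [].
  rewrite cI_cst ?mul1r; last exact: probability_setT.
  rewrite big1 ?mulr1// => j _; rewrite /b cI_real.
  by rewrite (hom j).2.
have iRe k : cintble (Pn #|v|) k ->
    (Pn #|v|).-integrable setT (EFin \o ((fun y => complex.Re (k y)) \_ (@cube R #|v|))).
  by move=> [ik _]; exact: integrable_patch.
have gE' : (g \_ (@cube R #|v|)) = (fun y => complex.Re (transfer om G y)) \_ (@cube R #|v|).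
  by apply/funext => y; rewrite !patchE; case: ifP => // /set_mem/gE ->.
have ig : (Pn #|v|).-integrable setT (EFin \o (g \_ (@cube R #|v|))) by rewrite gE'; exact: iRe.
(* [weak_partial] is a choice, and the chosen function is a weak derivative as soon as one exists;
   the real part of the transferred derivative is one, since [g] is real. *)
split => //; apply: getPex; exists (fun y => complex.Re (transfer om H y)).
split; [exact: integrable_loc|by apply: integrable_loc; exact: iRe|move=> psi tp].
have tp' := test_partials (enum [set: 'I_#|v|]%SET) tp.
have mRe k q : cintble (Pn #|v|) k -> test_function q ->
   \int[Pn #|v|]_u (((fun y => complex.Re (k y)) \_ (@cube R #|v|)) u * q u) = complex.Re (cI (Pn #|v|) (fun u => k u * (q u)%:C%C)).
  move=> ik tq; have mq := test_measurable tq.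
  transitivity (complex.Re (cI (Pn #|v|) (fun u => ((((fun y => complex.Re (k y)) \_ (@cube R #|v|)) u * q u)%:C%C)))).
    by rewrite cI_real.
  transitivity (complex.Re (cI (Pn #|v|) (fun u => (complex.Re (k u) * q u)%:C%C))).
    have m1 : @measurable_fun _ _ 'rV[mR]_#|v| _ setT ((fun y => complex.Re (k y)) \_ (@cube R #|v|)).
      by apply/measurable_EFinP; exact: (measurable_int _ (iRe _ ik)).
    have [m2 _] := cintble_meas ik.
    congr complex.Re; apply: eq_cI_cube; [by apply: cmeas_real; exact: measurable_funM|by apply: cmeas_real; exact: measurable_funM|].
    by move=> u cu; rewrite patch_cube.
  rewrite !Re_cI; apply: eq_Rintegral => u _; by rewrite ReM/= mulr0 subr0.
rewrite -!Rintegral_Pn gE' (mRe _ _ iTG tp') (mRe _ _ iTH tp) (wT _ tp).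
by rewrite -(rmorphN1 (real_complex R)) -rmorphXn ReM/= mul0r subr0.
Qed.

End weak_partials.

(** * Weights and transport *)

Section calculus.
Context {R : realType}.
Local Notation mR := (measurableTypeR R).

Lemma is_derive_cvg (F : R -> R) c d : is_derive c (1 : R) F d <->
  (fun h : R => h^-1 *: (F (h *: 1 + c) - F c)) @ 0^' --> d.
Proof.
split=> [[dF <-]|h]; first exact: dF.
by apply: DeriveDef; [exact: cvgP h|exact: cvg_lim h].
Qed.

Lemma is_derive_glue (F F1 F2 : R -> R) c d :
  (forall x, x <= c -> F x = F1 x) -> (forall x, c <= x -> F x = F2 x) ->
  is_derive c (1 : R) F1 d -> is_derive c (1 : R) F2 d -> is_derive c (1 : R) F d.
Proof.
move=> h1 h2 /is_derive_cvg d1 /is_derive_cvg d2; apply/is_derive_cvg.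
apply/cvgrPdist_le => e e0; near=> h.
have c1 : `|d - h^-1 *: (F1 (h *: 1 + c) - F1 c)| <= e.
  by near: h; move/cvgrPdist_le : d1; exact.
have c2 : `|d - h^-1 *: (F2 (h *: 1 + c) - F2 c)| <= e.
  by near: h; move/cvgrPdist_le : d2; exact.
have [h0|h0] := leP h 0.
  rewrite (h1 c) ?lexx// h1//; by rewrite /GRing.scale/= mulr1 gerDr.
rewrite (h2 c) ?lexx// h2//; by rewrite /GRing.scale/= mulr1 lerDr ltW.
Unshelve. all: by end_near. Qed.

Definition glue (c : R) (f g : R -> R) x := if x <= c then f x else g x.

Lemma glue_le c f g x : x <= c -> glue c f g x = f x.
Proof. by rewrite /glue => ->. Qed.

Lemma glue_ge c f g x : f c = g c -> c <= x -> glue c f g x = g x.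
Proof. by move=> e; rewrite /glue; have [xc cx|] := leP x c => //; rewrite (@le_anti _ _ x c) ?xc. Qed.

(** Records only that [F] has derivative [f] everywhere; continuity of [f] is stated separately
    wherever the fundamental theorem of calculus needs it. *)
Definition C1 (F f : R -> R) := forall x, is_derive x (1 : R) F (f x).

Lemma C1_continuous F f : C1 F f -> continuous F.
Proof.
move=> h x; have [d1 _] := h x.
by apply: differentiable_continuous; exact/derivable1_diffP.
Qed.

Lemma C1_glue c F1 F2 f1 f2 : C1 F1 f1 -> C1 F2 f2 -> F1 c = F2 c -> f1 c = f2 c ->
  C1 (glue c F1 F2) (glue c f1 f2).
Proof.
move=> d1 d2 e e' x; have [xc|xc|->] := ltgtP x c.
- rewrite glue_le ?ltW//; apply: near_eq_is_derive (d1 x).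
  near=> y; rewrite glue_le//; near: y; exact: lt_le_nbhsl.
- rewrite glue_ge ?ltW//; apply: near_eq_is_derive (d2 x).
  near=> y; rewrite glue_ge//; near: y; exact: lt_le_nbhsr.
- rewrite glue_le//; apply: (@is_derive_glue _ F1 F2) => //.
  + by move=> y yc; rewrite glue_le.
  + by move=> y yc; rewrite glue_ge.
  + by rewrite e'.
Unshelve. all: by end_near. Qed.

Lemma continuous_glue c f g : continuous f -> continuous g -> f c = g c -> continuous (glue c f g).
Proof.
move=> cf cg e x.
have -> : glue c f g = fun x => f (Num.min x c) + g (Num.max x c) - f c.
  apply/funext => y; rewrite /glue; have [yc|cy] := leP y c; first by rewrite e addrK.
  by rewrite addrC addKr.
apply: cvgB; last exact: cvg_cst.
apply: cvgD.
  apply: (@continuous_comp _ _ _ (fun x => Num.min x c) f); last exact: cf.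
  by apply: continuous_min; [exact: cvg_id|exact: cvg_cst].
apply: (@continuous_comp _ _ _ (fun x => Num.max x c) g); last exact: cg.
by apply: continuous_max; [exact: cvg_id|exact: cvg_cst].
Qed.

Lemma C1Z (k : R) F f : C1 F f -> C1 (fun x => k * F x) (fun x => k * f x).
Proof. by move=> h x; apply: (is_derive_ext (is_deriveZ k (h x))). Qed.

Lemma C1D F G f g : C1 F f -> C1 G g -> C1 (fun x => F x + G x) (fun x => f x + g x).
Proof. by move=> h h' x; apply: (is_derive_ext (is_deriveD (h x) (h' x))). Qed.

Lemma C1M F G f g : C1 F f -> C1 G g -> C1 (fun x => F x * G x) (fun x => F x * g x + f x * G x).
Proof.
move=> h h' x; apply: (is_derive_ext (is_deriveM (h x) (h' x))) => //.
by rewrite /GRing.scale/= [G x * _]mulrC.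
Qed.

Lemma C1_cst k : C1 (fun=> k) (fun=> 0).
Proof. by move=> x; exact: is_derive_cst. Qed.

Lemma C1_id : C1 id (fun=> 1).
Proof. by move=> x; exact: is_derive_id. Qed.

Lemma C1_affine F f c a : C1 F f -> C1 (fun x => F (c * x + a)) (fun x => c * f (c * x + a)).
Proof. by move=> h x; apply: is_derive_affine. Qed.

Lemma C1_ext F f G g : C1 F f -> F =1 G -> f =1 g -> C1 G g.
Proof. by move=> h /funext <- /funext <-. Qed.

Lemma C1_le F f a b : C1 F f -> a <= b -> (forall t, a <= t <= b -> 0 <= f t) -> F a <= F b.
Proof.
move=> h ab f0; have cF : {within `[a, b], continuous F} by apply: continuous_subspaceT; exact: C1_continuous h.
have [c + e] := MVT_segment ab (fun x _ => h x) cF.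
by rewrite in_itv/= => /f0 fc; rewrite -subr_ge0 e mulr_ge0// subr_ge0.
Qed.

Lemma C1_lt F f a b : C1 F f -> a < b -> (forall t, a < t < b -> 0 < f t) -> F a < F b.
Proof.
move=> h ab f0; have cF : {within `[a, b], continuous F} by apply: continuous_subspaceT; exact: C1_continuous h.
have [c + e] := MVT ab (fun x _ => h x) cF.
by rewrite in_itv/= => /f0 fc; rewrite -subr_gt0 e mulr_gt0// subr_gt0.
Qed.

Lemma FTC_cc F f a b : C1 F f -> continuous f -> a < b ->
  (@lebesgue_measure R).-integrable `[a, b] (EFin \o f) /\
  \int[@lebesgue_measure R]_(t in `[a, b]%classic) f t = F b - F a.
Proof.
move=> h cf ab; have cf' : {within `[a, b], continuous f} by exact: continuous_subspaceT.
split; first by apply: continuous_compact_integrable => //; exact: segment_compact.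
have cF := C1_continuous h.
rewrite /Rintegral (@continuous_FTC2 R f F a b ab cf')//.
- by split; [move=> x _; have [] := h x|apply: cvg_at_right_filter; exact: cF|apply: cvg_at_left_filter; exact: cF].
- by move=> x _; rewrite derive1E; have [_ ->] := h x.
Qed.

Lemma FTC_oc F f a b : C1 F f -> continuous f -> a < b ->
  \int[@lebesgue_measure R]_(t in `]a, b]%classic) f t = F b - F a.
Proof.
move=> h cf ab; have [i1 <-] := FTC_cc h cf ab.
apply: Rintegral_itv_obnd_cbnd; apply: integrableS i1 => //.
by apply: subset_itvr; rewrite bnd_simp.
Qed.

Lemma continuous_measurable (f : R -> R) : continuous f -> @measurable_fun _ _ mR _ setT f.
Proof. exact: continuous_measurable_fun. Qed.

Lemma Rintegral_Un_unit (f : R -> R) : @measurable_fun _ _ mR _ setT f ->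
  \int[Un]_t f t = \int[@lebesgue_measure R]_(t in unit_interval) f t.
Proof.
move=> mf; rewrite -Rintegral_Un /Rintegral; congr fine.
have mf' : measurable_fun setT (EFin \o (f : mR -> R)) by exact/measurable_EFinP.
apply: ae_eq_integral => //.
  apply/measurable_EFinP; apply/(measurable_restrictT _ _).1; first exact: measurable_unit_interval.
  exact: measurable_funTS.
have [N [mN N0 hN]] := @ae_Un_unit R; exists N; split => // t nt; apply: hN => /= t01; apply: nt => _ /=.
by rewrite patchE mem_set.
Qed.

Lemma FTC_Un F f u : C1 F f -> continuous f -> 0 < u <= 1 ->
  \int[Un]_t ((t <= u)%R%:R * f t) = F u - F 0.
Proof.
move=> h cf /andP[u0 u1].
have mle : @measurable_fun _ _ mR _ setT (fun t : R => (t <= u)%R%:R : R).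
  have -> : (fun t : R => (t <= u)%R%:R : R) = \1_(`]-oo, u]%classic).
    by apply/funext => t; rewrite indicE mem_setE in_itv.
  exact: measurable_indic.
rewrite Rintegral_Un_unit; last by apply: measurable_funM => //; exact: continuous_measurable.
have [i1 i2] := FTC_cc h cf u0; rewrite -i2.
have i3 : (@lebesgue_measure R).-integrable `]0, u] (EFin \o f).
  by apply: integrableS i1 => //; apply: subset_itvr; rewrite bnd_simp.
have i4 : (@lebesgue_measure R).-integrable `]0, u[ (EFin \o f).
  by apply: integrableS i1 => //; apply: subset_itv; rewrite bnd_simp.
rewrite -(Rintegral_itv_obnd_cbnd i3); move: u1; rewrite le_eqVlt => /predU1P[u1|u1].
  rewrite -(Rintegral_itv_bndo_bndc i4) u1; apply: eq_Rintegral => t.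
  by rewrite mem_setE in_itv/= => /andP[_ /ltW ->]; rewrite mul1r.
rewrite Rintegral_mkcond [RHS]Rintegral_mkcond; apply: eq_Rintegral => t _.
rewrite !patchE /unit_interval !mem_setE !in_itv/=; have [tu|tu] := leP t u.
  by rewrite (le_lt_trans tu u1) !andbT mul1r.
by rewrite mul0r andbF; case: ifP.
Qed.

Lemma FTC_Un1 F f : C1 F f -> continuous f -> \int[Un]_t f t = F 1 - F 0.
Proof.
move=> h cf; have h01 : ((0 : R) < 1) && ((1 : R) <= 1) by rewrite ltr01 lexx.
have mle : @measurable_fun _ _ mR _ setT (fun t : R => (t <= 1)%R%:R : R).
  have -> : (fun t : R => (t <= 1)%R%:R : R) = \1_(`]-oo, 1]%classic).
    by apply/funext => t; rewrite indicE mem_setE in_itv.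
  exact: measurable_indic.
have mf := continuous_measurable cf.
rewrite -(FTC_Un h cf h01) (Rintegral_Un_unit mf) (Rintegral_Un_unit (measurable_funM mle mf)).
apply: eq_Rintegral => t; rewrite /unit_interval mem_setE in_itv/= => /andP[_ /ltW ->].
by rewrite mul1r.
Qed.

End calculus.

(** * The smooth profile from which the weights are built *)

Section ramp.
Context {R : realType}.
Variable p : R.
Hypothesis p1 : 1 <= p.

Let p0 : 0 < p. Proof. exact: lt_le_trans p1. Qed.

(** The analogue of [flat] with real exponents and exp(-t^-p); again the family is stable under
    differentiation. *)
Definition flatR (q t : R) : R := if 0 < t then t `^ (- q) * expR (- t `^ (- p)) else 0.

Lemma flatR_ge0 q t : 0 <= flatR q t.
Proof. by rewrite /flatR; case: ifP => // _; rewrite mulr_ge0 ?powR_ge0 ?expR_ge0. Qed.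

(** One term of the exponential series contributes t^(-p(n+1)). As p >= 1 and n + 1 >= q + 2, this
    outweighs t^(-q-2) for 0 < t <= 1. *)
Lemma flatR_le q : 0 <= q -> exists2 C, 0 < C & forall t, t <= 1 -> flatR q t <= C * t ^+ 2.
Proof.
move=> q0; have [n hn] : exists n : nat, q + 2 <= n.+1%:R.
  by exists (Num.bound (q + 2)); apply/ltW/(lt_trans (archi_boundP _)); rewrite ?ltr_nat ?addr_ge0.
have f0 : 0 < n.+1`!%:R :> R by rewrite ltr0n fact_gt0.
exists n.+1`!%:R => // t t1.
rewrite /flatR; case: ifPn => [t0|_]; last by rewrite mulr_ge0 ?sqr_ge0// ltW.
have y0 : 0 < t `^ (- p) by exact: powR_gt0.
have h : t `^ (- p) ^+ n.+1 / n.+1`!%:R <= expR (t `^ (- p)).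
  by apply: le_trans (expR_ge1Dxn n (ltW y0)); rewrite lerDr.
rewrite expRN ler_pdivrMr ?expR_gt0//.
apply: (@le_trans _ _ (n.+1`!%:R * t ^+ 2 * (t `^ (- p) ^+ n.+1 / n.+1`!%:R))); last first.
  by rewrite ler_wpM2l// mulr_ge0 ?sqr_ge0// ltW.
have -> : n.+1`!%:R * t ^+ 2 * (t `^ (- p) ^+ n.+1 / n.+1`!%:R) = t ^+ 2 * t `^ (- p) ^+ n.+1.
  by rewrite [n.+1`!%:R * _]mulrC -mulrA [n.+1`!%:R * _]mulrC divfK ?gt_eqF.
rewrite -!powR_mulrn ?powR_ge0 ?(ltW t0)// -powRrM -powRD ?(gt_eqF t0) ?implybT//.
apply: ger_powR; first by rewrite t0.
have : 1 * n.+1%:R <= p * n.+1%:R by rewrite ler_wpM2r.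
by rewrite mul1r mulNr => h2; lra.
Qed.

Lemma C1_flatR q : 0 <= q -> C1 (flatR q) (fun t => p * flatR (q + p + 1) t - q * flatR (q + 1) t).
Proof.
move=> q0 t; have [t0|t0|t0] := ltgtP t 0.
- rewrite {2 3}/flatR !ltNge (ltW t0)/= !mulr0 subrr.
  apply: (near_eq_is_derive (f := fun=> 0 : R)).
  near=> x; rewrite /flatR ltNge; have -> // : x <= 0.
  by apply: ltW; near: x; exact: lt_nbhsl.
- have d1 := is_derive1_powR (- q) t0.
  have d2 := is_deriveN (is_derive1_powR (- p) t0).
  have d3 := @is_derive1_comp R expR (fun x : R => - x `^ (- p)) t _ _ (is_derive_expR _) d2.
  have d4 := is_deriveM d1 d3.
  apply: near_eq_is_derive; last first.
    apply: (is_derive_ext d4) => [x|]; first by [].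
    rewrite /flatR t0 /GRing.scale/= /GRing.scale/=.
    have -> : - (q + p + 1) = - q + (- p - 1) by ring.
    have -> : - (q + 1) = - q - 1 by ring.
    rewrite (@powRD _ t (- q) (- p - 1)) ?(gt_eqF t0) ?implybT//.
    by move: (_ `^ _) (_ `^ _) (_ `^ _) (expR _) => *; ring.
  near=> x; rewrite /flatR; have -> // : 0 < x.
  by near: x; exact: lt_nbhsr.
- rewrite {}t0 {2 3}/flatR ltxx !mulr0 subrr; apply/is_derive_cvg.
  have [C C0 hC] := flatR_le q0.
  apply/cvgr0Pnorm_le => e e0.
  near=> h; rewrite {2}/flatR ltxx subr0 addr0 /GRing.scale/= mulr1.
  rewrite normrM (ger0_norm (flatR_ge0 _ _)) normfV.
  have h0 : h != 0 by near: h; exact: nbhs_dnbhs_neq.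
  rewrite ler_pdivrMl ?normr_gt0//.
  apply: le_trans (hC _ _) _.
    near: h; apply: nbhs_dnbhs; apply: filterS (lt_nbhsl (ltr01 : 0 < 1 :> R)) => x; exact: ltW.
  rewrite -[h ^+ 2]real_normK ?num_real// expr2 mulrA mulrC ler_wpM2l//.
  rewrite -ler_pdivlMl//.
  near: h; apply: nbhs_dnbhs; rewrite /=.
  exists (C^-1 * e) => /= [|x]; first by rewrite mulr_gt0// invr_gt0.
  by rewrite /ball_/= sub0r normrN => /ltW.
Unshelve. all: by end_near. Qed.

Let K : R := 2 `^ (- p - 2) * expR (2 `^ p).
Let K0 : 0 < K. Proof. by rewrite mulr_gt0 ?powR_gt0 ?expR_gt0. Qed.

(** The function [eta] continued by 0 to the left of the origin, followed by its derivative and an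
    antiderivative. The latter is elementary because t^(-p-1) is, up to the factor p, the inner
    derivative of exp(-t^-p). *)
Definition eta_ext x := K * flatR (p + 1) x.
Definition deta_ext x := K * (p * flatR (p + 1 + p + 1) x - (p + 1) * flatR (p + 1 + 1) x).
Definition ieta_ext x := K / p * flatR 0 x.

Let C1_E : C1 eta_ext deta_ext.
Proof. by apply: C1Z; apply: C1_flatR; rewrite addr_ge0// ltW. Qed.

Let C1_ZE : C1 ieta_ext eta_ext.
Proof.
apply: (C1_ext (C1Z (K / p) (C1_flatR (lexx 0)))) => // x.
by rewrite /eta_ext add0r mul0r subr0 mulrA divfK// gt_eqF.
Qed.

Let cdE : continuous deta_ext.
Proof.
have -> : deta_ext = fun x => K * (p * flatR (p + 1 + p + 1) x + - (p + 1) * flatR (p + 1 + 1) x).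
  by apply/funext => x; rewrite /deta_ext mulNr.
have q1 : 0 <= p + 1 + p + 1 by rewrite !addr_ge0// ltW.
have q2 : 0 <= p + 1 + 1 by rewrite !addr_ge0// ltW.
exact: (C1_continuous (C1Z K (C1D (C1Z p (C1_flatR q1)) (C1Z (- (p + 1)) (C1_flatR q2))))).
Qed.

Lemma etaE x : 0 < x -> eta p x = eta_ext x.
Proof.
move=> x0; rewrite /eta gt_eqF// /eta_ext /K /flatR x0 expRD.
have -> : - p - 1 = - (p + 1) by ring.
by move: (_ `^ _) (_ `^ _) (expR _) (expR _) => *; ring.
Qed.

Lemma half_powR (q : R) : (2^-1 : R) `^ (- q) = 2 `^ q.
Proof. by rewrite -[2^-1]powR_inv1// -powRrM mulN1r opprK. Qed.

(** The constant 2^(-p-2) exp(2^p) in [eta] is chosen for this value: x -> eta x and x -> 1 - eta (1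
    - x) meet at 1/2, with equal derivatives by symmetry. *)
Let E_half : eta_ext (1 / 2) = 1 / 2.
Proof.
rewrite -etaE ?divr_gt0// /eta gt_eqF ?divr_gt0//.
have -> : - p - 1 = - (p + 1) by ring.
rewrite !div1r !half_powR subrr expR0 mulr1 -powRD; last by rewrite pnatr_eq0 implybT.
have -> : - p - 2 + (p + 1) = -1 by ring.
by rewrite powR_inv1.
Qed.

(** The sign is that of p x^-p - (p + 1). For 0 < x <= 1/2 and p >= 1 one has x^p <= x <= 1/2, hence
    x^-p >= 2, and 2p >= p + 1. *)
Let dE_ge0 x : x <= 1 / 2 -> 0 <= deta_ext x.
Proof.
move=> x12; rewrite /deta_ext mulr_ge0 ?(ltW K0)//.
rewrite /flatR; case: ifP => x0; last by rewrite !mulr0 subrr.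
have -> : - (p + 1 + p + 1) = - (p + 1 + 1) - p by ring.
rewrite (@powRD _ x (- (p + 1 + 1)) (- p)) ?(gt_eqF x0) ?implybT//.
have h : 2 <= x `^ (- p).
  have h1 : x `^ p <= x by apply: ge1r_powR => //; rewrite x0; lra.
  by rewrite powRN -[2]invrK lef_pV2 ?posrE ?invr_gt0 ?powR_gt0//; lra.
have -> : p * (x `^ (- (p + 1 + 1)) * x `^ (- p) * expR (- x `^ (- p))) - (p + 1) * (x `^ (- (p + 1 + 1)) * expR (- x `^ (- p))) =
   x `^ (- (p + 1 + 1)) * expR (- x `^ (- p)) * (p * x `^ (- p) - (p + 1)) by ring.
rewrite !mulr_ge0 ?powR_ge0 ?expR_ge0// subr_ge0.
apply: (@le_trans _ _ (p * 2)); first by rewrite mulr_natr mulr2n lerD2l.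
by rewrite ler_wpM2l// ltW.
Qed.

Let E_out x : x <= 0 -> eta_ext x = 0.
Proof. by move=> x0; rewrite /eta_ext /flatR ltNge x0 mulr0. Qed.

Let dE_out x : x <= 0 -> deta_ext x = 0.
Proof. by move=> x0; rewrite /deta_ext /flatR ltNge x0 !mulr0 subrr mulr0. Qed.

Let ZE_out x : x <= 0 -> ieta_ext x = 0.
Proof. by move=> x0; rewrite /ieta_ext /flatR ltNge x0 mulr0. Qed.

Let E_ge0 x : 0 <= eta_ext x. Proof. by rewrite mulr_ge0 ?flatR_ge0// ltW. Qed.

Let E_gt0 x : 0 < x -> 0 < eta_ext x.
Proof. by move=> x0; rewrite mulr_gt0// /flatR x0 mulr_gt0 ?powR_gt0 ?expR_gt0. Qed.

Let E_le x : x <= 1 / 2 -> eta_ext x <= 1 / 2.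
Proof.
move=> x12; rewrite -[leRHS]E_half; apply: (C1_le C1_E) => // t /andP[_ t12].
exact: dE_ge0.
Qed.

(* In the variable u / theta, ramp is (1 - theta) times the weight, dramp its
   derivative and aramp an antiderivative. *)
Definition ramp := glue (1 / 2) eta_ext (fun x => 1 - eta_ext (1 - x)).
Definition dramp := glue (1 / 2) deta_ext (fun x => deta_ext (1 - x)).
Definition aramp := glue (1 / 2) ieta_ext (fun x => x - 1 / 2 + ieta_ext (1 - x)).

Let half : 1 - 1 / 2 = 1 / 2 :> R. Proof. lra. Qed.

#[local] Opaque eta_ext deta_ext ieta_ext.

Lemma C1_ramp : C1 ramp dramp.
Proof.
have h : C1 (fun x => 1 - eta_ext (1 - x)) (fun x => deta_ext (1 - x)).
  apply: (C1_ext (C1D (C1_cst 1) (C1Z (-1) (C1_affine (-1) 1 C1_E)))) => x.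
    by rewrite !mulN1r [- x + 1]addrC.
  by rewrite !mulN1r opprK add0r [- x + 1]addrC.
apply: (C1_glue C1_E h); last by rewrite half.
by rewrite half E_half half.
Qed.

(** The shift x - 1/2 is the constant of integration for which both branches equal
    [ieta_ext (1 / 2)] at the junction. *)
Lemma C1_aramp : C1 aramp ramp.
Proof.
have h : C1 (fun x => x - 1 / 2 + ieta_ext (1 - x)) (fun x => 1 - eta_ext (1 - x)).
  apply: (C1_ext (C1D (C1D C1_id (C1_cst (- (1 / 2)))) (C1_affine (-1) 1 C1_ZE))) => x.
    by rewrite mulN1r [- x + 1]addrC.
  by rewrite !mulN1r addr0 [- x + 1]addrC.
apply: (C1_glue C1_ZE h); first by rewrite half subrr add0r.
by rewrite half E_half half.
Qed.

Lemma continuous_dramp : continuous dramp.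
Proof.
have h : continuous (fun x : R => deta_ext (1 - x)).
  move=> x; apply: (@continuous_comp _ _ _ (fun x : R => 1 - x) deta_ext); last exact: cdE.
  by apply: cvgB; [exact: cvg_cst|exact: cvg_id].
by apply: (continuous_glue cdE h); rewrite half.
Qed.

Lemma dramp_ge0 x : 0 <= dramp x.
Proof. by rewrite /dramp /glue; case: ifPn => h; apply: dE_ge0 => //; lra. Qed.

Lemma ramp_out x : x <= 0 -> ramp x = 0.
Proof. by move=> x0; rewrite /ramp glue_le ?E_out//; lra. Qed.

Lemma ramp1 x : 1 <= x -> ramp x = 1.
Proof. by move=> x1; rewrite /ramp glue_ge; [rewrite E_out; lra|by rewrite half E_half half|lra]. Qed.

Lemma dramp1 x : 1 <= x -> dramp x = 0.
Proof. by move=> x1; rewrite /dramp glue_ge; [rewrite dE_out//; lra|by rewrite half|lra]. Qed.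

Lemma dramp_out x : x <= 0 -> dramp x = 0.
Proof. by move=> x0; rewrite /dramp glue_le ?dE_out//; lra. Qed.

Lemma aramp_out x : x <= 0 -> aramp x = 0.
Proof. by move=> x0; rewrite /aramp glue_le ?ZE_out//; lra. Qed.

Lemma aramp1 x : 1 <= x -> aramp x = x - 1 / 2.
Proof. by move=> x1; rewrite /aramp glue_ge; [rewrite ZE_out; lra|by rewrite half subrr add0r|lra]. Qed.

Lemma ramp_gt0 x : 0 < x -> 0 < ramp x.
Proof.
move=> x0; rewrite /ramp /glue; case: ifPn => h; first exact: E_gt0.
have : eta_ext (1 - x) <= 1 / 2 by apply: E_le; lra.
by move=> h2; lra.
Qed.

Lemma ramp_ge0 x : 0 <= ramp x.
Proof. by have [/ramp_gt0/ltW//|/ramp_out ->] := ltP 0 x. Qed.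

Lemma ramp_le1 x : ramp x <= 1.
Proof.
rewrite /ramp /glue; case: ifPn => h; first by have := E_le h; lra.
by have := E_ge0 (1 - x); lra.
Qed.

Lemma rampE v (theta : R) : 0 < theta -> 0 < v ->
  (if v <= theta / 2 then eta p (v / theta) else if v < theta then 1 - eta p (1 - v / theta) else 1) =
  ramp (v / theta).
Proof.
move=> t0 v0; have vt : 0 < v / theta by rewrite divr_gt0.
case: ifPn => h1.
  by rewrite etaE// /ramp glue_le// ler_pdivrMr// mulrC mulrA mulr1.
case: ifPn => h2; last by rewrite ramp1// ler_pdivlMr// mul1r leNgt.
have h3 : v / theta < 1 by rewrite ltr_pdivrMr// mul1r.
rewrite /ramp glue_ge; [|by rewrite half E_half half|].
  by rewrite etaE// subr_gt0.
by rewrite ler_pdivlMr// mulrC mulrA mulr1 ltW// ltNge.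
Qed.

End ramp.

(** * The weights: normalisation, variation and distance to 1 *)

Section weights.
Context {R : realType}.
Local Notation mR := (measurableTypeR R).
Variables (p theta : R).
Hypotheses (p1 : 1 <= p) (ht : 0 < theta <= 1 / 2).

Let t0 : 0 < theta. Proof. by case/andP: ht. Qed.
Let t1 : theta <= 1 / 2. Proof. by case/andP: ht. Qed.
Let tn0 : theta != 0. Proof. by rewrite gt_eqF. Qed.
Let c : R := (1 - theta)^-1.
Let d0 : 0 < 1 - theta. Proof. by move: t1 => h; lra. Qed.
Let c0 : 0 < c. Proof. by rewrite invr_gt0. Qed.
Let c2 : c <= 2.
Proof. by rewrite -[2]invrK lef_pV2 ?posrE ?invr_gt0//; move: t1 => h; lra. Qed.
Let h12 : 1 - 1 / 2 = 1 / 2 :> R. Proof. lra. Qed.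
Let half1 : 1 <= (1 / 2) / theta.
Proof. by rewrite ler_pdivlMr// [1 * theta]mul1r. Qed.

(* wgt is C^1 on the real line and agrees with weight on (0,1). *)
Definition wgt := glue (1 / 2) (fun u => c * ramp p (u / theta)) (fun u => c * ramp p ((1 - u) / theta)).
Definition dwgt := glue (1 / 2) (fun u => c / theta * dramp p (u / theta))
  (fun u => - (c / theta) * dramp p ((1 - u) / theta)).
Definition awgt := glue (1 / 2) (fun u => c * theta * aramp p (u / theta))
  (fun u => 1 - c * theta * aramp p ((1 - u) / theta)).
(** The variation function of [wgt]: the decreasing half is reflected upwards, so that [vdwgt] is
    the absolute value of [dwgt]. The total variation is therefore vwgt 1 - vwgt 0 = 2c, at most 4
    because theta <= 1/2. *)
Let vwgt := glue (1 / 2) (fun u => c * ramp p (u / theta)) (fun u => 2 * c - c * ramp p ((1 - u) / theta)).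
Let vdwgt := glue (1 / 2) (fun u => c / theta * dramp p (u / theta))
  (fun u => c / theta * dramp p ((1 - u) / theta)).

Let C1_left (k : R) F f : C1 F f -> C1 (fun u => k * F (u / theta)) (fun u => k / theta * f (u / theta)).
Proof.
move=> h; apply: (C1_ext (C1Z k (C1_affine theta^-1 0 h))) => x.
  by rewrite addr0 [theta^-1 * x]mulrC.
by rewrite addr0 mulrA [theta^-1 * x]mulrC.
Qed.

Let C1_right (k : R) F f : C1 F f -> C1 (fun u => k * F ((1 - u) / theta)) (fun u => - (k / theta) * f ((1 - u) / theta)).
Proof.
move=> h; have e x : (1 - x) / theta = - theta^-1 * x + theta^-1 by field.
apply: (C1_ext (C1Z k (C1_affine (- theta^-1) theta^-1 h))) => x; rewrite e//.
by rewrite mulrA mulrN.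
Qed.

Let continuous_left (k : R) f : continuous f -> continuous (fun u : R => k * f (u / theta)).
Proof.
move=> h x; apply: cvgM; first exact: cvg_cst.
apply: (@continuous_comp _ _ _ (fun x : R => x / theta) f); last exact: h.
by apply: cvgM; [exact: cvg_id|exact: cvg_cst].
Qed.

Let continuous_right (k : R) f : continuous f -> continuous (fun u : R => k * f ((1 - u) / theta)).
Proof.
move=> h x; apply: cvgM; first exact: cvg_cst.
apply: (@continuous_comp _ _ _ (fun x : R => (1 - x) / theta) f); last exact: h.
by apply: cvgM; [apply: cvgB; [exact: cvg_cst|exact: cvg_id]|exact: cvg_cst].
Qed.

Lemma C1_wgt : C1 wgt dwgt.
Proof.
apply: (C1_glue (C1_left c (C1_ramp p1)) (C1_right c (C1_ramp p1))); first by rewrite h12.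
by rewrite h12 (dramp1 _ half1) !mulr0.
Qed.

(** Continuity at 1/2 amounts to c (1 - theta) / 2 = 1/2, which is where the normalisation c = (1 -
    theta)^-1 enters. *)
Lemma C1_awgt : C1 awgt wgt.
Proof.
have e k : k * theta / theta = k by rewrite mulfK.
have h1 : C1 (fun u => c * theta * aramp p (u / theta)) (fun u => c * ramp p (u / theta)).
  by apply: (C1_ext (C1_left (c * theta) (C1_aramp p1))) => x //; rewrite e.
have h2 : C1 (fun u => 1 - c * theta * aramp p ((1 - u) / theta)) (fun u => c * ramp p ((1 - u) / theta)).
  apply: (C1_ext (C1D (C1_cst 1) (C1Z (-1) (C1_right (c * theta) (C1_aramp p1))))) => x.
    by rewrite mulN1r.
  by rewrite mulN1r add0r e mulNr opprK.
apply: (C1_glue h1 h2); last by rewrite h12.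
rewrite h12 (aramp1 _ half1).
have -> : c * theta * (1 / 2 / theta - 1 / 2) = c * (1 - theta) / 2 by field.
by rewrite mulVf ?gt_eqF//; lra.
Qed.

Let C1_vwgt : C1 vwgt vdwgt.
Proof.
have h : C1 (fun u => 2 * c - c * ramp p ((1 - u) / theta)) (fun u => c / theta * dramp p ((1 - u) / theta)).
  apply: (C1_ext (C1D (C1_cst (2 * c)) (C1Z (-1) (C1_right c (C1_ramp p1))))) => x.
    by rewrite mulN1r.
  by rewrite mulN1r add0r mulNr opprK.
apply: (C1_glue (C1_left c (C1_ramp p1)) h); last by rewrite h12.
by rewrite h12 (ramp1 _ half1); lra.
Qed.

Lemma continuous_wgt : continuous wgt. Proof. exact: C1_continuous C1_wgt. Qed.

Lemma continuous_dwgt : continuous dwgt.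
Proof.
apply: (continuous_glue (continuous_left (continuous_dramp p1)) (continuous_right (continuous_dramp p1))).
by rewrite h12 (dramp1 _ half1) !mulr0.
Qed.

Let continuous_vdwgt : continuous vdwgt.
Proof.
apply: (continuous_glue (continuous_left (continuous_dramp p1)) (continuous_right (continuous_dramp p1))).
by rewrite h12.
Qed.

Let cont0 (k : R) : k <= 0 -> k / theta <= 0.
Proof. by move=> k0; rewrite pmulr_lle0// invr_gt0. Qed.

Lemma wgt_ge0 u : 0 <= wgt u.
Proof. by rewrite /wgt /glue; case: ifP => _; rewrite mulr_ge0 ?ramp_ge0// ltW. Qed.

Lemma wgt_gt0 u : 0 < u < 1 -> 0 < wgt u.
Proof.
move=> /andP[u0 u1]; rewrite /wgt /glue; case: ifP => _; rewrite mulr_gt0// ramp_gt0// divr_gt0//.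
by rewrite subr_gt0.
Qed.

Lemma wgt_le u : wgt u <= (1 - theta)^-1.
Proof.
by rewrite /wgt /glue; case: ifP => _; rewrite -[leRHS]mulr1 ler_wpM2l ?ramp_le1// ltW.
Qed.

Lemma wgt_le2 u : `|wgt u| <= 2.
Proof. by rewrite ger0_norm ?wgt_ge0// (le_trans (wgt_le u)). Qed.

Lemma weightE u : 0 < u < 1 -> weight p theta u = wgt u.
Proof.
move=> /andP[u0 u1]; rewrite /weight /wgt /glue.
by case: (u <= 1 / 2); rewrite rampE// subr_gt0.
Qed.

Lemma wgt0 : wgt 0 = 0.
Proof. by rewrite /wgt glue_le ?mul0r ?ramp_out ?mulr0//; lra. Qed.

Lemma awgt0 : awgt 0 = 0.
Proof. by rewrite /awgt glue_le ?mul0r ?aramp_out ?mulr0//; lra. Qed.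

Lemma awgt1 : awgt 1 = 1.
Proof.
rewrite /awgt glue_ge; first by rewrite subrr mul0r aramp_out// mulr0 subr0.
  have h1 : c * theta * (1 / 2 / theta - 1 / 2) = c * (1 - theta) / 2 by field.
  by rewrite h12 (aramp1 _ half1) h1 mulVf ?gt_eqF//; lra.
lra.
Qed.

Lemma awgt_lt u v : 0 <= u -> u < v -> v <= 1 -> awgt u < awgt v.
Proof.
move=> u0 uv v1; apply: (C1_lt C1_awgt) => // t /andP[h1 h2].
by apply: wgt_gt0; rewrite (le_lt_trans u0 h1) (lt_le_trans h2 v1).
Qed.

Lemma measurable_wgt : @measurable_fun _ _ mR _ setT wgt.
Proof. exact: continuous_measurable continuous_wgt. Qed.

Lemma measurable_dwgt : @measurable_fun _ _ mR _ setT dwgt.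
Proof. exact: continuous_measurable continuous_dwgt. Qed.

Lemma integrable_wgt : Un.-integrable setT (EFin \o (wgt : mR -> R)).
Proof. exact: integrable_bounded Un_lty measurable_wgt wgt_le2. Qed.

Lemma integral_wgt u : 0 < u <= 1 -> \int[Un]_t ((t <= u)%R%:R * wgt t) = awgt u.
Proof. by move=> hu; rewrite (FTC_Un C1_awgt continuous_wgt hu) awgt0 subr0. Qed.

Lemma integral_wgt1 : \int[Un]_t wgt t = 1.
Proof.
by rewrite (FTC_Un1 C1_awgt continuous_wgt) awgt1 awgt0 subr0.
Qed.

Lemma integral_weight u : 0 < u < 1 ->
  \int[@lebesgue_measure R]_(t in `]0, u]%classic) weight p theta t = awgt u.
Proof.
move=> /andP[u0 u1]; transitivity (awgt u - awgt 0); last by rewrite awgt0 subr0.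
rewrite -(FTC_oc C1_awgt continuous_wgt u0).
apply: eq_Rintegral => t; rewrite mem_setE in_itv/= => /andP[h1 h2].
by rewrite weightE// h1 (le_lt_trans h2 u1).
Qed.

Lemma dwgt_bounded : exists M, forall t, `|dwgt t| <= M.
Proof.
have cd : {within `[0, 1], continuous (fun t => `|dwgt t|)}.
  apply: continuous_subspaceT => t; apply: (@continuous_comp _ _ _ dwgt (fun x : R => `|x|)); first exact: continuous_dwgt.
  exact: norm_continuous.
have [a _ ha] := EVT_max (ler01 : 0 <= 1 :> R) cd.
exists `|dwgt a| => t; have [h|h] := boolP (0 <= t <= 1); first by apply: ha; rewrite in_itv.
suff -> : dwgt t = 0 by rewrite normr0.
have dr := @dramp_out R p.
move: h; rewrite negb_and -!ltNge => /orP[h|h].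
  by rewrite /dwgt glue_le ?dr ?mulr0//; [exact/cont0/ltW|lra].
rewrite /dwgt glue_ge; [|by rewrite h12 (dramp1 _ half1) !mulr0|lra].
by rewrite dr ?mulr0//; apply: cont0; lra.
Qed.

Lemma integrable_dwgt : Un.-integrable setT (EFin \o (dwgt : mR -> R)).
Proof. by have [M hM] := dwgt_bounded; exact: integrable_bounded Un_lty measurable_dwgt hM. Qed.

Lemma wgt_primitive u : 0 < u < 1 -> \int[Un]_t ((t <= u)%R%:R * dwgt t) = wgt u.
Proof.
move=> /andP[u0 /ltW u1].
by rewrite (FTC_Un C1_wgt continuous_dwgt (u := u)) ?u0// wgt0 subr0.
Qed.

Lemma integral_abs_dwgt : \int[Un]_t `|dwgt t| <= 4.
Proof.
have e t : `|dwgt t| = vdwgt t.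
  rewrite /dwgt /vdwgt /glue; case: ifP => _.
    by rewrite ger0_norm// mulr_ge0 ?dramp_ge0// ltW// divr_gt0.
  by rewrite mulNr normrN ger0_norm// mulr_ge0 ?dramp_ge0// ltW// divr_gt0.
under eq_Rintegral do rewrite e.
rewrite (FTC_Un1 C1_vwgt continuous_vdwgt).
rewrite /vwgt glue_ge; [|by rewrite h12 (ramp1 _ half1); lra|lra].
rewrite glue_le; last lra.
rewrite subrr !mul0r ramp_out// mulr0 !subr0.
by have := c2; lra.
Qed.

(** The product of [wgt] and a test function is C^1 and vanishes at 0 and 1, so the integral of its
    derivative is 0. *)
Lemma wder1_wgt : wder1 wgt dwgt.
Proof.
move=> chi tchi; have [schi [e e0 he]] := tchi; have [_ dchi] := smooth1_derive schi.
have tchi' := test1_derive tchi.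
have [M hM] := dwgt_bounded; have [N hN] := test1_bounded tchi; have [N' hN'] := test1_bounded tchi'.
have m1 := test1_measurable tchi; have m2 := test1_measurable tchi'.
have i1 := integrable_boundedM integrable_wgt m2 hN'.
have i2 := integrable_boundedM integrable_dwgt m1 hN.
under eq_cI do rewrite -rmorphM.
under [in RHS]eq_cI do rewrite -rmorphM.
rewrite !cI_real -rmorphN; congr (_%:C%C); apply/eqP; rewrite -addr_eq0; apply/eqP.
rewrite -RintegralD//.
have cc : continuous chi by exact: smooth1_continuous.
have cc' : continuous (derive1 chi) by apply: smooth1_continuous; have [] := tchi'.
have cf : continuous (fun t => wgt t * derive1 chi t + dwgt t * chi t).
  move=> x; apply: cvgD; apply: cvgM.
  - exact: continuous_wgt.
  - exact: cc'.
  - exact: continuous_dwgt.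
  - exact: cc.
have chi1 : chi 1 = 0 by apply: he; rewrite negb_and -!ltNge; apply/orP; right; lra.
have chi0 : chi 0 = 0 by apply: he; rewrite negb_and -!ltNge e0.
transitivity (wgt 1 * chi 1 - wgt 0 * chi 0); first exact: FTC_Un1 (C1M C1_wgt dchi) cf.
rewrite [X in X - _](_ : _ = 0); last by rewrite chi1 mulr0.
by rewrite sub0r chi0 mulr0 oppr0.
Qed.

(** On [theta, 1 - theta] the weight is the constant c, and c - 1 = theta c <= 2 theta. On the two
    strips of width theta it lies between 0 and 2, so its distance to 1 is at most 1. Each
    contribution is at most 2 theta. *)
Lemma integral_wgtB1 : \int[Un]_t `|wgt t - 1| <= 4 * theta.
Proof.
pose A : set R := `]-oo, theta[%classic `|` `]1 - theta, +oo[%classic.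
have mA : measurable (A : set mR) by apply: measurableU; exact: measurable_itv.
have b t : `|wgt t - 1| <= 2 * theta + \1_A t.
  rewrite indicE.
  have [tA|tA] := boolP (t \in A).
    have := wgt_ge0 t; have := le_trans (wgt_le t) c2 => h3 h4; have := t0 => h5.
    by rewrite /= ler_norml; apply/andP; split; lra.
  have /andP[ta tb] : theta <= t <= 1 - theta.
    by apply/andP; split; rewrite leNgt; apply: contra tA => tA; rewrite inE; [left|right]; rewrite /= in_itv/= ?andbT.
  have -> : wgt t = c.
    by rewrite /wgt /glue; case: ifP => _; rewrite ramp1 ?mulr1// ler_pdivlMr ?mul1r//; lra.
  have -> : c - 1 = theta * c by rewrite /c; field; rewrite gt_eqF.
  rewrite addr0 ger0_norm; last by rewrite mulr_ge0 ?(ltW t0) ?(ltW c0).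
  by rewrite [theta * c]mulrC ler_wpM2r// ltW.
have iA : Un.-integrable setT (EFin \o (\1_A : mR -> R)).
  apply: (@integrable_bounded _ _ _ _ _ 1 Un_lty) => [|t]; first exact: measurable_indic.
  by rewrite indicE; case: (_ \in _); rewrite ?normr1 ?normr0.
have i2 : Un.-integrable setT (EFin \o (fun=> 2 * theta : R)).
  exact: (integrable_bounded (M := `|2 * theta|) Un_lty (measurable_cst _)).
have iw : Un.-integrable setT (EFin \o (fun t : mR => `|wgt t - 1|)).
  apply: (@integrable_bounded _ _ _ _ _ 3 Un_lty) => [|t].
    by apply: measurableT_comp => //; apply: measurable_funB => //; exact: measurable_wgt.
  rewrite normr_id ler_norml; have := wgt_ge0 t; have := le_trans (wgt_le t) c2 => h3 h4.
  by apply/andP; split; lra.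
apply: (@le_trans _ _ (\int[Un]_t (2 * theta + \1_A t))).
  apply: le_Rintegral => //.
  by apply: eq_integrable (integrableD measurableT i2 iA).
rewrite RintegralD// Rintegral_cst1; last exact: probability_setT.
suff : \int[Un]_t (\1_A t : R) <= 2 * theta by move=> h; lra.
have -> : \int[Un]_t (\1_A t : R) = fine (Un A).
  by rewrite /Rintegral (@integral_indic _ mR R Un setT measurableT A mA) setIT.
have m1 : measurable (`]-oo, theta[%classic : set mR) by exact: measurable_itv.
have m2 : measurable (`]1 - theta, +oo[%classic : set mR) by exact: measurable_itv.
have e1 : Un (`]-oo, theta[%classic : set mR) = theta%:E.
  rewrite /Un/= /uniform /mrestr (_ : _ `&` _ = `]0, theta[%classic).
    by rewrite lebesgue_measure_itv/= lte_fin t0 sube0.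
  apply/seteqP; split => t; rewrite /unit_interval/= !in_itv/=; first by move=> [-> /andP[-> _]].
  by move=> /andP[-> h]; split => //=; have := t1; lra.
have e2 : Un (`]1 - theta, +oo[%classic : set mR) = theta%:E.
  rewrite /Un/= /uniform /mrestr (_ : _ `&` _ = `]1 - theta, 1[%classic).
    rewrite lebesgue_measure_itv/= lte_fin gtrBl t0 -EFinD opprB addrC subrK//.
  apply/seteqP; split => t; rewrite /unit_interval/= !in_itv/= ?andbT.
    by move=> [-> /andP[_ ->]].
  by move=> /andP[h ->]; split => //; rewrite andbT; have := t1; lra.
have h : (Un A <= theta%:E + theta%:E)%E by apply: le_trans (@measureU2 _ _ _ Un _ _ m1 m2) _; rewrite -[leLHS]/(Un _ + Un _)%E e1 e2.
have ff : Un A \is a fin_num by exact: fin_num_measure.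
by rewrite -lee_fin fineK//; apply: le_trans h _; rewrite -EFinD lee_fin; lra.
Qed.

End weights.

(** * The distribution function of the density *)

Section distribution_function.
Context {R : realType}.
Local Notation mR := (measurableTypeR R).
Local Notation leb := (@lebesgue_measure R).
Variable rho : R -> R.
Hypothesis hrho : admissible_density rho.

Let mrho : @measurable_fun _ _ mR _ setT rho. Proof. by have [[]] := hrho. Qed.
Let rho0 x : 0 < rho x. Proof. by have [_ h] := hrho. Qed.
Let rho_ge0 x : 0 <= rho x. Proof. exact: ltW. Qed.
Let irho1 : (\int[leb]_x (rho x)%:E = 1)%E. Proof. by have [[]] := hrho. Qed.

Lemma integrable_admissible : leb.-integrable setT (EFin \o (rho : mR -> R)).
Proof.
apply/integrableP; split; first exact/measurable_EFinP.
under eq_integral do rewrite /= ger0_norm//.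
by rewrite irho1 ltry.
Qed.

Let irho := integrable_admissible.

Let irhoS (A : set mR) : measurable A -> leb.-integrable A (EFin \o (rho : mR -> R)).
Proof. by move=> mA; apply: integrableS irho. Qed.

Lemma cdfB x y : x <= y -> Defs.cdf rho y - Defs.cdf rho x = \int[leb]_(t in `]x, y]%classic) rho t.
Proof.
move=> xy; apply: Rintegral_itvB; first by apply: irhoS; exact: measurable_itv.
  by rewrite bnd_simp.
by rewrite bnd_simp.
Qed.

(** Equality would force the strictly positive density to vanish almost everywhere on an interval of
    positive length. *)
Lemma cdf_lt x y : x < y -> Defs.cdf rho x < Defs.cdf rho y.
Proof.
move=> xy; rewrite -subr_gt0 (cdfB (ltW xy)) lt_neqAle; apply/andP; split; last first.
  by apply: Rintegral_ge0 => t _.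
apply/negP => /eqP/esym h.
have mxy : measurable (`]x, y]%classic : set mR) by exact: measurable_itv.
have h' : (\int[leb]_(t in `]x, y]%classic) `|(rho t)%:E| = 0)%E.
  under eq_integral do rewrite /= ger0_norm//.
  rewrite -[LHS]fineK; first by rewrite -[fine _]/(\int[leb]_(t in `]x, y]%classic) rho t) h.
  by apply: integrable_fin_num => //; exact: irhoS.
have mE : measurable_fun (`]x, y]%classic : set mR) (fun t => (rho t)%:E).
  by apply/measurable_EFinP; exact: measurable_funTS.
have [N [mN N0 hN]] := (ae_eq_integral_abs leb mxy mE).1 h'.
have : (leb `]x, y]%classic <= leb N)%E.
  apply: le_measure; rewrite ?inE// => t txy; apply: hN => /= /(_ txy) /eqP.
  by rewrite eqe gt_eqF.
by rewrite N0 lebesgue_measure_itv/= lte_fin xy -EFinB lee_fin subr_le0 leNgt xy.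
Qed.

Lemma cdf_inj : injective (Defs.cdf rho).
Proof.
move=> x y h; have [xy|yx|//] := ltgtP x y.
  by have := cdf_lt xy; rewrite h ltxx.
by have := cdf_lt yx; rewrite h ltxx.
Qed.

Lemma cdf_ltE x y : (Defs.cdf rho x < Defs.cdf rho y) = (x < y).
Proof.
apply/idP/idP => [|/cdf_lt//]; apply: contraLR; rewrite -!leNgt le_eqVlt => /predU1P[->//|/cdf_lt/ltW//].
Qed.

Let conv (A : nat -> set R) (B : set R) : (forall n, measurable (A n : set mR)) -> measurable (B : set mR) ->
  (forall x, (\1_(A n) x : R) @[n --> \oo] --> (\1_B x : R)) ->
  \int[leb]_(t in A n) rho t @[n --> \oo] --> \int[leb]_(t in B) rho t.
Proof.
move=> mA mB h.
have e (C : set R) : measurable (C : set mR) -> \int[leb]_(t in C) rho t = \int[leb]_t (rho t * \1_C t).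
  move=> mC; rewrite Rintegral_mkcond; apply: eq_Rintegral => t _; rewrite patchE indicE.
  by case: ifP => _; rewrite ?mulr1 ?mulr0.
rewrite e//; under eq_cvg => n do rewrite e//.
apply: (@cvg_Rintegral_mul _ mR R leb rho (fun n => \1_(A n)) (\1_B) irho).
- by move=> n; exact: measurable_indic.
- exact: measurable_indic.
- by move=> n x; rewrite indicE; case: (_ \in _); rewrite ?normr1 ?normr0.
- by apply: aeW => x; exact: h.
Qed.

Lemma cdf_cvg1 : Defs.cdf rho n%:R @[n --> \oo] --> (1 : R).
Proof.
have e1 : \int[leb]_(t in setT) rho t = 1 by rewrite /Rintegral irho1.
rewrite -[X in _ --> X]e1; apply: conv => [n| |x]; [exact: measurable_itv|exact: measurableT|].
rewrite indicT; apply: cvg_near_cst; exists (Num.bound `|x|) => // n /= hn.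
rewrite indicE mem_set//= in_itv/=; apply: le_trans (ler_norm _) _.
by apply/ltW/(lt_le_trans (archi_boundP (normr_ge0 x))); rewrite ler_nat.
Qed.

Lemma cdf_cvg0 : Defs.cdf rho (- n%:R) @[n --> \oo] --> (0 : R).
Proof.
rewrite -[X in _ --> X](Rintegral_set0 leb rho); apply: conv => [n| |x]; [exact: measurable_itv|exact: measurable0|].
rewrite indic0; apply: cvg_near_cst; exists (Num.bound `|x|) => // n /= hn.
rewrite indicE memNset//= in_itv/=; apply/negP; rewrite -ltNge ltrNl.
apply: le_lt_trans (_ : `|x| < _); first by rewrite -normrN ler_norm.
by apply: lt_le_trans (archi_boundP (normr_ge0 x)) _; rewrite ler_nat.
Qed.

Lemma cdf_itv x : 0 < Defs.cdf rho x < 1.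
Proof.
apply/andP; split.
  apply: (le_lt_trans _ (cdf_lt (_ : x - 1 < x))); last by rewrite gtrBl.
  by apply: Rintegral_ge0 => t _.
apply: (lt_le_trans (cdf_lt (_ : x < x + 1))); first by rewrite ltrDl.
have e1 : \int[leb]_t rho t = 1 by rewrite /Rintegral irho1.
rewrite -[leRHS]e1; apply: fine_le; [by apply: integrable_fin_num => //; apply: irhoS; exact: measurable_itv|by apply: integrable_fin_num|].
have mi : measurable (`]-oo, x + 1]%classic : set mR) by exact: measurable_itv.
have mE : measurable_fun [set: mR] (EFin \o rho) by exact/measurable_EFinP.
apply: (ge0_subset_integral leb mi measurableT mE) => //.
by move=> t _; rewrite lee_fin.
Qed.

(** An upper bound of the density is a Lipschitz constant. *)
Lemma cdf_continuous : continuous (Defs.cdf rho).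
Proof.
have [M0 hM0] : has_ubound (range rho) by have [_ _ _ h] := hrho.
have hM t : rho t <= M0 by apply: hM0; exists t.
have M0p : 0 < M0 by exact: lt_le_trans (rho0 0) (hM 0).
have lip x y : x <= y -> `|Defs.cdf rho y - Defs.cdf rho x| <= M0 * (y - x).
  move=> xy; rewrite ger0_norm; last by rewrite subr_ge0 le_eqVlt in xy *; case/predU1P : xy => [->|/cdf_lt/ltW]; rewrite ?eqxx// => h; rewrite h orbT.
  rewrite (cdfB xy).
  have mxy : measurable (`]x, y]%classic : set mR) by exact: measurable_itv.
  have -> : M0 * (y - x) = \int[leb]_(t in `]x, y]%classic) M0.
    rewrite Rintegral_cst// -[X in _ = _ * fine X]/(lebesgue_measure `]x, y]%classic) lebesgue_measure_itv/= lte_fin; case: ltP => //= h.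
    by have -> : x = y; [apply: le_anti; rewrite xy h|rewrite subrr].
  apply: le_Rintegral => //; first exact: irhoS.
  have : leb.-integrable `[x, y] (EFin \o (fun=> M0)).
    apply: continuous_compact_integrable; first exact: segment_compact.
    by apply: continuous_subspaceT; exact: cst_continuous.
  by apply: integrableS => //; apply: subset_itvr; rewrite bnd_simp.
have lip' x y : `|Defs.cdf rho x - Defs.cdf rho y| <= M0 * `|x - y|.
  have [xy|yx] := leP x y.
    by rewrite distrC (le_trans (lip _ _ xy))// ler_wpM2l ?(ltW M0p)// distrC ler_norm.
  by rewrite (le_trans (lip _ _ (ltW yx)))// ler_wpM2l ?(ltW M0p)// ler_norm.
move=> x; apply/cvgrPdist_le => e e0; near=> y.
apply: le_trans (lip' _ _) _; rewrite -ler_pdivlMl//.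
near: y; exists (M0^-1 * e) => /= [|z]; first by rewrite mulr_gt0// invr_gt0.
by rewrite /ball_/= => /ltW.
Unshelve. all: by end_near. Qed.

Lemma cdf_surj c : 0 < c < 1 -> exists x, Defs.cdf rho x = c.
Proof.
move=> /andP[c0 c1].
have [a ha] : exists a, Defs.cdf rho a < c.
  have /cvgrPdist_lt/(_ c c0)[n _ /(_ n (leqnn n))] := cdf_cvg0.
  by rewrite sub0r normrN => h; exists (- n%:R); apply: le_lt_trans h; exact: ler_norm.
have [b hb] : exists b, c < Defs.cdf rho b.
  have h1 : 0 < 1 - c by rewrite subr_gt0.
  have /cvgrPdist_lt/(_ _ h1)[n _ /(_ n (leqnn n))] := cdf_cvg1.
  move=> h; exists n%:R; have := le_lt_trans (ler_norm _) h; lra.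
have ab : a <= b by rewrite ltW// -cdf_ltE (lt_trans ha hb).
have cc : {within `[a, b], continuous (Defs.cdf rho)} by apply: continuous_subspaceT; exact: cdf_continuous.
have [|x _ hx] := IVT ab cc (v := c); last by exists x.
by rewrite ge_min le_max (ltW ha) (ltW hb) orbT.
Qed.

Lemma cdf_pinvK c : 0 < c < 1 -> Defs.cdf rho ('pinv_(fun=> 0) setT (Defs.cdf rho) c) = c.
Proof.
by move=> /cdf_surj[x hx]; apply: pinvK; rewrite inE; exists x.
Qed.

Lemma integral_ray x : \int[leb]_(t in `]x, +oo[%classic) rho t = 1 - Defs.cdf rho x.
Proof.
have e1 : \int[leb]_(t in `]-oo, +oo[%classic) rho t = 1 by rewrite set_itvE /Rintegral irho1.
rewrite -[X in X - _]e1.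
rewrite (@Rintegral_itvB R rho -oo%O +oo%O x)//.
by apply: irhoS; rewrite set_itvE; exact: measurableT.
Qed.

End distribution_function.

(** * The transport and its change of variables *)

Section transport.
Context {R : realType}.
Local Notation mR := (measurableTypeR R).
Local Notation leb := (@lebesgue_measure R).
Variables (rho : R -> R) (p theta : R).
Hypotheses (hrho : admissible_density rho) (p1 : 1 <= p) (ht : 0 < theta <= 1 / 2).

Let mrho : @measurable_fun _ _ mR _ setT rho. Proof. by have [[]] := hrho. Qed.
Let rho0 x : 0 < rho x. Proof. by have [_ h] := hrho. Qed.
Let rho_ge0 x : 0 <= rho x. Proof. exact: ltW. Qed.
Let irho1 : (\int[leb]_x (rho x)%:E = 1)%E. Proof. by have [[]] := hrho. Qed.

Lemma awgt_itv (u : R) : 0 < u < 1 -> 0 < awgt p theta u < 1.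
Proof.
move=> /andP[u0 u1]; have a0 := awgt_lt p1 ht (lexx 0) u0 (ltW u1).
have a1 := awgt_lt p1 ht (ltW u0) u1 (lexx 1).
by rewrite awgt0 in a0; rewrite (awgt1 p ht) in a1; rewrite a0 a1.
Qed.

Lemma awgt_ltE (u v : R) : 0 < u < 1 -> 0 < v < 1 -> (awgt p theta u < awgt p theta v) = (u < v).
Proof.
move=> /andP[u0 u1] /andP[v0 v1]; have lt := awgt_lt p1 ht; apply/idP/idP => [|uv]; last by apply: lt uv (ltW v1); exact: ltW.
apply: contraLR; rewrite -!leNgt le_eqVlt => /predU1P[->//|vu].
exact: ltW (awgt_lt p1 ht (ltW v0) vu (ltW u1)).
Qed.

Lemma cdf_transport1 u : 0 < u < 1 -> Defs.cdf rho (transport1 rho p theta u) = awgt p theta u.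
Proof.
by move=> hu; rewrite /transport1 integral_weight// cdf_pinvK// awgt_itv.
Qed.

(** The transport set to 0 outside (0,1), which makes it measurable on the whole line. *)
Definition tau := transport1 rho p theta \_ unit_interval.

Lemma tauE u : 0 < u < 1 -> tau u = transport1 rho p theta u.
Proof. by move=> hu; rewrite /tau patchE mem_set//= in_itv. Qed.

(** By monotonicity of the distribution function, tau u > x on (0,1) means awgt u > cdf x, a
    condition on a continuous function. *)
Lemma measurable_tau : @measurable_fun _ _ mR mR setT tau.
Proof.
apply/(measurable_restrictT _ _).1; first exact: measurable_unit_interval.
move=> mU; apply: (measurability (@RGenOInfty.G R)) => //; first exact: RGenOInfty.measurableE.
move=> _ [_ [x ->] <-].
have -> : unit_interval `&` transport1 rho p theta @^-1` `]x, +oo[%classic =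
    unit_interval `&` awgt p theta @^-1` `]Defs.cdf rho x, +oo[%classic.
  apply/seteqP; split => u [hu]; rewrite /= !in_itv/= !andbT => h; split=> //.
    by rewrite -cdf_transport1 ?cdf_ltE//; move: hu; rewrite /unit_interval/= in_itv.
  by move: h; rewrite -cdf_transport1 ?cdf_ltE//; move: hu; rewrite /unit_interval/= in_itv.
have cw := C1_continuous (C1_awgt p1 ht).
have mw := continuous_measurable cw.
by apply: measurableI => //; rewrite -[X in measurable X]setTI; apply: mw => //; exact: measurable_itv.
Qed.

Definition tauV x : R := xget (1 / 2) [set u | 0 < u < 1 /\ awgt p theta u = Defs.cdf rho x].

Lemma tauVP x : 0 < tauV x < 1 /\ awgt p theta (tauV x) = Defs.cdf rho x.
Proof.
rewrite /tauV; case: xgetP => [y -> //|h]; exfalso.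
have /andP[c0 c1] := cdf_itv hrho x.
have cw := C1_continuous (C1_awgt p1 ht).
have cw' : {within `[0, 1], continuous (awgt p theta)} by exact: continuous_subspaceT.
have [|u] := IVT (ler01 : 0 <= 1 :> R) cw' (v := Defs.cdf rho x).
  by rewrite (awgt0 p theta) (awgt1 p ht) ge_min le_max (ltW c0) (ltW c1) orbT.
rewrite in_itv/= => /andP[u0 u1] hu; apply: (h u); split => //.
rewrite !lt_neqAle u0 u1 !andbT; apply/andP; split.
  by apply: contraTneq c0 => e; rewrite -hu -e (awgt0 p theta) ltxx.
by apply: contraTneq c1 => e; rewrite -hu e (awgt1 p ht) ltxx.
Qed.

Lemma transport1K x : transport1 rho p theta (tauV x) = x.
Proof.
have [h e] := tauVP x; apply: (cdf_inj hrho); by rewrite cdf_transport1.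
Qed.

Lemma measurable_tauV : @measurable_fun _ _ mR mR setT tauV.
Proof.
apply: (measurability (@RGenOInfty.G R)) => //; first exact: RGenOInfty.measurableE.
move=> _ [_ [c ->] <-]; rewrite setTI.
have mc : @measurable_fun _ _ mR mR setT (Defs.cdf rho) by exact: continuous_measurable (cdf_continuous hrho).
have [c0|c0] := leP c 0.
  rewrite (_ : _ @^-1` _ = setT); first exact: measurableT.
  apply/seteqP; split => // x _; rewrite /= in_itv/= andbT.
  by have [/andP[h _] _] := tauVP x; exact: le_lt_trans c0 h.
have [c1|c1] := leP 1 c.
  rewrite (_ : _ @^-1` _ = set0); first exact: measurable0.
  apply/seteqP; split => // x; rewrite /= in_itv/= andbT.
  by have [/andP[_ h] _] := tauVP x => h'; have := lt_trans h' h; rewrite ltNge c1.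
have c01 : 0 < c < 1 by rewrite c0.
rewrite (_ : _ @^-1` _ = Defs.cdf rho @^-1` `]awgt p theta c, +oo[%classic).
  by rewrite -[X in measurable X]setTI; apply: mc => //; exact: measurable_itv.
apply/seteqP; split => x; rewrite /= !in_itv/= !andbT.
  by have [h1 h2] := tauVP x; rewrite -h2 awgt_ltE.
by have [h1 h2] := tauVP x; rewrite -h2 awgt_ltE.
Qed.

Let w := wgt p theta.
Let mw : @measurable_fun _ _ mR _ setT w. Proof. exact: measurable_wgt. Qed.
Let w0 x : 0 <= w x. Proof. exact: wgt_ge0. Qed.

Let nu1 := density leb mrho.
Let nu2 : {measure set mR -> \bar R} :=
  measure_function_pushforward__canonical__measure_function_Measure (density Un mw) measurable_tau.

Let nu1E (h : R -> \bar R) : @measurable_fun _ _ mR _ setT h -> (forall x, 0 <= h x)%E ->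
  (\int[nu1]_x h x = \int[leb]_x (h x * (rho x)%:E))%E.
Proof. by move=> mh h0; apply: integral_density => // x; exact: ltW. Qed.

Let nu2E (h : R -> \bar R) : @measurable_fun _ _ mR _ setT h -> (forall x, 0 <= h x)%E ->
  (\int[nu2]_x h x = \int[Un]_u (h (tau u) * (w u)%:E))%E.
Proof.
move=> mh h0; rewrite ge0_integral_pushforward//; first last.
- exact: measurable_tau.
rewrite preimage_setT integral_density//.
- by apply: measurableT_comp => //; exact: measurable_tau.
- by move=> x; exact: h0.
Qed.

Let indic (x : R) : (\int[leb]_t ((\1_(`]x, +oo[%classic) t * rho t)%:E) = (1 - Defs.cdf rho x)%:E)%E.
Proof.
rewrite -(integral_ray hrho) /Rintegral fineK.
  rewrite [RHS]integral_mkcond; apply: eq_integral => t _; rewrite patchE indicE.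
  by case: (_ \in _); rewrite ?mul1r ?mul0r.
apply: integrable_fin_num; first exact: measurable_itv.
by apply: integrableS (integrable_admissible hrho) => //; exact: measurable_itv.
Qed.

Let nu_ray (x : R) : nu1 `]x, +oo[%classic = nu2 `]x, +oo[%classic.
Proof.
have mx : measurable (`]x, +oo[%classic : set mR) by exact: measurable_itv.
transitivity ((1 - Defs.cdf rho x)%:E); first by rewrite /nu1 densityE.
transitivity (density Un mw (tau @^-1` `]x, +oo[%classic)); last by [].
have mt : measurable (tau @^-1` `]x, +oo[%classic : set mR).
  by rewrite -[X in measurable X]setTI; exact: measurable_tau.
rewrite densityE//.
have [h01 e] := tauVP x.
have hint : Un.-integrable setT (EFin \o (fun t : mR => \1_(tau @^-1` `]x, +oo[%classic) t * w t)).
  apply: (integrable_bounded (M := 2) Un_lty) => [|t].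
    by apply: measurable_funM => //; exact: measurable_indic.
  rewrite indicE; case: (_ \in _); rewrite ?mul1r ?mul0r ?normr0//; exact: wgt_le2.
rewrite -[RHS]fineK; last exact: integrable_fin_num hint.
congr (_%:E); rewrite -[RHS]/(\int[Un]_t (\1_(tau @^-1` `]x, +oo[%classic) t * w t)).
have h1 : 0 < tauV x <= 1 by have /andP[-> /ltW ->] := h01.
have mle : @measurable_fun _ _ mR _ setT (fun t : R => (t <= tauV x)%R%:R : R).
  have -> : (fun t : R => (t <= tauV x)%R%:R : R) = \1_(`]-oo, tauV x]%classic).
    by apply/funext => t; rewrite indicE mem_setE in_itv.
  exact: measurable_indic.
rewrite -e -(integral_wgt p1 ht h1) -[X in X - _](integral_wgt1 p1 ht) -RintegralB//; last 2 first.
- exact: integrable_wgt.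
- apply: (integrable_bounded (M := 2) Un_lty) => [|t]; first exact: measurable_funM.
  by case: (t <= _); rewrite ?mul1r ?mul0r ?normr0//; exact: wgt_le2.
rewrite !Rintegral_Un_unit; first last.
- by apply: measurable_funB => //; exact: measurable_funM.
- by apply/measurable_EFinP; exact: (measurable_int _ hint).
apply: eq_Rintegral => t; rewrite /unit_interval mem_setE in_itv/= => t01.
have -> : \1_(tau @^-1` `]x, +oo[%classic) t = (tauV x < t)%R%:R :> R.
  have key : (x < transport1 rho p theta t) = (tauV x < t).
    by rewrite -(cdf_ltE hrho) cdf_transport1// -e awgt_ltE.
  rewrite indicE -key -tauE//; congr ((_ : bool)%:R); apply/idP/idP.
    by rewrite inE/= in_itv/= andbT.
  by rewrite inE/= in_itv/= andbT.
by case: ltP => _; rewrite ?mul1r ?mul0r ?subr0 ?subrr.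
Qed.

Lemma change_of_variables (g : R -> R) : @measurable_fun _ _ mR _ setT g ->
  \int[leb]_x (g x * rho x) = \int[Un]_u (g (tau u) * w u).
Proof.
move=> mg.
have nuE (A : set mR) : measurable A -> nu1 A = nu2 A.
  have f1 : (nu1 setT < +oo)%E.
    rewrite /nu1 densityE//; under eq_integral do rewrite indicT mul1r.
    by rewrite irho1 ltry.
  exact: (ray_measure_unique f1 nu_ray).
have pos (h : R -> \bar R) : @measurable_fun _ _ mR _ setT h -> (forall x, 0 <= h x)%E ->
    (\int[leb]_x (h x * (rho x)%:E) = \int[Un]_u (h (tau u) * (w u)%:E))%E.
  move=> mh h0; apply: (etrans (esym (nu1E mh h0))); apply: (etrans _ (nu2E mh h0)).
  by apply: eq_measure_integral => A mA _; exact: nuE.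
have mEg : @measurable_fun _ _ mR _ setT (EFin \o g) by exact/measurable_EFinP.
rewrite /Rintegral; congr fine; rewrite [LHS]integralE [RHS]integralE; congr (_ - _)%E.
  have e (h k : mR -> R) x : 0 <= k x ->
      ((fun x => (h x * k x)%:E)^\+ x = (EFin \o h)^\+ x * (k x)%:E)%E.
    by move=> k0; rewrite !funeposE /= -!EFin_max -EFinM maxr_pMl ?mul0r.
  transitivity (\int[leb]_x ((EFin \o g)^\+%E x * (rho x)%:E))%E; first by apply: eq_integral => x _; exact: e.
  rewrite (pos _ (measurable_funepos mEg) (fun x => funepos_ge0 _ x)).
  by apply: eq_integral => u _; have := e (g \o tau) w u (w0 u); rewrite !funeposE /= => ->.
have e (h k : mR -> R) x : 0 <= k x ->
    ((fun x => (h x * k x)%:E)^\- x = (EFin \o h)^\- x * (k x)%:E)%E.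
  by move=> k0; rewrite !funenegE /= -!EFin_max -EFinM maxr_pMl ?mul0r ?mulNr.
transitivity (\int[leb]_x ((EFin \o g)^\-%E x * (rho x)%:E))%E; first by apply: eq_integral => x _; exact: e.
rewrite (pos _ (measurable_funeneg mEg) (fun x => funeneg_ge0 _ x)).
by apply: eq_integral => u _; have := e (g \o tau) w u (w0 u); rewrite !funenegE /= => ->.
Qed.

End transport.

(** * ANOVA components on the cube *)

Section anova.
Context {R : realType}.
Local Notation mR := (measurableTypeR R).
Local Notation leb := (@lebesgue_measure R).
Variables (rho : R -> R) (p : R) (s : nat) (theta : 'I_s -> R).
Hypotheses (hrho : admissible_density rho) (p1 : 1 <= p) (ht : forall j, 0 < theta j <= 1 / 2).

Local Notation P1 := (@Defs.proj1 R rho s).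
Let w j := wgt p (theta j).
Let mw j : @measurable_fun _ _ mR _ setT (w j). Proof. exact: measurable_wgt. Qed.
Let mrho : @measurable_fun _ _ mR _ setT rho. Proof. by have [[]] := hrho. Qed.

Let T (u : 'rV[R]_s) : 'rV[R]_s := \row_j tau rho p (theta j) (u ord0 j).

Lemma cubeE n (u : 'rV[R]_n) : @cube R n u <-> forall i, 0 < u ord0 i < 1.
Proof. by split=> h i; have := h i; rewrite /unit_interval/= in_itv. Qed.

Let TE u : @cube R s u -> transport rho p theta u = T u.
Proof. by move=> /cubeE h; apply/rowP => j; rewrite !mxE tauE. Qed.

Let mT : @measurable_fun _ _ 'rV[mR]_s 'rV[mR]_s setT T.
Proof.
apply: measurable_fun_row => j; under eq_fun do rewrite mxE.
by apply: measurableT_comp; [exact: measurable_tau|exact: measurable_row_coord].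
Qed.

Let mprodw (P : pred 'I_s) : @measurable_fun _ _ 'rV[mR]_s _ setT (fun u => \prod_(j | P j) w j (u ord0 j)).
Proof.
under eq_fun do rewrite big_mkcond/=; apply: measurable_prod => j _.
by case: (P j) => //; apply: measurableT_comp; [exact: mw|exact: measurable_row_coord].
Qed.

Lemma weighted_cubeE g u : @cube R s u -> weighted rho p theta g u = (\prod_j w j (u ord0 j)) * g (T u).
Proof.
move=> cu; rewrite /weighted TE//; congr (_ * _); apply: eq_bigr => j _.
by rewrite (weightE p (ht j))//; move/cubeE : cu.
Qed.

Definition wext g : 'rV[R]_s -> R := weighted rho p theta g \_ (@cube R s).

Lemma wextE g u : @cube R s u -> wext g u = (\prod_j w j (u ord0 j)) * g (T u).
Proof. by move=> cu; rewrite /wext patch_cube// weighted_cubeE. Qed.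

Lemma measurable_wext g : @measurable_fun _ _ 'rV[mR]_s _ setT g ->
  @measurable_fun _ _ 'rV[mR]_s _ setT (wext g).
Proof.
move=> mg.
have -> : wext g = (fun u => (\prod_j w j (u ord0 j)) * g (T u)) \_ (@cube R s).
  by apply/funext => u; rewrite /wext !patchE; case: ifP => // /set_mem/weighted_cubeE ->.
apply/measurable_patch_cube; apply: measurable_funTS; apply: measurable_funM; first exact: mprodw.
exact: measurableT_comp mg mT.
Qed.

(** Measurability of [f] has to be recovered from that of f^w: compose with the inverse transport
    [S] and divide by the weights, which are positive inside the cube. *)
Lemma measurable_unweighted f : measurable_fun (@cube R s : set 'rV[mR]_s) (weighted rho p theta f) ->
  @measurable_fun _ _ 'rV[mR]_s _ setT f.
Proof.
move=> /measurable_patch_cube mf.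
pose S (x : 'rV[R]_s) : 'rV[R]_s := \row_j tauV rho p (theta j) (x ord0 j).
have mS : @measurable_fun _ _ 'rV[mR]_s 'rV[mR]_s setT S.
  apply: measurable_fun_row => j; under eq_fun do rewrite mxE.
  by apply: measurableT_comp; [exact: measurable_tauV|exact: measurable_row_coord].
have Scube x : @cube R s (S x).
  by apply/cubeE => j; rewrite mxE; have [] := tauVP hrho p1 (ht j) (x ord0 j).
have -> : f = fun x => wext f (S x) * \prod_j (w j (S x ord0 j))^-1.
  apply/funext => x; rewrite wextE// mulrAC -big_split/= big1 ?mul1r => [|j _].
    congr f; apply/rowP => j; rewrite !mxE tauE ?transport1K//.
    by have [] := tauVP hrho p1 (ht j) (x ord0 j).
  rewrite mulfV// gt_eqF//; apply: wgt_gt0 => //; exact: (cubeE (S x)).1.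
apply: measurable_funM; first exact: measurableT_comp mf mS.
apply: measurable_prod => j _; apply: measurable_funTS.
have mSj : @measurable_fun _ _ 'rV[mR]_s _ setT (fun x => w j (S x ord0 j)).
  by apply: measurableT_comp; [exact: mw|exact: measurableT_comp (measurable_row_coord j) mS].
have -> : (fun x => (w j (S x ord0 j))^-1) = fun x => w j (S x ord0 j) `^ (-1).
  by apply/funext => x; rewrite powR_inv1// wgt_ge0.
exact: measurableT_comp (measurable_powR (-1)) mSj.
Qed.

Lemma measurable_set_coord (j : 'I_s) :
  measurable_fun setT (fun z : 'rV[mR]_s * mR => set_coord z.1 j z.2 : 'rV[mR]_s).
Proof.
apply: measurable_fun_row => i; under eq_fun do rewrite mxE.
case: (i == j); first exact: measurable_snd.
exact: measurableT_comp (measurable_row_coord i) measurable_fst.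
Qed.

Let meas_slice j (g : 'rV[R]_s -> R) u : @measurable_fun _ _ 'rV[mR]_s _ setT g ->
  @measurable_fun _ _ mR _ setT (fun t => g (set_coord u j t)).
Proof.
move=> mg; have pm : measurable_fun setT (fun t : mR => (u, t) : 'rV[mR]_s * mR) by exact: measurable_pair1.
exact: measurableT_comp mg (measurableT_comp (measurable_set_coord j) pm).
Qed.

Lemma measurable_proj1 j g : @measurable_fun _ _ 'rV[mR]_s _ setT g ->
  @measurable_fun _ _ 'rV[mR]_s _ setT (P1 j g).
Proof.
move=> mg; apply: (@measurable_Rintegral_section _ _ _ _ R leb (fun z : 'rV[mR]_s * mR => g (set_coord z.1 j z.2) * rho z.2)).
apply: measurable_funM; first exact: measurableT_comp mg (measurable_set_coord j).
exact: measurableT_comp mrho measurable_snd.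
Qed.

Lemma set_coord_cube (u : 'rV[R]_s) j t : @cube R s u -> 0 < t < 1 -> @cube R s (set_coord u j t).
Proof. by move=> /cubeE cu t01; apply/cubeE => i; rewrite set_coordE; case: eqP. Qed.

(** The change of variables turns rho(x_j) dx_j into w_j(t) dt. The new factor w_j(t) completes the
    product of weights under the integral, while the original w_j(u_j) stays outside. *)
Lemma wext_proj1 j g u : @measurable_fun _ _ 'rV[mR]_s _ setT g -> @cube R s u ->
  wext (P1 j g) u = w j (u ord0 j) * \int[Un]_t wext g (set_coord u j t).
Proof.
move=> mg cu; rewrite wextE// (bigD1 j)//= -mulrA; congr (_ * _).
have mgT : @measurable_fun _ _ mR _ setT (fun t => g (set_coord (T u) j t)) by exact: meas_slice.
rewrite /Defs.proj1 (change_of_variables hrho p1 (ht j) mgT).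
have mtau := measurable_tau hrho p1 (ht j).
have mgt : @measurable_fun _ _ mR _ setT (fun t => g (set_coord (T u) j (tau rho p (theta j) t)) * w j t).
  by apply: measurable_funM => //; exact: measurableT_comp mgT mtau.
pose c := \prod_(i < s | i != j) w i (u ord0 i).
have m1 : @measurable_fun _ _ mR _ setT (fun t => c * (g (set_coord (T u) j (tau rho p (theta j) t)) * w j t)).
  exact: measurable_funM.
have m2 : @measurable_fun _ _ mR _ setT (fun t => wext g (set_coord u j t)).
  by apply: (meas_slice j u (measurable_wext mg)).
rewrite -(Rintegral_scale Un c mgt) (Rintegral_Un_unit m1) (Rintegral_Un_unit m2).
apply: eq_Rintegral => t; rewrite /unit_interval mem_setE in_itv/= => t01.
rewrite wextE; last exact: set_coord_cube.
have -> : T (set_coord u j t) = set_coord (T u) j (tau rho p (theta j) t).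
  by apply/rowP => i; rewrite !mxE; case: eqP => [->|].
rewrite [in RHS](bigD1 j)//= set_coordE eqxx.
have -> : \prod_(i < s | i != j) w i (set_coord u j t ord0 i) = c.
  by apply: eq_bigr => i ij; rewrite set_coordE (negbTE ij).
by rewrite [in RHS]mulrC [in RHS]mulrA [in RHS]mulrC.
Qed.

Definition wextc g (u : 'rV[R]_s) : R[i] := (wext g u)%:C%C.

Lemma wextc_proj1 j g u : @measurable_fun _ _ 'rV[mR]_s _ setT g -> @cube R s u ->
  wextc (P1 j g) u = Ek (w j) j (wextc g) u.
Proof. by move=> mg cu; rewrite /wextc wext_proj1// /Ek cI_real -rmorphM. Qed.

Lemma Ek_cube n k j (g g' : 'rV[R]_n -> R[i]) u : cintble (Pn n) g -> cintble (Pn n) g' ->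
  (forall u, @cube R n u -> g u = g' u) -> @cube R n u -> Ek k j g u = Ek k j g' u.
Proof.
move=> ig ig' gg' /cubeE cu; rewrite /Ek; congr (_ * _).
apply: ae_eq_cI; [exact: section_cmeas ig u|exact: section_cmeas ig' u|].
have [N [mN N0 hN]] := @ae_Un_unit R; exists N; split => // t nt; apply: hN => /= t01; apply: nt.
by apply: gg'; apply/cubeE => i; rewrite set_coordE; case: eqP => // _; move: t01; rewrite /unit_interval/= in_itv.
Qed.

(** These folds copy those of [proj] and [anova] step by step, so the correspondence on the cube is
    a plain induction with no reordering. *)
Definition averages (r : seq 'I_s) (F : 'rV[R]_s -> R[i]) := foldr (fun j G => Ek (w j) j G) F r.
Definition deviations (r : seq 'I_s) (F : 'rV[R]_s -> R[i]) := foldr (fun j G u => G u - Ek (w j) j G u) F r.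

Let cw j : cintble Un (fun t : mR => (w j t)%:C%C).
Proof. by apply: cintble_real; exact: integrable_wgt. Qed.

Let cdw j : cintble Un (fun t : mR => (dwgt p (theta j) t)%:C%C).
Proof. by apply: cintble_real; exact: integrable_dwgt. Qed.

Let mixed_E j G : mixed G -> mixed (Ek (w j) j G).
Proof. by move=> mG; apply: mixed_Ek mG; [exact: cw|exact: cdw|exact: wder1_wgt]. Qed.

Lemma mixed_averages r F : mixed F -> mixed (averages r F).
Proof. by move=> mF; elim: r => [//|j r IH] /=; exact: mixed_E. Qed.

Lemma mixed_deviations r F : mixed F -> mixed (deviations r F).
Proof. by move=> mF; elim: r => [//|j r IH] /=; apply: mixedB => //; exact: mixed_E. Qed.

Variable f : 'rV[R]_s -> R.
Hypothesis hf : W12mix (weighted rho p theta f).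

Let mf : @measurable_fun _ _ 'rV[mR]_s _ setT f.
Proof. by apply: measurable_unweighted; have [[]] := hf. Qed.

Lemma mixed_wextc : mixed (wextc f). Proof. exact: W12mix_mixed. Qed.

Let cintble_wext h G : cintble (Pn s) G -> (forall u, @cube R s u -> wextc h u = G u) ->
  cintble (Pn s) (wextc h).
Proof.
move=> [iG _] hG; apply: cintble_real.
have -> : wext h = (fun u => complex.Re (G u)) \_ (@cube R s).
  apply/funext => u; rewrite patchE; case: ifP => [/set_mem/hG <- //|nc].
  by rewrite /wext patchE nc.
exact: integrable_patch.
Qed.

Lemma wextc_averages r : let g := foldr P1 f r in
  [/\ @measurable_fun _ _ 'rV[mR]_s _ setT g, cintble (Pn s) (wextc g) &
   forall u, @cube R s u -> wextc g u = averages r (wextc f) u].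
Proof.
elim: r => [|j r /= [mg ig gE]] /=; first by split => //; have [] := mixed_wextc.
have [iG _] := mixed_averages r mixed_wextc.
have mg' := measurable_proj1 j mg.
have e u : @cube R s u -> wextc (P1 j (foldr P1 f r)) u =
    Ek (w j) j (averages r (wextc f)) u.
  by move=> cu; rewrite wextc_proj1//; exact: Ek_cube.
split => //; have [iE _] := mixed_averages (j :: r) mixed_wextc.
exact: cintble_wext iE e.
Qed.

Lemma wextc_deviations r g F : @measurable_fun _ _ 'rV[mR]_s _ setT g -> cintble (Pn s) (wextc g) ->
    mixed F -> (forall u, @cube R s u -> wextc g u = F u) ->
  let h := foldr (fun j g x => g x - P1 j g x) g r in
  [/\ @measurable_fun _ _ 'rV[mR]_s _ setT h, cintble (Pn s) (wextc h) &
   forall u, @cube R s u -> wextc h u = deviations r F u].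
Proof.
move=> mg ig mF gF /=; elim: r => [//|j r [mh ih hE]] /=.
set h := foldr _ g r in mh ih hE *.
have [iG _] := mixed_deviations r mF.
have mh' : @measurable_fun _ _ 'rV[mR]_s _ setT (fun x => h x - P1 j h x).
  by apply: measurable_funB => //; exact: measurable_proj1.
have e u : @cube R s u -> wextc (fun x => h x - P1 j h x) u = deviations (j :: r) F u.
  move=> cu; rewrite /= -hE// -(Ek_cube _ _ ih iG hE cu) -wextc_proj1//.
  by rewrite /wextc !wextE// mulrBr rmorphB.
split => //; have [iE _] := mixed_deviations (j :: r) mF.
exact: cintble_wext iE e.
Qed.

Lemma wextc_anova (v : {set 'I_s}) u : @cube R s u ->
  wextc (anova rho f v) u = deviations (enum v) (averages (enum (~: v)%SET) (wextc f)) u.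
Proof.
have [m1 i1 e1] := wextc_averages (enum (~: v)%SET).
have mF := mixed_averages (enum (~: v)%SET) mixed_wextc.
by have [_ _ h] := wextc_deviations (enum v) m1 i1 mF e1; exact: h.
Qed.

(** Each [proj1 j] removes [j] from the set of coordinates on which a function depends, and I - P_j
    with j in [v] adds none outside [v]. This holds pointwise, not only almost everywhere. *)
Lemma anova_indep (v : {set 'I_s}) (x y : 'rV[R]_s) : (forall j, j \in v -> x ord0 j = y ord0 j) ->
  anova rho f v x = anova rho f v y.
Proof.
pose dep (A : pred 'I_s) (g : 'rV[R]_s -> R) := forall x y : 'rV[R]_s, (forall j, A j -> x ord0 j = y ord0 j) -> g x = g y.
have d1 (A B : pred 'I_s) j g : dep A g -> (forall i, A i -> i != j -> B i) -> dep B (P1 j g).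
  move=> dg AB x' y' h; apply: eq_Rintegral => t _; congr (_ * _); apply: dg => i Ai.
  by rewrite !set_coordE; case: eqVneq => // ij; apply: h; exact: AB.
have d2 r : dep (fun j => j \notin r) (foldr P1 f r).
  elim: r => [|j r IH] /=; first by move=> x' y' h; congr f; apply/rowP => j; rewrite h.
  by apply: d1 IH _ => i ir ij; rewrite inE negb_or ij.
have d3 (A : pred 'I_s) r g : (forall j, j \in r -> A j) -> dep A g ->
    dep A (foldr (fun j g x => g x - P1 j g x) g r).
  elim: r => [//|j r IH] hr dg /=; have hr' i : i \in r -> A i by move=> ir; apply: hr; rewrite inE ir orbT.
  have h := IH hr' dg => x' y' h'; congr (_ - _); first exact: h.
  by apply: (d1 _ A _ _ h) h'.
move=> h; apply: (d3 (fun j => j \in v)) h => [j|]; first by rewrite mem_enum.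
move=> x' y' h; apply: d2 => j; rewrite mem_enum inE negbK; exact: h.
Qed.

(** Since f_v depends on the coordinates in [v] only, the weights of the remaining coordinates split
    off as a product. *)
Lemma wextc_anova_weighted (v : {set 'I_s}) u : @cube R s u ->
  wextc (anova rho f v) u =
  (anova_weighted rho p theta f v (res v u) * \prod_(j in (~: v)%SET) w j (u ord0 j))%:C%C.
Proof.
move=> cu; rewrite /wextc wextE//; congr (_%:C%C).
rewrite /anova_weighted -mulrA [LHS]mulrC; congr (_ * _).
  rewrite -TE//; apply: anova_indep => j /in_setP_enum[i ->].
  rewrite !mxE; case: pickP => [k /eqP/enum_val_inj ->|/(_ i)]; last by rewrite eqxx.
  by rewrite /= mxE.
rewrite (bigID (fun j => j \in v))/=; congr (_ * _).
  rewrite big_enum_val/=; apply: eq_bigr => i _.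
  by rewrite mxE (weightE p (ht _) ((cubeE u).1 cu _)).
by apply: eq_bigl => j; rewrite inE.
Qed.

End anova.

(** * The orthonormal system *)

Section almost_everywhere.
Context {R : realType} {d} {T : measurableType d} (m : {measure set T -> \bar R}).

Lemma ae_imp (P Q : T -> Prop) : (forall x, P x -> Q x) ->
  {ae m, forall x, P x} -> {ae m, forall x, Q x}.
Proof. by move=> PQ; apply: filterS. Qed.

Lemma ae_and (P Q : T -> Prop) : {ae m, forall x, P x} -> {ae m, forall x, Q x} ->
  {ae m, forall x, P x /\ Q x}.
Proof. by move=> hP hQ; apply: filterS2 hP hQ. Qed.

Lemma ae_all (I : finType) (P : I -> T -> Prop) : (forall i, {ae m, forall x, P i x}) ->
  {ae m, forall x, forall i, P i x}.
Proof.
move=> hP; have : {ae m, forall x, forall i, i \in enum I -> P i x}.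
  elim: (enum I) => [|i r IH]; first by apply: aeW.
  apply: ae_imp (ae_and (hP i) IH) => x [h1 h2] j; rewrite inE => /predU1P[->//|]; exact: h2.
by apply: ae_imp => x h i; apply: h; rewrite mem_enum.
Qed.

End almost_everywhere.

(** * Integration by parts for primitives on the interval *)

Section primitive_parts.
Context {R : realType}.
Local Notation mR := (measurableTypeR R).

Lemma ae_leb_Un (Q : R -> Prop) :
  {ae @lebesgue_measure R, forall u, unit_interval u -> Q u} -> {ae @Un R, forall u : mR, Q u}.
Proof.
move=> [N [mN N0 hN]].
have [N' [mN' N0' hN']] := @ae_Un_unit R.
exists (N `|` N'); split.
- exact: measurableU.
- apply/eqP; rewrite -measure_le0; apply: le_trans (@measureU2 _ _ _ Un _ _ mN mN') _.
  rewrite -[leLHS]/(Un N + Un N')%E N0' adde0 -N0.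
  rewrite /Un/= /uniform /mrestr; apply: le_measure; rewrite ?inE//.
  by apply: measurableI => //; exact: measurable_unit_interval.
- move=> u /= nQ; have [uu|uu] := pselect (unit_interval u); last by right; exact: hN'.
  by left; apply: hN => /= h; apply: nQ; exact: h.
Qed.

Lemma Un_point (t : R) : {ae @Un R, forall u : mR, u != t}.
Proof.
exists [set t]; split.
- exact: measurable_set1.
- apply/eqP; rewrite -measure_le0 /Un/= /uniform /mrestr -(lebesgue_measure_set1 t).
  apply: le_measure; rewrite ?inE//.
  by apply: measurableI; [exact: measurable_set1|exact: measurable_unit_interval].
- by move=> u /= /negP; rewrite negbK => /eqP.
Qed.

(** Fubini for a(t) b(u): the indicators of t <= u and of u <= t add up to 1 off the diagonal, which
    is negligible. *)
Lemma prim_parts (a b : R -> R[i]) : @cmeas _ mR _ a -> @cmeas _ mR _ b -> cbounded a -> cbounded b ->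
  cI Un (fun u => prim a u * b u) + cI Un (fun u => a u * prim b u) = cI Un a * cI Un b.
Proof.
move=> ma mb ba bb.
have ia : cintble Un a by apply: cintble_bounded => //; exact: Un_lty.
have ib : cintble Un b by apply: cintble_bounded => //; exact: Un_lty.
pose F (z : mR * mR) : R[i] := ((z.2 : R) <= z.1)%R%:R * (a z.2 * b z.1).
have ma2 : cmeas (fun z : mR * mR => a z.2) by exact: (mpres_cmeas (mpres_snd Un Un) ma).
have mb1 : cmeas (fun z : mR * mR => b z.1) by exact: (mpres_cmeas (mpres_fst Un Un) mb).
have iF : cintble (Un \x Un)%E F.
  apply: cintble_bounded; [exact: prod_lty|apply: cmeasM; [exact: cmeas_le2|exact: cmeasM]|].
  apply: cboundedM; first exact: (cbounded_bool (fun z : mR * mR => (z.2 : R) <= z.1)).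
  by apply: cboundedM; [case: ba => M h; exists M => z; exact: h|case: bb => M h; exists M => z; exact: h].
have [i1 e1] := cI_fubini1 iF; have [i2 e2] := cI_fubini2 iF.
have -> : cI Un (fun u => prim a u * b u) = cI Un (fun u => cI Un (fun t => F (u, t))).
  apply: eq_cI => u; rewrite /prim mulrC -cIZ; last exact: prim_cintble.
  by apply: eq_cI => t; rewrite /F /=; ring.
rewrite e1 -e2 -cID//; last first.
  apply: cintble_bounded; [exact: Un_lty|by apply: cmeasM => //; exact: cmeas_prim|].
  by apply: cboundedM => //; exact: cbounded_prim.
transitivity (cI Un (fun t => cI Un b * a t)); last by rewrite cIZ// mulrC.
apply: eq_cI => t; rewrite mulrC.
have mle : @cmeas _ mR _ (fun u : R => (t <= u)%R%:R : R[i]).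
  have -> : (fun u : R => (t <= u)%R%:R : R[i]) = fun u => ((\1_(`[t, +oo[%classic) u : R))%:C%C.
    by apply/funext => u; rewrite indicE mem_setE in_itv/= andbT; case: (t <= u); rewrite ?rmorph1 ?rmorph0.
  apply: cmeas_real; exact: measurable_indic.
have ile : cintble Un (fun u : mR => (t <= u)%R%:R * b u).
  apply: cintble_bounded; [exact: Un_lty|exact: cmeasM|].
  by apply: cboundedM => //; exact: (cbounded_bool (fun u : mR => t <= u)).
have -> : cI Un (fun u => F (u, t)) = a t * cI Un (fun u : mR => (t <= u)%R%:R * b u).
  by rewrite -cIZ//; apply: eq_cI => u; rewrite /F /=; ring.
rewrite [prim b t * _]mulrC -mulrDr mulrC; congr (_ * _).
rewrite -cID//; last exact: prim_cintble.
apply: ae_eq_cI.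
- by apply: cmeasD; [exact: cintble_meas ile|exact: cintble_meas (prim_cintble mb t bb)].
- exact: mb.
apply: ae_imp (Un_point t) => u; rewrite neq_lt => /orP[h|h].
  by rewrite (ltW h) leNgt h /= mul0r add0r mul1r.
by rewrite (ltW h) leNgt h /= mul1r mul0r addr0.
Qed.

(** Integration by parts against the derivative of a test function [chi] shows that [a] annihilates
    [chi]; the fundamental lemma extends this to bounded functions. *)
Lemma prim_eq0 (a b : R -> R[i]) : @cmeas _ mR _ a -> @cmeas _ mR _ b -> cbounded a -> cbounded b ->
  {ae @Un R, forall u : mR, prim a u = 0} -> cI Un (fun u => a u * b u) = 0.
Proof.
move=> ma mb ba bb a0.
have ia : cintble Un a by apply: cintble_bounded => //; exact: Un_lty.
have mid : measurable_fun setT (fun t : mR => t : R) by exact: measurable_id.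
apply: (@fundamental_lemma_c R _ mR Un a (fun t => t) b ia mid (@ae_Un_unit R)) => // chi tchi.
have tchi' := test1_derive tchi.
have mc := test1_cmeas tchi'; have bc := test1_cbounded tchi'.
have := prim_parts ma mc ba bc.
have [schi [f f0 hf]] := tchi; have [_ dchi] := smooth1_derive schi.
have chi0 : chi 0 = 0 by apply: hf; rewrite negb_and -!ltNge f0.
have chi1 : chi 1 = 0 by apply: hf; rewrite negb_and -!ltNge; apply/orP; right; lra.
have cc' : continuous (derive1 chi) by apply: smooth1_continuous; have [] := tchi'.
have c0 : cI Un (fun t : mR => (derive1 chi t)%:C%C) = 0.
  by rewrite cI_real (FTC_Un1 dchi cc') chi1 chi0 subrr.
have pc : cI Un (fun u => a u * prim (fun t => (derive1 chi t)%:C%C) u) = cI Un (fun u => a u * (chi u)%:C%C).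
  apply: ae_eq_cI.
  - by apply: cmeasM => //; exact: cmeas_prim.
  - by apply: cmeasM => //; exact: test1_cmeas.
  apply: ae_imp (@ae_Un_unit R) => u; rewrite /unit_interval/= in_itv/= => /andP[u0 /ltW u1].
  rewrite /prim; congr (_ * _); under eq_cI => t.
    rewrite (_ : (t <= u)%R%:R * (derive1 chi t)%:C%C = ((t <= u)%R%:R * derive1 chi t)%:C%C); first over.
    by rewrite rmorphM rmorph_nat.
  rewrite cI_real (FTC_Un dchi cc'); last by rewrite u0.
  by rewrite chi0 subr0.
rewrite c0 mulr0 pc [X in X + _](_ : _ = 0) ?add0r//.
transitivity (cI Un (cst 0 : R -> R[i])); last by rewrite cI_cst//; exact: probability_setT.
apply: ae_eq_cI; [by apply: cmeasM => //; exact: cmeas_prim|exact: cmeas_cst|].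
by apply: ae_imp a0 => u ->; rewrite mul0r.
Qed.

End primitive_parts.

(** * Bessel's inequality for a finite orthonormal family *)

Section bessel.
Context {R : realType} {d} {T : measurableType d} (m : probability T R).
Variables (I : eqType) (r : seq I) (e : I -> T -> R[i]) (G : T -> R[i]).
Hypotheses (ur : uniq r) (me : forall i, cmeas (e i)) (be : forall i, cbounded (e i)).
Hypothesis orth : forall i j, i \in r -> j \in r -> cI m (fun x => e i x * conjc (e j x)) = (i == j)%:R.
Hypotheses (iG : cintble m G) (iG2 : m.-integrable setT (EFin \o (fun x => Normc.normc (G x) ^+ 2))).

(** With [P] the partial Fourier sum, the integrals of G conj(P) and of |P|^2 both equal [S], so the
    statement is the integral of |G - P|^2 >= 0. *)
Lemma bessel : \sum_(i <- r) Normc.normc (cI m (fun x => G x * conjc (e i x))) ^+ 2 <=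
  \int[m]_x (Normc.normc (G x) ^+ 2).
Proof.
pose c i := cI m (fun x => G x * conjc (e i x)).
pose S := \sum_(i <- r) Normc.normc (c i) ^+ 2.
pose P x := \sum_(i <- r) c i * e i x.
have moo : (m setT < +oo :> \bar R)%E by rewrite probability_setT ltry.
have mP : cmeas P by apply: cmeas_sum => i; apply: cmeasM => //; exact: cmeas_cst.
have bP : cbounded P by apply: cbounded_sum => i; apply: cboundedM => //; exact: cbounded_cst.
have mPc := cmeas_conj mP; have bPc := cbounded_conj bP.
have PcE x : conjc (P x) = \sum_(i <- r) conjc (c i) * conjc (e i x).
  by rewrite /P rmorph_sum; apply: eq_bigr => i _; rewrite rmorphM.
have mec i := cmeas_conj (me i); have bec i := cbounded_conj (be i).
have E1 : cI m (fun x => G x * conjc (P x)) = S%:C%C.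
  under eq_cI do rewrite PcE mulr_sumr.
  rewrite cI_sum => [|i]; last first.
    by under eq_fun do rewrite mulrCA; apply: cintbleZ; exact: cintbleMb.
  rewrite rmorph_sum; apply: eq_bigr => i _.
  under eq_cI do rewrite mulrCA.
  by rewrite cIZ ?[conjc _ * _]mulrC ?mulc_conj//; exact: cintbleMb.
have E2 : cI m (fun x => P x * conjc (P x)) = S%:C%C.
  have ie i : cintble m (e i) by exact: cintble_bounded.
  have ieP i : cintble m (fun x => e i x * conjc (P x)) by exact: cintbleMb.
  under eq_cI do rewrite {1}/P mulr_suml.
  rewrite cI_sum => [|i]; last by under eq_fun do rewrite -mulrA; exact: cintbleZ.
  rewrite rmorph_sum; apply: eq_big_seq => i ir.
  under eq_cI do rewrite -mulrA.
  rewrite cIZ//; transitivity (c i * conjc (c i)); last by rewrite mulc_conj.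
  congr (_ * _).
  under eq_cI do rewrite PcE mulr_sumr.
  rewrite cI_sum => [|j]; last first.
    by under eq_fun do rewrite mulrCA; apply: cintbleZ; exact: cintbleMb.
  rewrite (bigD1_seq i)//= big1_seq ?addr0 => [|j /andP[ji jr]].
    under eq_cI do rewrite mulrCA.
    by rewrite cIZ ?orth ?eqxx ?mulr1//; exact: cintbleMb.
  under eq_cI do rewrite mulrCA.
  by rewrite cIZ ?orth// 1?eq_sym ?(negbTE ji) ?mulr0//; exact: cintbleMb.
(* [Q] is |G|^2 - |G - P|^2 at each point; its integral is 2S - S = S. *)
pose Q x := (complex.Re (G x * conjc (P x)) + complex.Re (G x * conjc (P x))) - Normc.normc (P x) ^+ 2.
have [iGP _] : cintble m (fun x => G x * conjc (P x)) by exact: cintbleMb.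
have [iPP _] : cintble m (fun x => P x * conjc (P x)).
  by apply: cintble_bounded => //; [exact: cmeasM|exact: cboundedM].
have nE x : complex.Re (P x * conjc (P x)) = Normc.normc (P x) ^+ 2 by rewrite mulc_conj.
have iPP' : m.-integrable setT (EFin \o (fun x => Normc.normc (P x) ^+ 2)).
  by apply: eq_integrable iPP => // x _ /=; rewrite nE.
have iGP2 : m.-integrable setT (EFin \o (fun x => (complex.Re (G x * conjc (P x)) + complex.Re (G x * conjc (P x))))).
  exact: (integrableD measurableT iGP iGP).
have SQ : S = \int[m]_x Q x.
  rewrite /Q RintegralB//.
  rewrite RintegralD// -!Re_cI E1/=.
  under eq_Rintegral do rewrite -nE.
  by rewrite -Re_cI E2/= addrK.
rewrite -[leLHS]/S SQ; apply: le_Rintegral => //.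
  exact: (integrableB measurableT iGP2 iPP').
move=> x _; rewrite /Q; move: (P x) (G x) => -[pa pb] [ga gb].
rewrite !normc_sqr/=; have := sqr_ge0 (ga - pa); have := sqr_ge0 (gb - pb).
rewrite !expr2 mulrN opprK => h1 h2.
by rewrite -subr_ge0; apply: le_trans (addr_ge0 h1 h2) _; rewrite le_eqVlt; apply/orP; left; apply/eqP; ring.
Qed.

End bessel.

(** * Representatives bounded at every point *)

Section representatives.
Context {R : realType}.
Local Notation mR := (measurableTypeR R).
Local Notation leb := (@lebesgue_measure R).
Implicit Types g : R -> R[i].

Definition cpatch g (u : R) : R[i] := if u \in unit_interval then g u else 0.

Let ReE g : @complex.Re R \o cpatch g = (@complex.Re R \o g) \_ unit_interval.
Proof. by apply/funext => u; rewrite /= /cpatch patchE; case: ifP. Qed.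

Let ImE g : @complex.Im R \o cpatch g = (@complex.Im R \o g) \_ unit_interval.
Proof. by apply/funext => u; rewrite /= /cpatch patchE; case: ifP. Qed.

Lemma cmeas_cpatch g : measurable_fun (unit_interval : set mR) (@complex.Re R \o g) ->
  measurable_fun (unit_interval : set mR) (@complex.Im R \o g) -> @cmeas _ mR _ (cpatch g).
Proof.
by move=> h1 h2; split; rewrite ?ReE ?ImE; apply/(measurable_restrictT _ _).1 => //; exact: measurable_unit_interval.
Qed.

Lemma cintegral_unit g : cintegral leb unit_interval g = cI Un (cpatch g).
Proof.
rewrite /cI /cintegral -!Rintegral_Un; congr Complex; apply: eq_Rintegral => u _.
  by rewrite -[RHS]/((@complex.Re R \o cpatch g) u) ReE.
by rewrite -[RHS]/((@complex.Im R \o cpatch g) u) ImE.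
Qed.

Lemma primitive_prim g u : 0 < u < 1 -> primitive g u = prim (cpatch g) u.
Proof.
move=> /andP[u0 u1]; rewrite /primitive /prim.
have -> : (fun t : mR => ((t : R) <= u)%R%:R * cpatch g t) = cpatch (fun t => (t <= u)%R%:R * g t).
  by apply/funext => t; rewrite /cpatch; case: ifP; rewrite ?mulr0.
rewrite -cintegral_unit /cintegral; congr Complex; rewrite Rintegral_mkcond [RHS]Rintegral_mkcond;
  apply: eq_Rintegral => t _; rewrite !patchE /unit_interval !mem_setE !in_itv/=.
all: have [tu|tu] := leP t u; first by rewrite (le_lt_trans tu u1) !andbT mul1r.
all: by rewrite mul0r andbF; case: ifP.
Qed.

(** The representative is set to 0 where the modulus exceeds [C], which happens on a null set
    only. *)
Lemma bounded_representative g (C : R) : 0 <= C ->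
  measurable_fun (unit_interval : set mR) (@complex.Re R \o g) ->
  measurable_fun (unit_interval : set mR) (@complex.Im R \o g) ->
  {ae leb, forall u, unit_interval u -> Normc.normc (g u) <= C} ->
  exists f, [/\ @cmeas _ mR _ f, forall u, Normc.normc (f u) <= C & {ae @Un R, forall u : mR, f u = cpatch g u}].
Proof.
move=> C0 h1 h2 gC; have mg := cmeas_cpatch h1 h2.
pose A : set mR := [set u | Normc.normc (cpatch g u) <= C].
have mA : measurable A.
  have h : measurable_fun setT (fun u : mR => Normc.normc (cpatch g u) <= C).
    by apply: measurable_fun_ler => //; exact: measurable_normc.
  by rewrite -[A]setTI; exact: (h measurableT [set true]).
exists (fun u => (\1_A u : R)%:C%C * cpatch g u); split.
- by apply: cmeasM => //; apply: cmeas_real; exact: measurable_indic.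
- move=> u; rewrite indicE Normc.normcM normc_real; case: (boolP (u \in A)) => [/set_mem h|_].
    by rewrite normr1 mul1r.
  by rewrite normr0 mul0r.
- apply: ae_imp (ae_and (ae_leb_Un gC) (@ae_Un_unit R)) => u [h uu].
  by rewrite indicE mem_set ?mul1r// /A/= /cpatch mem_set.
Qed.

Lemma cLnorm_ae g (C : R) : (cLnorm +oo%E g <= C%:E)%E ->
  {ae leb, forall u, unit_interval u -> Normc.normc (g u) <= C}.
Proof.
(* The norm of exponent +oo is an essential supremum once the underlying space has positive measure;
   [0,1] witnesses that. *)
rewrite /cLnorm unlock /Lnorm ifT; last first.
  apply: (@lt_le_trans _ _ (leb `[0, 1]%classic)).
    by rewrite lebesgue_measure_itv/= lte_fin ltr01 sube0 lte_fin ltr01.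
  by apply: le_measure; rewrite ?inE//; exact: measurableT.
move=> /ess_sup_inf.ess_supP; apply: ae_imp => u /= h uu; move: h; rewrite patchE mem_set//= lee_fin.
by rewrite ger0_norm// normc_ge0.
Qed.

Lemma ae_Un_point (Q : R -> Prop) : {ae @Un R, forall u : mR, Q u} -> exists u, Q u.
Proof.
move=> h; apply: contrapT => /forallNP nQ.
have [N [mN N0 hN]] := h.
have NT : N = setT by apply/seteqP; split => // u _; apply: hN => /=; exact: nQ.
have := @probability_setT _ _ R (@Un R).
by rewrite -NT -[X in X = _]/(Un N) N0 => /eqP; rewrite eqe eq_sym oner_eq0.
Qed.

End representatives.

Section basis.
Context {R : realType}.
Local Notation mR := (measurableTypeR R).
Local Notation leb := (@lebesgue_measure R).
Variables (phi : nat -> R -> R[i]) (Cphi : R).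
Hypotheses (phi_basis : orthonormal_basis phi)
  (phi0 : {ae leb, forall u, unit_interval u -> phi 0%N u = 1})
  (hCphi : ereal_sup (range (fun k => cLnorm +oo%E (phi k))) = Cphi%:E).

Let phi_le k : {ae leb, forall u, unit_interval u -> Normc.normc (phi k u) <= Cphi}.
Proof. by apply: cLnorm_ae; rewrite -hCphi; apply: ereal_sup_ubound; exists k. Qed.

(** A common point of the almost sure properties exists, and there [phi 0] has the value 1 and
    modulus at most [Cphi]. *)
Lemma Cphi_ge1 : 1 <= Cphi.
Proof.
have [u [[h1 h2] uu]] := ae_Un_point (ae_and (ae_and (ae_leb_Un phi0) (ae_leb_Un (phi_le 0))) (@ae_Un_unit R)).
by move: h2; rewrite h1 Normc.normc1.
Qed.

(** Besides the pointwise bound, it matters that [psi 0] is 1 at every point: characters then do not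
    depend at all on coordinates with index 0. *)
Lemma bounded_basis : exists psi : nat -> R -> R[i], [/\ psi 0%N = (fun=> 1),
  forall k, @cmeas _ mR _ (psi k), forall k u, Normc.normc (psi k u) <= Cphi,
  forall k, {ae @Un R, forall u : mR, psi k u = cpatch (phi k) u} &
  forall k l, cI Un (fun u => psi k u * conjc (psi l u)) = (k == l)%:R].
Proof.
have [hL2 orth _] := phi_basis.
have /choice[f hf] k := bounded_representative (le_trans ler01 Cphi_ge1)
  (let: And3 m1 _ _ := hL2 k in m1) (let: And3 _ m2 _ := hL2 k in m2) (@phi_le k).
pose psi k := if k == 0%N then (fun=> 1) else f k.
have hpsi k : [/\ @cmeas _ mR _ (psi k), forall u, Normc.normc (psi k u) <= Cphi &
    {ae @Un R, forall u : mR, psi k u = cpatch (phi k) u}].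
  rewrite /psi; case: eqP => [->|_]; last exact: hf.
  split; [exact: cmeas_cst|by move=> u; rewrite Normc.normc1 Cphi_ge1|].
  by apply: ae_imp (ae_and (ae_leb_Un phi0) (@ae_Un_unit R)) => u [h uu]; rewrite /cpatch mem_set.
exists psi; split => // [k|k u|k|k l]; try by have [] := hpsi k.
rewrite -orth cintegral_unit.
have [m1 _ a1] := hpsi k; have [m2 _ a2] := hpsi l.
apply: ae_eq_cI.
- by apply: cmeasM => //; exact: cmeas_conj.
- have [mk1 mk2 _] := hL2 k; have [ml1 ml2 _] := hL2 l.
  have := cmeasM (cmeas_cpatch mk1 mk2) (cmeas_conj (cmeas_cpatch ml1 ml2)).
  congr cmeas; apply/funext => u; rewrite /cpatch; case: ifP => // _; by rewrite mul0r.
- apply: ae_imp (ae_and a1 a2) => u [-> ->]; rewrite /cpatch; case: ifP => // _; by rewrite mul0r.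
Qed.

Variables (lambda : nat -> R[i]) (calN calM : nat -> nat) (phistar : nat -> R -> R[i]).
Hypotheses (calN_gt0 : forall k, (0 < k)%N -> (0 < calN k)%N)
  (phistar_Loo : forall l, (0 < l)%N -> inLp +oo%E (phistar l) /\ cLnorm +oo%E (phistar l) = 1%E)
  (hprimitive : forall k, (0 < k)%N -> {ae leb, forall u, unit_interval u ->
     primitive (phi k) u = lambda k * phistar (calN k) u * phi (calM k) u}).

Lemma bounded_star (psi : nat -> R -> R[i]) : (forall k, @cmeas _ mR _ (psi k)) ->
  (forall k u, Normc.normc (psi k u) <= Cphi) ->
  (forall k, {ae @Un R, forall u : mR, psi k u = cpatch (phi k) u}) ->
  exists sigma : nat -> R -> R[i], [/\ forall l, @cmeas _ mR _ (sigma l),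
   forall l u, Normc.normc (sigma l u) <= 1 &
   forall k, (0 < k)%N -> {ae @Un R, forall u : mR, prim (psi k) u = lambda k * sigma (calN k) u * psi (calM k) u}].
Proof.
move=> mpsi bpsi apsi.
have /choice[sigma hs] : forall l, exists f : R -> R[i], [/\ @cmeas _ mR _ f, forall u, Normc.normc (f u) <= 1 &
    (0 < l)%N -> {ae @Un R, forall u : mR, f u = cpatch (phistar l) u}].
  (* Index 0 is not a value of [calN] at a positive argument; the constant 1 merely fills the
     place. *)
  case=> [|l]; first by exists (fun=> 1); split => [|u|//]; [exact: cmeas_cst|rewrite Normc.normc1].
  have [[m1 m2 _] n1] := phistar_Loo (ltn0Sn l).
  have h : (cLnorm +oo%E (phistar l.+1) <= 1%:E)%E by rewrite n1.
  by have [f [h1 h2 h3]] := bounded_representative ler01 m1 m2 (cLnorm_ae h); exists f.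
exists sigma; split => [l|l u|k k0]; try by have [] := hs l.
have [_ _ /(_ (calN_gt0 k0)) hsk] := hs (calN k).
have [hL2 _ _] := phi_basis.
have pE u : prim (psi k) u = prim (cpatch (phi k)) u.
  have [mk1 mk2 _] := hL2 k.
  apply: ae_eq_cI; [by apply: cmeasM => //; exact: cmeas_le|by apply: cmeasM; [exact: cmeas_le|exact: cmeas_cpatch]|].
  by apply: ae_imp (apsi k) => t ->.
apply: ae_imp (ae_and (ae_and (ae_leb_Un (hprimitive k0)) (@ae_Un_unit R)) (ae_and hsk (apsi (calM k)))) => u [[h uu] [-> ->]].
have u01 : 0 < u < 1 by move: uu; rewrite /unit_interval/= in_itv.
by rewrite pE -primitive_prim// h// /cpatch mem_set.
Qed.

End basis.

(** * Coefficients of the weights and injectivity of [calM] on fibres *)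

Section weight_coefficients.
Context {R : realType}.
Local Notation mR := (measurableTypeR R).
Variables (C : R) (psi sigma : nat -> R -> R[i]) (lambda : nat -> R[i]) (calN calM : nat -> nat).
Hypotheses (psi0 : psi 0%N = (fun=> 1)) (mpsi : forall k, @cmeas _ mR _ (psi k))
  (bpsi : forall k u, Normc.normc (psi k u) <= C)
  (orth : forall k l, cI Un (fun u => psi k u * conjc (psi l u)) = (k == l)%:R)
  (msigma : forall l, @cmeas _ mR _ (sigma l)) (bsigma : forall l u, Normc.normc (sigma l u) <= 1)
  (lambda_neq0 : forall k, (0 < k)%N -> lambda k != 0)
  (hprim : forall k, (0 < k)%N ->
    {ae @Un R, forall u : mR, prim (psi k) u = lambda k * sigma (calN k) u * psi (calM k) u}).

Let cbpsi k : cbounded (psi k). Proof. by exists C. Qed.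
Let mpsic k := cmeas_conj (mpsi k).
Let bpsic k := cbounded_conj (cbpsi k).
Let C0 : 0 <= C. Proof. exact: le_trans (normc_ge0 _) (bpsi 0 0). Qed.

Lemma prim_conj (f : R -> R[i]) u : @cmeas _ mR _ f -> cbounded f ->
  prim (fun t => conjc (f t)) u = conjc (prim f u).
Proof.
move=> mf bf; rewrite /prim -cI_conj; last exact: prim_cintble.
by apply: eq_cI => t; rewrite conjcM; congr (_ * _); case: (_ <= _); rewrite ?conjc1 ?conjc0.
Qed.

(** Orthogonality to the constant function [psi 0]. *)
Lemma integral_conj_psi k : (0 < k)%N -> cI Un (fun u => conjc (psi k u)) = 0.
Proof.
move=> k0; have := orth 0 k; rewrite psi0 eq_sym (gtn_eqF k0).
by under eq_cI do rewrite mul1r.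
Qed.

(* Two such indices would have proportional primitives, hence be proportional,
   against orthogonality. *)
Lemma calM_inj k k' : (0 < k)%N -> (0 < k')%N -> calN k = calN k' -> calM k = calM k' -> k = k'.
Proof.
move=> k0 k0' eN eM; apply/eqP/negPn/negP => kk'.
pose a u := lambda k' * psi k u + - lambda k * psi k' u.
have mz c l : @cmeas _ mR _ (fun t : R => c * psi l t) by apply: cmeasM => //; exact: cmeas_cst.
have bz c l : cbounded (fun t : R => c * psi l t) by exact: (cboundedM (cbounded_cst c) (cbpsi l)).
have ma : @cmeas _ mR _ a by exact: (cmeasD (mz _ _) (mz _ _)).
have ba : cbounded a by exact: (cboundedD (bz _ _) (bz _ _)).
have a0 : {ae @Un R, forall u : mR, prim a u = 0}.
  apply: ae_imp (ae_and (hprim k0) (hprim k0')) => u [h1 h2].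
  rewrite /a (primD _ (mz _ _) (mz _ _) (bz _ _) (bz _ _)).
  rewrite (primZ _ _ (mpsi k) (cbpsi k)) (primZ _ _ (mpsi k') (cbpsi k')) h1 h2 eN eM; ring.
have := prim_eq0 ma (mpsic k) ba (bpsic k) a0.
have i1 l : cintble Un (fun u => psi l u * conjc (psi k u)).
  exact: (cintble_bounded Un_lty (cmeasM (mpsi l) (mpsic k)) (cboundedM (cbpsi l) (bpsic k))).
under eq_cI do rewrite /a mulrDl -!mulrA.
rewrite cID; [|exact: cintbleZ|exact: cintbleZ].
rewrite !cIZ// !orth eqxx eq_sym (negbTE kk') mulr1 mulr0 addr0 => /eqP.
by rewrite (negbTE (lambda_neq0 k0')).
Qed.

Variables (p theta : R).
Hypotheses (p1 : 1 <= p) (ht : 0 < theta <= 1 / 2).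

Definition wcoef k := cI Un (fun u => (wgt p theta u)%:C%C * conjc (psi k u)).

Let bw : cbounded (fun u => (wgt p theta u)%:C%C).
Proof. by exists 2 => u; rewrite normc_real; exact: wgt_le2. Qed.
Let mw : @cmeas _ mR _ (fun u : mR => (wgt p theta u)%:C%C).
Proof. by apply: cmeas_real; exact: measurable_wgt. Qed.

Lemma wcoef0 : wcoef 0 = 1.
Proof.
rewrite /wcoef psi0; under eq_cI do rewrite conjc1 mulr1.
by rewrite cI_real integral_wgt1.
Qed.

Let bound (a : R -> R) (b : R -> R[i]) M N : @measurable_fun _ _ mR _ setT a -> @cmeas _ mR _ b ->
  (exists K, forall t, `|a t| <= K) -> (forall u, Normc.normc (b u) <= M) -> \int[Un]_t `|a t| <= N ->
  Normc.normc (cI Un (fun u => (a u)%:C%C * b u)) <= M * N.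
Proof.
move=> ma mb [K aK] bM aN.
have M0 : 0 <= M by exact: le_trans (normc_ge0 _) (bM 0).
have mac : @cmeas _ mR _ (fun u => (a u)%:C%C) by exact: cmeas_real.
have bb : cbounded b by exists M.
have bac : cbounded (fun u => (a u)%:C%C) by exists K => u; rewrite normc_real.
have iF : cintble Un (fun u => (a u)%:C%C * b u).
  by apply: cintble_bounded; [exact: Un_lty|exact: cmeasM|exact: cboundedM].
apply: le_trans (normc_cI_le iF) _.
have mabs : @measurable_fun _ _ mR _ setT (fun t => `|a t|) by exact: measurableT_comp.
apply: (@le_trans _ _ (\int[Un]_u (M * `|a u|))); last first.
  by rewrite Rintegral_scale// ler_wpM2l.
apply: le_Rintegral => //.
- apply: (integrable_bounded (M := K * M) Un_lty); first by apply: measurable_normc; exact: cmeasM.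
  move=> u; rewrite ger0_norm ?normc_ge0// Normc.normcM normc_real.
  by apply: ler_pM => //; exact: normc_ge0.
- apply: (integrable_bounded (M := M * K) Un_lty); first exact: measurable_funM.
  by move=> u; rewrite normrM normr_id (ger0_norm M0) ler_wpM2l.
- by move=> u _; rewrite Normc.normcM normc_real mulrC ler_wpM2r.
Qed.

(* The bound by theta holds because psi k has mean zero and wgt is within
   4 theta of 1 in L^1; the bound by lambda k is an integration by parts, the
   L^1 norm of the derivative of wgt being at most 4. *)
Lemma wcoef_le k : (0 < k)%N ->
  Normc.normc (wcoef k) ^+ 2 <= 16 * C ^+ 2 * Num.min (theta ^+ 2) (Normc.normc (lambda k) ^+ 2).
Proof.
move=> k0.
have t0 : 0 <= theta by case/andP: ht => /ltW.
have nl := normc_ge0 (lambda k).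
have h1 : Normc.normc (wcoef k) <= C * (4 * theta).
  have mw1 : @measurable_fun _ _ mR _ setT (fun t => wgt p theta t - 1).
    by apply: measurable_funB => //; exact: measurable_wgt.
  have -> : wcoef k = cI Un (fun u => (wgt p theta u - 1)%:C%C * conjc (psi k u)).
    have i1 : cintble Un (fun u => (wgt p theta u)%:C%C * conjc (psi k u)).
      exact: (cintble_bounded Un_lty (cmeasM mw (mpsic k)) (cboundedM bw (bpsic k))).
    have i2 : cintble Un (fun u => conjc (psi k u)) by exact: (cintble_bounded Un_lty (mpsic k) (bpsic k)).
    rewrite -[LHS]subr0 -(integral_conj_psi k0) -(cIB i1 i2); apply: eq_cI => u.
    by rewrite rmorphB rmorph1 mulrBl mul1r.
  apply: bound => //.
  - exists 3 => t; apply: le_trans (ler_normB _ _) _; rewrite normr1.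
    by have := wgt_le2 p1 ht t; lra.
  - by move=> u; rewrite normc_conj.
  - exact: integral_wgtB1.
have h2 : Normc.normc (wcoef k) <= Normc.normc (lambda k) * C * 4.
  have md : @cmeas _ mR _ (fun u => (dwgt p theta u)%:C%C) by apply: cmeas_real; exact: measurable_dwgt.
  have [K dK] := dwgt_bounded p1 ht.
  have bd : cbounded (fun u => (dwgt p theta u)%:C%C) by exists K => u; rewrite normc_real.
  have := prim_parts md (mpsic k) bd (bpsic k); rewrite integral_conj_psi// mulr0.
  have -> : cI Un (fun u => prim (fun t => (dwgt p theta t)%:C%C) u * conjc (psi k u)) = wcoef k.
    apply: ae_eq_cI; [by apply: cmeasM => //; exact: cmeas_prim|exact: cmeasM|].
    apply: ae_imp (@ae_Un_unit R) => u; rewrite /unit_interval/= in_itv/= => u01.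
    congr (_ * _); rewrite /prim; under eq_cI => t.
      rewrite (_ : (t <= u)%R%:R * (dwgt p theta t)%:C%C = ((t <= u)%R%:R * dwgt p theta t)%:C%C); first over.
      by rewrite rmorphM rmorph_nat.
    by rewrite cI_real wgt_primitive.
  move=> /eqP; rewrite addr_eq0 => /eqP ->; rewrite normcN.
  pose b u := conjc (lambda k * sigma (calN k) u * psi (calM k) u).
  have mb : @cmeas _ mR _ b.
    by apply: cmeas_conj; apply: cmeasM => //; apply: cmeasM => //; exact: cmeas_cst.
  have -> : cI Un (fun u => (dwgt p theta u)%:C%C * prim (fun t => conjc (psi k t)) u) =
      cI Un (fun u => (dwgt p theta u)%:C%C * b u).
    apply: ae_eq_cI; [by apply: cmeasM => //; exact: cmeas_prim|exact: cmeasM|].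
    by apply: ae_imp (hprim k0) => u h; rewrite prim_conj// h.
  apply: bound => //; [exact: measurable_dwgt|by exists K| |exact: integral_abs_dwgt].
  move=> u; rewrite normc_conj !Normc.normcM -mulrA ler_wpM2l//.
  by rewrite -[leRHS]mul1r; apply: ler_pM; rewrite ?normc_ge0.
have sq (a b : R) : 0 <= a -> 0 <= b -> a <= b -> a ^+ 2 <= b ^+ 2.
  by move=> a0 b0 ab; rewrite ler_pXn2r ?nnegrE.
have := normc_ge0 (wcoef k) => n0.
have g1 := sq _ _ n0 _ h1; have g2 := sq _ _ n0 _ h2.
rewrite minr_pMr ?mulr_ge0 ?sqr_ge0// le_min; apply/andP; split.
  by apply: le_trans (g1 _) _; rewrite ?mulr_ge0// le_eqVlt; apply/orP; left; apply/eqP; ring.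
by apply: le_trans (g2 _) _; rewrite ?mulr_ge0// le_eqVlt; apply/orP; left; apply/eqP; ring.
Qed.

End weight_coefficients.

(** * Coefficients of the components *)

Section fourier_coefficients.
Context {R : realType}.
Local Notation mR := (measurableTypeR R).
Local Notation leb := (@lebesgue_measure R).
Variables (C : R) (psi : nat -> R -> R[i]).
Hypotheses (psi0 : psi 0%N = (fun=> 1)) (mpsi : forall k, @cmeas _ mR _ (psi k))
  (bpsi : forall k u, Normc.normc (psi k u) <= C)
  (orth : forall k l, cI Un (fun u => psi k u * conjc (psi l u)) = (k == l)%:R).

Let cbpsi k : cbounded (psi k). Proof. by exists C. Qed.
Let mpsic k := cmeas_conj (mpsi k).
Let bpsic k := cbounded_conj (cbpsi k).

Definition chr n (k : {ffun 'I_n -> nat}) (u : 'rV[R]_n) : R[i] := \prod_j conjc (psi (k j) (u ord0 j)).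

Definition fhat n (G : 'rV[R]_n -> R[i]) (k : {ffun 'I_n -> nat}) := cI (Pn n) (fun u => G u * chr k u).

Lemma cmeas_chr n (k : {ffun 'I_n -> nat}) : @cmeas _ 'rV[mR]_n _ (chr k).
Proof. by apply: cmeas_prod => j; exact: (cmeas_coord j (mpsic (k j))). Qed.

Lemma cbounded_chr n (k : {ffun 'I_n -> nat}) : cbounded (chr k).
Proof. by apply: cbounded_prod => j; exact: (cbounded_coord j (bpsic (k j))). Qed.

Lemma cintble_chr n (G : 'rV[R]_n -> R[i]) k : cintble (Pn n) G -> cintble (Pn n) (fun u => G u * chr k u).
Proof. by move=> iG; exact: (cintbleMb iG (cmeas_chr k) (cbounded_chr k)). Qed.

Definition upd n (k : {ffun 'I_n -> nat}) (j : 'I_n) : {ffun 'I_n -> nat} :=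
  [ffun i => if i == j then 0%N else k i].

Lemma chr_upd n (k : {ffun 'I_n -> nat}) j u : chr k u = conjc (psi (k j) (u ord0 j)) * chr (upd k j) u.
Proof.
rewrite /chr (bigD1 j)//= [in RHS](bigD1 j)//= ffunE eqxx psi0 conjc1 mul1r; congr (_ * _).
by apply: eq_bigr => i ij; rewrite ffunE (negbTE ij).
Qed.

Lemma chr_upd_indep n (k : {ffun 'I_n -> nat}) j : indep_coord j (chr (upd k j)).
Proof.
move=> u t; apply: eq_bigr => i _; rewrite ffunE set_coordE; case: eqP => // _.
by rewrite psi0.
Qed.

Lemma section_cintble n (j : 'I_n) (g : 'rV[R]_n -> R[i]) : cintble (Pn n) g ->
  {ae Pn n, forall u : 'rV[mR]_n, cintble Un (fun t : mR => g (set_coord u j t))}.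
Proof.
move=> ig; have [i1 i2] := (mpres_cintble (mpres_set_coord j) (cintble_meas ig)).2 ig.
exact: ae_imp (ae_and (ae_integrable1 i1) (ae_integrable1 i2)).
Qed.

(** The j-th factor of the character combines with [w], and the remaining factors, with index 0 at
    [j], do not depend on u_j; independence of coordinates then splits the integral. The inner
    integral can be rearranged only where the section of [G] is integrable, that is almost
    everywhere. *)
Lemma fhat_Ek n (w : R -> R) (j : 'I_n) (G : 'rV[R]_n -> R[i]) k : cintble (Pn n) G ->
  @measurable_fun _ _ mR _ setT w -> (exists M, forall t, `|w t| <= M) ->
  fhat (Ek w j G) k = cI Un (fun t => (w t)%:C%C * conjc (psi (k j) t)) * fhat G (upd k j).
Proof.
move=> iG mw [M wM].
have mwc : @cmeas _ mR _ (fun t => (w t)%:C%C) by exact: cmeas_real.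
have bw : cbounded (fun t => (w t)%:C%C) by exists M => t; rewrite normc_real.
have iw := cintble_bounded Un_lty mwc bw.
have mb : @cmeas _ mR _ (fun t => (w t)%:C%C * conjc (psi (k j) t)) by exact: (cmeasM mwc (mpsic _)).
have bb : cbounded (fun t => (w t)%:C%C * conjc (psi (k j) t)) by exact: (cboundedM bw (bpsic _)).
have iK := cintble_chr (upd k j) iG.
have iKs := (mpres_cintble (mpres_set_coord j) (cintble_meas iK)).2 iK.
have [iH eH] := cI_fubini1 iKs.
have indH : indep_coord j (fun u : 'rV[R]_n => cI Un (fun t : mR => G (set_coord u j t) * chr (upd k j) (set_coord u j t))).
  move=> u t; apply: eq_cI => t' /=.
  suff -> : set_coord (set_coord u j t) j t' = set_coord u j t' by [].
  by apply/rowP => i; rewrite !set_coordE; case: eqP.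
rewrite mulrC /fhat -(mpres_cI (mpres_set_coord j) (cintble_meas iK)) -eH -(cI_indep iH indH mb bb).
apply: ae_eq_cI.
- exact: cintble_meas (cintble_chr k (Ek_cintble j iG iw)).
- exact: (cmeasM (cintble_meas iH) (cmeas_coord j mb)).
apply: ae_imp (section_cintble j iG) => u iu /=.
under eq_cI do rewrite chr_upd_indep mulrC.
by rewrite cIZ// (chr_upd k j) /Ek; ring.
Qed.

End fourier_coefficients.

(** Reordering of the projections is done on coefficients, where the operators commute
    algebraically, rather than on functions, where it would require Fubini and null sets. *)
Lemma foldr_perm (I : eqType) (A : Type) (o : I -> A -> A) a r r' :
  (forall i j b, o i (o j b) = o j (o i b)) -> perm_eq r r' -> foldr o a r = foldr o a r'.
Proof.
move=> oC; have cons r1 i r2 : foldr o a (r1 ++ i :: r2) = foldr o a (i :: r1 ++ r2).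
  by elim: r1 => [//|k r1 IH] /=; rewrite IH/= oC.
elim: r r' => [|i r IH] r' rr'; first by move: rr'; rewrite perm_sym => /perm_nilP ->.
have : i \in r' by rewrite -(perm_mem rr') inE eqxx.
move=> /path.splitPr h; case: h rr' => r1 r2 rr'.
rewrite cons /= (IH (r1 ++ r2))//; move: rr'.
by rewrite perm_sym perm_catC/= perm_cons perm_catC perm_sym.
Qed.

Lemma big_subsetU1 (V : zmodType) (I : finType) (S : {set I}) j (F : {set I} -> V) : j \notin S ->
  \sum_(v : {set I} | v \subset j |: S) F v = \sum_(v : {set I} | v \subset S) (F (j |: v) + F v).
Proof.
move=> jS; rewrite big_split/= (bigID (fun v : {set I} => j \in v))/=; congr (_ + _); last first.
  by apply: eq_bigl => v; rewrite -subsetD1 setU1K.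
rewrite (reindex_onto (fun v => j |: v)%SET (fun v => v :\ j)%SET)/=; last first.
  by move=> v /andP[_ jv]; rewrite finset.setD1K.
apply: eq_bigl => v; rewrite setU11 andbT.
have [jv|jv] := boolP (j \in v).
  have -> : (v \subset S) = false by apply/negbTE/fintype.subsetPn; exists j.
  by apply/negbTE; rewrite negb_and; apply/orP; right; apply/eqP => h; move: jv; rewrite -h !inE eqxx.
rewrite setU1K// eqxx andbT; apply/idP/idP => [|h]; last exact: finset.setUS.
move=> /fintype.subsetP h; apply/fintype.subsetP => x xv; have := h x; rewrite !inE xv orbT => /(_ isT).
by case/orP => [/eqP xj|//]; rewrite -xj xv in jv.
Qed.

(** * Expansion over subsets for operators on coefficients *)

Section coefficient_operators.
Context {R : realType}.
Variables (n : nat) (c : 'I_n -> nat -> R[i]).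
Hypothesis c0 : forall j, c j 0%N = 1.
Implicit Types (a b : {ffun 'I_n -> nat} -> R[i]) (v : {set 'I_n}) (k : {ffun 'I_n -> nat}).

(** [avg] is the action of [Ek] on Fourier coefficients, see [fhat_Ek]; [opv v] selects for each
    coordinate the deviation or the average. *)
Definition avg j a k := c j (k j) * a (upd k j).
Definition opv v j a k := if j \in v then a k - avg j a k else avg j a k.

Lemma upd_id k j : k j = 0%N -> upd k j = k.
Proof. by move=> kj; apply/ffunP => i; rewrite ffunE; case: eqP => // ->. Qed.

Lemma avg_id a k j : k j = 0%N -> avg j a k = a k.
Proof. by move=> kj; rewrite /avg upd_id// kj c0 mul1r. Qed.

Lemma avgC i j a : avg i (avg j a) = avg j (avg i a).
Proof.
have [->//|ij] := eqVneq i j; apply/funext => k; rewrite /avg !ffunE (negbTE ij) eq_sym (negbTE ij) mulrCA; congr (_ * (_ * a _)); apply/ffunP => x; rewrite !ffunE.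
by case: (x == j); case: (x == i).
Qed.

Lemma avgB i a b : avg i (fun k => a k - b k) = fun k => avg i a k - avg i b k.
Proof. by apply/funext => k; rewrite /avg mulrBr. Qed.

Lemma opvC v i j a : opv v i (opv v j a) = opv v j (opv v i a).
Proof.
have e i' : opv v i' = if i' \in v then (fun a k => a k - avg i' a k) else avg i'.
  by apply/funext => a'; apply/funext => k; rewrite /opv; case: ifP.
rewrite !e; case: ifP => _; case: ifP => _; rewrite ?avgB; apply/funext => k; rewrite (avgC j i)//.
ring.
Qed.

(** Induction on the list: the sets with and without the head [j] contribute a - avg j a and avg j
    a, which add up to the identity. *)
Lemma sum_opv r a k : uniq r -> \sum_(v : {set 'I_n} | v \subset [set x in r]) foldr (opv v) a r k = a k.
Proof.
elim: r k => [|j r IH] k /=.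
  move=> _; rewrite (big_pred1 (finset.set0 : {set 'I_n})) => [//|v].
  by rewrite (_ : [set x in [::]] = finset.set0)%SET ?finset.subset0//; apply/setP => x; rewrite !inE.
move=> /andP[jr ur].
rewrite (_ : [set x in j :: r] = j |: [set x in r])%SET; last by apply/setP => x; rewrite !inE.
rewrite big_subsetU1 ?inE// -[RHS]IH//; apply: eq_bigr => v vr.
have jv : j \notin v by apply/negP => /(fintype.subsetP vr); rewrite inE (negbTE jr).
have -> : foldr (opv (j |: v)) a r = foldr (opv v) a r.
  have : {subset r <= r} by [].
  (* The coordinates of the tail differ from [j], so adding [j] to [v] does not change their
     operators. *)
  elim: {1 3 4}r => [//|i q IHq] qr /=; rewrite IHq; last by move=> x xq; apply: qr; rewrite inE xq orbT.
  have ir : i \in r by apply: qr; rewrite inE eqxx.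
  have ij : i != j by apply: contraNneq jr => <-.
  by apply/funext => k'; rewrite /opv !inE (negbTE ij).
by rewrite /opv setU11 (negbTE jv) subrK.
Qed.

(* This expands the product over j of (I - avg j) + avg j = I. Off the support of
   k the operator avg j is the identity at k, because c j 0 = 1. *)
Lemma sum_opv_supp a k : \sum_(v : {set 'I_n} | v \subset supp k) foldr (opv v) a (enum 'I_n) k = a k.
Proof.
rewrite -[RHS](sum_opv a k (enum_uniq (mem (supp k)))).
have -> : [set x in enum (supp k)]%SET = supp k by apply/setP => x; rewrite inE mem_enum.
apply: eq_bigr => v vk.
have pe : perm_eq (enum 'I_n) (enum (~: supp k)%SET ++ enum (supp k)).
  apply: uniq_perm; rewrite ?enum_uniq// ?cat_uniq ?enum_uniq ?andbT//=.
    by apply/hasPn => x /=; rewrite !mem_enum finset.in_setC negbK.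
  by move=> x; rewrite mem_cat !mem_enum finset.in_setC orNb.
rewrite (foldr_perm a (opvC v) pe) foldr_cat; set b := foldr _ _ (enum (supp k)).
have : {subset enum (~: supp k)%SET <= ~: supp k} by move=> x; rewrite mem_enum.
elim: (enum (~: supp k)%SET) => [//|j q IH] hq /=.
have : j \in ~: supp k by apply: hq; rewrite inE eqxx.
rewrite !inE negbK => /eqP kj.
have jv : j \notin v by apply/negP => /(fintype.subsetP vk); rewrite inE kj.
rewrite /opv (negbTE jv) avg_id// IH// => x xq; apply: hq; by rewrite inE xq orbT.
Qed.

End coefficient_operators.

Section coefficients_of_components.
Context {R : realType}.
Local Notation mR := (measurableTypeR R).
Local Notation leb := (@lebesgue_measure R).
Variables (C : R) (psi : nat -> R -> R[i]).
Hypotheses (psi0 : psi 0%N = (fun=> 1)) (mpsi : forall k, @cmeas _ mR _ (psi k))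
  (bpsi : forall k u, Normc.normc (psi k u) <= C)
  (orth : forall k l, cI Un (fun u => psi k u * conjc (psi l u)) = (k == l)%:R).

Let cbpsi k : cbounded (psi k). Proof. by exists C. Qed.
Let mpsic k := cmeas_conj (mpsi k).
Let bpsic k := cbounded_conj (cbpsi k).

Definition cubec n (g : 'rV[R]_n -> R) (u : 'rV[R]_n) : R[i] := ((g \_ (@cube R n)) u)%:C%C.

Lemma cintegral_cube n (F : 'rV[R]_n -> R[i]) : cintegral (lebesgue_row n) (@cube R n) F =
  cI (Pn n) (fun u => if u \in @cube R n then F u else 0).
Proof.
rewrite /cI /cintegral /Rintegral -!integral_Pn; congr (Complex (fine _) (fine _)); apply: eq_integral => u _.
  by rewrite patchE; case: ifP.
by rewrite patchE; case: ifP.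
Qed.

Lemma fourier_fhat (phi : nat -> R -> R[i]) n (g : 'rV[R]_n -> R) k :
  (forall k, measurable_fun (unit_interval : set mR) (@complex.Re R \o phi k)) ->
  (forall k, measurable_fun (unit_interval : set mR) (@complex.Im R \o phi k)) ->
  (forall k, {ae @Un R, forall u : mR, psi k u = cpatch (phi k) u}) ->
  measurable_fun (@cube R n : set 'rV[mR]_n) g ->
  fourier phi (fun u => (g u)%:C%C) k = fhat psi (cubec g) k.
Proof.
move=> m1 m2 apsi /measurable_patch_cube mg; rewrite /fourier cintegral_cube.
transitivity (cI (Pn n) (fun u => cubec g u * \prod_j conjc (cpatch (phi (k j)) (u ord0 j)))).
  apply: eq_cI => u; rewrite /cubec patchE; case: ifP => [/set_mem cu|_]; last by rewrite mul0r.
  congr (_ * _); apply: eq_bigr => j _; rewrite /cpatch mem_set//; exact: cu.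
have mgc : @cmeas _ 'rV[mR]_n _ (cubec g) by exact: cmeas_real.
apply: ae_eq_cI.
- apply: (cmeasM mgc); apply: cmeas_prod => j.
  exact: (cmeas_coord j (cmeas_conj (cmeas_cpatch (m1 _) (m2 _)))).
- exact: (cmeasM mgc (cmeas_chr mpsi k)).
have h : {ae Pn n, forall u : 'rV[mR]_n, forall j, psi (k j) (u ord0 j) = cpatch (phi (k j)) (u ord0 j)}.
  by apply: ae_all => j; exact: (mpres_ae (mpres_coord j) (apsi (k j))).
apply: ae_imp h => u hu; congr (_ * _); apply: eq_bigr => j _; by rewrite hu.
Qed.

Section operators.
Variables (p : R) (s : nat) (theta : 'I_s -> R).
Hypotheses (p1 : 1 <= p) (ht : forall j, 0 < theta j <= 1 / 2).
Let w j := wgt p (theta j).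
Let c j := wcoef psi p (theta j).

Let mw j : @measurable_fun _ _ mR _ setT (w j). Proof. exact: measurable_wgt. Qed.
Let bw j : exists M, forall t, `|w j t| <= M. Proof. by exists 2 => t; exact: wgt_le2. Qed.
Let cw j : cintble Un (fun t : mR => (w j t)%:C%C).
Proof. by apply: cintble_real; exact: integrable_wgt. Qed.

Lemma fhat_averages r F k : mixed F ->
  fhat psi (averages p theta r F) k = foldr (avg c) (fhat psi F) r k.
Proof.
move=> mF; elim: r k => [//|j r IH] k /=.
have [iG _] := mixed_averages p1 ht r mF.
by rewrite (fhat_Ek psi0 mpsi bpsi _ _ iG (mw j) (bw j)) IH.
Qed.

Lemma fhat_deviations r F k : mixed F ->
  fhat psi (deviations p theta r F) k = foldr (fun j a k => a k - avg c j a k) (fhat psi F) r k.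
Proof.
move=> mF; elim: r k => [//|j r IH] k /=.
have [iG _] := mixed_deviations p1 ht r mF.
transitivity (fhat psi (deviations p theta r F) k - fhat psi (Ek (w j) j (deviations p theta r F)) k).
  rewrite /fhat -cIB; [|exact: (cintble_chr mpsi bpsi k iG)|
    exact: (cintble_chr mpsi bpsi k (Ek_cintble j iG (cw j)))].
  by apply: eq_cI => u; rewrite mulrBl.
by rewrite (fhat_Ek psi0 mpsi bpsi _ _ iG (mw j) (bw j)) !IH.
Qed.

(** After [sum_opv_supp], the coordinates are reordered so that the averages outside [v] are applied
    before the deviations in [v], as in the definition of the components. *)
Lemma fhat_decomposition F k : mixed F ->
  fhat psi F k = \sum_(v : {set 'I_s} | v \subset supp k)
    fhat psi (deviations p theta (enum v) (averages p theta (enum (~: v)%SET) F)) k.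
Proof.
move=> mF; have c0 j : c j 0 = 1 by exact: wcoef0.
rewrite -[LHS](sum_opv_supp c0); apply: eq_bigr => v _.
rewrite fhat_deviations; last exact: mixed_averages.
have pe : perm_eq (enum 'I_s) (enum v ++ enum (~: v)%SET).
  apply: uniq_perm; rewrite ?enum_uniq// ?cat_uniq ?enum_uniq ?andbT//=.
    by apply/hasPn => x /=; rewrite !mem_enum finset.in_setC.
  by move=> x; rewrite mem_cat !mem_enum finset.in_setC orbN.
rewrite (foldr_perm _ (opvC c v) pe) foldr_cat.
have -> : foldr (opv c v) (fhat psi F) (enum (~: v)%SET) = fhat psi (averages p theta (enum (~: v)%SET) F).
  apply/funext => k'; rewrite fhat_averages//.
  have : {subset enum (~: v)%SET <= ~: v} by move=> x; rewrite mem_enum.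
  elim: (enum (~: v)%SET) k' => [//|j q IH] k' hq /=.
  have /negbTE jv : j \notin v by have := hq j; rewrite inE eqxx finset.in_setC => /(_ isT).
  by rewrite /opv jv /avg IH// => x xq; apply: hq; rewrite inE xq orbT.
have : {subset enum v <= v} by move=> x; rewrite mem_enum.
elim: (enum v) k => [//|j q IH] k hq /=.
have jv : j \in v by apply: hq; rewrite inE eqxx.
by rewrite /opv jv /avg !IH// => x xq; apply: hq; rewrite inE xq orbT.
Qed.

Definition kres (v : {set 'I_s}) (k : {ffun 'I_s -> nat}) : {ffun 'I_#|v| -> nat} :=
  [ffun i => k (enum_val i)].

Lemma chr_split (v : {set 'I_s}) k (u : 'rV[R]_s) : chr psi k u =
  chr psi (kres v k) (res v u) * \prod_(j in (~: v)%SET) conjc (psi (k j) (u ord0 j)).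
Proof.
rewrite /chr (bigID (fun j => j \in v))/=; congr (_ * _); last by apply: eq_bigl => j; rewrite !inE.
by rewrite big_enum_val/=; apply: eq_bigr => i _; rewrite ffunE mxE.
Qed.

(** Both [G] and the character split into a part in the coordinates of [v] and a product over the
    others, so independence of the coordinates applies. *)
Lemma fhat_restrict (v : {set 'I_s}) (G : 'rV[R]_s -> R[i]) (g : 'rV[R]_#|v| -> R) k :
  cintble (Pn s) G -> (Pn #|v|).-integrable setT (EFin \o (g \_ (@cube R #|v|))) ->
  (forall u, @cube R s u -> G u = (g (res v u) * \prod_(j in (~: v)%SET) w j (u ord0 j))%:C%C) ->
  fhat psi G k = fhat psi (cubec g) (kres v k) * \prod_(j in (~: v)%SET) c j (k j).
Proof.
move=> iG ig GE.
have ic := cintble_chr mpsi bpsi (kres v k) (cintble_real ig).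
pose H u := cubec g (res v u) * chr psi (kres v k) (res v u).
have iH : cintble (Pn s) H by exact: (mpres_cintble (mpres_res v) (cintble_meas ic)).2.
pose b j t := (w j t)%:C%C * conjc (psi (k j) t).
have mb j : @cmeas _ mR _ (b j) by exact: (cmeasM (cmeas_real (mw j)) (mpsic _)).
have bb j : cbounded (b j).
  have [M hM] := bw j; apply: cboundedM (bpsic _); by exists M => t; rewrite normc_real.
have iHj j : j \in enum (~: v)%SET -> indep_coord j H.
  rewrite mem_enum finset.in_setC => jv u t; rewrite /H.
  suff -> : res v (set_coord u j t) = res v u by [].
  apply/rowP => i; rewrite !mxE; case: eqP => // ij; by rewrite -ij enum_valP in jv.
rewrite [fhat psi (cubec g) _](_ : _ = cI (Pn s) H); last first.
  exact: esym (mpres_cI (mpres_res v) (cintble_meas ic)).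
rewrite -[X in _ * X]big_enum/= -(cI_indep_prod (enum_uniq _) iH iHj mb bb); apply: eq_cI_cube.
- exact: (cmeasM (cintble_meas iG) (cmeas_chr mpsi k)).
- apply: (cmeasM (cintble_meas iH)); apply: cmeas_prod => j; exact: (cmeas_coord j (mb j)).
move=> u cu; rewrite GE// (chr_split v) /H /cubec patch_cube; last by move=> i; rewrite mxE; exact: cu.
rewrite rmorphM/= big_enum/= big_split/= rmorph_prod; ring.
Qed.

End operators.
End coefficients_of_components.

Lemma conjc_prod {R : realType} (I : Type) (r : seq I) (F : I -> R[i]) :
  conjc (\prod_(i <- r) F i) = \prod_(i <- r) conjc (F i).
Proof. by apply: (big_morph _ (@conjcM R)); exact: conjc1. Qed.

(** * Hoelder's inequality with bounds in the extended reals *)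

Section holder.
Context {R : realType}.

(** Young's inequality for the terms normalised by the sums [X] and [Y]. If one of these sums is 0,
    every term vanishes. Monotonicity of powers then passes to [A] and [B], which may be
    infinite. *)
Lemma holder_sum (I : eqType) (r : seq I) (x y : I -> R) (A B : \bar R) (a : R) : 0 < a < 1 ->
  (forall i, i \in r -> 0 <= x i) -> (forall i, i \in r -> 0 <= y i) ->
  ((\sum_(i <- r) x i)%R%:E <= A)%E -> ((\sum_(i <- r) y i)%R%:E <= B)%E ->
  ((\sum_(i <- r) x i `^ (1 - a) * y i `^ a)%R%:E <= B `^ a * A `^ (1 - a))%E.
Proof.
move=> /andP[a0 a1] x0 y0; set X := \sum_(i <- r) x i; set Y := \sum_(i <- r) y i => XA YB.
have X0 : 0 <= X by rewrite /X big_seq sumr_ge0.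
have Y0 : 0 <= Y by rewrite /Y big_seq sumr_ge0.
have a1' : 0 < 1 - a by rewrite subr_gt0.
suff h : \sum_(i <- r) x i `^ (1 - a) * y i `^ a <= Y `^ a * X `^ (1 - a).
  apply: (@le_trans _ _ (Y `^ a * X `^ (1 - a))%:E); first by rewrite lee_fin.
  rewrite EFinM -!poweR_EFin; apply: lee_pmul; rewrite ?poweR_ge0//.
    by apply: gt0_ler_poweR => //; rewrite ?ltW// !in_itv/= ?leey ?andbT ?lee_fin// (le_trans _ YB) ?lee_fin.
  by apply: gt0_ler_poweR => //; rewrite ?ltW// !in_itv/= ?leey ?andbT ?lee_fin// (le_trans _ XA) ?lee_fin.
have vanish (z : I -> R) : (forall i, i \in r -> 0 <= z i) -> \sum_(i <- r) z i = 0 -> forall i, i \in r -> z i = 0.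
  move=> z0 zs i ir; apply/eqP.
  have : \sum_(j <- r | j \in r) z j == 0 by rewrite -big_seq zs.
  by rewrite psumr_eq0// => /allP/(_ i ir); rewrite ir.
have [XE|Xn0] := eqVneq X 0.
  rewrite big_seq big1 ?mulr_ge0 ?powR_ge0// => i ir.
  by rewrite (vanish _ x0 XE i ir) powR0 ?mul0r ?gt_eqF.
have [YE|Yn0] := eqVneq Y 0.
  rewrite big_seq big1 ?mulr_ge0 ?powR_ge0// => i ir.
  by rewrite (vanish _ y0 YE i ir) powR0 ?mulr0 ?gt_eqF.
have Xp : 0 < X by rewrite lt_neqAle eq_sym Xn0.
have Yp : 0 < Y by rewrite lt_neqAle eq_sym Yn0.
have young i : i \in r -> (x i / X) `^ (1 - a) * (y i / Y) `^ a <= (1 - a) * (x i / X) + a * (y i / Y).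
  move=> ir; have xi := divr_ge0 (x0 i ir) X0; have yi := divr_ge0 (y0 i ir) Y0.
  have := @conjugate_powR R ((x i / X) `^ (1 - a)) ((y i / Y) `^ a) (1 - a)^-1 a^-1.
  rewrite !powR_ge0 !invr_gt0 !invrK subrK => /(_ isT isT a1' a0 erefl).
  have pow (z b : R) : 0 <= z -> 0 < b -> (z `^ b) `^ b^-1 = z.
    by move=> z0 b0; rewrite -powRrM divff ?gt_eqF// powRr1.
  by rewrite !pow// [_ * (1 - a)]mulrC [_ * a]mulrC.
have : \sum_(i <- r) (x i / X) `^ (1 - a) * (y i / Y) `^ a <= 1.
  apply: (@le_trans _ _ (\sum_(i <- r) ((1 - a) * (x i / X) + a * (y i / Y)))).
    by rewrite big_seq [leRHS]big_seq; apply: ler_sum => i; exact: young.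
  by rewrite big_split/= -!mulr_sumr -!mulr_suml !divff// !mulr1 subrK.
have e i : i \in r -> (x i / X) `^ (1 - a) * (y i / Y) `^ a =
    (x i `^ (1 - a) * y i `^ a) / (Y `^ a * X `^ (1 - a)).
  have pd (z Z b : R) : 0 <= z -> 0 < Z -> (z / Z) `^ b = z `^ b / Z `^ b.
    move=> z0 /ltW Z0; rewrite (powRM _ z0); last by rewrite invr_ge0.
    by rewrite -(powR_inv1 Z0) -powRrM mulN1r powRN.
  by move=> ir; rewrite !pd ?x0 ?y0// invfM; ring.
rewrite big_seq (eq_bigr _ e) -big_seq -mulr_suml ler_pdivrMr ?mul1r//.
by rewrite mulr_gt0 ?powR_gt0.
Qed.

Lemma powR_prod (I : Type) (r : seq I) (P : pred I) (F : I -> R) a : (forall i, 0 <= F i) ->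
  (\prod_(i <- r | P i) F i) `^ a = \prod_(i <- r | P i) F i `^ a.
Proof.
move=> F0; suff [] : (\prod_(i <- r | P i) F i) `^ a = \prod_(i <- r | P i) F i `^ a /\
  0 <= \prod_(i <- r | P i) F i by [].
apply: (big_rec2 (fun x y => x `^ a = y /\ 0 <= x)); first by rewrite powR1.
by move=> i y x _ [<- x0]; rewrite powRM// mulr_ge0.
Qed.

End holder.

(** * Bounds for the coefficients of one component *)

Section component_bounds.
Context {R : realType}.
Local Notation mR := (measurableTypeR R).
Variables (C : R) (psi sigma : nat -> R -> R[i]) (lambda : nat -> R[i]) (calN calM : nat -> nat).
Hypotheses (psi0 : psi 0%N = (fun=> 1)) (mpsi : forall k, @cmeas _ mR _ (psi k))
  (bpsi : forall k u, Normc.normc (psi k u) <= C)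
  (orth : forall k l, cI Un (fun u => psi k u * conjc (psi l u)) = (k == l)%:R)
  (msigma : forall l, @cmeas _ mR _ (sigma l)) (bsigma : forall l u, Normc.normc (sigma l u) <= 1)
  (lambda_neq0 : forall k, (0 < k)%N -> lambda k != 0)
  (hprim : forall k, (0 < k)%N ->
    {ae @Un R, forall u : mR, prim (psi k) u = lambda k * sigma (calN k) u * psi (calM k) u}).

Let cbpsi k : cbounded (psi k). Proof. by exists C. Qed.
Let mpsic k := cmeas_conj (mpsi k).
Let bpsic k := cbounded_conj (cbpsi k).

Lemma orth_chr n (k l : {ffun 'I_n -> nat}) :
  cI (Pn n) (fun u => conjc (chr psi k u) * conjc (conjc (chr psi l u))) = (k == l)%:R.
Proof.
under eq_cI => u.
  rewrite conjcK /chr conjc_prod -big_split/=.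
  under eq_bigr do rewrite conjcK; over.
rewrite (cI_tensor (b := fun j t => psi (k j) t * conjc (psi (l j) t))); first last.
- by move=> j; exact: (cboundedM (cbpsi _) (bpsic _)).
- by move=> j; exact: (cmeasM (mpsi _) (mpsic _)).
under eq_bigr do rewrite orth.
have [->|kl] := eqVneq k l; first by rewrite big1// => j _; rewrite eqxx.
have [j kj] : exists j, k j != l j.
  by apply/existsP; apply: contraNT kl => /existsPn h; apply/eqP/ffunP => j; have := h j; rewrite negbK => /eqP.
by rewrite (bigD1 j)//= (negbTE kj) mul0r.
Qed.

(** Only domination of [G] by the real function [h] is required, which leaves room for a factor of
    modulus at most 1. *)
Lemma bessel_fhat n (G : 'rV[R]_n -> R[i]) (h : 'rV[R]_n -> R) (r : seq {ffun 'I_n -> nat}) :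
  uniq r -> @cmeas _ 'rV[mR]_n _ G -> measurable_fun (@cube R n : set 'rV[mR]_n) h ->
  (forall u, Normc.normc (G u) <= `|(h \_ (@cube R n)) u|) ->
  ((\sum_(k <- r) Normc.normc (fhat psi G k) ^+ 2)%R%:E <= sqnorm h)%E.
Proof.
move=> ur mG mh Gh.
have [->|hoo] := eqVneq (sqnorm h) +oo%E; first by rewrite leey.
have hlt : (sqnorm h < +oo)%E by rewrite ltey.
have ih := sqnorm_integrable mh hlt.
have mh0 := (measurable_patch_cube h).1 mh.
have iG : cintble (Pn n) G.
  have [m1 m2] := mG.
  split; (apply: (le_integrable measurableT _ _ ih); first exact/measurable_EFinP) => u _ /=; rewrite lee_fin.
    exact: le_trans (Re_le_normc _) (Gh u).
  exact: le_trans (Im_le_normc _) (Gh u).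
have ih2 : (Pn n).-integrable setT (fun u => (((h \_ (@cube R n)) u) ^+ 2)%:E).
  apply/integrableP; split; first by apply/measurable_EFinP; exact: measurable_funX.
  by under eq_integral => u _ do rewrite gee0_abs ?lee_fin ?sqr_ge0//.
have mn := measurable_normc mG.
have le2 u : Normc.normc (G u) ^+ 2 <= ((h \_ (@cube R n)) u) ^+ 2.
  by rewrite -[leRHS]real_normK ?num_real// ler_pXn2r ?nnegrE ?normc_ge0.
have iG2 : (Pn n).-integrable setT (EFin \o (fun u => Normc.normc (G u) ^+ 2)).
  apply: (le_integrable measurableT _ _ ih2); first by apply/measurable_EFinP; exact: measurable_funX.
  by move=> u _ /=; rewrite lee_fin !ger0_norm ?sqr_ge0.
have mc k : @cmeas _ 'rV[mR]_n _ (fun u => conjc (chr psi k u)) by exact: (cmeas_conj (cmeas_chr mpsi k)).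
have bc k : cbounded (fun u : 'rV[R]_n => conjc (chr psi k u)) by exact: (cbounded_conj (cbounded_chr bpsi k)).
have := bessel ur mc bc (fun i j _ _ => orth_chr i j) iG iG2.
under eq_bigr => k _ do under eq_cI => u do rewrite conjcK.
move=> b; apply: (@le_trans _ _ (\int[Pn n]_x (Normc.normc (G x) ^+ 2))%:E); first by rewrite lee_fin.
rewrite /Rintegral fineK; last exact: integral_fune_fin_num.
apply: ge0_le_integral => //.
- by move=> u _; rewrite lee_fin sqr_ge0.
- by apply/measurable_EFinP; exact: measurable_funX.
- by apply/measurable_EFinP; exact: measurable_funX.
- by move=> u _; rewrite lee_fin.
Qed.

(** As calN (k j) is prescribed by [l'], the factor built from [sigma] is the same function for all
    indices considered. It can be absorbed into [h], and the results are coefficients of one single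
    function, ready for Bessel's inequality. *)
Lemma ibp_fhat n (g h : 'rV[R]_n -> R) (l' : 'I_n -> nat) (k : {ffun 'I_n -> nat}) :
  cintble (Pn n) (cubec g) -> cintble (Pn n) (cubec h) -> wder [set: 'I_n]%SET (cubec g) (cubec h) ->
  (forall j, (0 < k j)%N) -> (forall j, calN (k j) = l' j) ->
  fhat psi (cubec g) k = (-1) ^+ n * (conjc (\prod_j lambda (k j)) *
    fhat psi (fun u => cubec h u * \prod_j conjc (sigma (l' j) (u ord0 j))) [ffun j => calM (k j)]).
Proof.
move=> ig ih wgh k0 kN.
rewrite /fhat /chr (ibp ig ih wgh (fun j => mpsic (k j)) (fun j => bpsic (k j)) (fun j => integral_conj_psi psi0 orth (k0 j))).
have bs l : cbounded (sigma l) by exists 1.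
have ms : @cmeas _ 'rV[mR]_n _ (fun u => \prod_j conjc (sigma (l' j) (u ord0 j))).
  by apply: cmeas_prod => j; exact: (cmeas_coord j (cmeas_conj (msigma _))).
have bsp : cbounded (fun u : 'rV[R]_n => \prod_j conjc (sigma (l' j) (u ord0 j))).
  by apply: cbounded_prod => j; exact: (cbounded_coord j (cbounded_conj (bs _))).
have iF := cintble_chr mpsi bpsi [ffun j => calM (k j)] (cintbleMb ih ms bsp).
congr (_ * _); rewrite -(cIZ _ iF); apply: ae_eq_cI.
- apply: (cmeasM (cintble_meas ih)); apply: cmeas_prod => j.
  by apply: (cmeas_coord j); apply: cmeas_prim; [exact: mpsic|exact: bpsic].
- exact: cintble_meas (cintbleZ _ iF).
have hp : {ae Pn n, forall u : 'rV[mR]_n, forall j,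
    prim (psi (k j)) (u ord0 j) = lambda (k j) * sigma (calN (k j)) (u ord0 j) * psi (calM (k j)) (u ord0 j)}.
  by apply: ae_all => j; exact: (mpres_ae (mpres_coord j) (hprim (k0 j))).
apply: ae_imp hp => u hu; rewrite [LHS]mulrC conjc_prod.
have -> : \prod_j prim (fun t => conjc (psi (k j) t)) (u ord0 j) =
    \prod_j conjc (lambda (k j)) * (\prod_j conjc (sigma (l' j) (u ord0 j)) *
    \prod_j conjc (psi ([ffun j => calM (k j)] j) (u ord0 j))).
  rewrite -!big_split/=; apply: eq_bigr => j _.
  by rewrite prim_conj// hu ffunE kN !conjcM mulrA.
by rewrite -!mulrA; congr (_ * _); rewrite mulrA mulrC.
Qed.

(* Bessel's inequality bounds the squares of the coefficients by sqnorm g and,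
   after an integration by parts, their quotients by the squares of the lambdas
   by sqnorm h. *)
Lemma component_bound n (g h : 'rV[R]_n -> R) (l' : 'I_n -> nat) (r : seq {ffun 'I_n -> nat}) (a : R) :
  0 < a < 1 -> (Pn n).-integrable setT (EFin \o (g \_ (@cube R n))) -> is_weak_partial [set: 'I_n]%SET g h ->
  uniq r -> (forall k, k \in r -> forall j, (0 < k j)%N /\ calN (k j) = l' j) ->
  ((\sum_(k <- r) Normc.normc (fhat psi (cubec g) k) ^+ 2 * \prod_j Normc.normc (lambda (k j)) `^ (- (2 * a)))%R%:E
   <= sqnorm h `^ a * sqnorm g `^ (1 - a))%E.
Proof.
move=> a01 ig [lg lh wgh] ur rk.
have mg := loc_integrable_measurable lg; have mh := loc_integrable_measurable lh.
have icg : cintble (Pn n) (cubec g) by exact: cintble_real.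
pose L (k : {ffun 'I_n -> nat}) := \prod_j Normc.normc (lambda (k j)).
have L0 k : k \in r -> 0 < L k.
  move=> kr; apply: prodr_gt0 => j _; rewrite lt_neqAle normc_ge0 andbT eq_sym.
  by apply/eqP => /Normc.eq0_normc /eqP; rewrite (negbTE (lambda_neq0 (rk k kr j).1)).
pose x k := Normc.normc (fhat psi (cubec g) k) ^+ 2.
pose y k := x k * (L k ^+ 2)^-1.
have x0 k : 0 <= x k by exact: sqr_ge0.
have xA : ((\sum_(k <- r) x k)%R%:E <= sqnorm g)%E.
  by apply: bessel_fhat => //; [exact: cintble_meas icg|move=> u; rewrite normc_real].
have yB : ((\sum_(k <- r) y k)%R%:E <= sqnorm h)%E.
  (* A weak derivative is only known to be locally integrable; if it is not square integrable the
     bound is trivial. *)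
  have [->|hoo] := eqVneq (sqnorm h) +oo%E; first by rewrite leey.
  have hlt : (sqnorm h < +oo)%E by rewrite ltey.
  have ih : cintble (Pn n) (cubec h) by apply: cintble_real; exact: (sqnorm_integrable mh hlt).
  have wd : wder [set: 'I_n]%SET (cubec g) (cubec h) by exact/wder_real.
  pose G u := cubec h u * \prod_j conjc (sigma (l' j) (u ord0 j)).
  pose M (k : {ffun 'I_n -> nat}) : {ffun 'I_n -> nat} := [ffun j => calM (k j)].
  have Mi : {in r &, injective M}.
    move=> k k' kr kr' /ffunP e; apply/ffunP => j.
    have [k0 kN] := rk k kr j; have [k0' kN'] := rk k' kr' j.
    apply: (calM_inj mpsi bpsi orth lambda_neq0 hprim k0 k0'); first by rewrite kN.
    by have := e j; rewrite !ffunE.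
  have uM : uniq (map M r) by rewrite map_inj_in_uniq.
  have mG : @cmeas _ 'rV[mR]_n _ G.
    apply: (cmeasM (cintble_meas ih)); apply: cmeas_prod => j.
    exact: (cmeas_coord j (cmeas_conj (msigma _))).
  have Gh u : Normc.normc (G u) <= `|(h \_ (@cube R n)) u|.
    rewrite Normc.normcM normc_real -[leRHS]mulr1 ler_wpM2l// normc_prod.
    by apply: prodr_ile1 => j _; rewrite normc_conj normc_ge0/=.
  apply: le_trans (bessel_fhat uM mG mh Gh); rewrite lee_fin big_map big_seq [leRHS]big_seq.
  apply: ler_sum => k kr; rewrite /y /x (ibp_fhat icg ih wd (fun j => (rk k kr j).1) (fun j => (rk k kr j).2)).
  rewrite !Normc.normcM normc_conj normc_prod -[\prod_j _]/(L k) !exprMn.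
  have -> : Normc.normc ((-1) ^+ n : R[i]) ^+ 2 = 1.
    by rewrite -signr_odd; case: (odd n); rewrite ?expr0 ?expr1 ?normcN Normc.normc1 expr1n.
  by rewrite mul1r mulrAC divff ?mul1r// expf_neq0// gt_eqF// L0.
have y0 k : k \in r -> 0 <= y k by move=> kr; rewrite mulr_ge0// invr_ge0 sqr_ge0.
(* Here x^(1-a) y^a = x L^(-2a), since y is x divided by L^2. *)
apply: le_trans (holder_sum a01 (fun k _ => x0 k) y0 xA yB).
rewrite le_eqVlt; apply/orP; left; apply/eqP; congr (_%:E).
rewrite big_seq [RHS]big_seq; apply: eq_bigr => k kr.
have Lk := L0 k kr; have /andP[a0 a1] := a01.
have -> : \prod_j Normc.normc (lambda (k j)) `^ (- (2 * a)) = L k `^ (- (2 * a)).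
  by rewrite powR_prod// => j; exact: normc_ge0.
have -> : y k `^ a = x k `^ a * (L k ^+ 2)^-1 `^ a by rewrite powRM// invr_ge0 sqr_ge0.
rewrite mulrA -powRD; last by rewrite subrK oner_eq0.
rewrite subrK powRr1//; congr (_ * _).
by rewrite -powR_mulrn ?ltW// -powRN -powRrM mulNr.
Qed.

End component_bounds.

(** * Summation *)

Section finite_sums.
Context {R : realType}.

Lemma esum_le (T : choiceType) (S : set T) (a : T -> \bar R) (x : \bar R) :
  (forall r, uniq r -> (forall k, k \in r -> S k) -> (\sum_(k <- r) a k <= x)%E) ->
  (\esum_(k in S) a k <= x)%E.
Proof.
move=> h; apply: ge_ereal_sup => _ [X [fX XS] <-]; rewrite fsbig_finite//; apply: h; first exact: finmap.fset_uniq.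
by move=> k; rewrite in_fset_set// => /set_mem/XS.
Qed.

Lemma le_esum (T : choiceType) (S : set T) (a : T -> \bar R) r :
  uniq r -> (forall k, k \in r -> S k) -> (\sum_(k <- r) a k <= \esum_(k in S) a k)%E.
Proof.
move=> ur rS; apply: esum_ge; exists [set` r]; last by rewrite fsbig_seq.
by split => //; exact: finite_seq.
Qed.

(** Summation of 2 x_i x_j <= x_i^2 + x_j^2 over all pairs. *)
Lemma sqr_sum_le (I : finType) (P : pred I) (x : I -> R) :
  (\sum_(i | P i) x i) ^+ 2 <= #|P|%:R * \sum_(i | P i) x i ^+ 2.
Proof.
have e : \sum_(i | P i) \sum_(j | P j) (x i ^+ 2 + x j ^+ 2) =
    #|P|%:R * \sum_(i | P i) x i ^+ 2 + #|P|%:R * \sum_(i | P i) x i ^+ 2.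
  under eq_bigr do rewrite big_split/= sumr_const.
  by rewrite big_split/= sumrMnl sumr_const !mulr_natl.
have : (\sum_(i | P i) x i) ^+ 2 + (\sum_(i | P i) x i) ^+ 2 <=
    \sum_(i | P i) \sum_(j | P j) (x i ^+ 2 + x j ^+ 2).
  rewrite -mulr2n expr2 mulr_suml -sumrMnl; apply: ler_sum => i _.
  rewrite mulr_sumr -sumrMnl; apply: ler_sum => j _.
  by have := sqr_ge0 (x i - x j); rewrite sqrrB; lra.
by rewrite e; lra.
Qed.

Lemma ler_sum_subset (T : eqType) (r r' : seq T) (a : T -> R) : (forall x, 0 <= a x) ->
  uniq r -> uniq r' -> {subset r <= r'} -> \sum_(x <- r) a x <= \sum_(x <- r') a x.
Proof.
move=> a0 ur ur' rr'; rewrite [leRHS](bigID (mem r))/=.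
rewrite -[X in _ <= X + _]big_filter.
have -> : \sum_(x <- [seq i <- r' | i \in r]) a x = \sum_(x <- r) a x.
  apply: perm_big; apply: uniq_perm => //; first exact: filter_uniq.
  by move=> x; rewrite mem_filter; case: (boolP (x \in r)) => // /rr' ->.
by rewrite lerDl sumr_ge0.
Qed.

(* The indices k are determined by pi k and by their entries c i k, i in q. *)
Lemma sum_prod_le (T X I : eqType) (q : seq I) (a : X -> R) (t : I -> nat -> R) (L : seq X) (M : I -> seq nat)
    (c : I -> T -> nat) (pi : T -> X) (K : seq T) :
  (forall x, 0 <= a x) -> (forall i m, 0 <= t i m) -> uniq L -> (forall i, uniq (M i)) -> uniq K ->
  (forall k, k \in K -> pi k \in L) -> (forall k i, k \in K -> c i k \in M i) ->
  (forall k k', k \in K -> k' \in K -> pi k = pi k' -> (forall i, i \in q -> c i k = c i k') -> k = k') ->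
  \sum_(k <- K) a (pi k) * \prod_(i <- q) t i (c i k) <=
  (\sum_(x <- L) a x) * \prod_(i <- q) \sum_(m <- M i) t i m.
Proof.
move=> a0 t0 uL uM + + +; elim: q K => [|i q IH] K uK KL KM inj.
  rewrite big_nil mulr1 (eq_bigr (fun k => a (pi k))); last by move=> k _; rewrite big_nil mulr1.
  rewrite -(big_map pi predT a).
  apply: ler_sum_subset => //; last by move=> _ /mapP[k kK ->]; exact: KL.
  by rewrite map_inj_in_uniq// => k k' kK kK' e; apply: inj.
(* The indices are grouped by the value [m] of their i-th entry; within a group that entry is
   constant, so the rest of the list still determines the index. *)
have -> : \sum_(k <- K) a (pi k) * \prod_(i <- i :: q) t i (c i k) =
    \sum_(m <- M i) t i m * \sum_(k <- [seq k <- K | c i k == m]) a (pi k) * \prod_(i <- q) t i (c i k).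
  under [RHS]eq_bigr do rewrite mulr_sumr big_filter.
  rewrite (exchange_big_dep predT)//= [LHS]big_seq [RHS]big_seq; apply: eq_bigr => k kK.
  rewrite (eq_bigl (pred1 (c i k))); last by move=> m /=; rewrite eq_sym.
  by rewrite -[RHS]big_filter filter_pred1_uniq ?KM// big_seq1 big_cons mulrCA.
rewrite big_cons mulrCA mulr_suml; apply: ler_sum => m _; rewrite ler_wpM2l//; apply: IH.
- exact: filter_uniq.
- by move=> k; rewrite mem_filter => /andP[_ /KL].
- by move=> k j; rewrite mem_filter => /andP[_ kK]; exact: KM.
- move=> k k'; rewrite !mem_filter => /andP[/eqP km kK] /andP[/eqP km' kK'] e h; apply: inj => // j.
  by rewrite inE => /orP[/eqP ->|/h//]; rewrite km km'.
Qed.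

Lemma lee_prod (I : Type) (r : seq I) (P : pred I) (F G : I -> \bar R) :
  (forall i, P i -> (0 <= F i)%E /\ (F i <= G i)%E) ->
  (\prod_(i <- r | P i) F i <= \prod_(i <- r | P i) G i)%E.
Proof.
move=> h; suff [] : (0 <= \prod_(i <- r | P i) F i)%E /\
  (\prod_(i <- r | P i) F i <= \prod_(i <- r | P i) G i)%E by [].
apply: (big_rec2 (fun x y => (0 <= x)%E /\ (x <= y)%E)); first by rewrite lee_fin ler01 lexx.
by move=> i y x Pi [x0 xy]; have [F0 FG] := h i Pi; rewrite mule_ge0// lee_pmul.
Qed.

End finite_sums.

Lemma normc_sum_sqr {R : realType} (I : finType) (P : pred I) (z : I -> R[i]) :
  Normc.normc (\sum_(i | P i) z i) ^+ 2 <= #|P|%:R * \sum_(i | P i) Normc.normc (z i) ^+ 2.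
Proof.
apply: le_trans (sqr_sum_le P (fun i => Normc.normc (z i))).
rewrite ler_pXn2r ?nnegrE ?normc_ge0 ?sumr_ge0//; last by move=> i _; exact: normc_ge0.
apply: (big_rec2 (fun x y => Normc.normc x <= y)); first by rewrite Normc.normc0.
by move=> i y x _ h; apply: le_trans (normcD _ _) _; rewrite lerD2l.
Qed.

Theorem theorem3p5 (R : realType)
  (rho : R -> R) (hrho : admissible_density rho)
  (phi : nat -> R -> R[i]) (Cphi : R)
  (phi_Loo : forall k, inLp +oo%E (phi k))
  (phi_basis : orthonormal_basis phi)
  (phi0 : {ae @lebesgue_measure R, forall u, unit_interval u -> phi 0%N u = 1})
  (hCphi : ereal_sup (range (fun k => cLnorm +oo%E (phi k))) = Cphi%:E)
  (lambda : nat -> R[i]) (calN calM : nat -> nat) (phistar : nat -> R -> R[i])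
  (lambda_neq0 : forall k, (0 < k)%N -> lambda k != 0)
  (calN_gt0 : forall k, (0 < k)%N -> (0 < calN k)%N)
  (phistar_Loo : forall l, (0 < l)%N ->
     inLp +oo%E (phistar l) /\ cLnorm +oo%E (phistar l) = 1%E)
  (hprimitive : forall k, (0 < k)%N ->
     {ae @lebesgue_measure R, forall u, unit_interval u ->
        primitive (phi k) u = lambda k * phistar (calN k) u * phi (calM k) u})
  (p : R) (hp : 1 <= p)
  (s : nat) (theta : 'I_s -> R)
  (htheta : forall j, 0 < theta j <= 1 / 2)
  (f : 'rV[R]_s -> R) (hf : W12mix (weighted rho p theta f))
  (alpha : R) (halpha : 0 < alpha < 1)
  (l : {ffun 'I_s -> nat}) :
  (\esum_(k in calE calN l)
     (Normc.normc (fourier phi (fun u => (weighted rho p theta f u)%:C%C) k) ^+ 2 *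
      \prod_(j in supp l)
        Normc.normc (lambda (k j)) `^ (- (2 * alpha)))%R%:E
   <= (2 ^+ #|supp l|)%R%:E *
      \sum_(v : {set 'I_s} | v \subset supp l)
        (L2norm (weak_partial [set: 'I_#|v|]%SET (anova_weighted rho p theta f v))
           `^ (2 * alpha)%R *
         L2norm (anova_weighted rho p theta f v) `^ (2 - 2 * alpha)%R *
         \prod_(j in supp l :\: v) calS lambda calN Cphi (theta j) (l j) alpha))%E.
Proof.
have [psi [psi0 mpsi bpsi apsi orth]] := bounded_basis phi_basis phi0 hCphi.
have [sigma [msigma bsigma hprim]] := bounded_star phi_basis calN_gt0 phistar_Loo hprimitive mpsi bpsi apsi.
have [hL2 _ _] := phi_basis.
have [[mf _] _] := hf.
pose F := wextc rho p theta f.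
have mF : mixed F := mixed_wextc hf.
pose w j := wgt p (theta j); pose c j := wcoef psi p (theta j).
pose g (v : {set 'I_s}) := anova_weighted rho p theta f v; pose h (v : {set 'I_s}) := weak_partial [set: 'I_#|v|]%SET (g v).
pose D (v : {set 'I_s}) := deviations p theta (enum v) (averages p theta (enum (~: v)%SET) F).
have mD v : mixed (D v) by apply: mixed_deviations => //; exact: mixed_averages.
have DE (v : {set 'I_s}) u : cube u -> D v u = (g v (res v u) * \prod_(j in (~: v)%SET) w j (u ord0 j))%:C%C.
  by move=> cu; rewrite /D /F -(wextc_anova hrho hp htheta hf v cu) (wextc_anova_weighted _ _ htheta _ v cu).
(* Yields for every component both its integrability and the fact that the chosen [weak_partial] is
   a weak derivative. *)
have rw (v : {set 'I_s}) := restriction_weak_partial (mD v) (fun j => measurable_wgt hp (htheta j))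
  (fun j => ex_intro _ 2 (wgt_le2 hp (htheta j))) (fun j => integral_wgt1 hp (htheta j)) (DE v).
have c0 j : c j 0%N = 1 by exact: wcoef0.
have dec k : fhat psi F k = \sum_(v : {set 'I_s} | v \subset supp k)
    fhat psi (cubec (g v)) (kres v k) * \prod_(j in (~: v)%SET) c j (k j).
  rewrite (fhat_decomposition psi0 mpsi bpsi hp htheta k mF); apply: eq_bigr => v _.
  by have [iD _] := mD v; rewrite (fhat_restrict mpsi bpsi hp htheta k iD (rw v).1 (DE v)).
have al0 (m : nat) : 0 <= Normc.normc (lambda m) `^ (- (2 * alpha)) by exact: powR_ge0.
pose t j m := Normc.normc (c j m) ^+ 2 * Normc.normc (lambda m) `^ (- (2 * alpha)).
have t0 j m : 0 <= t j m by rewrite mulr_ge0 ?sqr_ge0.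
pose a (v : {set 'I_s}) (q : {ffun 'I_#|v| -> nat}) :=
  Normc.normc (fhat psi (cubec (g v)) q) ^+ 2 * \prod_i Normc.normc (lambda (q i)) `^ (- (2 * alpha)).
have a0 v q : 0 <= a v q by rewrite mulr_ge0 ?sqr_ge0// prodr_ge0.
have termwise k : calE calN l k ->
    Normc.normc (fourier phi (fun u => (weighted rho p theta f u)%:C%C) k) ^+ 2 *
      \prod_(j in supp l) Normc.normc (lambda (k j)) `^ (- (2 * alpha)) <=
    2 ^+ #|supp l| * \sum_(v : {set 'I_s} | v \subset supp l)
      a v (kres v k) * \prod_(j <- enum (supp l :\: v)%SET) t j (k j).
  move=> [sk _].
  rewrite (fourier_fhat mpsi k (fun k => let: And3 m1 _ _ := hL2 k in m1)
    (fun k => let: And3 _ m2 _ := hL2 k in m2) apsi mf) -[cubec _]/F dec sk.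
  have card : #|[pred v : {set 'I_s} | v \subset supp l]|%:R = 2 ^+ #|supp l| :> R.
    by rewrite -natrX -card_powerset; congr (_%:R); apply: eq_card => v; rewrite !inE.
  rewrite -card.
  apply: le_trans (_ : _ <= (#|[pred v : {set 'I_s} | v \subset supp l]|%:R *
     \sum_(v : {set 'I_s} | v \subset supp l) Normc.normc
    (fhat psi (cubec (g v)) (kres v k) * \prod_(j in (~: v)%SET) c j (k j)) ^+ 2) *
    \prod_(j in supp l) Normc.normc (lambda (k j)) `^ (- (2 * alpha))) _.
    by rewrite ler_wpM2r ?prodr_ge0//; exact: (normc_sum_sqr [pred v : {set 'I_s} | v \subset supp l]).
  rewrite -mulrA ler_wpM2l// mulr_suml; apply: ler_sum => v vl; rewrite le_eqVlt; apply/orP; left; apply/eqP.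
  (* Off the support of [l] the index is 0 and the coefficient of the weight is 1, the integral of
     the weight. *)
  have -> : \prod_(j in (~: v)%SET) c j (k j) = \prod_(j <- enum (supp l :\: v)%SET) c j (k j).
    rewrite big_enum/= (bigID (mem (supp l)))/= mulrC big1 ?mul1r; last first.
      by move=> j /andP[_]; rewrite -sk inE negbK => /eqP ->.
    by apply: eq_bigl => j; rewrite !inE.
  have -> : \prod_(j in supp l) Normc.normc (lambda (k j)) `^ (- (2 * alpha)) =
     \prod_i Normc.normc (lambda (kres v k i)) `^ (- (2 * alpha)) *
     \prod_(j <- enum (supp l :\: v)%SET) Normc.normc (lambda (k j)) `^ (- (2 * alpha)).
    rewrite (bigID (mem v))/= big_enum/=; congr (_ * _); last by apply: eq_bigl => j; rewrite !inE andbC.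
    rewrite (eq_bigl (mem v)); last by move=> j /=; case: (boolP (j \in v)) => [/(fintype.subsetP vl) ->|]; rewrite ?andbF.
    by rewrite big_enum_val/=; apply: eq_bigr => i _; rewrite ffunE.
  rewrite Normc.normcM normc_prod exprMn /a /t big_split/= -prodrXl; ring.
have calS_ge j r : uniq r -> (forall m, m \in r -> (0 < m)%N /\ calN m = l j) ->
    ((\sum_(m <- r) t j m)%R%:E <= calS lambda calN Cphi (theta j) (l j) alpha)%E.
  move=> ur rl; rewrite /calS.
  apply: (@le_trans _ _ ((16 * Cphi ^+ 2)%:E * (\sum_(m <- r) (Num.min (theta j ^+ 2) (Normc.normc (lambda m) ^+ 2) *
      Normc.normc (lambda m) `^ (- (2 * alpha))))%R%:E)%E).
    rewrite -EFinM lee_fin mulr_sumr big_seq [leRHS]big_seq; apply: ler_sum => m mr.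
    rewrite mulrA ler_wpM2r//.
    exact: (wcoef_le psi0 mpsi bpsi orth msigma bsigma hprim hp (htheta j) (rl m mr).1).
  apply: lee_wpmul2l; first by rewrite lee_fin mulr_ge0 ?sqr_ge0.
  by rewrite -sumEFin; exact: le_esum.
have component (v : {set 'I_s}) r : v \subset supp l -> uniq r -> (forall k, k \in r -> calE calN l k) ->
    ((\sum_(k <- r) a v (kres v k) * \prod_(j <- enum (supp l :\: v)%SET) t j (k j))%R%:E <=
     L2norm (h v) `^ (2 * alpha)%R * L2norm (g v) `^ (2 - 2 * alpha)%R *
     \prod_(j in supp l :\: v) calS lambda calN Cphi (theta j) (l j) alpha)%E.
  move=> vl ur rl.
  (* The finite family [r] is enlarged to the product of its projections: its restrictions to [v]
     and its entries at the other coordinates. The sum over this product factorises. *)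
  pose L := undup (map (kres v) r); pose M (j : 'I_s) := undup (map (fun k : {ffun 'I_s -> nat} => k j) r).
  have kl k : k \in r -> forall j, j \in supp l -> (0 < k j)%N /\ calN (k j) = l j.
    move=> /rl[sk kN] j jl; split; last exact: kN.
    by move: jl; rewrite -sk inE lt0n.
  apply: (@le_trans _ _ ((\sum_(q <- L) a v q) * \prod_(j <- enum (supp l :\: v)%SET) \sum_(m <- M j) t j m)%:E).
    rewrite lee_fin; apply: (@sum_prod_le R _ _ _ (enum (supp l :\: v)%SET) (a v) t L M (fun j (k : {ffun 'I_s -> nat}) => k j) (kres v) r) => //.
    - exact: undup_uniq.
    - by move=> j; exact: undup_uniq.
    - by move=> k kr; rewrite mem_undup map_f.
    - by move=> k j kr; rewrite mem_undup (map_f (fun k : {ffun 'I_s -> nat} => k j)).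
    - move=> k k' kr kr' /ffunP e e'; apply/ffunP => j.
      have [jv|jv] := boolP (j \in v).
        by have [i ->] := in_setP_enum jv; have := e i; rewrite !ffunE.
      have [jl|jl] := boolP (j \in supp l); first by apply: e'; rewrite mem_enum finset.in_setD jv.
      have [[sk _] [sk' _]] := (rl k kr, rl k' kr').
      move: (jl); rewrite -{1}sk inE negbK => /eqP ->.
      by move: jl; rewrite -sk' inE negbK => /eqP ->.
  rewrite EFinM; apply: lee_pmul.
  - by rewrite lee_fin sumr_ge0.
  - by rewrite lee_fin prodr_ge0// => j _; rewrite sumr_ge0.
  - rewrite (_ : 2 - 2 * alpha = 2 * (1 - alpha)); last by ring.
    rewrite !L2norm_pow.
    apply: (component_bound psi0 mpsi bpsi orth msigma bsigma lambda_neq0 hprim (l' := fun i => l (enum_val i)) halpha (rw v).1 (rw v).2).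
      exact: undup_uniq.
    move=> q; rewrite mem_undup => /mapP[k kr ->] i; rewrite ffunE; apply: kl => //.
    by apply: (fintype.subsetP vl); exact: enum_valP.
  - rewrite -prodEFin big_enum/=; apply: lee_prod => j; rewrite inE => /andP[_ jl]; split.
      by rewrite lee_fin sumr_ge0.
    apply: calS_ge; first exact: undup_uniq.
    by move=> m; rewrite mem_undup => /mapP[k kr ->]; exact: kl.
(* A sum of nonnegative terms is the supremum of its finite partial sums, so a finite duplicate-free
   list of indices suffices. *)
apply: esum_le => r ur rl; rewrite sumEFin.
apply: (@le_trans _ _ (2 ^+ #|supp l| * \sum_(v : {set 'I_s} | v \subset supp l)
    \sum_(k <- r) a v (kres v k) * \prod_(j <- enum (supp l :\: v)%SET) t j (k j))%:E).
  rewrite lee_fin exchange_big/= mulr_sumr big_seq [leRHS]big_seq; apply: ler_sum => k kr.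
  exact: termwise (rl k kr).
rewrite EFinM; apply: lee_wpmul2l; first by rewrite lee_fin exprn_ge0.
by rewrite -sumEFin; apply: lee_sum => v vl; exact: component.
Qed.
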